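(* There are absolute constants hidden in the $O(\cdot)$ below such that: for any $\delta \leq \epsilon$ with $\delta,\epsilon\in(0,0.1)$, any dimension $d$, and any sparsity $w\leq d$, there is a protocol in the specialized product-distributional communication model computing the partial match function $f_{\mathrm{pm}}(x,y)$, where Alice's input is $x\in\{0,1\}^d$ drawn from an arbitrary distribution $\lambda$ and Bob's input is an arbitrary $y\in\{0,1,\star\}^d$ with at most $w$ stars, with the following guarantees: 1. The protocol has $\delta$ soundness. 2. Under Merlin's unique special message, the protocol has false positive (type I) error at most $\epsilon+\delta$. 3. Merlin's communication is $c_m \leq O\Big(\big(\sqrt{w\log(w/\epsilon)}+\log(w/\epsilon)\big)\cdot\log\big(\frac{w}{\log(1/\epsilon)}\big)\Big)$. 4. Alice's communication is $c_a\leq O\Big(\log(1/\delta)+\sqrt{\frac{w}{\log(1/\epsilon)}}\Big)$; Bob's communication is $c_b \leq O\Big(\big(\sqrt{w\log(w/\epsilon)}+\log(w/\epsilon)\big)\log\big(\frac{w}{\log(1/\epsilon)}\big) + \log\log(w/\delta)\cdot\log\big(w+\log(w/\epsilon)\big)+\log(1/\delta)\Big)$; the time complexities of Alice and Bob satisfy $t_a,t_b\leq O\Big(\frac{dw^3}{\epsilon}\log(1/\delta)(\log d)^3\log(w/\epsilon)^3\Big)$. 5. Carol's communication is $c_c\leq O\Big(\frac{dw^3}{\epsilon}\log(1/\delta)(\log d)^3\log(w/\epsilon)^3\Big)$ and her time is $t_c\leq O\Big(\frac{dw^3}{\epsilon}\log(1/\delta)(\log d)^3\log(w/\epsilon)^3\cdot\mathcal{T}_{\mathrm{Sample}}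 + d\cdot\mathcal{T}_{\mathrm{Update}}\Big)$, where $\mathcal{T}_{\mathrm{Sample}}$ is the time to sample a set from $\lambda$ conditioned on the size of the sampled set lying in a given range, and $\mathcal{T}_{\mathrm{Update}}$ is the time to update $\lambda$ to its restriction to a subset of the coordinates $[d]$.
   Context: Partial match function: for $x\in\{0,1\}^d$, $y\in\{0,1,\star\}^d$, $f_{\mathrm{pm}}(x,y)=\bigwedge_{i=1}^d (x_i=y_i \lor y_i=\star)$. Vectors in $\{0,1\}^d$ are identified with subsets of $[d]$. Logarithms are base 2. Specialized product-distributional communication model for $f:\mathcal{X}\times\mathcal{Y}\to\{0,1\}$: four parties Alice, Bob, Carol, Merlin. Let $\lambda$ be an arbitrary distribution on $\mathcal{X}$ and $y\in\mathcal{Y}$ arbitrary (worst case). Alice knows $\lambda$ and her input $x\sim\lambda$; Bob knows only $y$; Carol knows only $\lambda$; Merlin knows $\lambda$, $x$ and $y$. Carol is the only party using randomness: public randomness $R_{\mathrm{pub}}$ (visible to Merlin) and private randomness $R_{\mathrm{pri}}$ (hidden from Merlin); Carol writes messages to a public channel seen by Alice and Bob, and Carol and Merlin see all messages between Alice and Bob. Merlin sends advice $m$ to Alice and Bob. The output is denoted $\pi(\lambda,x,y,m,R_{\mathrm{pub}},R_{\mathrm{pri}})$. For every $\lambda,x,y,R_{\mathrm{pub}}$ there is a unique special advice $m^*(\lambda,x,y,R_{\mathrm{pub}})$. The protocol has $\epsilon$ error and $\delta$ soundness if for all $\lambda$ and all $y$: (i) $\Pr_{x\sim\lambda,R_{\mathrm{pub}},R_{\mathrm{pri}}}[\pi(\lambda,x,y,m^*(\lambda,x,y,R_{\mathrm{pub}}),R_{\mathrm{pub}},R_{\mathrm{pri}})\neq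 f(x,y)]\leq\epsilon$; (ii) for every $x$ in the support of $\lambda$, every $R_{\mathrm{pub}}$ and every $m\neq m^*(\lambda,x,y,R_{\mathrm{pub}})$, $\Pr_{R_{\mathrm{pri}}}[\pi(\lambda,x,y,m,R_{\mathrm{pub}},R_{\mathrm{pri}})\neq 0]\leq\delta$. The error is false positive (type I) if under the special advice the protocol can be wrong only when $f(x,y)=0$. Cost $(c_a,c_b,c_c,c_m)$: total bits sent by Alice to Bob, Bob to Alice, Carol to Alice and Bob, and Merlin to Alice and Bob. Time $(t_a,t_b,t_c)$: time Alice, Bob and Carol use to construct all their messages.
   Formalization: In the bounds, log d and log(w/log(1/ε)) are read as max(1, log ·), since as written they vanish for d = 1 and are negative for w < log(1/ε); and w ≥ 1 is assumed, since log(w/ε) is undefined at w = 0. *)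

(* Defs.v *)
From HB Require Import structures.
From mathcomp Require Import all_boot all_order all_algebra.
From mathcomp Require Import archimedean reals exp.

Set Implicit Arguments.
Unset Strict Implicit.
Unset Printing Implicit Defensive.

Import Order.TTheory GRing.Theory Num.Theory.

Local Open Scope ring_scope.

(** * Partial match *)

Definition cube (d : nat) := {ffun 'I_d -> bool}.

(* [None] is the star. *)
Definition pattern (d : nat) := {ffun 'I_d -> option bool}.

Definition stars (d : nat) (y : pattern d) : nat := #|[pred i | y i == None]|.

Definition fpm (d : nat) (x : cube d) (y : pattern d) : bool :=
  [forall i, (Some (x i) == y i) || (y i == None)].

(** * Distributions and Carol's random tapes *)

Section Randomness.
Context {R : realType} {d : nat}.
Implicit Types (lam : {ffun cube d -> R}) (x z S : cube d).

Definition is_dist lam := (forall x, 0 <= lam x) /\ \sum_x lam x = 1.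

Definition weight x : nat := #|[pred i | x i]|.

Definition meet x S : cube d := [ffun i => x i && S i].

(* The restriction of [lam] to the coordinates in [S]: the law of the
   intersection with [S] of a set drawn from [lam]. *)
Definition restriction lam S z : R := \sum_(x | meet x S == z) lam x.

(* A query [(S, lo, hi)] asks for a sample of the restriction of the
   distribution to [S], conditioned on its size lying in [lo, hi].  Sizes are
   at most [d], so that bounds can be truncated at [d.+1]. *)
Definition query : finType := (cube d * 'I_d.+2 * 'I_d.+2)%type.

Definition in_range (q : query) z : bool :=
  (q.1.2 <= weight z)%N && (weight z <= q.2)%N.

Definition range_mass lam (q : query) : R :=
  \sum_(z | in_range q z) restriction lam q.1.1 z.

(* The law of the answer to a query; the answer is [None] exactly when the
   conditioning event is null. *)
Definition sample_law lam (q : query) (a : option (cube d)) : R :=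
  if a is Some z
  then if in_range q z then restriction lam q.1.1 z / range_mass lam q else 0
  else (range_mass lam q == 0)%:R.

(* A tape of length [n]: [n] coins, and for each [k < n] the answer that the
   [k]-th sampling request would receive for each possible query.  The entries
   are independent, so that every request, however adaptively chosen, receives
   a fresh sample from the right conditional law. *)
Definition tape (n : nat) : finType :=
  ({ffun 'I_n -> bool} * {ffun 'I_n * query -> option (cube d)})%type.

Definition tape_law (n : nat) lam (r : tape n) : R :=
  2 ^- n * \prod_(kq : 'I_n * query) sample_law lam kq.2 (r.2 kq).

Definition coin (n : nat) (r : tape n) (k : nat) : bool :=
  if insub k is Some i then r.1 i else false.

Definition sample (n : nat) (r : tape n) (k : nat) (q : query) :
    option (cube d) :=
  if insub k is Some i then r.2 (i, q) else None.

End Randomness.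

Arguments query : clear implicits.
Arguments tape : clear implicits.

(** * Random access machines with communication *)

(* Time is measured on the standard unit-cost RAM with addition and (truncated)
   subtraction, direct and indirect addressing; X_i is the content of register
   [i].  [O] is the type of the instructions that are specific to a party. *)
Inductive instr (O : Type) : Type :=
  | Const of nat & nat        (* X_i := c *)
  | Plus of nat & nat & nat    (* X_i := X_j + X_k *)
  | Minus of nat & nat & nat    (* X_i := X_j - X_k *)
  | Get of nat & nat         (* X_i := X_(X_j) *)
  | Put of nat & nat        (* X_(X_i) := X_j *)
  | Jz of nat & nat           (* if X_i = 0 then go to line l *)
  | Send of nat               (* send the bit X_i <> 0 *)
  | Recv of bool & nat        (* X_i := next bit of the left or right channel *)
  | Halt of nat               (* stop with result X_i <> 0 *)
  | Special of O.

Arguments Const {O}.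
Arguments Plus {O}.
Arguments Minus {O}.
Arguments Get {O}.
Arguments Put {O}.
Arguments Jz {O}.
Arguments Send {O}.
Arguments Recv {O}.
Arguments Halt {O}.

(* Alice's access to [lam]: [Digit i j k] sets X_i to the binary digit of index
   X_k of the probability of the vector stored from address X_j on. *)
Variant alice_instr : Type := Digit of nat & nat & nat.

(* Carol's randomness and access to [lam]; the boolean is [true] for private
   randomness.
   [Coin b i] sets X_i to a fresh random bit.
   [Sample b i lo hi] draws from the current distribution conditioned on the
   size lying in [X_lo, X_hi]; it sets X_(X_i) to 1 and stores the sample in
   the [d] next cells, or sets X_(X_i) to 0 if the condition is null.
   [Update i] restricts the current distribution to the set of coordinates
   whose indicator vector is stored from address X_i on. *)
Variant carol_instr : Type :=
  | Coin of bool & nat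
  | Sample of bool & nat & nat & nat
  | Update of nat.

Definition bits (n : nat) : nat := (trunc_log 2 n).+1.

Definition alice_instr_size (o : alice_instr) : nat :=
  let: Digit i j k := o in (bits i + bits j + bits k)%N.

Definition bob_instr_size (o : void) : nat := match o with end.

Definition carol_instr_size (o : carol_instr) : nat :=
  match o with
  | Coin _ i => bits i
  | Sample _ i lo hi => (bits i + bits lo + bits hi)%N
  | Update i => bits i
  end.

(* A protocol may depend on all the parameters of the problem, so its code may
   contain precomputed data; the length of the code is therefore charged as
   time (see [alice_time] etc.), constants being charged by their bit length. *)
Definition instr_size (O : Type) (osize : O -> nat) (c : instr O) : nat :=
  match c with
  | Const i j | Get i j | Put i j | Jz i j => (1 + bits i + bits j)%N
  | Plus i j k | Minus i j k => (1 + bits i + bits j + bits k)%N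
  | Send i | Recv _ i | Halt i => (1 + bits i)%N
  | Special o => (1 + osize o)%N
  end.

Definition code_size (O : Type) (osize : O -> nat) (code : seq (instr O)) : nat :=
  \sum_(c <- code) instr_size osize c.

Definition memory := nat -> nat.

Definition upd (f : memory) (i v : nat) : memory :=
  fun j => if j == i then v else f j.

Definition incr (g : bool -> nat) (b : bool) : bool -> nat :=
  fun b' => (g b' + (b' == b))%N.

Definition read_vec (d : nat) (f : memory) (a : nat) : cube d :=
  [ffun i : 'I_d => f (a + i)%N != 0%N].

Definition write_vec (d : nat) (f : memory) (a : nat) (z : cube d) : memory :=
  fun j => if (a <= j)%N then
             if insub (j - a)%N is Some i then nat_of_bool (z i) else f j
           else f j.

(* [T] is the type of the data used by the special instructions. *)
Record machine (T : Type) : Type := Machine {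
  line : nat;
  mem : memory;
  nread : bool -> nat;      (* bits already read on each incoming channel *)
  steps : nat;
  result : option bool;
  aux : T
}.

Section Step.
Variables (O T : Type) (code : seq (instr O)).
Variable special : O -> memory -> T -> memory * T.

(* One step, given the bits written so far on the incoming channels; returns
   the bits sent.  A halted machine, and a machine waiting for a bit that has
   not been sent yet, do not move and consume no time. *)
Definition step (inc : bool -> seq bool) (s : machine T) :
    machine T * seq bool :=
  let f := mem s in
  let goto l f' :=
    Machine l f' (nread s) (steps s).+1 None (aux s) in
  let next f' := goto (line s).+1 f' in
  if result s is Some _ then (s, [::]) else
  match nth (Halt 0%N) code (line s) with
  | Const i c => (next (upd f i c), [::])
  | Plus i j k => (next (upd f i (f j + f k)%N), [::])
  | Minus i j k => (next (upd f i (f j - f k)%N), [::])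
  | Get i j => (next (upd f i (f (f j))), [::])
  | Put i j => (next (upd f (f i) (f j)), [::])
  | Jz i l => (goto (if f i == 0%N then l else (line s).+1) f, [::])
  | Send i => (next f, [:: f i != 0%N])
  | Recv b i =>
      if onth (inc b) (nread s b) is Some v then
        (Machine (line s).+1 (upd f i (nat_of_bool v))
           (incr (nread s) b) (steps s).+1 None (aux s),
         [::])
      else (s, [::])
  | Halt i =>
      (Machine (line s) f (nread s) (steps s).+1 (Some (f i != 0%N)) (aux s),
       [::])
  | Special o =>
      let: (f', t) := special o f (aux s) in
      (Machine (line s).+1 f' (nread s) (steps s).+1 None t, [::])
  end.

End Step.

(* Inputs are stored in the first registers, all others contain 0. *)
Definition start (T : Type) (input : seq nat) (t : T) : machine T :=
  Machine 0 (nth 0%N input) (fun=> 0%N) 0 None t.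

(** * The specialized product-distributional model *)

(* Carol's sampling data: the coordinates of the current restriction, the
   number of coins and samples used so far on each tape, the number of
   updates. *)
Record carol_data (d : nat) : Type := CarolData {
  coords : cube d;
  ncoins : bool -> nat;
  nsamples : bool -> nat;
  nupdates : nat
}.

(* Merlin's advice is a string of [advice_len] bits and [special_advice] is
   m*.  [tape_len] is the length of Carol's two tapes, [horizon] a number of
   rounds after which all executions are over (see [terminates]). *)
Record protocol (R : realType) (d : nat) : Type := Protocol {
  alice : seq (instr alice_instr);
  bob : seq (instr void);
  carol : seq (instr carol_instr);
  tape_len : nat;
  horizon : nat;
  advice_len : nat;
  special_advice : {ffun cube d -> R} -> cube d -> pattern d ->
                   tape d tape_len -> advice_len.-tuple bool
}.

Arguments special_advice {R d} P lam x y rpub : rename.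

Record config (d : nat) : Type := Config {
  st_alice : machine unit;
  st_bob : machine unit;
  st_carol : machine (carol_data d);
  ch_alice : seq bool;
  ch_bob : seq bool;
  ch_carol : seq bool
}.

Section Execution.
Context {R : realType} {d : nat}.
Variable P : protocol R d.
Variables (lam : {ffun cube d -> R}) (x : cube d) (y : pattern d).
Variable m : (advice_len P).-tuple bool.
Variables (rpub rpri : tape d (tape_len P)).

Definition alice_special (o : alice_instr) (f : memory) (t : unit) :
    memory * unit :=
  let: Digit i j k := o in
  (upd f i (Num.truncn (2 ^+ f k * lam (read_vec d f (f j))) %% 2)%N, t).

Definition bob_special (o : void) (f : memory) (t : unit) : memory * unit :=
  match o with end.

Definition carol_special (o : carol_instr) (f : memory) (t : carol_data d) :
    memory * carol_data d :=
  let tp b := if b then rpri else rpub in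
  match o with
  | Coin b i =>
      (upd f i (nat_of_bool (coin (tp b) (ncoins t b))),
       CarolData (coords t) (incr (ncoins t) b) (nsamples t) (nupdates t))
  | Sample b i lo hi =>
      let q := (coords t, inord (minn (f lo) d.+1), inord (minn (f hi) d.+1)) in
      (if sample (tp b) (nsamples t b) q is Some z
       then write_vec (upd f (f i) 1) (f i).+1 z
       else upd f (f i) 0,
       CarolData (coords t) (ncoins t) (incr (nsamples t) b) (nupdates t))
  | Update i =>
      (f, CarolData (meet (coords t) (read_vec d f (f i)))
            (ncoins t) (nsamples t) (nupdates t).+1)
  end.

Definition alice_input : seq nat :=
  [seq nat_of_bool (x i) | i <- enum 'I_d] ++ [seq nat_of_bool b | b <- m].

(* Bob's input uses 2 for the star. *)
Definition bob_input : seq nat :=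
  [seq (if y i is Some b then nat_of_bool b else 2%N) | i <- enum 'I_d]
    ++ [seq nat_of_bool b | b <- m].

Definition init : config d :=
  Config (start alice_input tt) (start bob_input tt)
         (start [::] (CarolData [ffun=> true] (fun=> 0%N) (fun=> 0%N) 0))
         [::] [::] [::].

(* Each machine receives on its left (false) and right (true) channels:
   Alice from Bob and Carol, Bob from Alice and Carol, Carol from Alice and
   Bob.  Receiving is blocking, so that the messages do not depend on the
   relative speed of the machines. *)
Definition round (c : config d) : config d :=
  let: (sa, oa) := step (alice P) alice_special
    (fun b => if b then ch_carol c else ch_bob c) (st_alice c) in
  let: (sb, ob) := step (bob P) bob_special
    (fun b => if b then ch_carol c else ch_alice c) (st_bob c) in
  let: (sc, oc) := step (carol P) carol_special
    (fun b => if b then ch_bob c else ch_alice c) (st_carol c) in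
  Config sa sb sc (ch_alice c ++ oa) (ch_bob c ++ ob) (ch_carol c ++ oc).

Definition final : config d := iter (horizon P) round init.

Definition terminates : bool :=
  [&& isSome (result (st_alice final)), isSome (result (st_bob final))
    & isSome (result (st_carol final))].

(* The output of the protocol is the bit with which Bob stops. *)
Definition output : bool := odflt false (result (st_bob final)).

Definition alice_cost : nat := size (ch_alice final).
Definition bob_cost : nat := size (ch_bob final).
Definition carol_cost : nat := size (ch_carol final).

Definition alice_time : nat :=
  (code_size alice_instr_size (alice P) + steps (st_alice final))%N.

Definition bob_time : nat :=
  (code_size bob_instr_size (bob P) + steps (st_bob final))%N.

(* [tsample] and [tupdate] are the times of a conditional sampling and of an
   update. *)
Definition carol_time (tsample tupdate : nat) : nat :=
  let t := aux (st_carol final) in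
  (code_size carol_instr_size (carol P) + steps (st_carol final)
   + (nsamples t false + nsamples t true) * tsample
   + nupdates t * tupdate)%N.

End Execution.

Section Guarantees.
Context {R : realType} {d : nat}.
Variables (P : protocol R d) (Y : pred (pattern d)).

Definition error (lam : {ffun cube d -> R}) (y : pattern d) : R :=
  \sum_x \sum_(rpub : tape d (tape_len P)) \sum_(rpri : tape d (tape_len P)
      | output lam x y (special_advice P lam x y rpub) rpub rpri != fpm x y)
    lam x * tape_law lam rpub * tape_law lam rpri.

Definition accept_prob (lam : {ffun cube d -> R}) (x : cube d) (y : pattern d)
    (m : (advice_len P).-tuple bool) (rpub : tape d (tape_len P)) : R :=
  \sum_(rpri : tape d (tape_len P) | output lam x y m rpub rpri != false)
    tape_law lam rpri.

Definition has_error (eps : R) :=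
  forall lam y, is_dist lam -> Y y -> error lam y <= eps.

Definition has_soundness (delta : R) :=
  forall lam y x rpub m, is_dist lam -> Y y -> 0 < lam x ->
    0 < tape_law lam rpub -> m != special_advice P lam x y rpub ->
    accept_prob lam x y m rpub <= delta.

Definition false_positive_only :=
  forall lam y x rpub rpri, is_dist lam -> Y y -> 0 < lam x ->
    0 < tape_law lam rpub -> 0 < tape_law lam rpri -> fpm x y ->
    output lam x y (special_advice P lam x y rpub) rpub rpri.

(* [Q] holds of every possible execution, whatever Merlin's advice. *)
Definition all_executions
    (Q : {ffun cube d -> R} -> cube d -> pattern d ->
         (advice_len P).-tuple bool ->
         tape d (tape_len P) -> tape d (tape_len P) -> Prop) :=
  forall lam x y m rpub rpri, is_dist lam -> Y y -> 0 < lam x ->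
    0 < tape_law lam rpub -> 0 < tape_law lam rpri ->
    Q lam x y m rpub rpri.

End Guarantees.

Arguments has_error {R d} P Y eps.
Arguments has_soundness {R d} P Y delta.
Arguments false_positive_only {R d} P Y.
Arguments all_executions {R d} P Y Q.

(** * Bounds *)

Section Bounds.
Context {R : realType}.
Implicit Types (eps delta : R) (d w : nat).

Definition log2 (t : R) : R := ln t / ln 2.

(* Inside O-bounds a factor log t stands for max(1, log t).  For the parameters
   considered (0 < delta <= eps < 1/10 and w >= 1) this only matters for log d,
   which is 0 if d = 1, and for log (w / log (1 / eps)), which is negative if
   w < log (1 / eps); all other logarithms exceed 1. *)
Definition log2_1 (t : R) : R := Num.max 1 (log2 t).

Definition merlin_bound w eps : R :=
  (Num.sqrt (w%:R * log2 (w%:R / eps)) + log2 (w%:R / eps))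
  * log2_1 (w%:R / log2 (1 / eps)).

Definition alice_bound w eps delta : R :=
  log2 (1 / delta) + Num.sqrt (w%:R / log2 (1 / eps)).

Definition bob_bound w eps delta : R :=
  (Num.sqrt (w%:R * log2 (w%:R / eps)) + log2 (w%:R / eps))
    * log2_1 (w%:R / log2 (1 / eps))
  + log2 (log2 (w%:R / delta)) * log2 (w%:R + log2 (w%:R / eps))
  + log2 (1 / delta).

Definition time_bound d w eps delta : R :=
  d%:R * w%:R ^+ 3 / eps * log2 (1 / delta) * log2_1 d%:R ^+ 3
  * log2 (w%:R / eps) ^+ 3.

End Bounds.

(* Main.v *)
(* Bob stays silent and Merlin does the work.  Let A be the set of inputs that
   are consistent with everything announced so far.  In each round Carol
   publishes n groups of samples of lambda; the first element of A in each
   group gives a point distributed (almost) as lambda conditioned on A, and the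
   n points z yield a majority center and the set C of coordinates on which z is
   not nearly constant.  Merlin announces at most two parities of y, taken over
   sets of non-star coordinates: one over a random sparse set Q (if it avoids
   the stars), one over a single coordinate of C chosen by public coins and
   named by the index of the first useful trial.  If C contains at most M
   non-stars he announces instead that the inputs close to the center outside C
   are decided in this round.
   Either lambda conditioned on A disagrees with y in many coordinates, and the
   parity over Q cuts A, or C consists of coordinates on which A really varies
   and the single coordinate cuts A, or most of A is close to the center.  In
   all cases A loses a fraction of order 2^-a of its mass, so that it has mass
   at most eps after about 2^a log(1/eps) rounds; with 4^a of order
   w / log(1/eps) this is sqrt(w log(1/eps)) rounds of a + O(1) bits each.
   In the round that decides x, Merlin encodes the non-stars of C, and the
   difference between x and the center on the remaining stars, by gaps of
   O(a) bits; Bob then knows x on the set U of all relevant coordinates if it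
   matches y, and the parties compare x on U by k random inner products, with
   private coins of Carol.  The advice that passes all deterministic checks and
   describes x correctly is unique, whence soundness 2^-k. *)

Require Import Defs.
From mathcomp Require Import all_boot all_order all_algebra.
From mathcomp Require Import archimedean reals exp boolp zify ring lra.

Set Implicit Arguments.
Unset Strict Implicit.
Unset Printing Implicit Defensive.

Import Order.TTheory GRing.Theory Num.Theory.

Local Open Scope ring_scope.

(** * Feed-forward networks of machines *)

(** Code length is charged as well as running time, so every program is unrolled, branch-free code:
    the number of steps is the number of lines. With Bob silent and Carol never listening, the three
    machines can be analysed one after another. Carol never restricts [lam]. Among [G] samples, with
    [G] of order n/eps, one is likely to lie in A as long as A has mass eps/2, and below that mass
    nothing has to be gained. Progress is measured in expectation: a round contracts the excess of
    the surviving mass over eps/2 by the factor 1 - 1/(8192 * 2^a). The delicate case is a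
    coordinate that enters C by chance although A hardly varies there. Instead of a union bound over
    the d coordinates, a coordinate with a small rate p of disagreement with [y] is shown to collect
    h = a + 4 disagreements with probability at most 32 p; the expected number of such accidents is
    then bounded by the expected distance to [y], whatever d is. On the stars, where [y] gives no
    reference value, exchangeability of the samples and the input takes over. *)

Section Solo.
Variables (O T : Type) (code : seq (instr O)).
Variable special : O -> memory -> T -> memory * T.
Implicit Types (F : bool -> seq bool) (p : machine T * seq bool).

Definition tick F p : machine T * seq bool :=
  let r := step code special F p.1 in (r.1, p.2 ++ r.2).

Definition is_recv (c : instr O) := if c is Recv _ _ then true else false.
Definition is_send (c : instr O) := if c is Send _ then true else false.

Lemma onth_prefix (s1 s2 : seq bool) k v :
  prefix s1 s2 -> onth s1 k = Some v -> onth s2 k = Some v.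
Proof.
move=> /prefixP[s' ->]; elim: s1 k => [|a s1 IH] [|k] //=; exact: IH.
Qed.

(** No instruction tests for the absence of a bit, so more input can only turn a blocked receive
    into a successful one. Hence the relative speed of the machines does not matter. *)
Lemma step_prefix F F' s : (forall b, prefix (F b) (F' b)) ->
  step code special F s = step code special F' s \/
  step code special F s = (s, [::]).
Proof.
move=> FF'; rewrite /step; case: (result s) => [b|]; first by left.
case: (nth _ _ _); try by left.
move=> b i; case E: (onth (F b) _) => [v|]; last by right.
by rewrite (onth_prefix (FF' b) E); left.
Qed.

Lemma step_norecv F F' s : ~~ has is_recv code ->
  step code special F s = step code special F' s.
Proof.
move=> nr; rewrite /step; case: (result s) => [//|].
case E: (nth _ _ _) => [||||||| b i||] //.
have [lt_l|ge_l] := ltnP (line s) (size code).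
  by case/negP: nr; apply/(has_nthP (Halt 0)); exists (line s); rewrite ?E.
by rewrite nth_default in E.
Qed.

Lemma step_nosend F s : ~~ has is_send code ->
  (step code special F s).2 = [::].
Proof.
move=> ns; rewrite /step; case: (result s) => [//|].
case E: (nth _ _ _) => [||||||i|b i||o] //.
- have [lt_l|ge_l] := ltnP (line s) (size code).
    by case/negP: ns; apply/(has_nthP (Halt 0)); exists (line s); rewrite ?E.
  by rewrite nth_default in E.
- by case: (onth _ _).
- by case: (special _ _ _).
Qed.

Lemma tick_halted F p : result p.1 -> tick F p = p.
Proof.
by case: p => s o /=; rewrite /tick /step /=; case: (result s) => //= b; rewrite cats0.
Qed.

Lemma iter_tick_halted F p N k : result (iter N (tick F) p).1 ->
  (N <= k)%N -> iter k (tick F) p = iter N (tick F) p.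
Proof.
move=> h /subnK<-; rewrite iterD; elim: (k - N)%N => //= i ->.
exact: tick_halted.
Qed.

Lemma iter_tick_prefix F p i j : (i <= j)%N ->
  prefix (iter i (tick F) p).2 (iter j (tick F) p).2.
Proof.
move=> /subnK<-; rewrite iterD; elim: (j - i)%N => /= [|k IH].
  exact: prefix_refl.
exact: (prefix_trans IH (prefix_prefix _ _)).
Qed.

Lemma iter_tick_prefix_halted F p N k : result (iter N (tick F) p).1 ->
  prefix (iter k (tick F) p).2 (iter N (tick F) p).2.
Proof.
move=> h; case: (leqP k N) => [/iter_tick_prefix//|/ltnW /(iter_tick_halted h)->].
exact: prefix_refl.
Qed.

End Solo.

Section Network.
Context {R : realType} {d : nat}.
Variable P : protocol R d.
Variables (lam : {ffun cube d -> R}) (x : cube d) (y : pattern d).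
Variable m : (advice_len P).-tuple bool.
Variables (rpub rpri : tape d (tape_len P)).

Let carol0 : machine (carol_data d) :=
  start [::] (CarolData [ffun=> true] (fun=> 0%N) (fun=> 0%N) 0).

Definition carol_run k :=
  iter k (tick (carol P) (carol_special rpub rpri) (fun=> [::])) (carol0, [::]).

Definition alice_run Fc k :=
  iter k (tick (alice P) (alice_special lam) (fun b => if b then Fc else [::]))
    (start (alice_input x m) tt, [::]).

Definition bob_run Fc Fa k :=
  iter k (tick (bob P) bob_special (fun b => if b then Fc else Fa))
    (start (bob_input y m) tt, [::]).

(* Receiving is blocking, so the machines of an acyclic network can be run one
   after the other, each with the complete messages of its predecessors. *)
Lemma network_final NC NA NB :
  let Cf := carol_run NC in let Af := alice_run Cf.2 NA in
  let Bf := bob_run Cf.2 Af.2 NB in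
  ~~ has (@is_recv _) (carol P) -> ~~ has (@is_send _) (bob P) ->
  result Cf.1 -> result Af.1 -> result Bf.1 ->
  (NC + NA + NB <= horizon P)%N ->
  final lam x y m rpub rpri = Config Af.1 Bf.1 Cf.1 Af.2 [::] Cf.2.
Proof.
move=> Cf Af Bf nr ns hC hA hB le_h.
(* At any time each machine is at some point of its solo run with complete messages; [ka] and [kb]
   count solo ticks. Alice can stall only during the first [NC] rounds, Bob only during the first
   [NC + NA], which gives the two inequalities. *)
have step_n : forall tau, exists ka kb,
    [/\ iter tau (round lam rpub rpri) (init x y m) =
        Config (alice_run Cf.2 ka).1 (bob_run Cf.2 Af.2 kb).1 (carol_run tau).1
          (alice_run Cf.2 ka).2 [::] (carol_run tau).2,
        (tau <= NC + ka)%N & (tau <= NC + NA + kb)%N].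
  elim=> [|tau [ka [kb [E leA leB]]]]; first by exists 0%N, 0%N; split.
  rewrite iterS E {E} /round /=.
  set cC := carol_run tau; set cA := alice_run Cf.2 ka.
  set cB := bob_run Cf.2 Af.2 kb.
  have pC : prefix cC.2 Cf.2 by apply: iter_tick_prefix_halted.
  have pA : prefix cA.2 Af.2 by apply: iter_tick_prefix_halted.
  have EA : tick (alice P) (alice_special lam)
      (fun b => if b then Cf.2 else [::]) cA = alice_run Cf.2 ka.+1 by [].
  have EB : tick (bob P) bob_special
      (fun b => if b then Cf.2 else Af.2) cB = bob_run Cf.2 Af.2 kb.+1 by [].
  rewrite (step_norecv _ _ (fun=> [::]) cC.1 nr).
  have ob0 := step_nosend bob_special (fun b => if b then cC.2 else cA.2) cB.1 ns.
  have [ka' [Ea leA']] : exists ka', tick (alice P) (alice_special lam)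
      (fun b => if b then cC.2 else [::]) cA = alice_run Cf.2 ka' /\
      (tau.+1 <= NC + ka')%N.
    have [le_tau|lt_tau] := leqP NC tau.
      exists ka.+1; rewrite addnS ltnS; split=> //; rewrite -EA.
      by rewrite /cC /carol_run (iter_tick_halted hC le_tau).
    have [|E|E] := @step_prefix _ _ (alice P) (alice_special lam)
      (fun b => if b then cC.2 else [::]) (fun b => if b then Cf.2 else [::]) cA.1.
    - by case.
    - exists ka.+1; rewrite -EA /tick E; split=> //; exact: leq_trans lt_tau (leq_addr _ _).
    - exists ka; rewrite /tick E /= cats0 -surjective_pairing; split=> //.
      exact: leq_trans lt_tau (leq_addr _ _).
  have [kb' [Eb leB']] : exists kb', tick (bob P) bob_special
      (fun b => if b then cC.2 else cA.2) cB = bob_run Cf.2 Af.2 kb' /\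
      (tau.+1 <= NC + NA + kb')%N.
    have [le_tau|lt_tau] := leqP (NC + NA) tau.
      exists kb.+1; rewrite addnS ltnS; split=> //; rewrite -EB.
      have le1 : (NC <= tau)%N by exact: leq_trans (leq_addr _ _) le_tau.
      have le2 : (NA <= ka)%N by rewrite -(leq_add2l NC); exact: leq_trans leA.
      by rewrite /cC /cA /carol_run /alice_run (iter_tick_halted hC le1)
        (iter_tick_halted hA le2).
    have [|E|E] := @step_prefix _ _ (bob P) bob_special
      (fun b => if b then cC.2 else cA.2) (fun b => if b then Cf.2 else Af.2) cB.1.
    - by case.
    - exists kb.+1; rewrite -EB /tick E; split=> //; exact: leq_trans lt_tau (leq_addr _ _).
    - exists kb; rewrite /tick E /= cats0 -surjective_pairing; split=> //.
      exact: leq_trans lt_tau (leq_addr _ _).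
  exists ka', kb'; rewrite -Ea -Eb; split=> //; rewrite /tick /=.
  case: (step (alice P) _ _ _) => sa oa; case: (step (bob P) _ _ _) ob0 => sb ob /= ->.
  by case: (step (carol P) _ _ _).
have [ka [kb [E leA leB]]] := step_n (horizon P).
have leC : (NC <= horizon P)%N by lia.
have leA' : (NA <= ka)%N by lia.
have leB' : (NB <= kb)%N by lia.
rewrite /final E /carol_run /bob_run /alice_run (iter_tick_halted hC leC).
by rewrite (iter_tick_halted hA leA') (iter_tick_halted hB leB').
Qed.

End Network.

(** * Straight-line programs *)

(* [In k] is register [k] of the input, [Var g t j] cell [j] of the array of
   name [g] and index [t]. *)
Inductive exp : Type :=
  | In of nat
  | Var of nat & nat & nat
  | Cst of nat
  | Add of exp & exp
  | Sub of exp & exp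
  | Dst of exp & exp
  | Dbl of exp.

Definition env := nat -> nat -> nat -> nat.

(** The absolute difference by truncated subtractions. On bits it is exclusive or, from which
    equality tests and parities are built. *)
Definition distn' (a b : nat) : nat := ((a - b) + (b - a))%N.

Fixpoint eval (inp : nat -> nat) (v : env) (e : exp) : nat :=
  match e with
  | In k => inp k
  | Var g t j => v g t j
  | Cst c => c
  | Add e1 e2 => (eval inp v e1 + eval inp v e2)%N
  | Sub e1 e2 => (eval inp v e1 - eval inp v e2)%N
  | Dst e1 e2 => distn' (eval inp v e1) (eval inp v e2)
  | Dbl e1 => (eval inp v e1).*2
  end.

Inductive stmt : Type :=
  | SAsg of nat & nat & nat & exp
  | SRcv of bool & nat & nat & nat
  | SSnd of exp.

Definition updv (v : env) g t j c : env :=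
  fun g' t' j' => if [&& g' == g, t' == t & j' == j] then c else v g' t' j'.

(* Memory, bits left on the incoming channels, bits sent. *)
Definition hstate : Type := (env * (bool -> seq bool) * seq bool)%type.

Definition hstep (inp : nat -> nat) (s : hstate) (c : stmt) : hstate :=
  let: (v, r, o) := s in
  match c with
  | SAsg g t j e => (updv v g t j (eval inp v e), r, o)
  | SRcv b g t j => (updv v g t j (head false (r b)),
                     fun b' => if b' == b then behead (r b') else r b', o)
  | SSnd e => (v, r, rcons o (eval inp v e != 0%N))
  end.

Definition hexec inp (p : seq stmt) (s : hstate) : hstate := foldl (hstep inp) s p.

(** On an empty channel [hstep] reads [false], whereas the machine would block; this predicate
    excludes that discrepancy. *)
Fixpoint fed inp (p : seq stmt) (s : hstate) : bool :=
  if p is c :: p' then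
    (if c is SRcv b _ _ _ then s.1.2 b != [::] else true) && fed inp p' (hstep inp s c)
  else true.

Section Compilation.
Variables (base ng D dep cmax : nat).

(** Mixed-radix layout behind the input registers. All arrays have the same length [D], so every
    address is a constant of the code and no indirect addressing is compiled. *)
Definition reg g t j : nat := (base + (t * ng + g) * D + j)%N.

(* Number of rows of arrays, and the first temporary register. *)
Variable nt : nat.
Definition tmp k : nat := (base + nt * ng * D + k)%N.

Definition okvar g t j := [&& (g < ng)%N, (t < nt)%N & (j < D)%N].

(* [c] bounds the number of temporaries. *)
Fixpoint wf (c : nat) (e : exp) : bool :=
  match e with
  | In k => (k < base)%N
  | Var g t j => okvar g t j
  | Cst k => (k <= cmax)%N
  | Add e1 e2 | Sub e1 e2 => if c is c'.+1 then wf c' e1 && wf c e2 else false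
  | Dst e1 e2 => if c is c'.+2 then wf c'.+1 e1 && wf c e2 else false
  | Dbl e1 => wf c e1
  end.

Definition wfs (c : stmt) : bool :=
  match c with
  | SAsg g t j e => okvar g t j && wf dep e
  | SRcv b g t j => okvar g t j
  | SSnd e => wf dep e
  end.

Section Code.
Variable O : Type.

(** A copy is a zeroing followed by an addition, for want of a move instruction. The value of the
    second operand waits in [tmp k] while the first one uses the temporaries from [k.+1] on. *)
Fixpoint comp (k : nat) (e : exp) : seq (instr O) :=
  match e with
  | In i => [:: Const (tmp k) 0; Plus (tmp k) (tmp k) i]
  | Var g t j => [:: Const (tmp k) 0; Plus (tmp k) (tmp k) (reg g t j)]
  | Cst c => [:: Const (tmp k) c]
  | Add e1 e2 => comp k e2 ++ comp k.+1 e1 ++ [:: Plus (tmp k) (tmp k.+1) (tmp k)]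
  | Sub e1 e2 => comp k e2 ++ comp k.+1 e1 ++ [:: Minus (tmp k) (tmp k.+1) (tmp k)]
  | Dst e1 e2 => comp k e2 ++ comp k.+1 e1 ++
      [:: Minus (tmp k.+2) (tmp k.+1) (tmp k); Minus (tmp k) (tmp k) (tmp k.+1);
          Plus (tmp k) (tmp k.+2) (tmp k)]
  | Dbl e1 => comp k e1 ++ [:: Plus (tmp k) (tmp k) (tmp k)]
  end.

(** The value is complete in [tmp 0] before the target is cleared, so an assignment may read its own
    target, as [acc] does. *)
Definition comps (c : stmt) : seq (instr O) :=
  match c with
  | SAsg g t j e => comp 0 e ++
      [:: Const (reg g t j) 0; Plus (reg g t j) (reg g t j) (tmp 0)]
  | SRcv b g t j => [:: Recv b (reg g t j)]
  | SSnd e => comp 0 e ++ [:: Send (tmp 0)]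
  end.

Definition compile (p : seq stmt) : seq (instr O) := flatten (map comps p).

End Code.

Fixpoint esz (e : exp) : nat :=
  match e with
  | In _ | Var _ _ _ => 2
  | Cst _ => 1
  | Add e1 e2 | Sub e1 e2 => (esz e1 + esz e2).+1
  | Dst e1 e2 => (esz e1 + esz e2).+3
  | Dbl e1 => (esz e1).+1
  end.

Definition ssz (c : stmt) : nat :=
  match c with
  | SAsg _ _ _ e => (esz e).+2
  | SRcv _ _ _ _ => 1
  | SSnd e => (esz e).+1
  end.

Definition psz (p : seq stmt) : nat := sumn (map ssz p).

Lemma size_comp O k e : size (@comp O k e) = esz e.
Proof.
elim: e k => //= [e1 IH1 e2 IH2|e1 IH1 e2 IH2|e1 IH1 e2 IH2|e1 IH1] k;
  rewrite !size_cat /= ?IH1 ?IH2; lia.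
Qed.

Lemma size_compile O p : size (@compile O p) = psz p.
Proof.
elim: p => //= c p IH; rewrite size_cat IH; congr addn.
by case: c => //= *; rewrite size_cat size_comp /=; lia.
Qed.

Definition maxreg : nat := maxn (tmp dep.+1) cmax.

Lemma reg_lt_tmp g t j k : okvar g t j -> (reg g t j < tmp k)%N.
Proof.
move=> /and3P[hg ht hj]; rewrite /reg /tmp.
have h1 : (t * ng + g < nt * ng)%N by nia.
have h2 : ((t * ng + g) * D + j < nt * ng * D)%N by nia.
by lia.
Qed.

Lemma reg_inj g t j g' t' j' : okvar g t j -> okvar g' t' j' ->
  reg g t j = reg g' t' j' -> [/\ g = g', t = t' & j = j'].
Proof.
move=> /and3P[hg ht hj] /and3P[hg' ht' hj'] E.
have E1 : ((t * ng + g) * D + j = (t' * ng + g') * D + j')%N by rewrite /reg in E; lia.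
have uniq B a i a' i' : (i < B)%N -> (i' < B)%N ->
    (a * B + i = a' * B + i')%N -> a = a' /\ i = i'.
  move=> hi hi' Ei; have B0 : (0 < B)%N by lia.
  have := congr1 (divn^~ B) Ei; have := congr1 (modn^~ B) Ei.
  by rewrite /= !modnMDl !modn_small // !divnMDl // !divn_small // !addn0.
by have [/uniq[] // -> -> ->] := uniq _ _ _ _ _ hj hj' E1.
Qed.

Lemma bits_le i N : (i <= N)%N -> (bits i <= bits N)%N.
Proof. by move=> h; rewrite /bits ltnS leq_trunc_log. Qed.

(** An instruction has at most three numeric fields; if all are at most [N], this is the charge for
    one line of code. *)
Definition cheap (O : Type) (osize : O -> nat) N (c : instr O) :=
  (instr_size osize c <= 1 + 3 * bits N)%N.

Lemma code_size_cheap (O : Type) osize N (l : seq (instr O)) :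
  all (cheap osize N) l -> (code_size osize l <= size l * (1 + 3 * bits N))%N.
Proof.
rewrite /code_size; elim: l => [|c l IH] /=; first by rewrite big_nil.
by move=> /andP[hc /IH]; rewrite big_cons mulSn; move: hc; rewrite /cheap; lia.
Qed.

Lemma cheap_comp (O : Type) osize k c e : wf c e -> (k + c <= dep)%N ->
  all (cheap osize maxreg) (@comp O k e).
Proof.
have ht i : (i <= dep.+1)%N -> (bits (tmp i) <= bits maxreg)%N.
  by move=> hi; apply: bits_le; rewrite leq_max /tmp leq_add2l hi.
elim: e k c => /=.
- move=> i k c hi hk; rewrite /cheap /= !andbT.
  have h1 := ht k ltac:(lia); have h0 : (bits 0 <= bits maxreg)%N by apply: bits_le.
  have h2 : (bits i <= bits maxreg)%N by apply: bits_le; rewrite leq_max /tmp; lia.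
  by lia.
- move=> g t j k c hi hk; rewrite /cheap /= !andbT.
  have h1 := ht k ltac:(lia); have h0 : (bits 0 <= bits maxreg)%N by apply: bits_le.
  have h2 : (bits (reg g t j) <= bits maxreg)%N.
    by apply: bits_le; rewrite leq_max ltnW // reg_lt_tmp.
  by lia.
- move=> i k c hi hk; rewrite /cheap /= !andbT.
  have h1 := ht k ltac:(lia).
  have h2 : (bits i <= bits maxreg)%N by apply: bits_le; rewrite leq_max hi orbT.
  by lia.
- move=> e1 IH1 e2 IH2 k [//|c] /andP[w1 w2] hk.
  rewrite !all_cat (IH2 _ _ w2) ?(IH1 _ _ w1) /=; [|lia|lia].
  rewrite /cheap /= andbT; have h1 := ht k ltac:(lia); have h2 := ht k.+1 ltac:(lia); lia.
- move=> e1 IH1 e2 IH2 k [//|c] /andP[w1 w2] hk.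
  rewrite !all_cat (IH2 _ _ w2) ?(IH1 _ _ w1) /=; [|lia|lia].
  rewrite /cheap /= andbT; have h1 := ht k ltac:(lia); have h2 := ht k.+1 ltac:(lia); lia.
- move=> e1 IH1 e2 IH2 k [//|[//|c]] /andP[w1 w2] hk.
  rewrite !all_cat (IH2 _ _ w2) ?(IH1 _ _ w1) /=; [|lia|lia].
  rewrite /cheap /= andbT; have h1 := ht k ltac:(lia); have h2 := ht k.+1 ltac:(lia).
  have h3 := ht k.+2 ltac:(lia); lia.
- move=> e1 IH1 k c w1 hk; rewrite all_cat (IH1 _ _ w1) //=.
  by rewrite /cheap /= andbT; have h1 := ht k ltac:(lia); lia.
Qed.

Lemma cheap_compile (O : Type) osize p : all wfs p ->
  all (cheap osize maxreg) (@compile O p).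
Proof.
have ht i : (i <= dep.+1)%N -> (bits (tmp i) <= bits maxreg)%N.
  by move=> hi; apply: bits_le; rewrite leq_max /tmp leq_add2l hi.
have hr g t j : okvar g t j -> (bits (reg g t j) <= bits maxreg)%N.
  by move=> h; apply: bits_le; rewrite leq_max ltnW // reg_lt_tmp.
have h0 : (bits 0 <= bits maxreg)%N by apply: bits_le.
elim: p => //= c p IH /andP[wc /IH]; rewrite all_cat => ->; rewrite andbT.
case: c wc => /= [g t j e /andP[hv he]|b g t j hv|e he].
- rewrite all_cat (cheap_comp _ he) //= /cheap /= andbT.
  by have := hr _ _ _ hv; have := ht 0%N isT; lia.
- by rewrite /cheap /= andbT; have := hr _ _ _ hv; lia.
- by rewrite all_cat (cheap_comp _ he) //= /cheap /= andbT; have := ht 0%N isT; lia.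
Qed.

Lemma compile_nosend (O : Type) p :
  all (fun c => if c is SSnd _ then false else true) p ->
  ~~ has (@is_send O) (compile O p).
Proof.
have hc k e : ~~ has (@is_send O) (comp O k e).
  by elim: e k => //= [e1 I1 e2 I2|e1 I1 e2 I2|e1 I1 e2 I2|e1 I1] k;
    rewrite !has_cat /= !negb_or ?I1 ?I2.
elim: p => //= c p IH /andP[nc /IH]; rewrite has_cat negb_or => ->; rewrite andbT.
by case: c nc => //= *; rewrite has_cat negb_or hc.
Qed.

Section Correctness.
Variables (O T : Type) (code : seq (instr O)).
Variable special : O -> memory -> T -> memory * T.
Variable F : bool -> seq bool.
Variable inp : nat -> nat.

Definition at_code p (l : seq (instr O)) :=
  forall i, (i < size l)%N -> nth (Halt 0) code (p + i) = nth (Halt 0) l i.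

Lemma at_cat p l1 l2 : at_code p (l1 ++ l2) ->
  at_code p l1 /\ at_code (p + size l1) l2.
Proof.
move=> h; split=> i hi.
  by rewrite h ?nth_cat ?hi // size_cat ltn_addr.
by rewrite -addnA h ?size_cat ?ltn_add2l // nth_cat ltnNge leq_addr /= addKn.
Qed.

Definition seg n p f nr (t : T) f' nr' t' o :=
  forall c o0, iter n (tick code special F) (Machine p f nr c None t, o0) =
    (Machine (p + n) f' nr' (c + n) None t', o0 ++ o).

Lemma seg0 p f nr t : seg 0 p f nr t f nr t [::].
Proof. by move=> c o0; rewrite /= !addn0 cats0. Qed.

Lemma seg_add n1 n2 p f nr t f1 nr1 t1 o1 f2 nr2 t2 o2 :
  seg n1 p f nr t f1 nr1 t1 o1 -> seg n2 (p + n1) f1 nr1 t1 f2 nr2 t2 o2 ->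
  seg (n1 + n2) p f nr t f2 nr2 t2 (o1 ++ o2).
Proof.
by move=> h1 h2 c o0; rewrite addnC iterD h1 h2 catA -!addnA (addnC n2).
Qed.

Lemma seg_add0 n1 n2 p f nr t f1 nr1 t1 f2 nr2 t2 o2 :
  seg n1 p f nr t f1 nr1 t1 [::] -> seg n2 (p + n1) f1 nr1 t1 f2 nr2 t2 o2 ->
  seg (n1 + n2) p f nr t f2 nr2 t2 o2.
Proof. exact: seg_add. Qed.

Definition simple1 (c : instr O) (f : memory) : option memory :=
  match c with
  | Const i k => Some (upd f i k)
  | Plus i j k => Some (upd f i (f j + f k)%N)
  | Minus i j k => Some (upd f i (f j - f k)%N)
  | _ => None
  end.

Lemma seg_simple c p f nr t f' : nth (Halt 0) code p = c -> simple1 c f = Some f' ->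
  seg 1 p f nr t f' nr t [::].
Proof.
move=> hc h k o0; rewrite /= /tick /step /= hc.
by case: c h {hc} => //= [i j|i j l|i j l] [<-]; rewrite !addn1.
Qed.

Fixpoint simples (l : seq (instr O)) (f : memory) : option memory :=
  if l is c :: l' then obind (simples l') (simple1 c f) else Some f.

Lemma seg_simples l p f nr t f' : at_code p l -> simples l f = Some f' ->
  seg (size l) p f nr t f' nr t [::].
Proof.
elim: l p f => [|c l IH] p f /= hat; first by move=> [<-]; exact: seg0.
case E: (simple1 c f) => [f1|] //= h.
rewrite -add1n; apply: seg_add0.
  by apply: (seg_simple nr t _ E); rewrite -(addn0 p) hat.
by apply: IH h => i hi; rewrite addn1 addSnnS hat.
Qed.

Definition represents (f : memory) (v : env) :=
  (forall k, (k < base)%N -> f k = inp k) /\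
  (forall g t j, okvar g t j -> f (reg g t j) = v g t j).

Lemma represents_eq f f' v : represents f v ->
  (forall r, (r < tmp 0)%N -> f' r = f r) -> represents f' v.
Proof.
move=> [h1 h2] E; split=> [k hk|g t j hv].
  by rewrite E ?h1 // /tmp; lia.
by rewrite E ?h2 // reg_lt_tmp.
Qed.

Lemma simples_cat l1 l2 f f1 : simples l1 f = Some f1 ->
  simples (l1 ++ l2) f = simples l2 f1.
Proof.
by elim: l1 f => [|c l1 IH] f /=; [move=> [->]|case: (simple1 c f) => //= f2; exact: IH].
Qed.

Lemma tmp_neq i j : i != j -> (tmp i == tmp j) = false.
Proof. by move=> h; rewrite /tmp; lia. Qed.

Definition comp_ok e := forall c k f v, represents f v -> wf c e ->
  exists f', [/\ simples (comp O k e) f = Some f',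
    f' (tmp k) = eval inp v e & forall r, (r < tmp k)%N -> f' r = f r].

Lemma comp_ok2 e1 e2 c1 c2 k f v l : comp_ok e1 -> comp_ok e2 ->
  represents f v -> wf c1 e1 -> wf c2 e2 ->
  exists f', [/\ simples (comp O k e2 ++ comp O k.+1 e1 ++ l) f = simples l f',
      f' (tmp k) = eval inp v e2, f' (tmp k.+1) = eval inp v e1
      & forall r, (r < tmp k)%N -> f' r = f r].
Proof.
move=> IH1 IH2 r0 w1 w2.
have [f1 [E1 v1 fr1]] := IH2 _ k _ _ r0 w2.
have r1 : represents f1 v.
  by apply: (represents_eq r0) => r hr; apply: fr1; move: hr; rewrite /tmp; lia.
have [f2 [E2 v2 fr2]] := IH1 _ k.+1 _ _ r1 w1.
exists f2; split=> //.
- by rewrite (simples_cat _ E1) (simples_cat _ E2).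
- by rewrite fr2 ?v1 // /tmp; lia.
- by move=> r hr; rewrite fr2 ?fr1 //; move: hr; rewrite /tmp; lia.
Qed.

Lemma comp_correct e : comp_ok e.
Proof.
have base_tmp i j : (i < base)%N -> (i == tmp j) = false by rewrite /tmp; lia.
have fr (r i j : nat) : (r < tmp i)%N -> (i <= j)%N -> (r == tmp j) = false.
  by rewrite /tmp; lia.
have t1 k : (tmp k.+1 == tmp k) = false by apply: tmp_neq; lia.
have t2 k : (tmp k.+2 == tmp k) = false by apply: tmp_neq; lia.
have t3 k : (tmp k == tmp k.+2) = false by apply: tmp_neq; lia.
have t4 k : (tmp k.+1 == tmp k.+2) = false by apply: tmp_neq; lia.
have t5 k : (tmp k.+2 == tmp k.+1) = false by apply: tmp_neq; lia.
have t6 k : (tmp k == tmp k.+1) = false by apply: tmp_neq; lia.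
elim: e => [i|g t j|i|e1 IH1 e2 IH2|e1 IH1 e2 IH2|e1 IH1 e2 IH2|e1 IH1] c k f v.
- move=> [h1 h2] /= hi; eexists; split; first by [].
    by rewrite /upd eqxx base_tmp // h1.
  by move=> r hr; rewrite /upd !(fr _ _ _ hr).
- move=> [h1 h2] /= hi; eexists; split; first by [].
    by rewrite /upd eqxx (fr _ k k) ?h2 // reg_lt_tmp.
  by move=> r hr; rewrite /upd !(fr _ _ _ hr).
- move=> _ /= hi; eexists; split; first by [].
    by rewrite /upd eqxx.
  by move=> r hr; rewrite /upd !(fr _ _ _ hr).
- move=> r0; case: c => [//|c] /= /andP[w1 w2].
  have [f' [E E1 E2 E3]] := comp_ok2 k [:: Plus (tmp k) (tmp k.+1) (tmp k)] IH1 IH2 r0 w1 w2.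
  rewrite E /=; eexists; split; first by [].
    by rewrite /upd eqxx E1 E2.
  by move=> r hr; rewrite /upd !(fr _ _ _ hr) // E3.
- move=> r0; case: c => [//|c] /= /andP[w1 w2].
  have [f' [E E1 E2 E3]] := comp_ok2 k [:: Minus (tmp k) (tmp k.+1) (tmp k)] IH1 IH2 r0 w1 w2.
  rewrite E /=; eexists; split; first by [].
    by rewrite /upd eqxx E1 E2.
  by move=> r hr; rewrite /upd !(fr _ _ _ hr) // E3.
- move=> r0; case: c => [//|[//|c]] /= /andP[w1 w2].
  have [f' [-> E1 E2 E3]] := comp_ok2 k [:: Minus (tmp k.+2) (tmp k.+1) (tmp k);
    Minus (tmp k) (tmp k) (tmp k.+1); Plus (tmp k) (tmp k.+2) (tmp k)] IH1 IH2 r0 w1 w2.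
  eexists; split; first by [].
    by rewrite /upd !(eqxx, t1, t2, t3, t4, t5, t6) E1 E2.
  by move=> r hr; rewrite /upd !(fr _ _ _ hr) ?E3 //; lia.
- move=> r0 /= w1; have [f' [E E1 E2]] := IH1 _ k _ _ r0 w1.
  rewrite (simples_cat _ E) /=; eexists; split; first by [].
    by rewrite /upd eqxx E1 addnn.
  by move=> r hr; rewrite /upd !(fr _ _ _ hr) // E2.
Qed.

Lemma represents_upd f v g t j c : represents f v -> okvar g t j ->
  represents (upd f (reg g t j) c) (updv v g t j c).
Proof.
move=> [h1 h2] hv; split=> [k hk|g' t' j' hv'].
  by rewrite /upd ifF ?h1 // /reg; lia.
rewrite /upd /updv; case: ifP => [/eqP E|nE].
  by have [-> -> ->] := reg_inj hv' hv E; rewrite !eqxx.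
rewrite ifF ?h2 //; apply/negP => /and3P[/eqP ? /eqP ? /eqP ?]; subst.
by rewrite eqxx in nE.
Qed.

Definition channels (nr : bool -> nat) (r : bool -> seq bool) :=
  forall b, r b = drop (nr b) (F b).

(** By [fed] every receive finds its bit, so no tick is lost to waiting and the segment takes
    exactly as many ticks as it has lines. *)
Lemma compile_correct p l f nr (t : T) v r o : at_code l (compile O p) ->
  all wfs p -> represents f v -> channels nr r -> fed inp p (v, r, o) ->
  exists f' nr' o', let s := hexec inp p (v, r, o) in
    [/\ seg (size (compile O p)) l f nr t f' nr' t o',
        represents f' s.1.1, channels nr' s.1.2 & s.2 = o ++ o'].
Proof.
elim: p l f nr v r o => [|c p IH] l f nr v r o.
  move=> _ _ h1 h2 _; exists f, nr, [::]; split=> //; [exact: seg0|by rewrite cats0].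
move=> /at_cat[at1 at2] /andP[wc wp] rf ch /andP[fc fp].
rewrite [hexec _ _ _]/(hexec inp p (hstep inp (v, r, o) c)).
rewrite [compile O _]/(comps O c ++ compile O p).
suff [f1 [nr1 [o1 [s1 r1 c1 E1]]]] : exists f1 nr1 o1,
    [/\ seg (size (comps O c)) l f nr t f1 nr1 t o1,
     represents f1 (hstep inp (v, r, o) c).1.1,
     channels nr1 (hstep inp (v, r, o) c).1.2
     & (hstep inp (v, r, o) c).2 = o ++ o1].
  case: (hstep inp (v, r, o) c) r1 c1 E1 fp => [[v2 r2] o2] rr cc EE fp'.
  have [f' [nr' [o' [s' r' c' E']]]] := IH _ _ _ _ _ _ at2 wp rr cc fp'.
  exists f', nr', (o1 ++ o'); rewrite size_cat; split=> //.
  - exact: seg_add s1 s'.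
  - by move: EE => /= EE; rewrite E' EE catA.
case: c wc fc at1 {at2 fp} => [g t' j e|b g t' j|e] /=.
- move=> /andP[hv we] _ at1.
  have [f' [E E1 E2]] := comp_correct 0 rf we.
  have rf' := represents_eq rf E2.
  have E3 : simples (comp O 0 e ++ [:: Const (reg g t' j) 0;
     Plus (reg g t' j) (reg g t' j) (tmp 0)]) f =
     Some (upd (upd f' (reg g t' j) 0) (reg g t' j) (eval inp v e)).
    rewrite (simples_cat _ E) /= /upd eqxx ifF ?E1 ?add0n //.
    by have := reg_lt_tmp 0 hv; lia.
  eexists; exists nr, [::]; split; first exact: (seg_simples nr t at1 E3).
  - have := represents_upd (eval inp v e) (represents_upd 0 rf' hv) hv.
    move=> [q1 q2]; split=> // g1 t1 j1 h1; rewrite q2 // /hstep /updv /=.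
    by case: [&& _, _ & _].
  - exact: ch.
  - by rewrite cats0.
- move=> hv nb at1.
  case Er: (r b) nb => [//|a s] _.
  have Eo : onth (F b) (nr b) = Some a.
    move: (ch b); rewrite Er => {}Er.
    have hs : (nr b < size (F b))%N.
      by rewrite ltnNge; apply/negP => h; rewrite drop_oversize in Er.
    by rewrite onthE (nth_map false) // -[nr b]addn0 -nth_drop -Er.
  exists (upd f (reg g t' j) a), (incr nr b), [::]; split.
  - move=> k o0 /=; rewrite /tick /step /= -(addn0 l) at1 //= Eo /=.
    by rewrite !addn0 !addn1.
  - by rewrite /=; exact: represents_upd.
  - move=> b'; rewrite /incr (ch b'); case: ifP => _; last by rewrite addn0.
    by rewrite addn1 -drop1 drop_drop.
  - by rewrite cats0.
- move=> we _ at1.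
  have [f' [E E1 E2]] := comp_correct 0 rf we.
  have [at2 at3] := at_cat at1.
  exists f', nr, [:: eval inp v e != 0%N]; split=> //.
  + rewrite size_cat; apply: seg_add0 (seg_simples nr t at2 E) _.
    move=> k o0 /=; rewrite /tick /step /= -(addn0 (_ + _)%N) at3 //= E1.
    by rewrite !addn0 !addn1.
  + exact: represents_eq rf E2.
  + by rewrite cats1.
Qed.

End Correctness.
End Compilation.

(* In all these expressions the last operand is evaluated first, so that a fold
   needs a bounded number of temporaries. *)
Definition eN e := Sub (Cst 1) e.
Definition eA e1 e2 := Sub e1 (Sub (Cst 1) e2).
Definition eO e1 e2 := Sub (Cst 1) (Sub (Sub (Cst 1) e1) e2).
Definition eLe e1 e2 := eN (Sub e1 e2).
Definition eEq e1 e2 := eN (Dst e1 e2).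
Definition eSum n f := foldr (fun j acc => Add (f j) acc) (Cst 0) (iota 0 n).
Definition ePar n f := foldr (fun j acc => Dst (f j) acc) (Cst 0) (iota 0 n).
Definition eAll n f := foldr (fun j acc => eA (f j) acc) (Cst 1) (iota 0 n).
Definition eHas n f := foldr (fun j acc => eO (f j) acc) (Cst 0) (iota 0 n).
Definition eMux n b f :=
  foldr (fun j acc => eO (eA (b j) (f j)) (eA (eN (b j)) acc)) (Cst 0) (iota 0 n).
Definition eNum n f := foldr (fun j acc => Add (f j) (Dbl acc)) (Cst 0) (iota 0 n).

Definition num (s : seq bool) : nat := foldr (fun (b : bool) r => b + r.*2)%N 0 s.

Section Evaluation.
Variables (inp : nat -> nat) (v : env).
Local Notation ev := (eval inp v).
Implicit Types (b c : bool).

Lemma ev_N e b : ev e = b -> ev (eN e) = ~~ b.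
Proof. by move=> /= ->; case: b. Qed.

Lemma ev_A e1 e2 b c : ev e1 = b -> ev e2 = c -> ev (eA e1 e2) = b && c.
Proof. by move=> /= -> ->; case: b; case: c. Qed.

Lemma ev_O e1 e2 b c : ev e1 = b -> ev e2 = c -> ev (eO e1 e2) = b || c.
Proof. by move=> /= -> ->; case: b; case: c. Qed.

Lemma ev_Le e1 e2 m n : ev e1 = m -> ev e2 = n -> ev (eLe e1 e2) = (m <= n)%N.
Proof. by move=> /= -> ->; case: leqP => h; lia. Qed.

Lemma ev_Eq e1 e2 m n : ev e1 = m -> ev e2 = n -> ev (eEq e1 e2) = (m == n).
Proof. by move=> /= -> ->; rewrite /distn'; case: eqP => h; lia. Qed.

Lemma ev_Eqb e1 e2 b c : ev e1 = b -> ev e2 = c -> ev (eEq e1 e2) = (b == c).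
Proof. by move=> /ev_Eq h /h ->; case: b {h}; case: c. Qed.

Lemma ev_Sum n f (c : nat -> nat) : (forall j, (j < n)%N -> ev (f j) = c j) ->
  ev (eSum n f) = (\sum_(j < n) c j)%N.
Proof.
rewrite -(big_mkord xpredT c) /index_iota subn0 => h.
have : {in iota 0 n, forall j, ev (f j) = c j} by move=> j; rewrite mem_iota => /h.
rewrite /eSum; elim: (iota 0 n) => [|j s IH] hs; first by rewrite big_nil.
by rewrite big_cons /= hs ?mem_head // IH // => i hi; apply: hs; rewrite inE hi orbT.
Qed.

Lemma ev_Par n f (c : nat -> bool) : (forall j, (j < n)%N -> ev (f j) = c j) ->
  ev (ePar n f) = odd (\sum_(j < n) c j)%N.
Proof.
rewrite -(big_mkord xpredT (fun j => nat_of_bool (c j))) /index_iota subn0 => h.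
have : {in iota 0 n, forall j, ev (f j) = c j} by move=> j; rewrite mem_iota => /h.
rewrite /ePar; elim: (iota 0 n) => [|j s IH] hs; first by rewrite big_nil.
rewrite big_cons oddD [LHS]/= hs ?mem_head // IH; last first.
  by move=> i hi; apply: hs; rewrite inE hi orbT.
by case: (c j); case: (odd _).
Qed.

Lemma ev_All n f (c : nat -> bool) : (forall j, (j < n)%N -> ev (f j) = c j) ->
  ev (eAll n f) = all c (iota 0 n).
Proof.
move=> h; have : {in iota 0 n, forall j, ev (f j) = c j}.
  by move=> j; rewrite mem_iota => /h.
rewrite /eAll; elim: (iota 0 n) => [//|j s IH] hs.
apply: ev_A; first by rewrite hs ?mem_head.
by apply: IH => i hi; apply: hs; rewrite inE hi orbT.
Qed.

Lemma ev_Has n f (c : nat -> bool) : (forall j, (j < n)%N -> ev (f j) = c j) ->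
  ev (eHas n f) = has c (iota 0 n).
Proof.
move=> h; have : {in iota 0 n, forall j, ev (f j) = c j}.
  by move=> j; rewrite mem_iota => /h.
rewrite /eHas; elim: (iota 0 n) => [//|j s IH] hs.
apply: ev_O; first by rewrite hs ?mem_head.
by apply: IH => i hi; apply: hs; rewrite inE hi orbT.
Qed.

Lemma ev_Mux n eb ef (b f : nat -> bool) :
  (forall j, (j < n)%N -> ev (eb j) = b j /\ ev (ef j) = f j) ->
  ev (eMux n eb ef) = has b (iota 0 n) && f (find b (iota 0 n)).
Proof.
have main m k : (forall j, (k <= j < k + m)%N -> ev (eb j) = b j /\ ev (ef j) = f j) ->
    ev (foldr (fun j acc => eO (eA (eb j) (ef j)) (eA (eN (eb j)) acc)) (Cst 0)
      (iota k m)) = has b (iota k m) && f (k + find b (iota k m))%N.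
  elim: m k => [//|m IH] k hs.
  have [hb hf] := hs k ltac:(lia).
  have IH' := IH k.+1 (fun j hj => hs j ltac:(lia)).
  apply: (etrans (ev_O (ev_A hb hf) (ev_A (ev_N hb) IH'))).
  by rewrite /=; case: (b k); rewrite /= ?addn0 ?orbF // addSnnS.
by move=> hs; apply: (main n 0%N) => j hj; apply: hs.
Qed.

Lemma ev_Num n f (c : nat -> bool) : (forall j, (j < n)%N -> ev (f j) = c j) ->
  ev (eNum n f) = num (mkseq c n).
Proof.
move=> h; have : {in iota 0 n, forall j, ev (f j) = c j}.
  by move=> j; rewrite mem_iota => /h.
rewrite /eNum /mkseq; elim: (iota 0 n) => [//|j s IH] hs /=.
rewrite hs ?mem_head // IH // => i hi; apply: hs; by rewrite inE hi orbT.
Qed.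

End Evaluation.

Section WellFormed.
Variables (base ng D cmax nt : nat).
Hypothesis cmax_gt0 : (0 < cmax)%N.
Local Notation wf := (wf base ng D cmax nt).

Lemma wf_le c c' e : wf c e -> (c <= c')%N -> wf c' e.
Proof.
elim: e c c' => //= [e1 I1 e2 I2|e1 I1 e2 I2|e1 I1 e2 I2].
- move=> [//|c] [//|c'] /andP[h1 h2] hc; apply/andP; split; [exact: I1 h1 _|exact: I2 h2 _].
- move=> [//|c] [//|c'] /andP[h1 h2] hc; apply/andP; split; [exact: I1 h1 _|exact: I2 h2 _].
- move=> [//|[//|c]] [//|[//|c']] /andP[h1 h2] hc.
  by apply/andP; split; [exact: I1 h1 _|exact: I2 h2 _].
Qed.

Lemma wf_N c e : wf c.+1 e -> wf c.+1 (eN e).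
Proof. by move=> h; rewrite /= cmax_gt0. Qed.

Lemma wf_A c e1 e2 : wf c e1 -> wf c.+1 e2 -> wf c.+1 (eA e1 e2).
Proof. by move=> h1 h2; rewrite /= h1 cmax_gt0. Qed.

Lemma wf_O c e1 e2 : wf c.+1 e1 -> wf c.+2 e2 -> wf c.+2 (eO e1 e2).
Proof. by move=> h1 h2 /=; rewrite h1 h2 cmax_gt0. Qed.

Lemma wf_Le c e1 e2 : wf c e1 -> wf c.+1 e2 -> wf c.+1 (eLe e1 e2).
Proof. by move=> h1 h2; rewrite /= h1 cmax_gt0. Qed.

Lemma wf_Eq c e1 e2 : wf c.+1 e1 -> wf c.+2 e2 -> wf c.+2 (eEq e1 e2).
Proof. by move=> h1 h2; rewrite /= h1 cmax_gt0. Qed.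

Lemma wf_foldr c (op : nat -> exp -> exp) e0 n :
  (forall j acc, (j < n)%N -> wf c acc -> wf c (op j acc)) -> wf c e0 ->
  wf c (foldr op e0 (iota 0 n)).
Proof.
move=> h h0.
have : {in iota 0 n, forall j acc, wf c acc -> wf c (op j acc)}.
  by move=> j; rewrite mem_iota => /h; apply.
elim: (iota 0 n) => //= j s IH hs; apply: (hs); first exact: mem_head.
by apply: IH => i hi; apply: hs; rewrite inE hi orbT.
Qed.

Lemma wf_Sum c n f : (forall j, (j < n)%N -> wf c (f j)) -> wf c.+1 (eSum n f).
Proof. by move=> h; apply: wf_foldr => // j acc /h /= ->. Qed.

Lemma wf_Par c n f : (forall j, (j < n)%N -> wf c.+1 (f j)) -> wf c.+2 (ePar n f).
Proof. by move=> h; apply: wf_foldr => // j acc /h /= ->. Qed.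

Lemma wf_All c n f : (forall j, (j < n)%N -> wf c (f j)) -> wf c.+1 (eAll n f).
Proof. by move=> h; apply: wf_foldr => // j acc /h h1; exact: wf_A. Qed.

Lemma wf_Has c n f : (forall j, (j < n)%N -> wf c.+1 (f j)) -> wf c.+2 (eHas n f).
Proof. by move=> h; apply: wf_foldr => // j acc /h h1; exact: wf_O. Qed.

Lemma wf_Mux c n b f : (forall j, (j < n)%N -> wf c (b j)) ->
  (forall j, (j < n)%N -> wf c.+1 (f j)) -> wf c.+2 (eMux n b f).
Proof.
move=> hb hf; apply: wf_foldr => // j acc hj ha.
apply: wf_O; first by apply: wf_A; [exact: hb|exact: hf].
by apply: wf_A => //; apply: wf_N; apply: wf_le (hb _ hj) _.
Qed.

Lemma wf_Num c n f : (forall j, (j < n)%N -> wf c (f j)) -> wf c.+1 (eNum n f).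
Proof. by move=> h; apply: wf_foldr => // j acc /h /= ->. Qed.

End WellFormed.

Lemma esz_foldr (op : nat -> exp -> exp) e0 n B :
  (forall j acc, (j < n)%N -> (esz (op j acc) <= B + esz acc)%N) ->
  (esz (foldr op e0 (iota 0 n)) <= n * B + esz e0)%N.
Proof.
move=> h.
have : {in iota 0 n, forall j acc, (esz (op j acc) <= B + esz acc)%N}.
  by move=> j; rewrite mem_iota => /h; apply.
rewrite -[X in (_ <= X * _ + _)%N](size_iota 0 n); elim: (iota 0 n) => //= j s IH hs.
have := hs j (mem_head _ _) (foldr op e0 s).
have := IH (fun i hi => hs i ltac:(by rewrite inE hi orbT)).
by rewrite mulSn; lia.
Qed.

Lemma esz_Sum n f B : (forall j, (j < n)%N -> (esz (f j) <= B)%N) ->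
  (esz (eSum n f) <= n * (B + 5) + 1)%N.
Proof. by move=> h; apply: esz_foldr => j acc /h /=; lia. Qed.

Lemma esz_Par n f B : (forall j, (j < n)%N -> (esz (f j) <= B)%N) ->
  (esz (ePar n f) <= n * (B + 5) + 1)%N.
Proof. by move=> h; apply: esz_foldr => j acc /h /=; lia. Qed.

Lemma esz_All n f B : (forall j, (j < n)%N -> (esz (f j) <= B)%N) ->
  (esz (eAll n f) <= n * (B + 5) + 1)%N.
Proof. by move=> h; apply: esz_foldr => j acc /h /=; lia. Qed.

Lemma esz_Has n f B : (forall j, (j < n)%N -> (esz (f j) <= B)%N) ->
  (esz (eHas n f) <= n * (B + 5) + 1)%N.
Proof. by move=> h; apply: esz_foldr => j acc /h /=; lia. Qed.

Lemma esz_Num n f B : (forall j, (j < n)%N -> (esz (f j) <= B)%N) ->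
  (esz (eNum n f) <= n * (B + 5) + 1)%N.
Proof. by move=> h; apply: esz_foldr => j acc /h /=; lia. Qed.

(** Expressions are trees, so duplication costs. The selector is duplicated, whence [3 * B], but the
    accumulator is not, whence a size linear in [n]. *)
Lemma esz_Mux n b f B : (forall j, (j < n)%N -> (esz (b j) <= B)%N) ->
  (forall j, (j < n)%N -> (esz (f j) <= B)%N) ->
  (esz (eMux n b f) <= n * (3 * B + 13) + 1)%N.
Proof.
move=> hb hf; apply: esz_foldr => j acc hj /=; have := hb j hj; have := hf j hj; lia.
Qed.

(** * Array statements *)

Definition Lasg g t n e := [seq SAsg g t j (e j) | j <- iota 0 n].
Definition Lrcv b g t n := [seq SRcv b g t j | j <- iota 0 n].
(** Prefix sums: cell [j] receives the sum over the indices below [j]. Ranks and slot positions are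
    computed in this way. *)
Definition Lscan g t n e := SAsg g t 0 (Cst 0) ::
  [seq SAsg g t j.+1 (Add (e j) (Var g t j)) | j <- iota 0 n].

Definition setv (v : env) g t n (c : nat -> nat) : env :=
  fun g' t' j' => if [&& g' == g, t' == t & (j' < n)%N] then c j' else v g' t' j'.

Section Arrays.
Variable inp : nat -> nat.
Local Notation hexec := (hexec inp).
Local Notation fed := (fed inp).

Lemma hexec_cat p1 p2 s : hexec (p1 ++ p2) s = hexec p2 (hexec p1 s).
Proof. exact: foldl_cat. Qed.

Lemma fed_cat p1 p2 s : fed (p1 ++ p2) s = fed p1 s && fed p2 (hexec p1 s).
Proof. by elim: p1 s => //= c p1 IH s; rewrite IH andbA. Qed.

Definition same_but g t (v v' : env) :=
  forall g' t' j', (g' != g) || (t' != t) -> v' g' t' j' = v g' t' j'.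

Lemma setv0 v g t c : setv v g t 0 c = v.
Proof. by apply/funext => g'; apply/funext => t'; apply/funext => j'; rewrite /setv ltn0 !andbF. Qed.

Lemma setvS v g t n c : updv (setv v g t n c) g t n (c n) = setv v g t n.+1 c.
Proof.
apply/funext => g'; apply/funext => t'; apply/funext => j'; rewrite /setv /updv.
case: (g' == g) => //; case: (t' == t) => //=.
by rewrite ltnS [in RHS]leq_eqVlt; case: eqP => [->|].
Qed.

Lemma same_setv v g t n c : same_but g t v (setv v g t n c).
Proof. by move=> g' t' j'; rewrite /setv; do 2 case: eqP => //. Qed.

Lemma setvE v g t n c j : (j < n)%N -> setv v g t n c g t j = c j.
Proof. by move=> h; rewrite /setv !eqxx h. Qed.

(** The hypothesis quantifies over all states that differ only in the array being filled, so that
    the value of [e j] is the same at every stage of the filling. *)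
Lemma hexec_Lasg v r o g t n e c :
  (forall v' j, same_but g t v v' -> (j < n)%N -> eval inp v' (e j) = c j) ->
  hexec (Lasg g t n e) (v, r, o) = (setv v g t n c, r, o).
Proof.
rewrite /Lasg; elim: n => [|n IH] h; first by rewrite setv0.
rewrite -addn1 iotaD map_cat hexec_cat IH; last by move=> v' j h1 h2; apply: h => //; lia.
by rewrite /= add0n h //; [rewrite setvS addn1|exact: same_setv].
Qed.

Lemma fed_Lasg s g t n e : fed (Lasg g t n e) s.
Proof. by rewrite /Lasg; elim: (iota 0 n) s => //= j l IH s. Qed.

Lemma hexec_Lscan v r o g t n e c :
  (forall v' j, same_but g t v v' -> (j < n)%N -> eval inp v' (e j) = c j) ->
  hexec (Lscan g t n e) (v, r, o) =
    (setv v g t n.+1 (fun j => \sum_(i < j) c i)%N, r, o).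
Proof.
rewrite /Lscan; elim: n => [|n IH] h.
  by rewrite -setvS setv0 /= big_ord0.
rewrite -addn1 iotaD map_cat -cat_cons hexec_cat IH; last first.
  by move=> v' j h1 h2; apply: h => //; lia.
rewrite /= add0n h //; last exact: same_setv.
have -> : (c n + setv v g t n.+1 (fun j => \sum_(i < j) c i) g t n = \sum_(i < n.+1) c i)%N.
  by rewrite setvE // big_ord_recr addnC.
by rewrite addn1 setvS.
Qed.

Lemma fed_Lscan s g t n e : fed (Lscan g t n e) s.
Proof. by rewrite /Lscan /=; elim: (iota 0 n) (hstep _ _ _) => //= j l IH s'. Qed.

Lemma hexec_Lrcv v (r : bool -> seq bool) o b g t n l1 l2 : r b = l1 ++ l2 -> size l1 = n ->
  hexec (Lrcv b g t n) (v, r, o) =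
    (setv v g t n (fun j => nth false l1 j), fun b' => if b' == b then l2 else r b', o).
Proof.
elim: n l1 l2 => [|n IH] l1 l2 Er.
  move=> /size0nil E; rewrite setv0 /=; congr (_, _, _).
  by apply/funext => b'; case: eqP => // ->; rewrite Er E.
case/lastP: l1 Er => [//|l1 a]; rewrite cat_rcons size_rcons => Er [Es].
rewrite /Lrcv -addn1 iotaD map_cat hexec_cat (IH _ _ Er Es) /= add0n addn1 eqxx.
congr (_, _, _).
  rewrite -setvS nth_rcons Es ltnn eqxx; congr updv.
  apply/funext => g'; apply/funext => t'; apply/funext => j'; rewrite /setv.
  by case: and3P => // -[_ _ hj]; rewrite nth_rcons Es hj.
by apply/funext => b'; case: eqP.
Qed.

Lemma fed_Lrcv v (r : bool -> seq bool) o b g t n l1 l2 : r b = l1 ++ l2 -> size l1 = n ->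
  fed (Lrcv b g t n) (v, r, o).
Proof.
elim: n l1 l2 => [|n IH] l1 l2 Er //.
case/lastP: l1 Er => [//|l1 a]; rewrite cat_rcons size_rcons => Er [Es].
rewrite /Lrcv -addn1 iotaD map_cat fed_cat; apply/andP; split; first exact: IH Er Es.
by rewrite -/(Lrcv b g t n) (hexec_Lrcv _ _ _ _ Er Es) /= eqxx.
Qed.

End Arrays.

Section ArraySizes.
Variables (base ng D dep cmax nt : nat).
Local Notation wfs := (wfs base ng D dep cmax nt).

Lemma wfs_Lasg g t n e : (g < ng)%N -> (t < nt)%N -> (n <= D)%N ->
  (forall j, (j < n)%N -> wf base ng D cmax nt dep (e j)) -> all wfs (Lasg g t n e).
Proof.
move=> hg ht hn he; rewrite all_map; apply/allP => j; rewrite mem_iota add0n => hj /=.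
by rewrite he // andbT /okvar hg ht /=; lia.
Qed.

Lemma wfs_Lrcv b g t n : (g < ng)%N -> (t < nt)%N -> (n <= D)%N ->
  all wfs (Lrcv b g t n).
Proof.
move=> hg ht hn; rewrite all_map; apply/allP => j; rewrite mem_iota add0n => hj /=.
by rewrite /okvar hg ht /=; lia.
Qed.

Lemma wfs_Lscan g t n e : (g < ng)%N -> (t < nt)%N -> (n < D)%N ->
  (forall j, (j < n)%N -> wf base ng D cmax nt dep.-1 (e j)) -> (0 < dep)%N ->
  all wfs (Lscan g t n e).
Proof.
move=> hg ht hn he hd; rewrite /= /okvar hg ht /= !andbT; apply/andP; split; first by lia.
rewrite all_map; apply/allP => j; rewrite mem_iota add0n => hj /=.
rewrite /okvar hg ht /=; apply/andP; split; first by lia.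
by move: (he j hj) hd; case: dep => //= dep' -> _; lia.
Qed.

Lemma psz_cat p1 p2 : psz (p1 ++ p2) = (psz p1 + psz p2)%N.
Proof. by rewrite /psz map_cat sumn_cat. Qed.

Lemma psz_map (f : nat -> stmt) n B : (forall j, (j < n)%N -> (ssz (f j) <= B)%N) ->
  (psz [seq f j | j <- iota 0 n] <= n * B)%N.
Proof.
move=> h; have : {in iota 0 n, forall j, (ssz (f j) <= B)%N}.
  by move=> j; rewrite mem_iota => /h.
rewrite -[X in (_ <= X * _)%N](size_iota 0 n) /psz; elim: (iota 0 n) => //= j s IH hs.
have := hs j (mem_head _ _); have := IH (fun i hi => hs i ltac:(by rewrite inE hi orbT)).
by rewrite mulSn; lia.
Qed.

Lemma psz_Lasg g t n e B : (forall j, (j < n)%N -> (esz (e j) <= B)%N) ->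
  (psz (Lasg g t n e) <= n * (B + 5))%N.
Proof. by move=> h; apply: psz_map => j /h /=; lia. Qed.

Lemma psz_Lscan g t n e B : (forall j, (j < n)%N -> (esz (e j) <= B)%N) ->
  (psz (Lscan g t n e) <= n * (B + 5) + 3)%N.
Proof.
move=> h; rewrite /psz /= -/(psz _).
suff : (psz [seq SAsg g t j.+1 (Add (e j) (Var g t j)) | j <- iota 0 n] <= n * (B + 5))%N.
  by rewrite /psz; lia.
by apply: psz_map => j /h /=; lia.
Qed.

Lemma psz_Lrcv b g t n : psz (Lrcv b g t n) = n.
Proof.
rewrite /psz /Lrcv -[RHS](size_iota 0 n); by elim: (iota 0 n) => //= j s ->.
Qed.

Lemma psz_flatten (f : nat -> seq stmt) n B : (forall t, (t < n)%N -> (psz (f t) <= B)%N) ->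
  (psz (flatten [seq f t | t <- iota 0 n]) <= n * B)%N.
Proof.
move=> h; have : {in iota 0 n, forall j, (psz (f j) <= B)%N}.
  by move=> j; rewrite mem_iota => /h.
rewrite -[X in (_ <= X * _)%N](size_iota 0 n); elim: (iota 0 n) => //= j s IH hs.
have := hs j (mem_head _ _); have := IH (fun i hi => hs i ltac:(by rewrite inE hi orbT)).
by rewrite psz_cat mulSn; lia.
Qed.

End ArraySizes.

(** * Codes *)

Lemma nth_flatten_const (T : Type) (x0 : T) (f : nat -> seq T) B L t r :
  (forall i, (i < L)%N -> size (f i) = B) -> (t < L)%N -> (r < B)%N ->
  nth x0 (flatten [seq f i | i <- iota 0 L]) (t * B + r) = nth x0 (f t) r.
Proof.
move=> hs ht hr.
have main k : (forall i, (k <= i < k + L)%N -> size (f i) = B) ->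
    nth x0 (flatten [seq f i | i <- iota k L]) (t * B + r) = nth x0 (f (k + t)%N) r.
  elim: L t k ht {hs} => [//|L IH] [|t] k ht hs /=; rewrite nth_cat hs; try lia.
    by rewrite hr addn0.
  rewrite ifF; last by nia.
  rewrite mulSn -addnA addKn IH ?addSnnS //.
  by move=> i hi; apply: hs; lia.
by rewrite main ?add0n // => i hi; apply: hs; lia.
Qed.

Lemma size_flatten_const (T : Type) (f : nat -> seq T) B L :
  (forall i, (i < L)%N -> size (f i) = B) ->
  size (flatten [seq f i | i <- iota 0 L]) = (L * B)%N.
Proof.
elim: L => [//|L IH] h; rewrite -addn1 iotaD map_cat flatten_cat size_cat IH.
  by rewrite /= cats0 h //; lia.
by move=> i hi; apply: h; lia.
Qed.

Fixpoint tobits n v : seq bool :=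
  if n is n'.+1 then odd v :: tobits n' v./2 else [::].

Lemma size_tobits n v : size (tobits n v) = n.
Proof. by elim: n v => //= n IH v; rewrite IH. Qed.

Lemma num_tobits n v : (v < 2 ^ n)%N -> num (tobits n v) = v.
Proof.
elim: n v => [|n IH] v /=; first by rewrite expn0 ltnS leqn0 => /eqP ->.
move=> h; rewrite IH ?odd_double_half //; move: h; rewrite expnS.
by have := odd_double_half v; case: (odd v); lia.
Qed.

Lemma num_lt s : (num s < 2 ^ size s)%N.
Proof. by elim: s => //= b s IH; rewrite expnS; case: b; lia. Qed.

Lemma num_inj s s' : size s = size s' -> num s = num s' -> s = s'.
Proof.
elim: s s' => [|b s IH] [|b' s'] //= [hs] E.
have Eb : b = b'.
  by have := congr1 odd E; rewrite !oddD !odd_double !addbF !oddb.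
by rewrite Eb (IH s' hs) //; move: E; rewrite Eb; lia.
Qed.

(** Advice names a coordinate of a set by its rank in the set; this keeps the length of the advice
    independent of [d]. *)
Definition rk (C : nat -> bool) j : nat := (\sum_(i < j) C i)%N.

Lemma rkS C j : rk C j.+1 = (rk C j + C j)%N.
Proof. by rewrite /rk big_ord_recr. Qed.

Lemma rk_le C i j : (i <= j)%N -> (rk C i <= rk C j)%N.
Proof.
by move=> /subnK<-; elim: (j - i)%N => //= n IH; rewrite addSn rkS; lia.
Qed.

Lemma rk_lt (C : nat -> bool) i j : C i -> (i < j)%N -> (rk C i < rk C j)%N.
Proof. by move=> Ci /(rk_le C); rewrite rkS Ci addn1. Qed.

Lemma rk_inj (C : nat -> bool) i j : C i -> C j -> rk C i = rk C j -> i = j.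
Proof.
move=> Ci Cj E; case: (ltngtP i j) => // h; [have := rk_lt Ci h|have := rk_lt Cj h]; lia.
Qed.

Lemma rk_surj (C : nat -> bool) d r : (r < rk C d)%N -> exists2 j, (j < d)%N & C j && (rk C j == r).
Proof.
elim: d => [|d IH]; first by rewrite /rk big_ord0.
rewrite rkS => h; have [/IH[j hj E]|h2] := ltnP r (rk C d).
  by exists j => //; lia.
by exists d => //; case: (C d) h => h /=; apply/eqP; lia.
Qed.

(* A slot holds a gap [v <= b]; the value [b] means that [b] ranks are skipped,
   so that every sequence of slots is the code of at most one set of ranks. *)
Section Slots.
Variable b : nat.

Fixpoint decl p (vs : seq nat) : seq nat :=
  if vs is v :: vs' then
    if v == b then decl (p + b) vs' else (p + v)%N :: decl (p + v).+1 vs'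
  else [::].

Lemma decl_ge p vs r : r \in decl p vs -> (p <= r)%N.
Proof.
elim: vs p => //= v vs IH p; case: eqP => _; first by move/IH; lia.
by rewrite inE => /orP[/eqP->|/IH]; lia.
Qed.

Lemma decl_sorted p vs : sorted ltn (decl p vs).
Proof.
elim: vs p => //= v vs IH p; case: eqP => // _; rewrite /= path_min_sorted //.
by apply/allP => r /decl_ge; rewrite /=; lia.
Qed.

(** At the first differing slot, either two different ranks are declared, or one code declares a
    rank below [p + b] that the other has skipped for good. *)
Lemma decl_inj p vs vs' : size vs = size vs' -> all (leq^~ b) vs ->
  all (leq^~ b) vs' -> decl p vs = decl p vs' -> vs = vs'.
Proof.
elim: vs p vs' => [|v vs IH] p [|v' vs'] //= [hs] /andP[h1 h2] /andP[h1' h2'].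
case: (eqVneq v b) => [->|nv]; case: (eqVneq v' b) => [->|nv'] E.
- by rewrite (IH _ _ hs h2 h2' E).
- have : (p + v')%N \in decl (p + b) vs by rewrite E mem_head.
  by move/decl_ge; lia.
- have : (p + v)%N \in decl (p + b) vs' by rewrite -E mem_head.
  by move/decl_ge; lia.
- have Ev : v = v' by case: E; lia.
  by move: E; rewrite Ev => -[/(IH _ _ hs h2 h2') ->].
Qed.

(** A budget: as long as something is left, each slot lowers the left-hand side by at least [b], a
    declaration by removing an element of [rs], a skip by shortening the range [N - p]. *)
Lemma decl_surj p rs N n : sorted ltn rs -> all (leq p) rs -> all (ltn^~ N) rs ->
  (b * size rs + (N - p) <= b * n)%N -> (0 < b)%N ->
  exists vs, [/\ size vs = n, all (leq^~ b) vs & decl p vs = rs].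
Proof.
move=> so ge lt hn b0; elim: n p rs so ge lt hn => [|n IH] p rs so ge lt hn.
  case: rs so ge lt hn => [|r rs] /= _; last by nia.
  by exists [::].
case: rs so ge lt hn => [|r rs] so ge lt hn.
  (* Nothing is left to declare, and the surplus slots are filled with skips, the only value that
     declares nothing. *)
  have hn' : (b * size (@nil nat) + (N - (p + b)) <= b * n)%N.
    by move: hn; rewrite /= mulnS; lia.
  have [vs [E1 E2 E3]] := IH (p + b)%N [::] isT isT isT hn'.
  by exists (b :: vs); rewrite /= E1 E2 E3 leqnn eqxx.
have /= /andP[ge1 ge2] := ge; have /= /andP[lt1 lt2] := lt.
have [hb|hb] := leqP b (r - p).
  have ge' : all (leq (p + b)) (r :: rs).
    rewrite /=; apply/andP; split; first by lia.
    apply/allP => s hs; have := order_path_min ltn_trans so => /allP/(_ s hs).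
    by rewrite /=; lia.
  have hn' : (b * size (r :: rs) + (N - (p + b)) <= b * n)%N.
    by move: hn; rewrite (mulnS b n); lia.
  have [vs [E1 E2 E3]] := IH (p + b)%N (r :: rs) so ge' lt hn'.
  by exists (b :: vs); rewrite /= E1 E2 E3 leqnn eqxx.
have ge' : all (leq r.+1) rs by have := order_path_min ltn_trans so.
have hn' : (b * size rs + (N - r.+1) <= b * n)%N.
  by move: hn; rewrite /= !mulnS; lia.
have [vs [E1 E2 E3]] := IH r.+1 rs (path_sorted so) ge' lt2 hn'.
exists ((r - p)%N :: vs); rewrite /= E1 E2 ltnW //=; split=> //.
by rewrite ifF ?subnKC ?E3 //; lia.
Qed.

(** The accumulator of [decl] before slot [j] in closed form: a skip advances by [b], a declaration
    by one more than its gap. Being a prefix sum, it is accessible to [Lscan]. *)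
Definition pos (v : nat -> nat) j : nat := (\sum_(i < j) (v i + (v i != b)))%N.

Definition marked n (v : nat -> nat) r :=
  has (fun j => (v j != b) && (pos v j + v j == r)%N) (iota 0 n).

Lemma markedE n v r : marked n v r = (r \in decl 0 (mkseq v n)).
Proof.
(* The induction runs over suffixes of the slots; [p] is the current accumulator of [decl], so
   positions are measured relative to [pos v k]. *)
have main p k : (r \in decl p [seq v i | i <- iota k n]) =
    has (fun j => (v j != b) && (p + (pos v j - pos v k) + v j == r)%N) (iota k n).
  elim: n p k => [//|n IH] p k /=.
  have E j : (k < j)%N -> (pos v j = (pos v j - pos v k.+1) + pos v k.+1)%N.
    move=> hj; rewrite subnK // -(subnK hj).
    elim: (j - k.+1)%N => [//|i IHi]; rewrite addSn; apply: leq_trans IHi _.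
    by rewrite /pos [X in (_ <= X)%N]big_ord_recr /=; lia.
  have pS : pos v k.+1 = (pos v k + (v k + (v k != b)))%N by rewrite /pos big_ord_recr.
  case: eqP => hv.
    rewrite IH /=; apply: eq_in_has => j; rewrite mem_iota => /andP[hj _].
    have := E j hj; rewrite pS hv eqxx /=; case: (v j != b) => //= Ej.
    by congr (_ == r); lia.
  rewrite inE IH subnn addn0 eq_sym; congr (_ || _).
  apply: eq_in_has => j; rewrite mem_iota => /andP[hj _].
  have := E j hj; rewrite pS; case: (v j != b) => //=.
  by move/eqP: hv => -> /= Ej; congr (_ == r); lia.
rewrite /marked main; apply: eq_has => j.
by rewrite [pos v 0]/pos big_ord0 subn0 add0n.
Qed.

Variable n : nat.

(* The set of the coordinates of [C] whose ranks in [C] are coded by [v]. *)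
Definition decoded (C : nat -> bool) v j := C j && marked n v (rk C j).

(** A declared rank beyond the size of [C] leaves no trace in [decoded], so without this test
    different codes could describe the same set and the advice would not be unique. *)
Definition in_range_code d (C : nat -> bool) v :=
  all (fun j => (v j == b) || (pos v j + v j < rk C d)%N) (iota 0 n).

Lemma in_range_codeP d C v : in_range_code d C v ->
  forall r, marked n v r -> (r < rk C d)%N.
Proof.
move=> /allP h r /hasP[j /h /orP[/eqP->|hj] /andP[]]; first by rewrite eqxx.
by move=> _ /eqP <-.
Qed.

Lemma decoded_inj d C v v' : in_range_code d C v -> in_range_code d C v' ->
  (forall j, (j < d)%N -> decoded C v j = decoded C v' j) ->
  (forall j, (j < n)%N -> (v j <= b)%N /\ (v' j <= b)%N) ->
  forall j, (j < n)%N -> v j = v' j.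
Proof.
move=> ok ok' E hb j hj.
have Em : decl 0 (mkseq v n) =i decl 0 (mkseq v' n).
  move=> r; rewrite -!markedE; apply/idP/idP => hr.
  - have [i hi /andP[Ci /eqP ri]] := rk_surj (in_range_codeP ok hr).
    by have := E i hi; rewrite /decoded Ci ri hr => /esym/= ->.
  - have [i hi /andP[Ci /eqP ri]] := rk_surj (in_range_codeP ok' hr).
    by have := E i hi; rewrite /decoded Ci ri hr => /= ->.
have El := irr_sorted_eq ltn_trans ltnn (decl_sorted _ _) (decl_sorted _ _) Em.
have := decl_inj _ _ _ El; rewrite !size_mkseq => /(_ erefl) h.
have all_b u : (forall j, (j < n)%N -> (u j <= b)%N) -> all (leq^~ b) (mkseq u n).
  by move=> hu; apply/allP => i /mapP[t]; rewrite mem_iota => /hu ? ->.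
have : mkseq v n = mkseq v' n by apply: h; apply: all_b => i /hb[].
by move/(congr1 (nth 0%N ^~ j)); rewrite !nth_mkseq.
Qed.

Lemma decoded_surj d (C A : nat -> bool) : (forall j, A j -> C j) ->
  (b * rk A d + rk C d <= b * n)%N -> (0 < b)%N ->
  exists v : nat -> nat, [/\ in_range_code d C v,
    forall j, (j < d)%N -> decoded C v j = A j & forall j, (v j <= b)%N].
Proof.
move=> AC hn b0.
pose rs := [seq rk C j | j <- iota 0 d & A j].
have sz : size rs = rk A d.
  rewrite size_map size_filter /rk -(big_mkord xpredT (fun j => nat_of_bool (A j))).
  by rewrite /index_iota subn0 -sumn_count sumnE big_map.
have so : sorted ltn rs.
  rewrite sorted_map; have : sorted ltn [seq j <- iota 0 d | A j].
    by apply: (sorted_filter ltn_trans); exact: iota_ltn_sorted.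
  apply: (@sub_in_sorted _ (fun j => A j)); last exact: filter_all.
  by move=> i j Ai Aj /= h; apply: rk_lt => //; apply: AC.
have lt : all (ltn^~ (rk C d)) rs.
  apply/allP => r /mapP[j]; rewrite mem_filter mem_iota => /andP[Aj /andP[_ hj]] ->.
  by apply: rk_lt => //; apply: AC.
have ge : all (leq 0) rs by apply/allP.
have hn' : (b * size rs + (rk C d - 0) <= b * n)%N by rewrite sz subn0.
have [vs [E1 /allP E2 E3]] := decl_surj so ge lt hn' b0.
have hb j : (nth 0 vs j <= b)%N.
  have [h|h] := ltnP j (size vs); first by apply: E2; exact: mem_nth.
  by rewrite nth_default.
have Em r : marked n (nth 0%N vs) r = (r \in rs).
  by rewrite markedE -E1 (mkseq_nth 0%N) E3.
exists (nth 0%N vs); split=> //.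
  apply/allP => j; rewrite mem_iota add0n => /andP[_ hj].
  case: eqP => //= hv; have /(allP lt) : (pos (nth 0%N vs) j + nth 0%N vs j)%N \in rs.
    rewrite -Em; apply/hasP; exists j; first by rewrite mem_iota.
    by rewrite eqxx andbT; apply/eqP.
  by [].
move=> j hj; rewrite /decoded Em; case Cj: (C j) => /=; last first.
  by apply/esym/negP => /AC; rewrite Cj.
apply/mapP/idP => [[i]|Aj].
  by rewrite mem_filter => /andP[Ai _] /(rk_inj Cj (AC _ Ai)) ->.
by exists j => //; rewrite mem_filter Aj mem_iota.
Qed.

End Slots.

(** * The protocol *)

Section Protocol.
Variables (d n G th M L a be nsl : nat).

(** One less than a power of two: [a + 3] bits hold exactly the indices below [ntry] and the value
    [ntry], which stands for no trial. Likewise [skip] is the largest number of [a + 1] bits. *)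
Definition ntry : nat := (2 ^ (a + 3)).-1.
Definition skip : nat := (2 ^ (a + 1)).-1.
(** Each coordinate takes [be.+1] coins to decide its membership in Q, each trial [be.+2] coins to
    draw a rank. *)
Definition ncoin : nat := (d * be.+1 + ntry * be.+2)%N.

Definition zero_cube : cube d := [ffun=> false].

Definition bit (x : cube d) (j : nat) : bool :=
  if insub j is Some i then x i else false.

(** The announcement of one round: two parity sets with their values, the flag that inputs close to
    the center are decided here, the center, and C. *)
Record cstr : Type := Cstr {
  cq0 : nat -> bool; cb0 : bool;
  cq1 : nat -> bool; cb1 : bool;
  cmd : bool; cctr : nat -> bool; cC : nat -> bool }.

Definition par (q : nat -> bool) x : bool := odd (\sum_(j < d) (q j && bit x j))%N.

Definition wt (k : cstr) x : nat :=
  (\sum_(j < d) ((bit x j != cctr k j) && ~~ cC k j))%N.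

Definition parok (k : cstr) x : bool :=
  (par (cq0 k) x == cb0 k) && (par (cq1 k) x == cb1 k).

(** Three outcomes: a violated parity, a decision by closeness ([killed]), or survival. Under honest
    announcements only a violation shows that [x] does not match [y]. *)
Definition alive1 (k : cstr) x : bool := parok k x && ~~ (cmd k && (wt k x <= M)%N).
Definition killed (k : cstr) x : bool := parok k x && (cmd k && (wt k x <= M)%N).

Definition alive (K : seq cstr) x : bool := all (alive1^~ x) K.

(** A conjunction of [be.+1] coins, so Q has density 2^-(be+1) and avoids up to 2^be stars with
    probability at least 1/2. *)
Definition Qset (c : seq bool) j : bool :=
  all (fun i => nth false c (j * be.+1 + i)) (iota 0 be.+1).

Definition unum (c : seq bool) i : nat :=
  num (mkseq (fun r => nth false c (d * be.+1 + (i * be.+2 + r))) be.+2).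

Definition zvec (A : cube d -> bool) (s : seq (cube d)) i : cube d :=
  let P g := A (nth zero_cube s (i * G + g)) in
  if has P (iota 0 G) then nth zero_cube s (i * G + find P (iota 0 G))
  else zero_cube.

Definition zlist A s := mkseq (zvec A s) n.
Definition cnt (zs : seq (cube d)) j : nat := count (bit^~ j) zs.
Definition inC zs j : bool := (th <= cnt zs j)%N && (cnt zs j + th <= n)%N.
(** Outside C a count of at least [th] is a count above [n - th]; since [th] is far below n/2, this
    is the majority bit there. *)
Definition center zs j : bool := (th <= cnt zs j)%N.

(** At most one coordinate, because ranks inside C are distinct; the index [ntry] selects none. *)
Definition selected (C : nat -> bool) c idx j : bool :=
  [&& C j, (idx < ntry)%N & unum c idx == rk C j].

Definition mkc zs c (e b0 md b1 : bool) idx : cstr :=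
  let C := inC zs in
  Cstr (fun j => e && Qset c j) b0 (selected C c idx) b1 md (center zs) C.

Section Bob.
Variable y : pattern d.

Definition star (j : nat) : bool := if insub j is Some i then y i == None else false.
Definition yb (j : nat) : bool := if insub j is Some i then y i == Some true else false.

Definition can_e c : bool := ~~ has (fun j => star j && Qset c j) (iota 0 d).
Definition can_md (C : nat -> bool) : bool := (\sum_(j < d) (C j && ~~ star j) <= M)%N.
Definition valid (C : nat -> bool) c i : bool :=
  has (fun j => [&& C j, ~~ star j & unum c i == rk C j]) (iota 0 d).
(** A failed [find] returns [ntry] as well, so having no useful trial and needing none share one
    code. *)
Definition can_idx C c : nat :=
  if can_md C then ntry else find (valid C c) (iota 0 ntry).
Definition ypar (q : nat -> bool) : bool := odd (\sum_(j < d) (q j && yb j))%N.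

Definition canc zs c : cstr :=
  let C := inC zs in
  mkc zs c (can_e c) (ypar (fun j => can_e c && Qset c j)) (can_md C)
    (ypar (selected C c (can_idx C c))) (can_idx C c).

End Bob.

Section Run.
Variables (ss : nat -> seq (cube d)) (cs : nat -> seq bool) (m : seq bool).

(** A round takes five flags and [a + 3] bits of index. The flags: parity over Q announced, its
    value, decision by closeness, value at the single coordinate, [x] decided here. Behind the
    rounds stand the slots of E and of V. *)
Definition alen : nat := (L * (a + 8) + (nsl * (a + 1) + nsl * (a + 1)))%N.

Definition mrd t r : bool := nth false m (t * (a + 8) + r).
Definition midx t : nat := num (mkseq (fun i => mrd t (5 + i)) (a + 3)).
Definition slotE j : nat :=
  num (mkseq (fun i => nth false m (L * (a + 8) + (j * (a + 1) + i))) (a + 1)).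
Definition slotV j : nat :=
  num (mkseq (fun i => nth false m (L * (a + 8) + (nsl * (a + 1) + (j * (a + 1) + i))))
    (a + 1)).

Definition mkround K t : cstr :=
  mkc (zlist (alive K) (ss t)) (cs t) (mrd t 0) (mrd t 1) (mrd t 2) (mrd t 3) (midx t).

Fixpoint Kst t : seq cstr :=
  if t is t'.+1 then rcons (Kst t') (mkround (Kst t') t') else [::].

Definition kt t : cstr := mkround (Kst t) t.

Definition mf t : bool := mrd t 4.

(** The flags [mf] are forced by [x]. An input excluded by a parity is neither flagged nor alive at
    the end, and the last conjunct rejects it. *)
Definition aliceok x : bool :=
  all (fun t => mf t == alive (Kst t) x && killed (kt t) x) (iota 0 L)
  && (alive (Kst L) x || has mf (iota 0 L)).

Definition Cf j : bool := has (fun t => mf t && cC (kt t) j) (iota 0 L).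
Definition cf j : bool := has (fun t => mf t && cctr (kt t) j) (iota 0 L).
Definition Ej j : bool := decoded skip nsl Cf slotE j.
(** All coordinates except the stars of C. Alice does not know the stars and relies on E, which Bob
    verifies. If no round decides [x], the set is empty and nothing is compared. *)
Definition Uj j : bool := has mf (iota 0 L) && ~~ (Cf j && ~~ Ej j).

Variable y : pattern d.

Definition chk t : bool :=
  let zs := zlist (alive (Kst t)) (ss t) in let C := inC zs in
  [&& mrd t 0 == can_e y (cs t), mrd t 2 == can_md y C,
      midx t == can_idx y C (cs t),
      mrd t 1 == ypar y (fun j => mrd t 0 && Qset (cs t) j)
    & mrd t 3 == ypar y (selected C (cs t) (midx t))].

Definition Vj j : bool := decoded skip nsl (star y) slotV j.

Definition chkE : bool := in_range_code skip nsl d Cf slotE &&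
  all (fun j => Ej j == Cf j && ~~ star y j) (iota 0 d).
(** On U the set V is pinned down by the values of [x]. Nothing would pin it down elsewhere, so it
    must be empty there. *)
Definition chkV : bool := in_range_code skip nsl d (star y) slotV &&
  all (fun j => Vj j ==> Uj j) (iota 0 d).

Definition xhat j : bool := if star y j then cf j (+) Vj j else yb y j.

Definition bobok : bool := [&& all chk (iota 0 L), chkE & chkV].

Definition good x : bool :=
  [&& bobok, aliceok x & all (fun j => Uj j ==> (bit x j == xhat j)) (iota 0 d)].

End Run.

(** The course of an honest run. It depends on [y] and the public tape but not on [x], so the mass
    of the surviving inputs can be studied as a whole. *)
Fixpoint Kcan y ss cs t : seq cstr :=
  if t is t'.+1 then
    rcons (Kcan y ss cs t')
      (canc y (zlist (alive (Kcan y ss cs t')) (ss t')) (cs t'))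
  else [::].

(** * Uniqueness and existence of good advice *)

Lemma chk_canc ss cs m y t : chk ss cs m y t ->
  kt ss cs m t = canc y (zlist (alive (Kst ss cs m t)) (ss t)) (cs t).
Proof.
move=> /and5P[/eqP E0 /eqP E2 /eqP Ei /eqP E1 /eqP E3].
by rewrite /kt /mkround /canc -E0 -E2 -Ei -E1 -E3.
Qed.

Lemma bobok_Kcan ss cs m y t : bobok ss cs m y -> (t <= L)%N ->
  Kst ss cs m t = Kcan y ss cs t.
Proof.
move=> /and3P[/allP h _ _]; elim: t => //= t IH ht.
have E := chk_canc (h t ltac:(by rewrite mem_iota)).
by rewrite /kt in E; rewrite E IH //; exact: ltnW.
Qed.

(** Every bit is recomputed by somebody. Bob's checks force the announcements, hence all centers and
    sets C; then [x] forces the flags, the stars force E, and the values of [x] on U force V. The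
    slot codes of E and V are injective. *)
Lemma good_uniq ss cs m m' y x : size m = alen -> size m' = alen ->
  good ss cs m y x -> good ss cs m' y x -> m = m'.
Proof.
move=> sm sm' g g'.
have /and3P[b /andP[/allP al _] /allP ux] := g.
have /and3P[b' /andP[/allP al' _] /allP ux'] := g'.
have EK t : (t <= L)%N -> Kst ss cs m t = Kst ss cs m' t.
  by move=> ht; rewrite (bobok_Kcan b ht) (bobok_Kcan b' ht).
have io N t : (t < N)%N -> t \in iota 0 N by rewrite mem_iota.
have /and3P[/allP ck cE cV] := b; have /and3P[/allP ck' cE' cV'] := b'.
have Ei t : (t < L)%N -> midx m t = midx m' t.
  move=> ht; have := ck t (io _ _ ht); have := ck' t (io _ _ ht).
  rewrite /chk /= EK 1?ltnW // => /and5P[_ _ /eqP -> _ _] /and5P[_ _ /eqP -> _ _] //.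
have E0 t : (t < L)%N -> mrd m t 0 = mrd m' t 0.
  move=> ht; have := ck t (io _ _ ht); have := ck' t (io _ _ ht).
  by rewrite /chk /= EK 1?ltnW // => /and5P[/eqP -> _ _ _ _] /and5P[/eqP -> _ _ _ _].
have Ek t : (t < L)%N -> kt ss cs m t = kt ss cs m' t.
  move=> ht; rewrite (chk_canc (ck t (io _ _ ht))) (chk_canc (ck' t (io _ _ ht))).
  by rewrite EK // ltnW.
have Ef t : (t < L)%N -> mf m t = mf m' t.
  move=> ht; have /eqP -> := al t (io _ _ ht); have /eqP -> := al' t (io _ _ ht).
  by rewrite EK ?Ek // ltnW.
have Er t r : (t < L)%N -> (r < a + 8)%N -> mrd m t r = mrd m' t r.
  move=> ht hr; have Ek' := Ek t ht; have := f_equal cmd Ek'; have := f_equal cb0 Ek'.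
  have := f_equal cb1 Ek'; rewrite /= => q3 q1 q2.
  have [h5|h5] := ltnP r 5.
    case: r h5 {hr} => [|[|[|[|[|//]]]]] _ //; [exact: E0|exact: Ef].
  have Em : mkseq (fun i => mrd m t (5 + i)) (a + 3) = mkseq (fun i => mrd m' t (5 + i)) (a + 3).
    by apply: num_inj; [rewrite !size_mkseq|exact: Ei].
  move/(congr1 (fun s => nth false s (r - 5))): Em.
  have r5 : (r - 5 < a + 3)%N by clear -hr h5; lia.
  by rewrite !nth_mkseq // subnKC.
have Eh P P' : (forall t, (t < L)%N -> P t = P' t) -> has P (iota 0 L) = has P' (iota 0 L).
  by move=> E; apply: eq_in_has => t; rewrite mem_iota => /E.
have ECf : Cf ss cs m = Cf ss cs m'.
  by apply/funext => j; apply: Eh => t ht; rewrite Ef ?Ek.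
have Ecf : cf ss cs m = cf ss cs m'.
  by apply/funext => j; apply: Eh => t ht; rewrite Ef ?Ek.
have Ehf : has (mf m) (iota 0 L) = has (mf m') (iota 0 L) by exact: Eh.
have slot_le s : (size s = a + 1 -> num s <= skip)%N.
  by move=> hs; rewrite /skip -ltnS prednK ?expn_gt0 // -hs num_lt.
have /andP[rE /allP aE] := cE; have /andP[rE' /allP aE'] := cE'.
have EEj j : (j < d)%N -> Ej ss cs m j = Ej ss cs m' j.
  move=> hj; have /eqP -> := aE j (io _ _ hj); have /eqP -> := aE' j (io _ _ hj).
  by rewrite ECf.
have EU j : (j < d)%N -> Uj ss cs m j = Uj ss cs m' j.
  by move=> hj; rewrite /Uj Ehf ECf EEj.
have EE j : (j < nsl)%N -> slotE m j = slotE m' j.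
  move: rE' EEj; rewrite /Ej -ECf => rE' EEj.
  apply: (decoded_inj rE rE' EEj) => i _.
  by split; apply: slot_le; rewrite size_mkseq.
have /andP[rV /allP aV] := cV; have /andP[rV' /allP aV'] := cV'.
(* On a star in U the comparison says that [bit x j] is [cf j (+) Vj j], which determines [Vj j]. *)
have EVj j : (j < d)%N -> Vj m y j = Vj m' y j.
  move=> hj; have := aV j (io _ _ hj); have := aV' j (io _ _ hj).
  have := ux j (io _ _ hj); have := ux' j (io _ _ hj); rewrite -EU //.
  case: (Uj ss cs m j) => /=; last by rewrite !implybF => _ _ /negbTE-> /negbTE->.
  rewrite /xhat Ecf; case Es: (star y j); last first.
    by move=> _ _ _ _; rewrite /Vj /decoded Es.
  by move=> /eqP-> /eqP/addbI ->.
have EV j : (j < nsl)%N -> slotV m j = slotV m' j.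
  apply: (decoded_inj rV rV' EVj) => i _.
  by split; apply: slot_le; rewrite size_mkseq.
apply: (@eq_from_nth _ false); first by rewrite sm sm'.
have a8 : (0 < a + 8)%N by rewrite addnS.
have a1 : (0 < a + 1)%N by rewrite addn1.
move=> i hi; rewrite sm /alen in hi.
have [h1|h1] := ltnP i (L * (a + 8)).
  rewrite (divn_eq i (a + 8)); apply: Er; last by rewrite ltn_mod.
  by rewrite ltn_divLR.
have [h2|h2] := ltnP (i - L * (a + 8)) (nsl * (a + 1)).
  have hq : ((i - L * (a + 8)) %/ (a + 1) < nsl)%N by rewrite ltn_divLR.
  have hr : ((i - L * (a + 8)) %% (a + 1) < a + 1)%N by rewrite ltn_mod.
  have /num_inj := EE _ hq; rewrite !size_mkseq => /(_ erefl).
  move/(congr1 (fun s => nth false s ((i - L * (a + 8)) %% (a + 1)))).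
  by rewrite !nth_mkseq // -divn_eq subnKC.
set i' := (i - L * (a + 8) - nsl * (a + 1))%N.
have hq : (i' %/ (a + 1) < nsl)%N by rewrite ltn_divLR // /i'; clear -hi h1 h2; lia.
have hr : (i' %% (a + 1) < a + 1)%N by rewrite ltn_mod.
have /num_inj := EV _ hq; rewrite !size_mkseq => /(_ erefl).
move/(congr1 (fun s => nth false s (i' %% (a + 1)))).
rewrite !nth_mkseq // -divn_eq.
by have -> : (L * (a + 8) + (nsl * (a + 1) + i') = i)%N by rewrite /i'; clear -hi h1 h2; lia.
Qed.

Lemma bitE x (i : 'I_d) : bit x i = x i.
Proof. by rewrite /bit valK. Qed.

Lemma starE y (i : 'I_d) : star y i = (y i == None).
Proof. by rewrite /star valK. Qed.

Lemma ybE y (i : 'I_d) : yb y i = (y i == Some true).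
Proof. by rewrite /yb valK. Qed.

Lemma fpmP x y : reflect (forall j, (j < d)%N -> ~~ star y j -> bit x j = yb y j) (fpm x y).
Proof.
apply: (iffP forallP) => h.
  move=> j hj; rewrite -[j]/(val (Ordinal hj)) starE bitE ybE => ns.
  have := h (Ordinal hj); rewrite (negbTE ns) orbF => /eqP <-.
  by case: (x _).
move=> i; have := h i (ltn_ord i); rewrite starE bitE ybE.
by case: (y i) => [[]|] //= /(_ isT) ->.
Qed.

Lemma rk_star y : rk (star y) d = stars y.
Proof.
rewrite /rk /stars -sum1_card [RHS]big_mkcond /=; apply: eq_bigr => i _.
by rewrite starE inE /=; case: (y i == None).
Qed.

(** If some round decides [x], then U contains all non-stars, because E is exactly the set of
    non-stars of C, and agreement on U is a match. An undecided input is accepted without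
    comparison; this is the source of the error eps. *)
Lemma good_fpm_or_alive ss cs m y x : good ss cs m y x ->
  fpm x y \/ alive (Kcan y ss cs L) x.
Proof.
move=> /and3P[b /andP[_ /orP[ha|hf]] /allP hx].
  by right; rewrite -(bobok_Kcan b).
left; apply/fpmP => j hj ns.
have : j \in iota 0 d by rewrite mem_iota.
move=> jd; have := hx j jd; rewrite /Uj hf /xhat (negbTE ns) /=.
have /and3P[_ /andP[_ /allP/(_ j jd)/eqP ->] _] := b.
by rewrite ns andbT andbN /= => /eqP.
Qed.

(** Both announced parity sets avoid the stars: Q by [can_e], the single coordinate because it
    shares its rank in C with a non-star of C. *)
Lemma alive_canc_fpm y x zs c : fpm x y -> parok (canc y zs c) x.
Proof.
move=> /fpmP h; rewrite /parok /= /par /ypar; apply/andP; split.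
  apply/eqP; congr odd; apply: eq_bigr => i _.
  case E: (can_e y c && Qset c i) => //=; congr nat_of_bool.
  apply: h => //; apply/negP => Si; case/andP: E; rewrite /can_e => /hasPn/(_ i).
  by rewrite mem_iota ltn_ord => /(_ isT); rewrite Si /= => /negbTE->.
apply/eqP; congr odd; apply: eq_bigr => i _.
case E: (selected _ _ _ i) => //=; congr nat_of_bool.
apply: h => //; move: E => /and3P[Ci hi /eqP Ei].
move: hi Ei; rewrite /can_idx; case: ifP => _; first by rewrite ltnn.
move=> hi Ei; have hv : has (valid y (inC zs) c) (iota 0 ntry).
  by rewrite has_find size_iota.
have := nth_find 0%N hv; rewrite nth_iota // add0n => /hasP[j _ /and3P[Cj nsj /eqP]].
by rewrite Ei => /(rk_inj Ci Cj) ->.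
Qed.

(** In the deciding round C has at most [M] non-stars, hence at most [w + M] elements, and closeness
    leaves at most [M] off-center stars outside C. The inequality is the slot budget of
    [decoded_surj] for both codes. *)
Lemma good_exists ss cs y x w : fpm x y -> (stars y <= w)%N ->
  (skip * M + (w + M) <= skip * nsl)%N ->
  exists2 m, size m = alen & good ss cs m y x.
Proof.
move=> fxy hw hn.
have skip0 : (0 < skip)%N.
  by clear; rewrite /skip addn1 expnS; have := expn_gt0 2 a; case: (2 ^ a)%N => // q; rewrite mulnS.
pose K t := Kcan y ss cs t.
pose zs t := zlist (alive (K t)) (ss t).
pose c t := canc y (zs t) (cs t).
pose f t := alive (K t) x && killed (c t) x.
have KS t : K t.+1 = rcons (K t) (c t) by [].
pose C0 j := has (fun t => f t && cC (c t) j) (iota 0 L).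
pose c0 j := has (fun t => f t && cctr (c t) j) (iota 0 L).
pose A j := [&& (j < d)%N, C0 j & ~~ star y j].
pose B j := [&& (j < d)%N, star y j, ~~ C0 j, bit x j != c0 j & has f (iota 0 L)].
(* An input decided in one round is not alive later. With at most one flagged round, a disjunction
   over all rounds simply reads that round's data. *)
have f_uniq t t' : f t -> f t' -> t = t'.
  have aux t1 t2 : f t1 -> f t2 -> (t1 < t2)%N -> False.
    move=> /andP[_ k1] /andP[a2 _] lt.
    have : c t1 \in [pred k | alive1 k x] = false.
      by apply/negP; rewrite inE /alive1 => /andP[_]; move: k1; rewrite /killed => /andP[_ ->].
    move=> /negP; apply; move: a2; rewrite -(subnK lt).
    elim: (t2 - t1.+1)%N => [|i IH].
      by rewrite add0n KS /alive all_rcons => /andP[].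
    by rewrite addSn KS /alive all_rcons => /andP[_ /IH].
  by move=> h1 h2; case: (ltngtP t t') => // h; [case: (aux _ _ h1 h2 h)|case: (aux _ _ h2 h1 h)].
have has1 (g : nat -> bool) t : (t < L)%N -> f t ->
    has (fun i => f i && g i) (iota 0 L) = g t.
  move=> ht ft; apply/hasP/idP => [[i _ /andP[fi gi]]|gt].
    by rewrite (f_uniq _ _ ft fi).
  by exists t; rewrite ?mem_iota ?ft.
have sizes : (rk A d <= M)%N /\ (rk C0 d <= w + M)%N /\ (rk B d <= M)%N.
  have [/hasP[t]|nf] := boolP (has f (iota 0 L)); last first.
    have C00 j : C0 j = false.
      apply/negP => /hasP[t ht /andP[ft _]]; case/negP: nf; apply/hasP; by exists t.
    have z (C : nat -> bool) : (forall j, C j = false) -> rk C d = 0%N.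
      by move=> h; rewrite /rk big1 // => i _; rewrite h.
    rewrite (z A) ?(z C0) ?(z B) // => j; rewrite /A /B ?C00 ?(negbTE nf) ?andbF //.
  rewrite mem_iota add0n => /andP[_ ht] ft.
  have EC j : C0 j = cC (c t) j by rewrite /C0 (has1 (fun t => cC (c t) j) t).
  have Ec j : c0 j = cctr (c t) j by rewrite /c0 (has1 (fun t => cctr (c t) j) t).
  have /andP[_ /andP[_ /andP[md le_wt]]] := ft.
  have hA : (rk A d <= M)%N.
    rewrite (leq_trans _ (md : (_ <= M)%N)) //; apply: leq_sum => i _.
    by rewrite /A EC ltn_ord.
  split=> //; split.
    apply: leq_trans (leq_add hw hA); rewrite -rk_star /rk -big_split /=.
    by apply: leq_sum => i _; rewrite /A ltn_ord /=; case: (C0 i); case: (star y i).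
  apply: leq_trans le_wt; apply: leq_sum => i _.
  rewrite /B ltn_ord -Ec -EC /=.
  by case: (star y i) => //; case: (C0 i) => //=; case: (bit x i != c0 i); rewrite //= leq_b1.
have [hA [hC hB]] := sizes.
have [vE [rE dE bE]] : exists v : nat -> nat, [/\ in_range_code skip nsl d C0 v,
    forall j, (j < d)%N -> decoded skip nsl C0 v j = A j & forall j, (v j <= skip)%N].
  apply: decoded_surj => //; first by move=> j /and3P[].
  by apply: leq_trans hn; apply: leq_add => //; rewrite leq_pmul2l.
have [vV [rV dV bV]] : exists v : nat -> nat, [/\ in_range_code skip nsl d (star y) v,
    forall j, (j < d)%N -> decoded skip nsl (star y) v j = B j & forall j, (v j <= skip)%N].
  apply: decoded_surj => //; first by move=> j /and5P[].
  apply: leq_trans hn; apply: leq_add; first by rewrite leq_pmul2l.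
  by rewrite rk_star; apply: leq_trans hw _; rewrite leq_addr.
pose idx t := can_idx y (inC (zs t)) (cs t).
pose rb t : seq bool := [:: can_e y (cs t); cb0 (c t); cmd (c t); cb1 (c t); f t]
  ++ tobits (a + 3) (idx t).
have srb t : size (rb t) = (a + 8)%N by rewrite size_cat size_tobits /= addnC -addnA.
pose m1 := flatten [seq rb t | t <- iota 0 L].
pose m2 := flatten [seq tobits (a + 1) (vE j) | j <- iota 0 nsl].
pose m3 := flatten [seq tobits (a + 1) (vV j) | j <- iota 0 nsl].
pose m := m1 ++ (m2 ++ m3).
have s1 : size m1 = (L * (a + 8))%N by apply: size_flatten_const => i _.
have s2 : size m2 = (nsl * (a + 1))%N.
  by apply: size_flatten_const => i _; rewrite size_tobits.
have s3 : size m3 = (nsl * (a + 1))%N.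
  by apply: size_flatten_const => i _; rewrite size_tobits.
have rd t r : (t < L)%N -> (r < a + 8)%N -> mrd m t r = nth false (rb t) r.
  move=> ht hr; rewrite /mrd /m nth_cat s1 ifT; last by clear -ht hr; nia.
  exact: nth_flatten_const.
have num_nth k (s : seq bool) g : size s = k ->
    (forall i, (i < k)%N -> g i = nth false s i) -> num (mkseq g k) = num s.
  move=> hs hg; congr num; apply: (@eq_from_nth _ false); rewrite size_mkseq ?hs //.
  by move=> i hi; rewrite nth_mkseq // hg.
have eidx t : (t < L)%N -> midx m t = idx t.
  move=> ht; rewrite /midx (@num_nth _ (tobits (a + 3) (idx t))) ?size_tobits //.
    rewrite num_tobits // /idx /can_idx; case: ifP => _.
      by rewrite /ntry -ltnS prednK ?expn_gt0.
    by apply: leq_ltn_trans (find_size _ _) _; rewrite size_iota /ntry -ltnS prednK ?expn_gt0.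
  by move=> i hi; rewrite rd //; clear -hi; lia.
have lt_b (v : nat) : (v <= skip)%N -> (v < 2 ^ (a + 1))%N.
  by rewrite /skip -ltnS prednK ?expn_gt0.
have eE j : (j < nsl)%N -> slotE m j = vE j.
  move=> hj; rewrite /slotE (@num_nth _ (tobits (a + 1) (vE j))) ?size_tobits ?num_tobits ?lt_b //.
  move=> i hi; rewrite /m nth_cat s1 ifF; last by apply/negbTE; rewrite -leqNgt leq_addr.
  rewrite addKn nth_cat s2 ifT; last by clear -hj hi; nia.
  by apply: nth_flatten_const => // k _; rewrite size_tobits.
have eV j : (j < nsl)%N -> slotV m j = vV j.
  move=> hj; rewrite /slotV (@num_nth _ (tobits (a + 1) (vV j))) ?size_tobits ?num_tobits ?lt_b //.
  move=> i hi; rewrite /m nth_cat s1 ifF; last by apply/negbTE; rewrite -leqNgt leq_addr.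
  rewrite addKn nth_cat s2 ifF; last by apply/negbTE; rewrite -leqNgt leq_addr.
  rewrite addKn.
  by apply: nth_flatten_const => // k _; rewrite size_tobits.
have EK t : (t <= L)%N -> Kst ss cs m t = K t /\ ((t < L)%N -> kt ss cs m t = c t).
  elim: t => [|t IH] ht.
    by split=> // hL; rewrite /kt /mkround /= eidx // !rd ?addnS.
  have [EKt Ekt] := IH (ltnW ht); have Ekt' := Ekt ht.
  have E : Kst ss cs m t.+1 = K t.+1 by rewrite /= -/(kt ss cs m t) Ekt' EKt.
  by split=> // hL; rewrite /kt /mkround E eidx // !rd ?addnS.
have Ef t : (t < L)%N -> mf m t = f t by move=> ht; rewrite /mf rd ?addnS.
have io N t : (t \in iota 0 N) = (t < N)%N by rewrite mem_iota.
have Eh P P' : (forall t, (t < L)%N -> P t = P' t) -> has P (iota 0 L) = has P' (iota 0 L).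
  by move=> E; apply: eq_in_has => t; rewrite mem_iota => /E.
have ECf : Cf ss cs m = C0.
  by apply/funext => j; apply: Eh => t ht; rewrite Ef // (EK t (ltnW ht)).2.
have Ecf : cf ss cs m = c0.
  by apply/funext => j; apply: Eh => t ht; rewrite Ef // (EK t (ltnW ht)).2.
have Ehf : has (mf m) (iota 0 L) = has f (iota 0 L) by exact: Eh.
have ext v v' : (forall j, (j < nsl)%N -> v j = v' j) ->
    (marked skip nsl v = marked skip nsl v') /\
    (forall C, in_range_code skip nsl d C v = in_range_code skip nsl d C v').
  move=> E; have Ep j : (j < nsl)%N -> pos skip v j = pos skip v' j.
    by move=> hj; apply: eq_bigr => i _; rewrite E //; exact: ltn_trans (ltn_ord i) hj.
  split=> [|C]; first apply/funext => r.
    by apply: eq_in_has => j; rewrite io => hj; rewrite E ?Ep.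
  by apply: eq_in_all => j; rewrite io => hj; rewrite E ?Ep.
have [xE1 xE2] := ext _ _ eE; have [xV1 xV2] := ext _ _ eV.
have EEj j : (j < d)%N -> Ej ss cs m j = A j.
  by move=> hj; rewrite /Ej /decoded ECf xE1 -dE.
have EVj j : (j < d)%N -> Vj m y j = B j.
  by move=> hj; rewrite /Vj /decoded xV1 -dV.
have EU j : (j < d)%N -> Uj ss cs m j = has f (iota 0 L) && ~~ (C0 j && star y j).
  move=> hj; rewrite /Uj Ehf ECf EEj // /A hj /=.
  by case: (C0 j) => //=; case: (star y j).
exists m; first by rewrite !size_cat s1 s2 s3.
apply/and3P; split.
- apply/and3P; split.
  + apply/allP => t; rewrite io => ht; have [E1 /(_ ht) E2] := EK t (ltnW ht).
    rewrite /chk E1 eidx // !rd ?addnS //.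
    by rewrite /= -/(zs t) -/(idx t) !eqxx.
  + rewrite /chkE ECf xE2 rE; apply/allP => j; rewrite io => hj.
    by rewrite EEj // /A hj.
  + rewrite /chkV xV2 rV; apply/allP => j; rewrite io => hj.
    rewrite EVj // EU //; apply/implyP => /and5P[_ -> /negbTE -> _ ->] //.
- apply/andP; split.
    apply/allP => t; rewrite io => ht; have [E1 /(_ ht) E2] := EK t (ltnW ht).
    by rewrite Ef // E1 E2.
  rewrite Ehf (EK L _).1 //; have [//|nf] := boolP (has f (iota 0 L)); first by rewrite orbT.
  rewrite orbF; suff : forall T, (T <= L)%N -> alive (K T) x by apply.
  elim=> // T IH hT; rewrite KS /alive all_rcons.
  have aT := IH (ltnW hT); apply/andP; split=> //.
  rewrite /alive1 alive_canc_fpm //=; apply/negP => hk; case/negP: nf; apply/hasP.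
  by exists T; rewrite ?io // /f aT /killed alive_canc_fpm.
- apply/allP => j; rewrite io => hj; rewrite EU // /xhat Ecf EVj //.
  apply/implyP => /andP[hf nC]; case Sj: (star y j); last first.
    by apply/eqP; move/fpmP: fxy; apply=> //; rewrite Sj.
  move: nC; rewrite Sj andbT => nC; rewrite /B hj Sj nC hf andbT /=.
  by case: (bit x j); case: (c0 j).
Qed.

End Protocol.

(** * The programs of Alice and Bob *)

Notation aX := 0%N (only parsing).
Notation aCoin := 1%N (only parsing).
Notation aAlive := 2%N (only parsing).
Notation aZ := 3%N (only parsing).
Notation aRk := 4%N (only parsing).
Notation aU := 5%N (only parsing).
Notation aIdx := 6%N (only parsing).
Notation aAcc := 7%N (only parsing).
Notation aHash := 8%N (only parsing).
Notation aBit := 9%N (only parsing).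
Notation aQ := 10%N (only parsing).
Notation aCnt := 11%N (only parsing).
Notation aC := 12%N (only parsing).
Notation aQ0 := 13%N (only parsing).
Notation aQ1 := 14%N (only parsing).
Notation aKil := 15%N (only parsing).
Notation aCf := 16%N (only parsing).
Notation acf := 17%N (only parsing).
Notation aRkf := 18%N (only parsing).
Notation aSE := 19%N (only parsing).
Notation aPE := 20%N (only parsing).
Notation aE := 21%N (only parsing).
Notation aUj := 22%N (only parsing).
Notation aSV := 23%N (only parsing).
Notation aPV := 24%N (only parsing).
Notation aRks := 25%N (only parsing).
Notation aV := 26%N (only parsing).
Notation aXh := 27%N (only parsing).
Notation aVal := 28%N (only parsing).

Section Programs.
Variables (d n G th M L a be nsl k : nat).

Definition emrd t r := In (d + (t * (a + 8) + r)).
Definition eIdx t := eNum (a + 3) (fun i => emrd t (5 + i)).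
Definition eX i j := Var aX 0 (i * d + j).
Definition eCtr t j := eLe (Cst th) (Var aCnt t j).
Definition eParok t X :=
  eA (eEq (ePar d (fun j => eA (Var aQ0 t j) (X j))) (emrd t 1))
     (eEq (ePar d (fun j => eA (Var aQ1 t j) (X j))) (emrd t 3)).
Definition eWt t X :=
  eA (emrd t 2)
     (eLe (eSum d (fun j => eA (Dst (X j) (eCtr t j)) (eN (Var aC t j)))) (Cst M)).
Definition eAlive t X := eAll t (fun t' => eA (eParok t' X) (eN (eWt t' X))).
Definition eKilled t X := eA (eParok t X) (eWt t X).

(** Alice and Bob run the same simulation. [aCnt], [aC], [aQ0] and [aQ1] are kept in row [t], since
    later tests of aliveness consult all earlier rounds; everything else is scratch in row 0. *)
Definition simround t : seq stmt :=
  Lrcv true aX 0 (n * G * d) ++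
  (Lrcv true aCoin 0 (ncoin d a be) ++
  (Lasg aAlive 0 (n * G) (fun i => eAlive t (eX i)) ++
  (Lasg aZ 0 (n * d) (fun q => eMux G (fun g => Var aAlive 0 (q %/ d * G + g))
     (fun g => eX (q %/ d * G + g) (q %% d))) ++
  (Lasg aCnt t d (fun j => eSum n (fun i => Var aZ 0 (i * d + j))) ++
  (Lasg aC t d (fun j => eA (eCtr t j) (eLe (Add (Var aCnt t j) (Cst th)) (Cst n))) ++
  (Lscan aRk 0 d (fun j => Var aC t j) ++
  (Lasg aU 0 (ntry a)
     (fun i => eNum be.+2 (fun r => Var aCoin 0 (d * be.+1 + (i * be.+2 + r)))) ++
  (Lasg aIdx 0 1 (fun _ => eIdx t) ++
  (Lasg aQ 0 d (fun j => eAll be.+1 (fun i => Var aCoin 0 (j * be.+1 + i))) ++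
  (Lasg aQ0 t d (fun j => eA (emrd t 0) (Var aQ 0 j)) ++
   Lasg aQ1 t d (fun j => eA (Var aC t j) (eHas (ntry a)
     (fun i => eA (eEq (Var aIdx 0 0) (Cst i)) (eEq (Var aU 0 i) (Var aRk 0 j)))))
  )))))))))).

Definition eAnyf := eHas L (fun t => emrd t 4).

Definition eSkip s j := eEq (Var s 0 j) (Cst (skip a)).

Definition eMarked s p e := eHas nsl (fun j =>
  eA (eN (eSkip s j)) (eEq (Add (Var p 0 j) (Var s 0 j)) e)).

Definition finround : seq stmt :=
  Lasg aCf 0 d (fun j => eHas L (fun t => eA (emrd t 4) (Var aC t j))) ++
  (Lscan aRkf 0 d (fun j => Var aCf 0 j) ++
  (Lasg aSE 0 nsl (fun j => eNum (a + 1)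
     (fun i => In (d + (L * (a + 8) + (j * (a + 1) + i))))) ++
  (Lscan aPE 0 nsl (fun j => Add (Var aSE 0 j) (eN (eSkip aSE j))) ++
  (Lasg aE 0 d (fun j => eA (Var aCf 0 j) (eMarked aSE aPE (Var aRkf 0 j))) ++
   Lasg aUj 0 d (fun j => eA eAnyf (eN (eA (Var aCf 0 j) (eN (Var aE 0 j))))))))).

Definition eOk := eA (eAll L (fun t => Var aKil 0 t)) (eO (eAlive L In) eAnyf).

Definition ahash : seq stmt := Lrcv true aHash 0 d ++
  [:: SSnd (ePar d (fun j => eA (Var aHash 0 j) (eA (Var aUj 0 j) (In j))))].

Definition aprog : seq stmt :=
  flatten [seq simround t | t <- iota 0 L] ++
  (finround ++
  (Lasg aKil 0 L (fun t => eEq (emrd t 4) (eA (eAlive t In) (eKilled t In))) ++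
  (SSnd eOk :: flatten [seq ahash | _ <- iota 0 k]))).

Definition eStar j := eEq (In j) (Cst 2).
Definition eYb j := eEq (In j) (Cst 1).
Definition eMd t := eLe (eSum d (fun j => eA (Var aC t j) (eN (eStar j)))) (Cst M).

(** The index is verified, not computed: if it names a trial, that trial is useful, and no useful
    trial comes before it. *)
Definition eChk t :=
  eA (eEq (emrd t 0) (eN (eHas d (fun j => eA (eStar j) (Var aQ 0 j)))))
  (eA (eEq (emrd t 2) (eMd t))
  (eA (eA (eO (eN (eMd t)) (eEq (Var aIdx 0 0) (Cst (ntry a))))
          (eO (eMd t) (eAll (ntry a) (fun i =>
             eA (eO (eN (eEq (Var aIdx 0 0) (Cst i))) (Var aVal 0 i))
                (eO (eN (Var aVal 0 i)) (eLe (Var aIdx 0 0) (Cst i)))))))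
  (eA (eEq (emrd t 1) (ePar d (fun j => eA (Var aQ0 t j) (eYb j))))
      (eEq (emrd t 3) (ePar d (fun j => eA (Var aQ1 t j) (eYb j))))))).

Definition acc e : stmt := SAsg aAcc 0 0 (eA (Var aAcc 0 0) e).

Definition bround t : seq stmt := simround t ++
  (Lasg aVal 0 (ntry a) (fun i => eHas d (fun j =>
     eA (Var aC t j) (eA (eN (eStar j)) (eEq (Var aU 0 i) (Var aRk 0 j))))) ++
   [:: acc (eChk t)]).

Definition eRange s p e := eAll nsl (fun j =>
  eO (eSkip s j) (eLe (Add (Add (Var p 0 j) (Var s 0 j)) (Cst 1)) e)).

Definition eChkE := eA (eRange aSE aPE (Var aRkf 0 d))
  (eAll d (fun j => eEq (Var aE 0 j) (eA (Var aCf 0 j) (eN (eStar j))))).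
Definition eChkV := eA (eRange aSV aPV (Var aRks 0 d))
  (eAll d (fun j => eO (eN (Var aV 0 j)) (Var aUj 0 j))).

Definition bfin : seq stmt :=
  Lasg acf 0 d (fun j => eHas L (fun t => eA (emrd t 4) (eCtr t j))) ++
  (Lasg aSV 0 nsl (fun j => eNum (a + 1)
     (fun i => In (d + (L * (a + 8) + (nsl * (a + 1) + (j * (a + 1) + i)))))) ++
  (Lscan aPV 0 nsl (fun j => Add (Var aSV 0 j) (eN (eSkip aSV j))) ++
  (Lscan aRks 0 d (fun j => eStar j) ++
  (Lasg aV 0 d (fun j => eA (eStar j) (eMarked aSV aPV (Var aRks 0 j))) ++
  (Lasg aXh 0 d (fun j => eA (Var aUj 0 j)
     (eO (eA (eStar j) (Dst (Var acf 0 j) (Var aV 0 j))) (eA (eN (eStar j)) (eYb j)))) ++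
  [:: acc (eA eChkE eChkV)]))))).

Definition bhash : seq stmt := Lrcv true aHash 0 d ++ (Lrcv false aBit 0 1 ++
  [:: acc (eEq (Var aBit 0 0) (ePar d (fun j => eA (Var aHash 0 j) (Var aXh 0 j))))]).

Definition bprog : seq stmt :=
  SAsg aAcc 0 0 (Cst 1) :: (flatten [seq bround t | t <- iota 0 L] ++
  (finround ++ (bfin ++ (Lrcv false aBit 0 1 ++
  (acc (Var aBit 0 0) :: flatten [seq bhash | _ <- iota 0 k]))))).

Definition sample_bits (x : cube d) : seq bool := mkseq (bit x) d.

Definition round_stream (s : seq (cube d)) (c : seq bool) : seq bool :=
  flatten (map sample_bits s) ++ c.

(** * What the programs of Alice and Bob compute *)

Section Semantics.
Variables (inp : nat -> nat) (m : seq bool).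
Variables (ss : nat -> seq (cube d)) (cs : nat -> seq bool).
Hypothesis inp_m : forall i, inp (d + i) = nth false m i.
Hypothesis size_ss : forall t, size (ss t) = (n * G)%N.
Hypothesis size_cs : forall t, size (cs t) = ncoin d a be.

Local Notation Kst := (Kst n G th M a be ss cs m).
Local Notation kt := (kt n G th M a be ss cs m).
Local Notation zs t := (zlist n G (alive M (Kst t)) (ss t)).
Local Notation ev := (eval inp).

Lemma ev_mrd v t r : ev v (emrd t r) = mrd a m t r.
Proof. by rewrite /= inp_m. Qed.

Lemma Kst_all t (x : cube d) : alive M (Kst t) x = all (fun t' => alive1 M (kt t') x) (iota 0 t).
Proof.
elim: t => // t IH; rewrite -addn1 iotaD all_cat -IH addn1 /= andbT.
by rewrite /alive all_rcons andbC.
Qed.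

Definition inv t (v : env) := forall t' j, (t' < t)%N -> (j < d)%N ->
  [/\ v aCnt t' j = cnt (zs t') j, v aC t' j = cC (kt t') j,
      v aQ0 t' j = cq0 (kt t') j & v aQ1 t' j = cq1 (kt t') j].

Lemma inv_same t v v' : inv t v ->
  (forall g t' j, (10 < g < 15)%N -> v' g t' j = v g t' j) -> inv t v'.
Proof. by move=> h E t' j ht hj; rewrite !E //; exact: h. Qed.

Lemma ev_parok t v X (x : cube d) : inv t.+1 v -> (forall j, (j < d)%N -> ev v (X j) = bit x j) ->
  ev v (eParok t X) = parok (kt t) x.
Proof.
move=> hi hX; apply: ev_A; apply: ev_Eqb; try exact: ev_mrd.
  apply: (ev_Par (c := fun j => cq0 (kt t) j && bit x j)) => j hj.
  by apply: ev_A (hX _ hj); have [_ _ E _] := hi t j (ltnSn _) hj.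
apply: (ev_Par (c := fun j => cq1 (kt t) j && bit x j)) => j hj.
by apply: ev_A (hX _ hj); have [_ _ _ E] := hi t j (ltnSn _) hj.
Qed.

Lemma ev_wt t v X (x : cube d) : inv t.+1 v -> (forall j, (j < d)%N -> ev v (X j) = bit x j) ->
  ev v (eWt t X) = cmd (kt t) && (wt (kt t) x <= M)%N.
Proof.
move=> hi hX; apply: ev_A; first exact: ev_mrd.
apply: ev_Le => //.
apply: (ev_Sum (c := fun j => (bit x j != cctr (kt t) j) && ~~ cC (kt t) j)) => j hj.
have [h1 h2 _ _] := hi t j (ltnSn _) hj.
apply: ev_A; last by apply: ev_N; rewrite /= h2.
have -> : ev v (Dst (X j) (eCtr t j)) = distn' (ev v (X j)) (ev v (eCtr t j)) by [].
rewrite hX // (@ev_Le _ _ _ _ th (cnt (zs t) j)) //.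
by rewrite /= /center; case: (bit x j); case: (_ <= _)%N.
Qed.

Lemma ev_alive t v X (x : cube d) : inv t v -> (forall j, (j < d)%N -> ev v (X j) = bit x j) ->
  ev v (eAlive t X) = alive M (Kst t) x.
Proof.
move=> hi hX; rewrite Kst_all; apply: ev_All => t' ht'.
have hi' : inv t'.+1 v by move=> t1 j h1 hj; apply: hi => //; apply: leq_trans h1 ht'.
by apply: ev_A; [exact: ev_parok|apply: ev_N; exact: ev_wt].
Qed.

Lemma ev_killed t v X (x : cube d) : inv t.+1 v -> (forall j, (j < d)%N -> ev v (X j) = bit x j) ->
  ev v (eKilled t X) = killed M (kt t) x.
Proof. by move=> hi hX; apply: ev_A; [exact: ev_parok|exact: ev_wt]. Qed.

Lemma ev_idx v t : ev v (eIdx t) = midx a m t.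
Proof. by apply: ev_Num => i hi; exact: ev_mrd. Qed.

Definition setr (r : bool -> seq bool) b l : bool -> seq bool :=
  fun b' => if b' == b then l else r b'.

Lemma setrE r b l : setr r b l b = l.
Proof. by rewrite /setr eqxx. Qed.

Lemma setr2 r b l l' : setr (setr r b l) b l' = setr r b l'.
Proof. by apply/funext => b'; rewrite /setr; case: eqP. Qed.

Lemma nth_samples s i j : (i < size s)%N -> (j < d)%N ->
  nth false (flatten (map sample_bits s)) (i * d + j) = bit (nth (zero_cube d) s i) j.
Proof.
move=> hi hj; rewrite -(mkseq_nth (zero_cube d) s) -map_comp nth_flatten_const //.
  by rewrite nth_mkseq // nth_mkseq.
by move=> i' _; rewrite size_mkseq.
Qed.

(** Row-0 values that Bob's check of round [t] still reads before the next round overwrites them. *)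
Definition scratch t (v : env) :=
  [/\ forall j, (j < d)%N -> v aQ 0 j = Qset be (cs t) j,
      forall j, (j < d)%N -> v aRk 0 j = rk (cC (kt t)) j,
      forall i, (i < ntry a)%N -> v aU 0 i = unum d be (cs t) i &
      v aIdx 0 0 = midx a m t].

Lemma has_eq_nat N i (P : nat -> bool) :
  has (fun j => (i == j) && P j) (iota 0 N) = (i < N)%N && P i.
Proof.
apply/hasP/andP => [[j]|[hi Pi]].
  by rewrite mem_iota => hj /andP[/eqP-> ->].
by exists i; rewrite ?mem_iota ?eqxx.
Qed.

Lemma simround_exec t v r o rest : inv t v ->
  r true = round_stream (ss t) (cs t) ++ rest ->
  exists v', [/\ hexec inp (simround t) (v, r, o) = (v', setr r true rest, o),
    fed inp (simround t) (v, r, o), inv t.+1 v', scratch t v' &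
    forall g t' j, (g == aAcc) || (14 < g)%N -> v' g t' j = v g t' j].
Proof.
move=> hi Er.
have s1 : size (flatten (map sample_bits (ss t))) = (n * G * d)%N.
  rewrite -(mkseq_nth (zero_cube d) (ss t)) -map_comp (@size_flatten_const _ _ d) ?size_ss //.
  by move=> i _; rewrite size_mkseq.
have Er1 : r true = flatten (map sample_bits (ss t)) ++ (cs t ++ rest).
  by rewrite Er /round_stream catA.
set st1 := flatten (map sample_bits (ss t)) in s1 Er1.
pose v1 := setv v aX 0 (n * G * d) (fun j => nth false st1 j).
pose v2 := setv v1 aCoin 0 (ncoin d a be) (fun j => nth false (cs t) j).
pose A : cube d -> bool := alive M (Kst t).
have ltd i j : (i < n * G)%N -> (j < d)%N -> (i * d + j < n * G * d)%N.
  by move=> hi' hj; nia.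
have hX v' : (forall t' j, v' aX t' j = v2 aX t' j) -> forall i j,
    (i < n * G)%N -> (j < d)%N -> ev v' (eX i j) = bit (nth (zero_cube d) (ss t) i) j.
  move=> E i j hi' hj; rewrite /= E /v2 /v1 /setv /= ltd // nth_samples //.
  by rewrite size_ss.
have hCn v' : (forall t' j, v' aCoin t' j = v2 aCoin t' j) -> forall j,
    (j < ncoin d a be)%N -> ev v' (Var aCoin 0 j) = nth false (cs t) j.
  by move=> E j hj; rewrite /= E /v2 /setv /= hj.
pose c3 i : nat := A (nth (zero_cube d) (ss t) i).
pose v3 := setv v2 aAlive 0 (n * G) c3.
have inv2 : inv t v2 by apply: (inv_same hi) => g t' j; case: g => [|[|]].
have X3 : forall v' i, same_but aAlive 0 v2 v' -> (i < n * G)%N ->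
    ev v' (eAlive t (eX i)) = c3 i.
  move=> v' i sb hi'; apply: (@ev_alive _ _ _ (nth (zero_cube d) (ss t) i)).
    by apply: (inv_same inv2) => g t' j hg; rewrite sb //; move: g hg; do 3 case=> //.
  by move=> j hj; apply: hX => // t' j'; rewrite sb.
pose c4 q : nat := bit (zvec G A (ss t) (q %/ d)) (q %% d).
pose v4 := setv v3 aZ 0 (n * d) c4.
have X4 : forall v' q, same_but aZ 0 v3 v' -> (q < n * d)%N ->
    ev v' (eMux G (fun g => Var aAlive 0 (q %/ d * G + g))
      (fun g => eX (q %/ d * G + g) (q %% d))) = c4 q.
  move=> v' q sb hq; have d0 : (0 < d)%N by case: (d) hq => //; rewrite muln0.
  have hq1 : (q %/ d < n)%N by rewrite ltn_divLR.
  have hq2 : (q %% d < d)%N by rewrite ltn_mod.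
  have lt g : (g < G)%N -> (q %/ d * G + g < n * G)%N by move=> hg; clear -hg hq1; nia.
  rewrite (@ev_Mux _ _ _ _ _ (fun g => A (nth (zero_cube d) (ss t) (q %/ d * G + g)))
    (fun g => bit (nth (zero_cube d) (ss t) (q %/ d * G + g)) (q %% d))); last first.
    move=> g hg; split; last by apply: hX; [move=> t' j'; rewrite sb|exact: lt|].
    by rewrite /= sb // /v3 setvE ?lt.
  (* If the group has no survivor, the multiplexer yields 0, which agrees with the bits of
     [zero_cube]. *)
  rewrite /c4 /zvec; case: ifP => //= _.
  by rewrite /bit; case: insubP => //= i _ _; rewrite ffunE.
pose c5 j := cnt (zs t) j.
pose v5 := setv v4 aCnt t d c5.
have X5 : forall v' j, same_but aCnt t v4 v' -> (j < d)%N ->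
    ev v' (eSum n (fun i => Var aZ 0 (i * d + j))) = c5 j.
  move=> v' j sb hj; rewrite (@ev_Sum _ _ _ _ (fun i => bit (zvec G A (ss t) i) j)).
    rewrite -(big_mkord xpredT (fun i => nat_of_bool (bit (zvec G A (ss t) i) j))).
    by rewrite /c5 /cnt -sumn_count sumnE !big_map /index_iota subn0.
  move=> i hi'; rewrite /= sb // /v4 /setv /= ifT; last by clear -hi' hj; nia.
  have d0 : (0 < d)%N by apply: leq_ltn_trans hj.
  by rewrite /c4 divnMDl // divn_small // addn0 modnMDl modn_small.
pose c6 j : nat := inC n th (zs t) j.
pose v6 := setv v5 aC t d c6.
have X6 : forall v' j, same_but aC t v5 v' -> (j < d)%N ->
    ev v' (eA (eCtr t j) (eLe (Add (Var aCnt t j) (Cst th)) (Cst n))) = c6 j.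
  move=> v' j sb hj; have E : ev v' (Var aCnt t j) = c5 j by rewrite /= sb // /v5 setvE.
  apply: ev_A; first exact: ev_Le.
  by apply: ev_Le => //; rewrite -[LHS]/(ev v' (Var aCnt t j) + th)%N E.
pose v7 := setv v6 aRk 0 d.+1 (fun j => \sum_(i < j) c6 i)%N.
have X7 : forall v' j, same_but aRk 0 v6 v' -> (j < d)%N -> ev v' (Var aC t j) = c6 j.
  by move=> v' j sb hj; rewrite /= sb // /v6 setvE.
pose c8 i := unum d be (cs t) i.
pose v8 := setv v7 aU 0 (ntry a) c8.
have X8 : forall v' i, same_but aU 0 v7 v' -> (i < ntry a)%N ->
    ev v' (eNum be.+2 (fun r => Var aCoin 0 (d * be.+1 + (i * be.+2 + r)))) = c8 i.
  move=> v' i sb hi'; apply: ev_Num => q hq; apply: hCn.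
    by move=> t' j'; rewrite sb // /v7 /v6 /v5 /v4 /v3 /setv.
  by rewrite /ncoin ltn_add2l; clear -hi' hq; nia.
pose v9 := setv v8 aIdx 0 1 (fun=> midx a m t).
have X9 : forall v' (i : nat), same_but aIdx 0 v8 v' -> (i < 1)%N ->
    ev v' (eIdx t) = midx a m t by move=> v' i _ _; exact: ev_idx.
pose c10 j : nat := Qset be (cs t) j.
pose v10 := setv v9 aQ 0 d c10.
have X10 : forall v' j, same_but aQ 0 v9 v' -> (j < d)%N ->
    ev v' (eAll be.+1 (fun i => Var aCoin 0 (j * be.+1 + i))) = c10 j.
  move=> v' j sb hj; apply: ev_All => i hi'; apply: hCn.
    by move=> t' j'; rewrite sb // /v9 /v8 /v7 /v6 /v5 /v4 /v3 /setv.
  by rewrite /ncoin; apply: ltn_addr; clear -hi' hj; nia.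
pose c11 j : nat := mrd a m t 0 && Qset be (cs t) j.
pose v11 := setv v10 aQ0 t d c11.
have X11 : forall v' j, same_but aQ0 t v10 v' -> (j < d)%N ->
    ev v' (eA (emrd t 0) (Var aQ 0 j)) = c11 j.
  move=> v' j sb hj; apply: ev_A; first exact: ev_mrd.
  by rewrite /= sb // /v10 setvE.
pose c12 j : nat := selected d a be (inC n th (zs t)) (cs t) (midx a m t) j.
pose v12 := setv v11 aQ1 t d c12.
have X12 : forall v' j, same_but aQ1 t v11 v' -> (j < d)%N ->
    ev v' (eA (Var aC t j) (eHas (ntry a)
     (fun i => eA (eEq (Var aIdx 0 0) (Cst i)) (eEq (Var aU 0 i) (Var aRk 0 j))))) = c12 j.
  move=> v' j sb hj.
  have -> : c12 j = inC n th (zs t) j && has (fun i => (midx a m t == i) &&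
      (c8 i == rk (inC n th (zs t)) j)) (iota 0 (ntry a)).
    by rewrite /c12 /selected has_eq_nat.
  apply: ev_A.
    by rewrite /= sb // /v11 /v10 /v9 /v8 /v7 /setv /= /v6 setvE.
  apply: ev_Has => i hi'; apply: ev_A.
    apply: ev_Eq => //; rewrite /= sb // /v11 /v10 /setv /= /v9 setvE //.
  apply: ev_Eq.
    by rewrite /= sb // /v11 /v10 /v9 /setv /= /v8 setvE.
  by rewrite /= sb // /v11 /v10 /v9 /v8 /setv /= /v7 setvE // ltnS ltnW.
have E1 : hexec inp (Lrcv true aX 0 (n * G * d)) (v, r, o) =
    (v1, setr r true (cs t ++ rest), o) by exact: hexec_Lrcv Er1 s1.
have E2 : hexec inp (Lrcv true aCoin 0 (ncoin d a be)) (v1, setr r true (cs t ++ rest), o) =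
    (v2, setr r true rest, o).
  by rewrite (@hexec_Lrcv inp v1 _ o true aCoin 0 _ (cs t) rest) ?setrE ?size_cs // -/(setr _ _ _) setr2.
exists v12; split.
- rewrite /simround hexec_cat E1 hexec_cat E2.
  rewrite hexec_cat (hexec_Lasg _ _ X3) -/v3 hexec_cat (hexec_Lasg _ _ X4) -/v4.
  rewrite hexec_cat (hexec_Lasg _ _ X5) -/v5 hexec_cat (hexec_Lasg _ _ X6) -/v6.
  rewrite hexec_cat (hexec_Lscan _ _ X7) -/v7 hexec_cat (hexec_Lasg _ _ X8) -/v8.
  rewrite hexec_cat (hexec_Lasg _ _ X9) -/v9 hexec_cat (hexec_Lasg _ _ X10) -/v10.
  by rewrite hexec_cat (hexec_Lasg _ _ X11) -/v11 (hexec_Lasg _ _ X12) -/v12.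
- rewrite /simround fed_cat (fed_Lrcv _ _ _ _ _ Er1 s1) E1 fed_cat.
  rewrite (@fed_Lrcv inp v1 _ o true aCoin 0 _ (cs t) rest) ?setrE ?size_cs // E2.
  by rewrite !(fed_cat, fed_Lasg, fed_Lscan).
- move=> t' j; rewrite ltnS leq_eqVlt => /orP[/eqP-> hj|ht' hj].
    by rewrite /v12 /v11 /v10 /v9 /v8 /v7 /v6 /v5 /setv /= !eqxx hj.
  have nt : (t' == t) = false by apply/negbTE; rewrite neq_ltn ht'.
  rewrite /v12 /v11 /v10 /v9 /v8 /v7 /v6 /v5 /v4 /v3 /setv /= nt /=.
  exact: inv2.
- split=> [j hj|j hj|i hi'|].
  + by rewrite /v12 /v11 /setv /= /v10 setvE.
  + by rewrite /v12 /v11 /v10 /v9 /v8 /setv /= /v7 setvE // ltnS ltnW.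
  + by rewrite /v12 /v11 /v10 /v9 /setv /= /v8 setvE.
  + by rewrite /v12 /v11 /v10 /setv /= /v9 setvE.
- move=> g t' j.
  rewrite /v12 /v11 /v10 /v9 /v8 /v7 /v6 /v5 /v4 /v3 /v2 /v1 /setv.
  by do 15 (case: g => [//|g]).
Qed.

Definition rounds_stream T : seq bool :=
  flatten [seq round_stream (ss t) (cs t) | t <- iota 0 T].

Lemma simrounds_exec T v r o rest : r true = rounds_stream T ++ rest ->
  exists v', [/\ hexec inp (flatten [seq simround t | t <- iota 0 T]) (v, r, o)
      = (v', setr r true rest, o),
    fed inp (flatten [seq simround t | t <- iota 0 T]) (v, r, o) & inv T v'].
Proof.
elim: T rest => [|T IH] rest Er.
  exists v; split=> //=; congr (_, _, _); apply/funext => b; rewrite /setr.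
  by case: eqP => // ->; rewrite Er.
move: Er; rewrite /rounds_stream -addn1 iotaD !map_cat !flatten_cat /= !cats0 -catA add0n.
move=> /IH[v1 [E1 f1 i1]].
have [v2 [E2 f2 i2 _ _]] := @simround_exec T v1 (setr r true (round_stream (ss T) (cs T) ++ rest))
  o rest i1 (setrE _ _ _).
exists v2; rewrite hexec_cat fed_cat E1 f1 E2 f2 setr2 addn1; split=> //.
Qed.

Local Notation Cf := (Cf n G th M L a be ss cs m).
Local Notation cf := (cf n G th M L a be ss cs m).
Local Notation Ej := (Ej n G th M L a be nsl ss cs m).
Local Notation Uj := (Uj n G th M L a be nsl ss cs m).

Definition finfacts (v : env) :=
  [/\ forall j, (j < d)%N -> v aCf 0 j = Cf j,
      forall j, (j <= d)%N -> v aRkf 0 j = rk Cf j,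
      forall j, (j < nsl)%N -> v aSE 0 j = slotE L a m j /\
                  v aPE 0 j = pos (skip a) (slotE L a m) j,
      forall j, (j < d)%N -> v aE 0 j = Ej j
    & forall j, (j < d)%N -> v aUj 0 j = Uj j].

Lemma ev_anyf v : ev v eAnyf = has (mf a m) (iota 0 L).
Proof. by apply: ev_Has => t _; exact: ev_mrd. Qed.

Lemma ev_skip v s j c : v s 0 j = c -> ev v (eSkip s j) = (c == skip a).
Proof. by move=> E; exact: ev_Eq. Qed.

Lemma ev_marked v s p e f r : (forall j, (j < nsl)%N -> v s 0 j = f j /\
    v p 0 j = pos (skip a) f j) -> ev v e = r ->
  ev v (eMarked s p e) = marked (skip a) nsl f r.
Proof.
move=> h he; apply: ev_Has => j /h[h1 h2]; apply: ev_A.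
  by apply: ev_N; exact: ev_skip.
by apply: ev_Eq he; rewrite /= h1 h2.
Qed.

Lemma finround_exec v r o : inv L v ->
  exists v', [/\ hexec inp finround (v, r, o) = (v', r, o),
    fed inp finround (v, r, o), finfacts v' &
    forall g t j, (g < 16)%N || (g == acf) -> v' g t j = v g t j].
Proof.
move=> hi.
pose v1 := setv v aCf 0 d (fun j => Cf j : nat).
have X1 : forall v' j, same_but aCf 0 v v' -> (j < d)%N ->
    ev v' (eHas L (fun t => eA (emrd t 4) (Var aC t j))) = Cf j :> nat.
  move=> v' j sb hj; apply: ev_Has => t ht; apply: ev_A; first exact: ev_mrd.
  by rewrite /= sb //; have [_ -> _ _] := hi t j ht hj.
pose v2 := setv v1 aRkf 0 d.+1 (fun j => \sum_(i < j) Cf i)%N.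
have X2 : forall v' j, same_but aRkf 0 v1 v' -> (j < d)%N ->
    ev v' (Var aCf 0 j) = Cf j :> nat.
  by move=> v' j sb hj; rewrite /= sb // /v1 setvE.
pose v3 := setv v2 aSE 0 nsl (slotE L a m).
have X3 : forall v' j, same_but aSE 0 v2 v' -> (j < nsl)%N ->
    ev v' (eNum (a + 1) (fun i => In (d + (L * (a + 8) + (j * (a + 1) + i))))) = slotE L a m j.
  by move=> v' j _ _; apply: ev_Num => i _; exact: inp_m.
pose v4 := setv v3 aPE 0 nsl.+1 (pos (skip a) (slotE L a m)).
have X4 : forall v' j, same_but aPE 0 v3 v' -> (j < nsl)%N ->
    ev v' (Add (Var aSE 0 j) (eN (eSkip aSE j))) =
    (slotE L a m j + (slotE L a m j != skip a))%N.
  move=> v' j sb hj; have E : v' aSE 0 j = slotE L a m j by rewrite sb // /v3 setvE.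
  by rewrite -[LHS]/(v' aSE 0 j + ev v' (eN (eSkip aSE j)))%N (ev_N (ev_skip E)) E.
pose v5 := setv v4 aE 0 d (fun j => Ej j : nat).
have X5 : forall v' j, same_but aE 0 v4 v' -> (j < d)%N ->
    ev v' (eA (Var aCf 0 j) (eMarked aSE aPE (Var aRkf 0 j))) = Ej j :> nat.
  move=> v' j sb hj; apply: ev_A.
    by rewrite /= sb // /v4 /v3 /v2 /setv /= /v1 setvE.
  apply: ev_marked => [i hi'|]; last first.
    by rewrite /= sb // /v4 /v3 /setv /= /v2 setvE // ltnS ltnW.
  rewrite !sb //; split; first by rewrite /v4 /setv /= /v3 setvE.
  by rewrite /v4 setvE // ltnS ltnW.
pose v6 := setv v5 aUj 0 d (fun j => Uj j : nat).
have X6 : forall v' j, same_but aUj 0 v5 v' -> (j < d)%N ->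
    ev v' (eA eAnyf (eN (eA (Var aCf 0 j) (eN (Var aE 0 j))))) = Uj j :> nat.
  move=> v' j sb hj; apply: ev_A; first exact: ev_anyf.
  apply: ev_N; apply: ev_A; first by rewrite /= sb // /v5 /v4 /v3 /v2 /setv /= /v1 setvE.
  by apply: ev_N; rewrite /= sb // /v5 setvE.
exists v6; split.
- rewrite /finround hexec_cat (hexec_Lasg _ _ X1) -/v1 hexec_cat (hexec_Lscan _ _ X2) -/v2.
  rewrite hexec_cat (hexec_Lasg _ _ X3) -/v3 hexec_cat (hexec_Lscan _ _ X4).
  rewrite -[setv _ _ _ _ _]/v4.
  by rewrite hexec_cat (hexec_Lasg _ _ X5) -/v5 (hexec_Lasg _ _ X6) -/v6.
- by rewrite /finround !(fed_cat, fed_Lasg, fed_Lscan).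
- split=> [j hj|j hj|j hj|j hj|j hj].
  + by rewrite /v6 /v5 /v4 /v3 /v2 /setv /= /v1 setvE.
  + by rewrite /v6 /v5 /v4 /v3 /setv /= /v2 setvE.
  + by rewrite /v6 /v5 /v4 /setv /= /v3 /setv /= hj ltnS ltnW.
  + by rewrite /v6 /setv /= /v5 setvE.
  + by rewrite /v6 setvE.
- move=> g t j; rewrite /v6 /v5 /v4 /v3 /v2 /v1 /setv.
  by do 23 (case: g => [//|g]).
Qed.

Section Alice.
Variable x : cube d.
Hypothesis inp_x : forall j, (j < d)%N -> inp j = bit x j.
Variable hb : nat -> seq bool.
Hypothesis size_hb : forall i, size (hb i) = d.

Definition hpar (r : seq bool) (f : nat -> bool) : bool :=
  odd (\sum_(j < d) (nth false r j && f j))%N.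

Definition alice_msg : seq bool := aliceok n G th M L a be ss cs m x ::
  mkseq (fun i => hpar (hb i) (fun j => Uj j && bit x j)) k.

Lemma ahash_exec K (v : env) r o rest : (forall j, (j < d)%N -> v aUj 0 j = Uj j) ->
  r true = flatten [seq hb i | i <- iota 0 K] ++ rest ->
  exists v', [/\ hexec inp (flatten [seq ahash | _ <- iota 0 K]) (v, r, o) =
     (v', setr r true rest, o ++ mkseq (fun i => hpar (hb i) (fun j => Uj j && bit x j)) K),
     fed inp (flatten [seq ahash | _ <- iota 0 K]) (v, r, o) &
     forall j, (j < d)%N -> v' aUj 0 j = Uj j].
Proof.
move=> hU; elim: K rest => [|K IH] rest Er.
  exists v; rewrite /= cats0; split=> //; congr (_, _, _); apply/funext => b.
  by rewrite /setr; case: eqP => // ->; rewrite Er.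
move: Er; rewrite /mkseq -addn1 iotaD !map_cat !flatten_cat /= !cats0 -catA add0n.
move=> /IH[v1 [E1 f1 i1]].
set r1 := setr r true (hb K ++ rest) in E1.
have Er1 : r1 true = hb K ++ rest by rewrite /r1 setrE.
have E2 := hexec_Lrcv inp v1 (o ++ mkseq (fun i => hpar (hb i) (fun j => Uj j && bit x j)) K)
  aHash 0 Er1 (size_hb K).
have f2 := fed_Lrcv inp v1 (o ++ mkseq (fun i => hpar (hb i) (fun j => Uj j && bit x j)) K)
  aHash 0 Er1 (size_hb K).
set v2 := setv _ _ _ _ _ in E2.
exists v2; rewrite !hexec_cat !fed_cat E1 f1 f2 E2 andbT; split=> //.
  rewrite /= -/(setr r1 true rest) setr2; congr (_, _, _).
  rewrite -cats1 -catA; congr (_ ++ (_ ++ [:: _])).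
  rewrite (@ev_Par _ _ _ _ (fun j => nth false (hb K) j && (Uj j && bit x j))).
    by rewrite /hpar; case: (odd _).
  move=> j hj; apply: ev_A; first by rewrite /= /v2 setvE.
  apply: ev_A; last by rewrite /= inp_x.
  by rewrite /= /v2 /setv /= i1.
Qed.

Lemma aprog_exec (v : env) r rest :
  r true = rounds_stream L ++ (flatten [seq hb i | i <- iota 0 k] ++ rest) ->
  exists v', hexec inp aprog (v, r, [::]) = (v', setr r true rest, alice_msg) /\
    fed inp aprog (v, r, [::]).
Proof.
move=> Er; have [v1 [E1 f1 i1]] := simrounds_exec v [::] Er.
set r1 := setr r true _ in E1.
have [v2 [E2 f2 [h1 h2 h3 h4 h5] pr2]] := finround_exec r1 [::] i1.
have i2 : inv L v2.
  by apply: (inv_same i1) => g t j /andP[_ hg]; rewrite pr2 // (ltn_trans hg).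
pose c3 t : nat := mf a m t == alive M (Kst t) x && killed M (kt t) x.
pose v3 := setv v2 aKil 0 L c3.
have X3 : forall v' t, same_but aKil 0 v2 v' -> (t < L)%N ->
   ev v' (eEq (emrd t 4) (eA (eAlive t In) (eKilled t In))) = c3 t.
  move=> v' t sb ht.
  have i3 : inv t.+1 v'.
    move=> t' j ht' hj; have lt' : (t' < L)%N by apply: leq_trans ht.
    by have := i2 t' j lt' hj; rewrite !sb.
  apply: ev_Eqb; first exact: ev_mrd.
  apply: ev_A; last exact: (ev_killed i3).
  by apply: ev_alive => // t' j ht' hj; apply: i3 => //; apply: ltnW.
have hU3 j : (j < d)%N -> v3 aUj 0 j = Uj j by move=> hj; rewrite /v3 /setv /= h5.
have i3 : inv L v3 by apply: (inv_same i2) => g t j; rewrite /v3 /setv; case: eqP => // ->.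
have eok : ev v3 eOk = aliceok n G th M L a be ss cs m x.
  apply: ev_A; first by apply: ev_All => t ht; rewrite /= /v3 setvE.
  by apply: ev_O; [exact: ev_alive|exact: ev_anyf].
have [v4 [E4 f4 _]] := @ahash_exec k v3 r1
  [:: aliceok n G th M L a be ss cs m x] rest hU3 (setrE _ _ _).
have Es : hstep inp (v3, r1, [::]) (SSnd eOk) =
    (v3, r1, [:: aliceok n G th M L a be ss cs m x]).
  by rewrite /hstep eok /=; case: aliceok.
rewrite /r1 setr2 in E4.
exists v4; split.
  rewrite /aprog hexec_cat E1 hexec_cat E2 hexec_cat (hexec_Lasg _ _ X3) -/v3.
  by rewrite -[hexec _ (_ :: _) _]/(hexec inp _ (hstep inp _ _)) Es E4.
rewrite /aprog fed_cat f1 E1 fed_cat f2 E2 fed_cat fed_Lasg (hexec_Lasg _ _ X3) -/v3.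
by rewrite -[fed _ (_ :: _) _]/(fed inp _ (hstep inp _ _)) Es f4.
Qed.

End Alice.

Section Bob.
Variable y : pattern d.
Hypothesis inp_y : forall j, (j < d)%N ->
  inp j = if star y j then 2%N else yb y j.

Local Notation chk := (chk n G th M a be ss cs m y).
Local Notation Vj := (Vj L a nsl m y).
Local Notation xhat := (xhat n G th M L a be nsl ss cs m y).

Lemma ev_star v j : (j < d)%N -> ev v (eStar j) = star y j.
Proof.
move=> hj; rewrite (ev_Eq (m := inp j) (n := 2%N)) // inp_y //.
by case: (star y j) => //; case: (yb y j).
Qed.

Lemma ev_yb v j : (j < d)%N -> ev v (eYb j) = ~~ star y j && yb y j.
Proof.
move=> hj; rewrite (ev_Eq (m := inp j) (n := 1%N)) // inp_y //.
by case: (star y j) => //; case: (yb y j).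
Qed.

Lemma yb_star j : yb y j -> ~~ star y j.
Proof. by rewrite /yb /star; case: insub => // i /eqP ->. Qed.

Lemma ev_yb' v j : (j < d)%N -> ev v (eYb j) = yb y j.
Proof.
move=> hj; rewrite ev_yb //; have := @yb_star j.
by case: (yb y j); rewrite ?andbF // => ->.
Qed.

(** The value [N] stands for a failed search: then the first implications are vacuous and the second
    ones say that [P] never holds. *)
Lemma find_iotaE N i (P : nat -> bool) : (i <= N)%N ->
  all (fun j => ((i == j) ==> P j) && (P j ==> (i <= j)%N)) (iota 0 N) =
  (i == find P (iota 0 N)).
Proof.
move=> hi; apply/allP/eqP => [h|-> j].
  have [hN|hN] := boolP (has P (iota 0 N)); last first.
    rewrite hasNfind // size_iota; apply/eqP; rewrite eqn_leq hi leqNgt.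
    apply/negP => lt; case/negP: hN; apply/hasP; exists i; first by rewrite mem_iota.
    by have := h i; rewrite mem_iota lt eqxx => /(_ isT)/andP[].
  have hf : (find P (iota 0 N) < N)%N by rewrite -[X in (_ < X)%N](size_iota 0 N) -has_find.
  have Pf := nth_find 0%N hN; rewrite nth_iota // add0n in Pf.
  have le1 : (i <= find P (iota 0 N))%N.
    by have := h (find P (iota 0 N)); rewrite mem_iota hf Pf => /(_ isT)/andP[].
  apply/eqP; rewrite eqn_leq le1 leqNgt; apply/negP => lt.
  have Pi : P i.
    by have := h i; rewrite mem_iota eqxx (leq_ltn_trans le1 hf) => /(_ isT)/andP[].
  have := before_find 0%N lt; rewrite nth_iota ?add0n ?Pi //; exact: leq_ltn_trans le1 hf.
rewrite mem_iota add0n => /andP[_ hj]; apply/andP; split; apply/implyP.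
  move=> /eqP E; have hN : has P (iota 0 N) by rewrite has_find E size_iota.
  by have := nth_find 0%N hN; rewrite E nth_iota // add0n.
move=> Pj; rewrite leqNgt; apply/negP => lt.
by have := before_find 0%N lt; rewrite nth_iota // add0n Pj.
Qed.

Lemma acc_exec (v : env) r o e (b c : bool) : v aAcc 0 0 = b -> ev v e = c ->
  hexec inp [:: acc e] (v, r, o) = (updv v aAcc 0 0 (b && c), r, o).
Proof. by move=> h1 h2; congr (updv _ _ _ _ _, _, _); apply: ev_A. Qed.

Lemma bround_exec t (v : env) r o rest (b : bool) : inv t v -> v aAcc 0 0 = b ->
  r true = round_stream (ss t) (cs t) ++ rest ->
  exists v', [/\ hexec inp (bround t) (v, r, o) = (v', setr r true rest, o),
    fed inp (bround t) (v, r, o), inv t.+1 v' & v' aAcc 0 0 = b && chk t].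
Proof.
move=> hi hb Er; have [v1 [E1 f1 i1 [q1 q2 q3 q4] pr1]] := simround_exec o hi Er.
set C := cC (kt t) in q2.
have hC j : (j < d)%N -> v1 aC t j = C j by move=> hj; have [_ -> _ _] := i1 t j (ltnSn _) hj.
pose c2 i : nat := valid be y C (cs t) i.
pose v2 := setv v1 aVal 0 (ntry a) c2.
have X2 : forall v' i, same_but aVal 0 v1 v' -> (i < ntry a)%N ->
    ev v' (eHas d (fun j => eA (Var aC t j)
      (eA (eN (eStar j)) (eEq (Var aU 0 i) (Var aRk 0 j))))) = c2 i.
  move=> v' i sb hi'; apply: ev_Has => j hj; apply: ev_A; first by rewrite /= sb // hC.
  apply: ev_A; first by apply: ev_N; exact: ev_star.
  by apply: ev_Eq; rewrite /= sb // ?q3 ?q2.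
have sb2 : same_but aVal 0 v1 v2 by exact: same_setv.
have md : ev v2 (eMd t) = can_md M y C.
  apply: ev_Le => //; apply: (ev_Sum (c := fun j => C j && ~~ star y j)) => j hj.
  by apply: ev_A; [rewrite /= sb2 // hC|apply: ev_N; exact: ev_star].
have idx : v2 aIdx 0 0 = midx a m t by rewrite sb2.
(* The index is read from [a + 3] bits, so even a dishonest one satisfies the hypothesis of
   [find_iotaE]. *)
have le_idx : (midx a m t <= ntry a)%N.
  rewrite -ltnS prednK ?expn_gt0 //; have := num_lt (mkseq (fun i => mrd a m t (5 + i)) (a + 3)).
  by rewrite size_mkseq.
have ek : ev v2 (eChk t) = chk t.
  apply: ev_A.
    apply: ev_Eqb; first exact: ev_mrd.
    apply: ev_N; apply: ev_Has => j hj; apply: ev_A; first exact: ev_star.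
    by rewrite /= sb2 // q1.
  apply: ev_A; first by apply: ev_Eqb; [exact: ev_mrd|exact: md].
  apply: ev_A.
    have -> : (midx a m t == can_idx M a be y C (cs t)) =
      (~~ can_md M y C || (midx a m t == ntry a)) &&
      (can_md M y C || all (fun i => (~~ (midx a m t == i) || valid be y C (cs t) i) &&
         (~~ valid be y C (cs t) i || (midx a m t <= i)%N)) (iota 0 (ntry a))).
      rewrite /can_idx; case: (can_md M y C) => /=; first by rewrite andbT.
      rewrite -find_iotaE //; apply: eq_all => i.
      by rewrite !implybE.
    apply: ev_A; first by apply: ev_O; [exact: ev_N|exact: ev_Eq].
    apply: ev_O; first exact: md.
    apply: ev_All => i hi'.
    have hv : ev v2 (Var aVal 0 i) = valid be y C (cs t) i by rewrite /= /v2 setvE.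
    apply: ev_A; apply: ev_O => //; first by apply: ev_N; exact: ev_Eq.
      exact: ev_N.
    exact: ev_Le.
  apply: ev_A.
    apply: ev_Eqb; first exact: ev_mrd.
    apply: (ev_Par (c := fun j => (mrd a m t 0 && Qset be (cs t) j) && yb y j)) => j hj.
    apply: ev_A; last exact: ev_yb'.
    by rewrite /= sb2 //; have [_ _ -> _] := i1 t j (ltnSn _) hj.
  apply: ev_Eqb; first exact: ev_mrd.
  apply: (ev_Par (c := fun j => selected d a be C (cs t) (midx a m t) j && yb y j)) => j hj.
  apply: ev_A; last exact: ev_yb'.
  by rewrite /= sb2 //; have [_ _ _ ->] := i1 t j (ltnSn _) hj.
exists (updv v2 aAcc 0 0 (b && chk t)); split.
- rewrite /bround hexec_cat E1 hexec_cat (hexec_Lasg _ _ X2) -/v2.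
  by apply: acc_exec => //; rewrite sb2 // pr1.
- by rewrite /bround fed_cat f1 E1 fed_cat fed_Lasg.
- apply: (inv_same i1) => g t' j hg; rewrite /updv /v2 /setv.
  by do 15 (case: g hg => [//|g] hg).
- by rewrite /updv !eqxx.
Qed.

Lemma brounds_exec T (v : env) r o rest (b : bool) : v aAcc 0 0 = b ->
  r true = rounds_stream T ++ rest ->
  exists v', [/\ hexec inp (flatten [seq bround t | t <- iota 0 T]) (v, r, o)
      = (v', setr r true rest, o),
    fed inp (flatten [seq bround t | t <- iota 0 T]) (v, r, o), inv T v'
    & v' aAcc 0 0 = b && all chk (iota 0 T)].
Proof.
move=> hb; elim: T rest => [|T IH] rest Er.
  exists v; split=> //=; last by rewrite andbT.
  congr (_, _, _); apply/funext => b'; rewrite /setr.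
  by case: eqP => // ->; rewrite Er.
move: Er; rewrite /rounds_stream -addn1 iotaD !map_cat !flatten_cat /= !cats0 -catA add0n.
move=> /IH[v1 [E1 f1 i1 a1]].
have [v2 [E2 f2 i2 a2]] := @bround_exec T v1
  (setr r true (round_stream (ss T) (cs T) ++ rest)) o rest _ i1 a1 (setrE _ _ _).
exists v2; rewrite hexec_cat fed_cat E1 f1 E2 f2 setr2 addn1; split=> //.
by rewrite a2 all_cat /= andbT andbA.
Qed.

Lemma ev_range v s p e f (C : nat -> bool) : (forall j, (j < nsl)%N -> v s 0 j = f j /\
    v p 0 j = pos (skip a) f j) -> ev v e = rk C d ->
  ev v (eRange s p e) = in_range_code (skip a) nsl d C f.
Proof.
move=> h he; apply: ev_All => j /h[h1 h2]; apply: ev_O; first exact: ev_skip.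
by apply: (@ev_Le _ _ _ _ _ (rk C d)) => //; rewrite /= h1 h2 addn1.
Qed.

Lemma bfin_exec (v : env) r o (b : bool) : inv L v -> finfacts v -> v aAcc 0 0 = b ->
  exists v', [/\ hexec inp bfin (v, r, o) = (v', r, o), fed inp bfin (v, r, o),
    forall j, (j < d)%N -> v' aXh 0 j = Uj j && xhat j &
    v' aAcc 0 0 = [&& b, chkE n G th M L a be nsl ss cs m y
                     & chkV n G th M L a be nsl ss cs m y]].
Proof.
move=> hi [h1 h2 h3 h4 h5] hb.
pose v1 := setv v acf 0 d (fun j => cf j : nat).
have X1 : forall v' j, same_but acf 0 v v' -> (j < d)%N ->
    ev v' (eHas L (fun t => eA (emrd t 4) (eCtr t j))) = cf j :> nat.
  move=> v' j sb hj; apply: ev_Has => t ht; apply: ev_A; first exact: ev_mrd.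
  by apply: ev_Le => //; rewrite /= sb //; have [-> _ _ _] := hi t j ht hj.
pose v2 := setv v1 aSV 0 nsl (slotV L a nsl m).
have X2 : forall v' j, same_but aSV 0 v1 v' -> (j < nsl)%N ->
    ev v' (eNum (a + 1) (fun i =>
      In (d + (L * (a + 8) + (nsl * (a + 1) + (j * (a + 1) + i)))))) = slotV L a nsl m j.
  by move=> v' j _ _; apply: ev_Num => i _; exact: inp_m.
pose v3 := setv v2 aPV 0 nsl.+1 (pos (skip a) (slotV L a nsl m)).
have X3 : forall v' j, same_but aPV 0 v2 v' -> (j < nsl)%N ->
    ev v' (Add (Var aSV 0 j) (eN (eSkip aSV j))) =
    (slotV L a nsl m j + (slotV L a nsl m j != skip a))%N.
  move=> v' j sb hj; have E : v' aSV 0 j = slotV L a nsl m j by rewrite sb // /v2 setvE.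
  by rewrite -[LHS]/(v' aSV 0 j + ev v' (eN (eSkip aSV j)))%N (ev_N (ev_skip E)) E.
pose v4 := setv v3 aRks 0 d.+1 (rk (star y)).
have X4 : forall v' j, same_but aRks 0 v3 v' -> (j < d)%N ->
    ev v' (eStar j) = star y j by move=> v' j _; exact: ev_star.
have hs4 v' : same_but aV 0 v4 v' -> forall j, (j < nsl)%N ->
    v' aSV 0 j = slotV L a nsl m j /\ v' aPV 0 j = pos (skip a) (slotV L a nsl m) j.
  move=> sb j hj; rewrite !sb //; split; first by rewrite /v4 /v3 /setv /= /v2 setvE.
  by rewrite /v4 /setv /= /v3 setvE // ltnS ltnW.
pose v5 := setv v4 aV 0 d (fun j => Vj j : nat).
have X5 : forall v' j, same_but aV 0 v4 v' -> (j < d)%N ->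
    ev v' (eA (eStar j) (eMarked aSV aPV (Var aRks 0 j))) = Vj j :> nat.
  move=> v' j sb hj; apply: ev_A; first exact: ev_star.
  apply: ev_marked; first exact: hs4.
  by rewrite /= sb // /v4 setvE // ltnS ltnW.
pose v6 := setv v5 aXh 0 d (fun j => Uj j && xhat j : nat).
have X6 : forall v' j, same_but aXh 0 v5 v' -> (j < d)%N ->
    ev v' (eA (Var aUj 0 j) (eO (eA (eStar j) (Dst (Var acf 0 j) (Var aV 0 j)))
      (eA (eN (eStar j)) (eYb j)))) = Uj j && xhat j :> nat.
  move=> v' j sb hj; apply: ev_A.
    by rewrite /= sb // /v5 /v4 /v3 /v2 /v1 /setv /= h5.
  have -> : xhat j = (star y j && (cf j (+) Vj j)) || (~~ star y j && yb y j).
    by rewrite /xhat; case: (star y j); rewrite /= ?orbF.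
  apply: ev_O; last by apply: ev_A; [apply: ev_N; exact: ev_star|exact: ev_yb'].
  apply: ev_A; first exact: ev_star.
  have e1 : v' acf 0 j = cf j by rewrite sb // /v5 /v4 /v3 /v2 /setv /= /v1 setvE.
  have e2 : v' aV 0 j = Vj j by rewrite sb // /v5 setvE.
  by rewrite /= e1 e2; case: (cf j); case: (Vj j).
have U6 j : (j < d)%N -> v6 aUj 0 j = Uj j.
  by move=> hj; rewrite /v6 /v5 /v4 /v3 /v2 /v1 /setv /= h5.
have ecE : ev v6 eChkE = chkE n G th M L a be nsl ss cs m y.
  apply: ev_A.
    apply: ev_range.
      move=> j hj; have := h3 j hj.
      by rewrite /v6 /v5 /v4 /v3 /v2 /v1 /setv.
    by rewrite /= /v6 /v5 /v4 /v3 /v2 /v1 /setv /= h2.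
  apply: ev_All => j hj; apply: ev_Eqb.
    by rewrite /= /v6 /v5 /v4 /v3 /v2 /v1 /setv /= h4.
  apply: ev_A; last by apply: ev_N; exact: ev_star.
  by rewrite /= /v6 /v5 /v4 /v3 /v2 /v1 /setv /= h1.
have ecV : ev v6 eChkV = chkV n G th M L a be nsl ss cs m y.
  apply: ev_A.
    apply: ev_range.
      by move=> j hj; have := hs4 v4 (fun _ _ _ _ => erefl) j hj; rewrite /v6 /v5 /setv.
    by rewrite /= /v6 /v5 /setv /= /v4 setvE.
  apply: ev_All => j hj.
  have -> : (Vj j ==> Uj j) = ~~ Vj j || Uj j by rewrite implybE.
  apply: ev_O; last exact: U6.
  by apply: ev_N; rewrite /= /v6 /setv /= /v5 setvE.
have eacc : v6 aAcc 0 0 = b by rewrite /v6 /v5 /v4 /v3 /v2 /v1 /setv /= hb.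
pose z := [&& b, chkE n G th M L a be nsl ss cs m y
                     & chkV n G th M L a be nsl ss cs m y].
exists (updv v6 aAcc 0 0 z); split.
- rewrite /bfin hexec_cat (hexec_Lasg _ _ X1) -/v1 hexec_cat (hexec_Lasg _ _ X2) -/v2.
  rewrite hexec_cat (hexec_Lscan _ _ X3) -[setv v2 _ _ _ _]/v3.
  rewrite hexec_cat (hexec_Lscan _ _ X4) -[setv v3 _ _ _ _]/v4.
  rewrite hexec_cat (hexec_Lasg _ _ X5) -/v5 hexec_cat (hexec_Lasg _ _ X6) -/v6.
  by apply: acc_exec => //; apply: ev_A.
- by rewrite /bfin !(fed_cat, fed_Lasg, fed_Lscan).
- by move=> j hj; rewrite /updv /= /v6 setvE.
- by rewrite /updv !eqxx.
Qed.

Variable hb : nat -> seq bool.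
Hypothesis size_hb : forall i, size (hb i) = d.

Lemma bhash_exec K (v : env) r o restc resta (ab : nat -> bool) (b : bool) :
  (forall j, (j < d)%N -> v aXh 0 j = Uj j && xhat j) -> v aAcc 0 0 = b ->
  r true = flatten [seq hb i | i <- iota 0 K] ++ restc ->
  r false = mkseq ab K ++ resta ->
  exists v', [/\ hexec inp (flatten [seq bhash | _ <- iota 0 K]) (v, r, o) =
     (v', fun c => if c then restc else resta, o),
     fed inp (flatten [seq bhash | _ <- iota 0 K]) (v, r, o),
     (forall j, (j < d)%N -> v' aXh 0 j = Uj j && xhat j) &
     v' aAcc 0 0 = b && all (fun i => ab i == hpar (hb i) (fun j => Uj j && xhat j)) (iota 0 K)].
Proof.
move=> hx hb0; elim: K restc resta => [|K IH] restc resta Ec Ea.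
  exists v; rewrite /= andbT; split=> //; congr (_, _, _); apply/funext => -[] //.
move: Ec Ea; rewrite /mkseq -addn1 iotaD !map_cat !flatten_cat /= !cats0 -!catA add0n => Ec Ea.
have [v1 [E1 f1 x1 a1]] := IH _ _ Ec Ea.
set r1 : bool -> seq bool := fun c => _ in E1.
have Er1 : r1 true = hb K ++ restc by [].
have E2 := hexec_Lrcv inp v1 o aHash 0 Er1 (size_hb K).
have f2 := fed_Lrcv inp v1 o aHash 0 Er1 (size_hb K).
set v2 := setv _ _ _ _ _ in E2; set r2 : bool -> seq bool := fun c => _ in E2.
have Er2 : r2 false = [:: ab K] ++ resta by [].
have E3 := hexec_Lrcv inp v2 o aBit 0 Er2 (erefl (size [:: ab K])).
have f3 := fed_Lrcv inp v2 o aBit 0 Er2 (erefl (size [:: ab K])).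
set v3 := setv _ _ _ _ _ in E3; set r3 : bool -> seq bool := fun c => _ in E3.
exists (updv v3 aAcc 0 0 ((b && all (fun i => ab i == hpar (hb i) (fun j => Uj j && xhat j))
   (iota 0 K)) && (ab K == hpar (hb K) (fun j => Uj j && xhat j)))); split.
- rewrite hexec_cat E1 hexec_cat E2 hexec_cat E3.
  have -> : r3 = (fun c => if c then restc else resta) by apply/funext => -[].
  apply: acc_exec; first by rewrite /= /v3 /v2 /setv /= a1.
  apply: ev_Eqb; first by rewrite /= /v3 setvE.
  apply: (ev_Par (c := fun j => nth false (hb K) j && (Uj j && xhat j))) => j hj.
  apply: ev_A; first by rewrite /= /v3 /setv /= /v2 setvE.
  by rewrite /= /v3 /v2 /setv /= x1.
- by rewrite fed_cat f1 E1 fed_cat f2 E2 fed_cat f3 E3.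
- by move=> j hj; rewrite /updv /= /v3 /v2 /setv /= x1.
- by rewrite /updv !eqxx all_cat /= andbT andbA.
Qed.

Definition bob_result (msg : seq bool) : bool :=
  [&& bobok n G th M L a be nsl ss cs m y, nth false msg 0 &
      all (fun i => nth false msg i.+1 == hpar (hb i) (fun j => Uj j && xhat j)) (iota 0 k)].

Lemma bprog_exec (v : env) r rest msg : size msg = k.+1 -> r false = msg ->
  r true = rounds_stream L ++ (flatten [seq hb i | i <- iota 0 k] ++ rest) ->
  exists v' r', [/\ hexec inp bprog (v, r, [::]) = (v', r', [::]),
    fed inp bprog (v, r, [::]) & v' aAcc 0 0 = bob_result msg].
Proof.
move=> sm Ea Ec.
pose v0 := updv v aAcc 0 0 1.
have [v1 [E1 f1 i1 a1]] := @brounds_exec L v0 r [::] _ true erefl Ec.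
set r1 := setr r true _ in E1.
have [v2 [E2 f2 ff pr2]] := finround_exec r1 [::] i1.
have i2 : inv L v2.
  by apply: (inv_same i1) => g t j /andP[_ hg]; rewrite pr2 // (ltn_trans hg).
have a2 : v2 aAcc 0 0 = all chk (iota 0 L) by rewrite pr2 // a1.
have [v3 [E3 f3 x3 a3]] := bfin_exec r1 [::] i2 ff a2.
have Er3 : r1 false = [:: head false msg] ++ behead msg.
  by rewrite /r1 /setr /= Ea; case: msg sm {Ea}.
have E4 := hexec_Lrcv inp v3 [::] aBit 0 Er3 (erefl (size [:: head false msg])).
have f4 := fed_Lrcv inp v3 [::] aBit 0 Er3 (erefl (size [:: head false msg])).
set v4 := setv _ _ _ _ _ in E4; set r4 : bool -> seq bool := fun c => _ in E4.
pose b5 := [&& all chk (iota 0 L), chkE n G th M L a be nsl ss cs m y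
              & chkV n G th M L a be nsl ss cs m y] && head false msg.
pose v5 := updv v4 aAcc 0 0 b5.
have Eb : behead msg = mkseq (nth false (behead msg)) k ++ [::].
  have <- : size (behead msg) = k by rewrite size_behead sm.
  by rewrite mkseq_nth cats0.
have x5 j : (j < d)%N -> v5 aXh 0 j = Uj j && xhat j.
  by move=> hj; rewrite /v5 /updv /= /v4 /setv /= x3.
have [v6 [E6 f6 _ a6]] := @bhash_exec k v5 r4 [::] rest [::] _ b5 x5
  ltac:(by rewrite /v5 /updv !eqxx) (setrE _ _ _) Eb.
have Es : hstep inp (v4, r4, [::]) (acc (Var aBit 0 0)) = (v5, r4, [::]).
  congr (updv _ _ _ _ _, _, _); apply: ev_A => //.
exists v6; eexists; split.
- rewrite /bprog -[hexec _ (_ :: _) _]/(hexec inp _ (v0, r, [::])).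
  rewrite hexec_cat E1 hexec_cat E2 hexec_cat E3 hexec_cat E4.
  by rewrite -[hexec _ (_ :: _) _]/(hexec inp _ (hstep inp _ _)) Es; exact: E6.
- rewrite /bprog -[fed _ (_ :: _) _]/(fed inp _ (v0, r, [::])).
  rewrite fed_cat f1 E1 fed_cat f2 E2 fed_cat f3 E3 fed_cat f4 E4.
  by rewrite -[fed _ (_ :: _) _]/(fed inp _ (hstep inp _ _)) Es f6.
- rewrite a6 /bob_result /b5 /bobok nth0 -andbA; congr (_ && (_ && _)).
  by apply: eq_all => i; rewrite nth_behead.
Qed.

End Bob.
End Semantics.
End Programs.

(** * Sizes of the programs *)

Lemma wf_Add base ng D cmax nt c e1 e2 : wf base ng D cmax nt c e1 ->
  wf base ng D cmax nt c.+1 e2 -> wf base ng D cmax nt c.+1 (Add e1 e2).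
Proof. by move=> h1 h2; apply/andP. Qed.

Lemma wf_Dst base ng D cmax nt c e1 e2 : wf base ng D cmax nt c.+1 e1 ->
  wf base ng D cmax nt c.+2 e2 -> wf base ng D cmax nt c.+2 (Dst e1 e2).
Proof. by move=> h1 h2; apply/andP. Qed.

Lemma all_consE (T : Type) (p : pred T) c s : all p (c :: s) = p c && all p s.
Proof. by []. Qed.

Lemma all_flatten_map (T : Type) (p : pred T) (f : nat -> seq T) N :
  (forall t, (t < N)%N -> all p (f t)) -> all p (flatten [seq f t | t <- iota 0 N]).
Proof.
elim: N => // N IH h; rewrite -addn1 iotaD map_cat flatten_cat all_cat IH /=.
  by rewrite cats0 h.
by move=> t ht; apply: h; apply: ltnW.
Qed.

Lemma eszA e1 e2 : esz (eA e1 e2) = (esz e1 + esz e2 + 3)%N.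
Proof. by rewrite /=; lia. Qed.

Lemma eszN e : esz (eN e) = (esz e + 2)%N.
Proof. by rewrite /=; lia. Qed.

Lemma eszO e1 e2 : esz (eO e1 e2) = (esz e1 + esz e2 + 5)%N.
Proof. by rewrite /=; lia. Qed.

Lemma eszEq e1 e2 : esz (eEq e1 e2) = (esz e1 + esz e2 + 5)%N.
Proof. by rewrite /=; lia. Qed.

Ltac wf_step := match goal with
  | |- is_true (wf _ _ _ _ _ _ (eA _ _)) => apply: wf_A => //
  | |- is_true (wf _ _ _ _ _ _ (eO _ _)) => apply: wf_O => //
  | |- is_true (wf _ _ _ _ _ _ (eN _)) => apply: wf_N => //
  | |- is_true (wf _ _ _ _ _ _ (eLe _ _)) => apply: wf_Le => //
  | |- is_true (wf _ _ _ _ _ _ (eEq _ _)) => apply: wf_Eq => //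
  | |- is_true (wf _ _ _ _ _ _ (eSum _ _)) => apply: wf_Sum => //; intros
  | |- is_true (wf _ _ _ _ _ _ (ePar _ _)) => apply: wf_Par => //; intros
  | |- is_true (wf _ _ _ _ _ _ (eAll _ _)) => apply: wf_All => //; intros
  | |- is_true (wf _ _ _ _ _ _ (eHas _ _)) => apply: wf_Has => //; intros
  | |- is_true (wf _ _ _ _ _ _ (eNum _ _)) => apply: wf_Num => //; intros
  | |- is_true (wf _ _ _ _ _ _ (eMux _ _ _)) => apply: wf_Mux => //; intros
  | |- is_true (wf _ _ _ _ _ _ (Add _ _)) => apply: wf_Add => //
  | |- is_true (wf _ _ _ _ _ _ (Dst _ _)) => apply: wf_Dst => //
  end.

Section Sizes.
Variables (d n G th M L a be nsl k : nat).
Hypotheses (d0 : (0 < d)%N) (n0 : (0 < n)%N) (G0 : (0 < G)%N) (L0 : (0 < L)%N).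

Definition pbase : nat := (d + alen L a nsl)%N.
(** A sum in place of a maximum: one row length for all arrays. The loss is a constant factor in the
    addresses, of which only the logarithm is charged. *)
Definition pD : nat :=
  (n * G * d + (ncoin d a be + (n * d + (d + (nsl + (L + (ntry a + 2)))))))%N.
Definition pcmax : nat := (M + (th + (n + (ntry a + (skip a + 2)))))%N.
(** A constant suffices because each fold keeps its accumulator in a single temporary. *)
Definition pdep : nat := 20.

Local Notation wfs := (wfs pbase 29 pD pdep pcmax L.+1).

Let cmax0 : (0 < pcmax)%N. Proof. by rewrite /pcmax; lia. Qed.
Local Hint Resolve cmax0 : core.

Let okv g t j : (g < 29)%N -> (t <= L)%N -> (j < pD)%N -> okvar 29 pD L.+1 g t j.
Proof. by move=> h1 h2 h3; rewrite /okvar h1 h3 ltnS h2. Qed.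

Let okd g t j : (g < 29)%N -> (t < L)%N -> (j < d)%N -> okvar 29 pD L.+1 g t j.
Proof. by move=> h1 h2 h3; apply: okv => //; [exact: ltnW|rewrite /pD; lia]. Qed.

Let okd0 g j : (g < 29)%N -> (j <= d)%N -> okvar 29 pD L.+1 g 0 j.
Proof. by move=> h1 h3; apply: okv; rewrite // /pD; lia. Qed.

Let oks0 g j : (g < 29)%N -> (j <= nsl)%N -> okvar 29 pD L.+1 g 0 j.
Proof. by move=> h1 h3; apply: okv; rewrite // /pD; lia. Qed.

Let okt0 g j : (g < 29)%N -> (j <= ntry a)%N -> okvar 29 pD L.+1 g 0 j.
Proof. by move=> h1 h3; apply: okv; rewrite // /pD; lia. Qed.

Let okL0 g j : (g < 29)%N -> (j <= L)%N -> okvar 29 pD L.+1 g 0 j.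
Proof. by move=> h1 h3; apply: okv; rewrite // /pD; lia. Qed.

Let okX i j : (i < n * G)%N -> (j < d)%N -> okvar 29 pD L.+1 aX 0 (i * d + j).
Proof. by move=> hi hj; apply: okv => //; rewrite /pD; nia. Qed.

Let okC j : (j < ncoin d a be)%N -> okvar 29 pD L.+1 aCoin 0 j.
Proof. by move=> hj; apply: okv => //; rewrite /pD; lia. Qed.

Let okm t r : (t < L)%N -> (r < a + 8)%N -> (d + (t * (a + 8) + r) < pbase)%N.
Proof. by move=> ht hr; rewrite /pbase /alen ltn_add2l; nia. Qed.

Let okd' j : (j < d)%N -> (j < pbase)%N.
Proof. by rewrite /pbase; lia. Qed.

Let okcst c : (c <= M)%N || (c <= th)%N || (c <= n)%N || (c <= ntry a)%N || (c <= skip a)%N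
  || (c <= 2)%N -> (c <= pcmax)%N.
Proof. by rewrite /pcmax; lia. Qed.

Ltac leaf := try (rewrite /=; first
  [ by apply: okd | by apply: okd0; lia | by apply: oks0; lia | by apply: okt0; lia
  | by apply: okL0; lia | by apply: okX | by apply: okm; lia | by apply: okd'
  | by apply: okcst; rewrite ?leqnn ?orbT //; lia ]).
Ltac wfa := repeat wf_step; leaf.

Lemma wf_parok t X c : (t < L)%N -> (forall c' j, (j < d)%N -> wf pbase 29 pD pcmax L.+1 c' (X j)) ->
  (6 <= c)%N -> wf pbase 29 pD pcmax L.+1 c (eParok d a t X).
Proof.
move=> ht hX hc; apply: (@wf_le _ _ _ _ _ 6) => //; rewrite /eParok /emrd; wfa; by apply: hX.
Qed.

Lemma wf_wt t X c : (t < L)%N -> (forall c' j, (j < d)%N -> wf pbase 29 pD pcmax L.+1 c' (X j)) ->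
  (8 <= c)%N -> wf pbase 29 pD pcmax L.+1 c (eWt d th M a t X).
Proof.
move=> ht hX hc; apply: (@wf_le _ _ _ _ _ 8) => //; rewrite /eWt /emrd /eCtr; wfa; by apply: hX.
Qed.

Lemma wf_alive t X c : (t <= L)%N -> (forall c' j, (j < d)%N -> wf pbase 29 pD pcmax L.+1 c' (X j)) ->
  (12 <= c)%N -> wf pbase 29 pD pcmax L.+1 c (eAlive d th M a t X).
Proof.
move=> ht hX hc; apply: (@wf_le _ _ _ _ _ 12) => //; rewrite /eAlive; wfa.
- by apply: wf_parok => //; apply: leq_trans ht.
- by apply: wf_wt => //; apply: leq_trans ht.
Qed.

Lemma wfs_simround t : (t < L)%N -> all wfs (simround d n G th M a be t).
Proof.
move=> ht; have ht' : (t < L.+1)%N by rewrite ltnS ltnW.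
rewrite /simround !all_cat; apply/and5P; split; last (apply/and5P; split; last (apply/and4P; split)).
- by apply: wfs_Lrcv => //; rewrite /pD; lia.
- by apply: wfs_Lrcv => //; rewrite /pD; lia.
- apply: wfs_Lasg => //; first by rewrite /pD; nia.
  by move=> i hi; apply: (wf_alive (ltnW ht)) => // c' j hj; exact: okX.
- apply: wfs_Lasg => //; first by rewrite /pD; lia.
  move=> q hq; have hq1 : (q %/ d < n)%N by rewrite ltn_divLR.
  have hq2 : (q %% d < d)%N by rewrite ltn_mod.
  have lt g : (g < G)%N -> (q %/ d * G + g < n * G)%N by move=> hg; clear -hg hq1; nia.
  wfa; last by apply: okX => //; exact: lt.
  by apply: okv => //; rewrite /pD; have := lt _ H; nia.
- apply: wfs_Lasg => //; first by rewrite /pD; lia.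
  move=> j hj; wfa.
  by apply: okv => //; rewrite /pD; nia.
- apply: wfs_Lasg => //; first by rewrite /pD; lia.
  by move=> j hj; rewrite /eCtr; wfa.
- apply: wfs_Lscan => //; first by rewrite /pD; lia.
  by move=> j hj; wfa.
- apply: wfs_Lasg => //; first by rewrite /pD; lia.
  move=> i hi; wfa.
  by apply: okC; rewrite /ncoin ltn_add2l; nia.
- apply: wfs_Lasg => //; first by rewrite /pD; lia.
  by move=> i hi; rewrite /eIdx /emrd; wfa.
- apply: wfs_Lasg => //; first by rewrite /pD; lia.
  move=> j hj; wfa.
  by apply: okC; rewrite /ncoin; apply: ltn_addr; nia.
- apply: wfs_Lasg => //; first by rewrite /pD; lia.
  by move=> j hj; rewrite /emrd; wfa.
- apply: wfs_Lasg => //; first by rewrite /pD; lia.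
  by move=> j hj; wfa.
Qed.

Lemma wf_anyf c : (4 <= c)%N -> wf pbase 29 pD pcmax L.+1 c (eAnyf d L a).
Proof. by move=> hc; apply: (@wf_le _ _ _ _ _ 4) => //; rewrite /eAnyf /emrd; wfa. Qed.

Lemma wf_marked s p e c : (s < 29)%N -> (p < 29)%N ->
  (forall c', wf pbase 29 pD pcmax L.+1 c' e) ->
  (8 <= c)%N -> wf pbase 29 pD pcmax L.+1 c (eMarked a nsl s p e).
Proof.
move=> hs hp he hc; apply: (@wf_le _ _ _ _ _ 8) => //; rewrite /eMarked /eSkip; by wfa.
Qed.

Let okse j i : (j < nsl)%N -> (i < a + 1)%N ->
  (d + (L * (a + 8) + (j * (a + 1) + i)) < pbase)%N.
Proof. by move=> hj hi; rewrite /pbase /alen !ltn_add2l; nia. Qed.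

Let oksv j i : (j < nsl)%N -> (i < a + 1)%N ->
  (d + (L * (a + 8) + (nsl * (a + 1) + (j * (a + 1) + i))) < pbase)%N.
Proof. by move=> hj hi; rewrite /pbase /alen !ltn_add2l; nia. Qed.

Lemma wfs_finround : all wfs (finround d L a nsl).
Proof.
rewrite /finround !all_cat; apply/and5P; split; last (apply/andP; split).
- apply: wfs_Lasg => //; first by rewrite /pD; lia.
  by move=> j hj; rewrite /emrd; wfa.
- apply: wfs_Lscan => //; first by rewrite /pD; lia.
  by move=> j hj; wfa.
- apply: wfs_Lasg => //; first by rewrite /pD; lia.
  by move=> j hj; wfa; exact: okse.
- apply: wfs_Lscan => //; first by rewrite /pD; lia.
  by move=> j hj; rewrite /eSkip; wfa.
- apply: wfs_Lasg => //; first by rewrite /pD; lia.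
  move=> j hj; wfa; apply: wf_marked => // c'.
  by leaf.
- apply: wfs_Lasg => //; first by rewrite /pD; lia.
  by move=> j hj; wfa; apply: wf_anyf.
Qed.

Lemma wf_In c j : (j < d)%N -> wf pbase 29 pD pcmax L.+1 c (In j).
Proof. exact: okd'. Qed.

Lemma wfs_aprog : all wfs (aprog d n G th M L a be nsl k).
Proof.
rewrite /aprog all_cat; apply/andP; split; last (rewrite all_cat; apply/andP; split;
  last (rewrite all_cat; apply/andP; split; last (rewrite all_consE; apply/andP; split))).
- apply: all_flatten_map => t ht.
  exact: wfs_simround.
- exact: wfs_finround.
- apply: wfs_Lasg => //; first by rewrite /pD; lia.
  move=> t ht; rewrite /eKilled /emrd; wfa.
  + by apply: (wf_alive (ltnW ht)) => // c'; exact: wf_In.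
  + by apply: wf_parok => // c'; exact: wf_In.
  + by apply: wf_wt => // c'; exact: wf_In.
- rewrite /wfs /eOk; wfa; last exact: wf_anyf.
  by apply: wf_alive => // c'; exact: wf_In.
- apply: all_flatten_map => t _.
  rewrite /ahash all_cat; apply/andP; split; first by apply: wfs_Lrcv => //; rewrite /pD; lia.
  by rewrite all_seq1 /wfs; wfa.
Qed.

Lemma wf_star c j : (2 <= c)%N -> (j < d)%N -> wf pbase 29 pD pcmax L.+1 c (eStar j).
Proof. by move=> hc hj; apply: (@wf_le _ _ _ _ _ 2) => //; rewrite /eStar; wfa. Qed.

Lemma wf_yb c j : (2 <= c)%N -> (j < d)%N -> wf pbase 29 pD pcmax L.+1 c (eYb j).
Proof. by move=> hc hj; apply: (@wf_le _ _ _ _ _ 2) => //; rewrite /eYb; wfa. Qed.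

Lemma wf_md c t : (6 <= c)%N -> (t < L)%N -> wf pbase 29 pD pcmax L.+1 c (eMd d M t).
Proof.
move=> hc ht; apply: (@wf_le _ _ _ _ _ 6) => //; rewrite /eMd; wfa.
exact: wf_star.
Qed.

Lemma wfs_acc e : wf pbase 29 pD pcmax L.+1 pdep e -> wfs (acc e).
Proof. by move=> he; apply/andP; split; [exact: okd0|apply: wf_A => //; exact: okd0]. Qed.

Lemma wfs_bround t : (t < L)%N -> all wfs (bround d n G th M a be t).
Proof.
move=> ht; rewrite /bround all_cat wfs_simround // andTb all_cat; apply/andP; split.
  apply: wfs_Lasg => //; first by rewrite /pD; lia.
  by move=> i hi; wfa; exact: wf_star.
rewrite all_seq1; apply: wfs_acc; rewrite /eChk /emrd; wfa;
  solve [exact: wf_star|exact: wf_yb|exact: wf_md].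
Qed.

Lemma wf_range s p e c : (s < 29)%N -> (p < 29)%N ->
  (forall c', wf pbase 29 pD pcmax L.+1 c' e) ->
  (8 <= c)%N -> wf pbase 29 pD pcmax L.+1 c (eRange a nsl s p e).
Proof.
move=> hs hp he hc; apply: (@wf_le _ _ _ _ _ 8) => //; rewrite /eRange /eSkip; by wfa.
Qed.

Lemma wfs_bfin : all wfs (bfin d th L a nsl).
Proof.
rewrite /bfin !all_cat; apply/and5P; split; last (apply/and3P; split).
- apply: wfs_Lasg => //; first by rewrite /pD; lia.
  by move=> j hj; rewrite /emrd /eCtr; wfa.
- apply: wfs_Lasg => //; first by rewrite /pD; lia.
  by move=> j hj; wfa; exact: oksv.
- apply: wfs_Lscan => //; first by rewrite /pD; lia.
  by move=> j hj; rewrite /eSkip; wfa.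
- apply: wfs_Lscan => //; first by rewrite /pD; lia.
  by move=> j hj; exact: wf_star.
- apply: wfs_Lasg => //; first by rewrite /pD; lia.
  move=> j hj; wfa; first exact: wf_star.
  by apply: wf_marked => // c'; leaf.
- apply: wfs_Lasg => //; first by rewrite /pD; lia.
  by move=> j hj; wfa; solve [exact: wf_star|exact: wf_yb].
- rewrite all_seq1; apply: wfs_acc; rewrite /eChkE /eChkV; wfa.
  + by apply: wf_range => // c'; leaf.
  + exact: wf_star.
  + by apply: wf_range => // c'; leaf.
Qed.

Lemma wfs_bprog : all wfs (bprog d n G th M L a be nsl k).
Proof.
rewrite /bprog all_consE; apply/andP; split; first by rewrite /= okd0.
rewrite all_cat; apply/andP; split; last (rewrite all_cat; apply/andP; split;
  last (rewrite all_cat; apply/andP; split; last (rewrite all_cat; apply/andP; split;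
  last (rewrite all_consE; apply/andP; split)))).
- apply: all_flatten_map => t ht.
  exact: wfs_bround.
- exact: wfs_finround.
- exact: wfs_bfin.
- by apply: wfs_Lrcv => //; rewrite /pD; lia.
- by apply: wfs_acc; wfa.
- apply: all_flatten_map => t _.
  rewrite /bhash !all_cat; apply/and3P; split.
  + by apply: wfs_Lrcv => //; rewrite /pD; lia.
  + by apply: wfs_Lrcv => //; rewrite /pD; lia.
  + by rewrite all_seq1; apply: wfs_acc; wfa.
Qed.

(** Aliveness is not cached: each sample of round [t] is tested against all earlier announcements.
    Over all rounds this costs order L^2 n G d and dominates the running time. *)
Lemma esz_alive t X : (forall j, (j < d)%N -> (esz (X j) <= 2)%N) ->
  (esz (eAlive d th M a t X) <= 100 * (t * d) + 1)%N /\
  (esz (eKilled d th M a t X) <= 100 * d)%N.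
Proof.
move=> hX.
have hp t' : (esz (eParok d a t' X) <= 24 * d + 20)%N.
  rewrite /eParok /=.
  have hq g j : (j < d)%N -> (esz (eA (Var g t' j) (X j)) <= 7)%N.
    by move=> /hX /=; lia.
  have h1 := esz_Par (hq aQ0); have h2 := esz_Par (hq aQ1).
  by lia.
have hw t' : (esz (eWt d th M a t' X) <= 23 * d + 10)%N.
  rewrite /eWt /=.
  have hq j : (j < d)%N -> (esz (eA (Dst (X j) (eCtr th t' j)) (eN (Var aC t' j))) <= 18)%N.
    by move=> /hX /=; lia.
  have h1 := esz_Sum hq.
  by lia.
split; last by rewrite /eKilled eszA; have := hp t; have := hw t; lia.
have hq t' : (t' < t)%N -> (esz (eA (eParok d a t' X) (eN (eWt d th M a t' X))) <= 95 * d)%N.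
  by move=> _; have := hp t'; have := hw t'; rewrite eszA eszN; lia.
have := esz_All hq; rewrite -/(eAlive d th M a t X) => h; apply: leq_trans h _.
have : (t * (95 * d + 5) <= t * (100 * d))%N by rewrite leq_mul2l; lia.
by lia.
Qed.

Definition roundB : nat :=
  (n * G * L.+1 * d + (d * (ntry a + be.+2) + (ntry a * be.+2 + (a + 3))))%N.
Definition finB : nat := (d * (L + nsl + 1) + nsl * (a + 1))%N.

Let nd_le : (n * d <= n * G * d)%N.
Proof. by rewrite -mulnA leq_mul2l leq_pmull ?orbT. Qed.
Let d_le : (d <= n * G * d)%N.
Proof. by rewrite leq_pmull // muln_gt0 n0. Qed.
Let nG_le : (n * G <= n * G * d)%N.
Proof. by rewrite leq_pmulr. Qed.
Let RB_eq : (n * G * L.+1 * d = n * G * d * L + n * G * d)%N.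
Proof. by lia. Qed.
Let dL_le : (d * L <= n * G * d * L)%N.
Proof. by rewrite leq_mul2r d_le orbT. Qed.

Lemma psz_simround t : (t < L)%N -> (psz (simround d n G th M a be t) <= 400 * roundB)%N.
Proof.
move=> ht; rewrite /simround !psz_cat !psz_Lrcv.
have h3 := psz_Lasg aAlive 0 (n := n * G)
  (e := fun i => eAlive d th M a t (eX d i)) (B := 100 * (t * d) + 1)
  (fun i _ => (esz_alive t (X := eX d i) (fun j _ => leqnn _)).1).
have h4 := psz_Lasg aZ 0 (n := n * d)
  (e := fun q => eMux G (fun g => Var aAlive 0 (q %/ d * G + g))
     (fun g => eX d (q %/ d * G + g) (q %% d))) (B := G * (3 * 2 + 13) + 1)
  (fun q _ => ltac:(by apply: esz_Mux)).
have h5 := psz_Lasg aCnt t (n := d)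
  (e := fun j => eSum n (fun i => Var aZ 0 (i * d + j))) (B := n * (2 + 5) + 1)
  (fun j _ => ltac:(by apply: esz_Sum)).
have h6 := psz_Lasg aC t (n := d)
  (e := fun j => eA (eCtr th t j) (eLe (Add (Var aCnt t j) (Cst th)) (Cst n)))
  (B := 30) (fun j _ => isT).
have h7 := psz_Lscan aRk 0 (n := d) (e := fun j => Var aC t j) (B := 2)
  (fun j _ => isT).
have h8 := psz_Lasg aU 0 (n := ntry a)
  (e := fun i => eNum be.+2 (fun r => Var aCoin 0 (d * be.+1 + (i * be.+2 + r))))
  (B := be.+2 * (2 + 5) + 1) (fun i _ => ltac:(by apply: esz_Num)).
have h9 := psz_Lasg aIdx 0 (n := 1) (e := fun=> eIdx d a t)
  (B := (a + 3) * (2 + 5) + 1) (fun i _ => ltac:(by apply: esz_Num)).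
have h10 := psz_Lasg aQ 0 (n := d)
  (e := fun j => eAll be.+1 (fun i => Var aCoin 0 (j * be.+1 + i)))
  (B := be.+1 * (2 + 5) + 1) (fun i _ => ltac:(by apply: esz_All)).
have h11 := psz_Lasg aQ0 t (n := d)
  (e := fun j => eA (emrd d a t 0) (Var aQ 0 j)) (B := 30) (fun j _ => isT).
have h12 := psz_Lasg aQ1 t (n := d)
  (e := fun j => eA (Var aC t j) (eHas (ntry a)
     (fun i => eA (eEq (Var aIdx 0 0) (Cst i)) (eEq (Var aU 0 i) (Var aRk 0 j)))))
  (B := ntry a * (30 + 5) + 6)
  (fun j _ => ltac:(have := esz_Has (n := ntry a) (B := 30)
     (f := fun i => eA (eEq (Var aIdx 0 0) (Cst i)) (eEq (Var aU 0 i) (Var aRk 0 j)))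
     (fun i _ => isT); rewrite /=; lia)).
have ht2 : (n * G * (t * d) <= n * G * d * L)%N.
  by rewrite -[X in (_ <= X)%N]mulnA leq_mul2l [(d * L)%N]mulnC leq_mul2r (ltnW ht) !orbT.
rewrite /ncoin /roundB RB_eq; clear -h3 h4 h5 h6 h7 h8 h9 h10 h11 h12 ht2 nd_le d_le nG_le; lia.
Qed.

Lemma psz_finround : (psz (finround d L a nsl) <= 100 * finB)%N.
Proof.
rewrite /finround !psz_cat.
have h1 := psz_Lasg aCf 0 (n := d)
  (e := fun j => eHas L (fun t => eA (emrd d a t 4) (Var aC t j))) (B := L * (7 + 5) + 1)
  (fun j _ => ltac:(by apply: esz_Has)).
have h2 := psz_Lscan aRkf 0 (n := d) (e := fun j => Var aCf 0 j) (B := 2)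
  (fun j _ => isT).
have h3 := psz_Lasg aSE 0 (n := nsl) (e := fun j => eNum (a + 1)
     (fun i => In (d + (L * (a + 8) + (j * (a + 1) + i))))) (B := (a + 1) * (2 + 5) + 1)
  (fun j _ => ltac:(by apply: esz_Num)).
have h4 := psz_Lscan aPE 0 (n := nsl)
  (e := fun j => Add (Var aSE 0 j) (eN (eSkip a aSE j))) (B := 20) (fun j _ => isT).
have h5 := psz_Lasg aE 0 (n := d)
  (e := fun j => eA (Var aCf 0 j) (eMarked a nsl aSE aPE (Var aRkf 0 j)))
  (B := nsl * (30 + 5) + 6)
  (fun j _ => ltac:(have := esz_Has (n := nsl) (B := 30) (f := fun j' =>
      eA (eN (eSkip a aSE j')) (eEq (Add (Var aPE 0 j') (Var aSE 0 j')) (Var aRkf 0 j)))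
     (fun i _ => isT); rewrite /eMarked /=; lia)).
have h6 := psz_Lasg aUj 0 (n := d)
  (e := fun j => eA (eAnyf d L a) (eN (eA (Var aCf 0 j) (eN (Var aE 0 j)))))
  (B := L * (2 + 5) + 20)
  (fun j _ => ltac:(have := esz_Has (n := L) (B := 2) (f := fun t => emrd d a t 4)
     (fun i _ => isT); rewrite /eAnyf /=; lia)).
by rewrite /finB; clear -h1 h2 h3 h4 h5 h6 d0; lia.
Qed.

Definition progB : nat := (L * roundB + (finB + k * d))%N.

Lemma psz_aprog : (psz (aprog d n G th M L a be nsl k) <= 60 * 60 * progB)%N.
Proof.
rewrite /aprog psz_cat [psz (finround _ _ _ _ ++ _)]psz_cat [psz (Lasg _ _ _ _ ++ _)]psz_cat.
have h1 := psz_flatten (n := L) (f := simround d n G th M a be) (B := 400 * roundB)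
  (fun t ht => psz_simround ht).
have h2 := psz_finround.
have e_in t := esz_alive t (X := In) (fun j _ => leqnn 2).
have hk t : (t < L)%N -> (esz (eEq (emrd d a t 4)
    (eA (eAlive d th M a t In) (eKilled d th M a t In))) <= 100 * (L * d) + 1 + 100 * d + 20)%N.
  move=> ht; have [q1 q2] := e_in t.
  have q3 : (t * d <= L * d)%N by rewrite leq_mul2r (ltnW ht) orbT.
  by rewrite eszEq eszA [esz (emrd _ _ _ _)]/=; clear -q1 q2 q3; lia.
have h3 := psz_Lasg aKil 0 hk.
have h4 : (psz (SSnd (eOk d th M L a) :: flatten [seq ahash d | _ <- iota 0 k]) <=
    200 * (L * d) + 30 * L + 30 + k * (40 * d + 40))%N.
  rewrite -cat1s psz_cat.
  have q1 := psz_flatten (n := k) (f := fun=> ahash d) (B := 40 * d + 40)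
    (fun t _ => ltac:(rewrite /ahash psz_cat psz_Lrcv /psz /=;
      have := esz_Par (n := d) (B := 12)
       (f := fun j => eA (Var aHash 0 j) (eA (Var aUj 0 j) (In j))) (fun i _ => isT); lia)).
  have q2 := esz_All (n := L) (f := fun t => Var aKil 0 t) (B := 2) (fun j _ => isT).
  have q3 := esz_Has (n := L) (B := 2) (f := fun t => emrd d a t 4) (fun i _ => isT).
  have [q4 _] := e_in L.
  have -> : psz [:: SSnd (eOk d th M L a)] = (esz (eOk d th M L a)).+1 by rewrite /psz /= addn0.
  rewrite -/(eAnyf d L a) in q3; rewrite /eOk eszA eszO; clear -q1 q2 q3 q4; lia.
have h5 : (L * (L * d) <= L * (n * G * d * L))%N by rewrite leq_mul2l (mulnC L d) dL_le orbT.
have h6 : (L * d <= L * (n * G * d))%N by rewrite leq_mul2l d_le orbT.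
have h7 : (L <= L * d)%N by rewrite leq_pmulr.
have h8 : (k <= k * d)%N by rewrite leq_pmulr.
have h9 : (L * (n * G * d * L) + L * (n * G * d) <= L * roundB)%N.
  by rewrite -mulnDr leq_mul2l /roundB RB_eq leq_addr orbT.
by rewrite /progB; clear -h1 h2 h3 h4 h5 h6 h7 h8 h9 L0; lia.
Qed.

Lemma psz_bprog : (psz (bprog d n G th M L a be nsl k) <= 60 * 60 * progB)%N.
Proof.
have d_roundB : (d * ntry a + d <= roundB)%N.
  rewrite /roundB RB_eq; clear -d_le; lia.
have nt_roundB : (ntry a <= roundB)%N by rewrite /roundB; clear; lia.
have md t : (esz (eMd d M t) <= 22 * d + 10)%N.
  rewrite /eMd /=; have := esz_Sum (n := d) (B := 15)
    (f := fun j => eA (Var aC t j) (eN (eStar j))) (fun i _ => isT); lia.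
have hb t : (t < L)%N -> (psz (bround d n G th M a be t) <= 1400 * roundB)%N.
  move=> ht; rewrite /bround psz_cat [psz (Lasg _ _ _ _ ++ _)]psz_cat; have q1 := psz_simround ht.
  have q2 := psz_Lasg aVal 0 (n := ntry a) (e := fun i => eHas d (fun j =>
     eA (Var aC t j) (eA (eN (eStar j)) (eEq (Var aU 0 i) (Var aRk 0 j)))))
     (B := d * (30 + 5) + 1) (fun i _ => ltac:(by apply: esz_Has)).
  have q3 : (psz [:: acc (eChk d M a t)] <= 200 * d + 200 + ntry a * 60)%N.
    have p1 := esz_Has (n := d) (B := 20) (f := fun j => eA (eStar j) (Var aQ 0 j)) (fun i _ => isT).
    have p2 := md t.
    have p3 := esz_All (n := ntry a) (B := 50) (f := fun i =>
             eA (eO (eN (eEq (Var aIdx 0 0) (Cst i))) (Var aVal 0 i))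
                (eO (eN (Var aVal 0 i)) (eLe (Var aIdx 0 0) (Cst i)))) (fun i _ => isT).
    have p4 := esz_Par (n := d) (B := 20) (f := fun j => eA (Var aQ0 t j) (eYb j)) (fun i _ => isT).
    have p5 := esz_Par (n := d) (B := 20) (f := fun j => eA (Var aQ1 t j) (eYb j)) (fun i _ => isT).
    have -> : psz [:: acc (eChk d M a t)] = (esz (eChk d M a t) + 7)%N by rewrite /psz /= ; clear; lia.
    rewrite /eChk; move: (eMd d M t) p2 => emd p2.
    rewrite !(eszA, eszEq, eszN, eszO) ![esz (emrd _ _ _ _)]/= ![esz (Var _ _ _)]/= ![esz (Cst _)]/=.
    by clear -p1 p2 p3 p4 p5; lia.
  clear -q1 q2 q3 d_roundB nt_roundB d0; lia.
rewrite /bprog -cat1s psz_cat [psz (flatten _ ++ _)]psz_cat [psz (finround _ _ _ _ ++ _)]psz_cat.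
rewrite [psz (bfin _ _ _ _ _ ++ _)]psz_cat [psz (Lrcv _ _ _ _ ++ _)]psz_cat.
have h1 := psz_flatten (n := L) hb.
have h2 := psz_finround.
have h3 : (psz (bfin d th L a nsl) <= 400 * finB)%N.
  rewrite /bfin !psz_cat.
  have q1 := psz_Lasg acf 0 (n := d)
    (e := fun j => eHas L (fun t => eA (emrd d a t 4) (eCtr th t j))) (B := L * (20 + 5) + 1)
    (fun j _ => ltac:(by apply: esz_Has)).
  have q2 := psz_Lasg aSV 0 (n := nsl) (e := fun j => eNum (a + 1)
     (fun i => In (d + (L * (a + 8) + (nsl * (a + 1) + (j * (a + 1) + i))))))
     (B := (a + 1) * (2 + 5) + 1) (fun j _ => ltac:(by apply: esz_Num)).
  have q3 := psz_Lscan aPV 0 (n := nsl)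
    (e := fun j => Add (Var aSV 0 j) (eN (eSkip a aSV j))) (B := 20) (fun j _ => isT).
  have q4 := psz_Lscan aRks 0 (n := d) (e := fun j => eStar j) (B := 20)
    (fun j _ => isT).
  have q5 := psz_Lasg aV 0 (n := d)
    (e := fun j => eA (eStar j) (eMarked a nsl aSV aPV (Var aRks 0 j)))
    (B := nsl * (30 + 5) + 20)
    (fun j _ => ltac:(have := esz_Has (n := nsl) (B := 30) (f := fun j' =>
      eA (eN (eSkip a aSV j')) (eEq (Add (Var aPV 0 j') (Var aSV 0 j')) (Var aRks 0 j)))
     (fun i _ => isT); rewrite /eMarked /=; lia)).
  have q6 := psz_Lasg aXh 0 (n := d) (e := fun j => eA (Var aUj 0 j)
     (eO (eA (eStar j) (Dst (Var acf 0 j) (Var aV 0 j))) (eA (eN (eStar j)) (eYb j))))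
     (B := 60) (fun j _ => isT).
  have q7 : (psz [:: acc (eA (eChkE d a nsl) (eChkV d a nsl))] <=
      80 * nsl + 80 * d + 80)%N.
    have p1 := esz_All (n := nsl) (B := 30) (f := fun j =>
      eO (eSkip a aSE j) (eLe (Add (Add (Var aPE 0 j) (Var aSE 0 j)) (Cst 1)) (Var aRkf 0 d)))
      (fun i _ => isT).
    have p2 := esz_All (n := nsl) (B := 30) (f := fun j =>
      eO (eSkip a aSV j) (eLe (Add (Add (Var aPV 0 j) (Var aSV 0 j)) (Cst 1)) (Var aRks 0 d)))
      (fun i _ => isT).
    have p3 := esz_All (n := d) (B := 30) (f := fun j =>
      eEq (Var aE 0 j) (eA (Var aCf 0 j) (eN (eStar j)))) (fun i _ => isT).
    have p4 := esz_All (n := d) (B := 30) (f := fun j => eO (eN (Var aV 0 j)) (Var aUj 0 j))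
      (fun i _ => isT).
    have -> : forall e, psz [:: acc e] = (esz e + 7)%N by move=> e; rewrite /psz /=; clear; lia.
    by rewrite /eChkE /eChkV !eszA /eRange; clear -p1 p2 p3 p4; lia.
  by rewrite /finB; clear -q1 q2 q3 q4 q5 q6 q7 d0; lia.
have h4 : (psz (acc (Var aBit 0 0) :: flatten [seq bhash d | _ <- iota 0 k]) <=
    30 + k * (40 * d + 40))%N.
  rewrite -cat1s psz_cat.
  have q1 := psz_flatten (n := k) (f := fun=> bhash d) (B := 40 * d + 40)
    (fun t _ => ltac:(rewrite /bhash !psz_cat !psz_Lrcv /psz /=;
      have := esz_Par (n := d) (B := 12)
       (f := fun j => eA (Var aHash 0 j) (Var aXh 0 j)) (fun i _ => isT); lia)).
  by rewrite /psz /= -/(psz _); clear -q1; lia.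
have h5 : (psz [:: SAsg aAcc 0 0 (Cst 1)] <= 10)%N by [].
have h8 : (k <= k * d)%N by rewrite leq_pmulr.
have h10 : (d <= finB)%N by rewrite /finB; clear -L0; nia.
rewrite psz_Lrcv.
by rewrite /progB; clear -h1 h2 h3 h4 h5 h8 h10 d0; lia.
Qed.

End Sizes.

(** * Carol, and executions *)

(** Unrolled loops. The invariant carries the number of the copy because the tape counters advance
    from copy to copy. *)
Lemma seg_flatten (O T : Type) (code : seq (instr O)) special F
    (B : nat -> seq (instr O)) N nr (I : nat -> memory -> T -> Prop) (o : nat -> seq bool) p :
  at_code code p (flatten [seq B i | i <- iota 0 N]) ->
  (forall i p f t, (i < N)%N -> at_code code p (B i) -> I i f t ->
    exists f' t', seg code special F (size (B i)) p f nr t f' nr t' (o i) /\ I i.+1 f' t') ->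
  forall f t, I 0%N f t ->
  exists f' t', seg code special F (size (flatten [seq B i | i <- iota 0 N])) p f nr t f' nr t'
    (flatten [seq o i | i <- iota 0 N]) /\ I N f' t'.
Proof.
elim: N => [|N IH] hat hB f t I0; first by exists f, t; split=> //; exact: seg0.
move: hat; rewrite -addn1 iotaD !map_cat !flatten_cat /= !cats0 add0n size_cat.
move=> /at_cat[at1 at2].
have [f1 [t1 [s1 I1]]] := IH at1 (fun i p f t hi => hB i p f t (ltnW hi)) f t I0.
have [f2 [t2 [s2 I2]]] := hB N _ _ _ (ltnSn N) at2 I1.
by exists f2, t2; rewrite addn1; split=> //; exact: seg_add s1 s2.
Qed.

Section Carol.
Context {d : nat}.
Variables (n G L a be k : nat).

(** Register 0 holds the address 3, registers 1 and 2 the bounds 0 and [d]. The success flag lands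
    in cell 3 and the sample in the cells from 4 on. *)
Definition csample : seq (instr carol_instr) :=
  Special (Sample false 0 1 2) :: [seq Send (4 + j) | j <- iota 0 d].
Definition ccoin b : seq (instr carol_instr) := [:: Special (Coin b 3); Send 3].

Definition cround : seq (instr carol_instr) :=
  flatten [seq csample | _ <- iota 0 (n * G)] ++
  flatten [seq ccoin false | _ <- iota 0 (ncoin d a be)].

Definition cbody : seq (instr carol_instr) :=
  [:: Const 0 3; Const 2 d] ++ (flatten [seq cround | _ <- iota 0 L] ++
  flatten [seq flatten [seq ccoin true | _ <- iota 0 d] | _ <- iota 0 k]).

Definition ccode := cbody ++ [:: Halt 0].

Lemma size_flatten_nseq (T : Type) (l : seq T) N :
  size (flatten [seq l | _ <- iota 0 N]) = (N * size l)%N.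
Proof. exact: size_flatten_const. Qed.

Lemma size_cround : size cround = (n * G * d.+1 + ncoin d a be * 2)%N.
Proof. by rewrite size_cat !size_flatten_nseq /= size_map size_iota. Qed.

Lemma size_ccode :
  size ccode = (L * (n * G * d.+1 + ncoin d a be * 2) + k * (d * 2) + 3)%N.
Proof.
rewrite /ccode /cbody !size_cat [size (Const _ _ :: _)]/= size_flatten_nseq size_cround.
by rewrite !size_flatten_nseq /=; lia.
Qed.

Lemma ccode_norecv : ~~ has (@is_recv _) ccode.
Proof.
rewrite -all_predC /ccode /cbody !all_cat /= !andbT.
apply/andP; split; apply: all_flatten_map => t _; last exact: all_flatten_map.
rewrite all_cat; apply/andP; split; apply: all_flatten_map => // i _ /=.
by rewrite all_map; apply/allP.
Qed.

Lemma ccode_cheap : all (cheap carol_instr_size (d + 4)) ccode.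
Proof.
have h3 : (bits 3 <= bits (d + 4))%N by apply: bits_le; lia.
have h2 : (bits 2 <= bits (d + 4))%N by apply: bits_le; lia.
have h1 : (bits 1 <= bits (d + 4))%N by apply: bits_le; lia.
have h0 : (bits 0 <= bits (d + 4))%N by apply: bits_le; lia.
have hd : (bits d <= bits (d + 4))%N by apply: bits_le; lia.
have hc b : all (cheap carol_instr_size (d + 4)) (ccoin b).
  by rewrite /= /cheap /= andbT; apply/andP; split; lia.
rewrite /ccode /cbody !all_cat; apply/andP; split; last by rewrite /= /cheap /=; lia.
apply/and3P; split.
- by rewrite /= /cheap /= andbT; apply/andP; split; lia.
- apply: all_flatten_map => t _; rewrite all_cat; apply/andP; split.
    apply: all_flatten_map => i _; rewrite all_consE; apply/andP; split.
      by rewrite /cheap /=; lia.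
    rewrite all_map; apply/allP => j; rewrite mem_iota => hj; rewrite /= /cheap /=.
    have : (bits (4 + j) <= bits (d + 4))%N by apply: bits_le; lia.
    by lia.
  by apply: all_flatten_map.
- by apply: all_flatten_map => t _; apply: all_flatten_map.
Qed.

Section Tapes.
Variable N : nat.
Variables (rpub rpri : tape d N).

(** No restriction and a vacuous condition on the size: the answers are plain samples of [lam]. *)
Definition full_query : query d := ([ffun=> true], inord 0, inord d).

Definition pub_sample i : cube d := odflt (zero_cube d) (sample rpub i full_query).

Definition pub_samples_of t : seq (cube d) := mkseq (fun i => pub_sample (t * (n * G) + i)) (n * G).
Definition pub_coins_of t : seq bool :=
  mkseq (fun i => coin rpub (t * ncoin d a be + i)) (ncoin d a be).
Definition pri_coins_of i : seq bool := mkseq (fun j => coin rpri (i * d + j)) d.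

End Tapes.

Variables (R : realType) (P : protocol R d).
Variables (rpub rpri : tape d (tape_len P)).
Local Notation smp := (pub_sample rpub).
Local Notation pub_samples := (pub_samples_of rpub).
Local Notation pub_coins := (pub_coins_of rpub).
Local Notation pri_coins := (pri_coins_of rpri).

Hypothesis sampled : forall i, (i < L * (n * G))%N -> sample rpub i full_query = Some (smp i).

Local Notation code := ccode.
Local Notation special := (carol_special (P := P) rpub rpri).
Local Notation F := (fun _ : bool => [::] : seq bool).

Definition cdata i j p : carol_data d :=
  CarolData [ffun=> true] (fun b => if b then p else j) (fun b => if b then 0%N else i) 0.

Definition cinv (f : memory) := [/\ f 0%N = 3%N, f 1%N = 0%N & f 2%N = d].

Lemma send_seg p f nr t i c : at_code code p [seq Send (4 + j) | j <- iota i c] ->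
  seg code special F c p f nr t f nr t [seq f (4 + j)%N != 0%N | j <- iota i c].
Proof.
elim: c p i => [|c IH] p i hat; first exact: seg0.
rewrite -add1n -[map _ (iota i _)]cat1s; apply: seg_add.
  move=> q o0; have := hat 0%N isT; rewrite addn0 /= => E.
  by rewrite /tick /step /= E /= !addn1.
by apply: IH => j hj; rewrite addn1 addSnnS hat.
Qed.

Lemma csample_seg p f nr i j q : at_code code p csample -> cinv f ->
  (i < L * (n * G))%N ->
  exists f', seg code special F (size csample) p f nr (cdata i j q) f' nr
     (cdata i.+1 j q) (sample_bits (smp i)) /\ cinv f'.
Proof.
move=> hat [f0 f1 f2] hi.
pose f' := write_vec (upd f 3 1) 4 (smp i).
have Ef : cinv f' by rewrite /f' /write_vec /upd /=.
exists f'; split=> //; have -> : size csample = (1 + d)%N by rewrite /= size_map size_iota.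
rewrite -[sample_bits _]cat0s; apply: seg_add.
  move=> c o0; have := hat 0%N isT; rewrite addn0 /= => E.
  rewrite /tick /step /= E /= f1 f2 min0n.
  have -> : minn d d.+1 = d by apply/minn_idPl.
  rewrite -/full_query sampled // f0 /= cats0 !addn1.
  have -> : CarolData [ffun=> true] (fun b => if b then q else j)
      (incr (fun b => if b then 0%N else i) false) 0 = cdata i.+1 j q.
    by congr CarolData; apply/funext => -[]; rewrite /incr /= ?addn0 ?addn1.
  by [].
have -> : sample_bits (smp i) = [seq f' (4 + j)%N != 0%N | j <- iota 0 d].
  rewrite /sample_bits /mkseq; apply/eq_in_map => c; rewrite mem_iota add0n => /andP[_ hc].
  rewrite /f' /write_vec leq_addr addKn /bit; case: insubP => [u _ _|]; last by rewrite hc.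
  by case: (smp i u).
by apply: send_seg => c hc; rewrite addn1 addSnnS hat.
Qed.

Lemma ccoin_seg b p f nr i j q : at_code code p (ccoin b) -> cinv f ->
  exists f', seg code special F 2 p f nr (cdata i j q) f' nr
     (if b then cdata i j q.+1 else cdata i j.+1 q)
     [:: if b then coin rpri q else coin rpub j] /\ cinv f'.
Proof.
move=> hat [f0 f1 f2].
pose c := if b then coin rpri q else coin rpub j.
exists (upd f 3 c); split=> // s o0.
have := hat 0%N isT; rewrite addn0 /= => E0; have := hat 1%N isT; rewrite addn1 /= => E1.
rewrite /tick /step /= E0 /= E1 /= cats0 addn2 addn2 /upd eqxx.
have -> : CarolData [ffun=> true] (incr (fun b => if b then q else j) b)
    (fun b => if b then 0%N else i) 0 = if b then cdata i j q.+1 else cdata i j.+1 q.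
  by rewrite /cdata; case: (b); congr CarolData; apply/funext => -[];
    rewrite /incr /= ?addn0 ?addn1.
by rewrite /c; case: (b) => /=; case: (coin _ _).
Qed.

Lemma flatten_mkseq1 (T : Type) (f : nat -> T) c :
  flatten [seq [:: f i] | i <- iota 0 c] = mkseq f c.
Proof. by rewrite /mkseq; elim: (iota 0 c) => //= i s ->. Qed.

Lemma ccode_seg f nr : cinv (upd (upd f 0 3) 2 d) ->
  exists f', seg code special F (size cbody) 0 f nr (cdata 0 0 0) f' nr
    (cdata (L * (n * G)) (L * ncoin d a be) (k * d))
    (rounds_stream pub_samples pub_coins L ++ (flatten [seq pri_coins i | i <- iota 0 k] ++ [::])).
Proof.
move=> ci; have hat : at_code code 0 cbody.
  by move=> i hi; rewrite add0n /code /ccode nth_cat hi.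
rewrite /cbody in hat *; have [at1 at2] := at_cat hat.
have [at3 at4] := at_cat at2.
have s1 : seg code special F 2 0 f nr (cdata 0 0 0) (upd (upd f 0 3) 2 d) nr (cdata 0 0 0) [::].
  by apply: (seg_simples _ _ _ _ at1).
pose A := (L * (n * G))%N; pose B := (L * ncoin d a be)%N.
pose I1 t (f : memory) (u : carol_data d) :=
  cinv f /\ u = cdata (t * (n * G)) (t * ncoin d a be) 0.
have H1 t p f3 u : (t < L)%N -> at_code code p cround -> I1 t f3 u ->
    exists f' t', seg code special F (size cround) p f3 nr u f' nr t'
      (round_stream (pub_samples t) (pub_coins t)) /\ I1 t.+1 f' t'.
  move=> ht hat3 [ci3 ->]; have [hat4 hat5] := at_cat hat3.
  pose I4 i (f : memory) (u : carol_data d) :=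
    cinv f /\ u = cdata (t * (n * G) + i) (t * ncoin d a be) 0.
  have H4 i p' f6 u' : (i < n * G)%N -> at_code code p' csample -> I4 i f6 u' ->
      exists f' t', seg code special F (size csample) p' f6 nr u' f' nr t'
        (sample_bits (smp (t * (n * G) + i))) /\ I4 i.+1 f' t'.
    move=> hi hat6 [ci6 ->].
    have lt : (t * (n * G) + i < L * (n * G))%N.
      apply: leq_trans (_ : t.+1 * (n * G) <= _)%N; first by rewrite mulSn addnC ltn_add2r.
      by rewrite leq_mul2r ht orbT.
    have [f7 [s7 ci7]] := csample_seg nr (t * ncoin d a be) 0 hat6 ci6 lt.
    by exists f7; eexists; split; [exact: s7|split=> //; rewrite addnS].
  have I40 : I4 0%N f3 (cdata (t * (n * G)) (t * ncoin d a be) 0).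
    by split=> //; rewrite addn0.
  have [f4 [t4 [s4 [ci4 E4]]]] := seg_flatten hat4 H4 I40; subst t4.
  pose I5 i (f : memory) (u : carol_data d) :=
    cinv f /\ u = cdata (t * (n * G) + n * G) (t * ncoin d a be + i) 0.
  have H5 i p' f6 u' : (i < ncoin d a be)%N -> at_code code p' (ccoin false) -> I5 i f6 u' ->
      exists f' t', seg code special F (size (ccoin false)) p' f6 nr u' f' nr t'
        [:: coin rpub (t * ncoin d a be + i)] /\ I5 i.+1 f' t'.
    move=> hi hat6 [ci6 ->]; have [f7 [s7 ci7]] :=
      ccoin_seg nr (t * (n * G) + n * G) (t * ncoin d a be + i) 0 hat6 ci6.
    by exists f7; eexists; split; [exact: s7|split=> //; rewrite addnS].
  have I50 : I5 0%N f4 (cdata (t * (n * G) + n * G) (t * ncoin d a be) 0).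
    by split=> //; rewrite addn0.
  have [f5 [t5 [s5 [ci5 E5]]]] := seg_flatten hat5 H5 I50; subst t5.
  exists f5; eexists; split; last first.
    by split; [exact: ci5|reflexivity].
  rewrite size_cat /round_stream; apply: seg_add.
    by rewrite /pub_samples_of /mkseq -map_comp; exact: s4.
  rewrite flatten_mkseq1 in s5; rewrite mulSn [(n * G + _)%N]addnC mulSn [(ncoin d a be + _)%N]addnC.
  exact: s5.
have I10 : I1 0%N (upd (upd f 0 3) 2 d) (cdata 0 0 0) by [].
have [f1 [t1 [s2 [ci1 E1]]]] := seg_flatten at3 H1 I10; subst t1.
pose I3 t (f : memory) (u : carol_data d) := cinv f /\ u = cdata A B (t * d).
have H3 t p f3 u : (t < k)%N -> at_code code p (flatten [seq ccoin true | _ <- iota 0 d]) ->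
    I3 t f3 u -> exists f' t', seg code special F
      (size (flatten [seq ccoin true | _ <- iota 0 d])) p f3 nr u f' nr t'
      (pri_coins t) /\ I3 t.+1 f' t'.
  move=> ht hat3 [ci3 ->].
  pose I4 i (f : memory) (u : carol_data d) := cinv f /\ u = cdata A B (t * d + i).
  have H4 i p' f6 u' : (i < d)%N -> at_code code p' (ccoin true) -> I4 i f6 u' ->
      exists f' t', seg code special F (size (ccoin true)) p' f6 nr u' f' nr t'
        [:: coin rpri (t * d + i)] /\ I4 i.+1 f' t'.
    move=> hi hat5 [ci5 ->]; have [f6' [s6 ci6]] := ccoin_seg nr A B (t * d + i) hat5 ci5.
    by exists f6'; eexists; split; [exact: s6|split=> //; rewrite addnS].
  have I40 : I4 0%N f3 (cdata A B (t * d)) by split=> //; rewrite addn0.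
  have [f4 [t4 [s4 [ci4 E4]]]] := seg_flatten hat3 H4 I40; subst t4.
  exists f4, (cdata A B (t.+1 * d)); split; last by split.
  by rewrite flatten_mkseq1 in s4; rewrite mulSn addnC.
have I30 : I3 0%N f1 (cdata A B 0) by [].
have [f2 [t2 [s3 [ci2 E2]]]] := seg_flatten at4 H3 I30; subst t2.
exists f2; rewrite cats0 size_cat size_cat; apply: seg_add0 s1 _.
exact: seg_add s2 s3.
Qed.

End Carol.

Lemma run_compiled (base ng D dep cmax nt : nat) (O : Type) (code : seq (instr O))
    special (F : bool -> seq bool) (input : seq nat) p h v' r' out :
  code = compile base ng D nt O p ++ [:: Halt h] ->
  all (wfs base ng D dep cmax nt) p -> size input = base ->
  hexec (nth 0%N input) p (fun _ _ _ => 0%N, F, [::]) = (v', r', out) ->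
  fed (nth 0%N input) p (fun _ _ _ => 0%N, F, [::]) ->
  exists s, [/\ iter (size code) (tick code special F) (start input tt, [::]) = (s, out),
    steps s = size code,
    represents base ng D nt (nth 0%N input) (Defs.mem s) v' &
    result s = Some (Defs.mem s h != 0%N)].
Proof.
move=> Ec wp si Ex fd.
have hat : at_code code 0 (compile base ng D nt O p).
  by move=> i hi; rewrite add0n Ec nth_cat hi.
have rep : represents base ng D nt (nth 0%N input) (nth 0%N input) (fun _ _ _ => 0%N).
  split=> // g t j _; rewrite nth_default // si /reg -addnA leq_addr //.
have ch : channels F (fun=> 0%N) F by move=> b; rewrite drop0.
have [f' [nr' [o' [sg rep' _]]]] := compile_correct special tt hat wp rep ch fd.
rewrite Ex /= => Eo; rewrite Ex /= in rep'.
have Eh : nth (Halt 0) code (size (compile base ng D nt O p)) = Halt h.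
  by rewrite Ec nth_cat ltnn subnn.
set s1 := size (compile base ng D nt O p) in sg Eh.
have sc : size code = s1.+1 by rewrite Ec size_cat addn1.
exists (Machine s1 f' nr' s1.+1 (Some (f' h != 0%N)) tt); split=> //.
have := sg 0%N [::]; rewrite !add0n => sg1.
rewrite sc iterS [iter _ _ _]sg1 /tick /step /= Eh /= cats0.
by rewrite -Eo.
Qed.

(** * Assembling the protocol *)

Section Assembly.
Variables (R : realType) (d n G th M L a be nsl k : nat).
Hypotheses (d0 : (0 < d)%N) (n0 : (0 < n)%N) (G0 : (0 < G)%N) (L0 : (0 < L)%N).

Local Notation base := (pbase d L a nsl).
Local Notation D := (pD d n G L a be nsl).
Local Notation cmax := (pcmax n th M a).

Definition acode : seq (instr alice_instr) :=
  compile base 29 D L.+1 alice_instr (aprog d n G th M L a be nsl k) ++ [:: Halt 0].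
Definition bcode : seq (instr void) :=
  compile base 29 D L.+1 void (bprog d n G th M L a be nsl k) ++
  [:: Halt (reg base 29 D aAcc 0 0)].

(** A common length of both tapes that covers samples, public coins and private coins. *)
Definition tlen : nat := (L * (n * G) + (L * ncoin d a be + k * d))%N.

Local Notation ss r := (pub_samples_of n G r).
Local Notation cs r := (pub_coins_of a be r).
Local Notation good m x y r := (good n G th M L a be nsl (ss r) (cs r) m y x).

(** By [good_uniq] at most one advice is good. If none is, the default is harmless: by [bad_accept]
    no advice is then likely to be accepted. *)
Definition special_of (x : cube d) (y : pattern d) (r : tape d tlen) :
    (alen L a nsl).-tuple bool :=
  odflt [tuple of nseq (alen L a nsl) false]
    [pick m : (alen L a nsl).-tuple bool | good m x y r].

Definition prot : protocol R d :=
  @Protocol R d acode bcode (@ccode d n G L a be k) tlen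
    (size (@ccode d n G L a be k) + size acode + size bcode)
    (alen L a nsl) (fun _ x y r => special_of x y r).

Lemma bcode_nosend : ~~ has (@is_send _) bcode.
Proof.
rewrite has_cat negb_or andbT; apply: compile_nosend.
have hA g t c e : all (fun c => if c is SSnd _ then false else true) (Lasg g t c e).
  by rewrite all_map; apply/allP.
have hS g t c e : all (fun c => if c is SSnd _ then false else true) (Lscan g t c e).
  by rewrite /= all_map; apply/allP.
have hR b g t c : all (fun c => if c is SSnd _ then false else true) (Lrcv b g t c).
  by rewrite all_map; apply/allP.
rewrite /bprog all_consE andTb all_cat; apply/andP; split.
  apply: all_flatten_map => t _; rewrite /bround /simround.
  by rewrite !(all_cat, hA, hS, hR).
rewrite all_cat; apply/andP; split; first by rewrite /finround !(all_cat, hA, hS, hR).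
rewrite all_cat; apply/andP; split; first by rewrite /bfin !(all_cat, hA, hS, hR).
rewrite all_cat; apply/andP; split; first exact: hR.
rewrite all_consE andTb; apply: all_flatten_map => t _.
by rewrite /bhash !(all_cat, hA, hS, hR).
Qed.

Variables (lam : {ffun cube d -> R}) (x : cube d) (y : pattern d).
Variable m : (alen L a nsl).-tuple bool.
Variables (rpub rpri : tape d tlen).
Hypothesis sampled : forall i, (i < L * (n * G))%N ->
  sample rpub i full_query = Some (pub_sample rpub i).

Local Notation hb := (pri_coins_of rpri).

Definition amsg : seq bool := alice_msg n G th M L a be nsl k m (ss rpub) (cs rpub) x hb.
Definition bres : bool := bob_result n G th M L a be nsl k m (ss rpub) (cs rpub) y hb amsg.
Definition cstream : seq bool := rounds_stream (ss rpub) (cs rpub) L ++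
  (flatten [seq hb i | i <- iota 0 k] ++ [::]).

Lemma nth_advice (s : seq nat) i : size s = d ->
  nth 0%N (s ++ [seq nat_of_bool b | b <- m]) (d + i) = nth false m i.
Proof.
move=> hs; rewrite nth_cat hs ltnNge leq_addr /= addKn.
have [h|h] := ltnP i (size m); first by rewrite (nth_map false).
by rewrite !nth_default ?size_map.
Qed.

Lemma exec_final : exists sa sb sc,
  [/\ final (P := prot) lam x y m rpub rpri = Config sa sb sc amsg [::] cstream,
      isSome (result sa) /\ steps sa = size acode,
      result sb = Some bres /\ steps sb = size bcode,
      isSome (result sc) /\ steps sc = size (@ccode d n G L a be k) &
      aux sc = cdata (L * (n * G)) (L * ncoin d a be) (k * d)].
Proof.
have size_ss t : size (ss rpub t) = (n * G)%N by rewrite size_mkseq.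
have size_cs t : size (cs rpub t) = ncoin d a be by rewrite size_mkseq.
have size_hb i : size (hb i) = d by rewrite size_mkseq.
have [fc segc] := @ccode_seg d n G L a be k R prot rpub rpri sampled (nth 0%N [::]) (fun=> 0%N)
  ltac:(by split).
set sc0 := size (@cbody d n G L a be k) in segc.
pose sc := Machine sc0 fc (fun=> 0%N) sc0.+1 (Some (fc 0%N != 0%N))
  (cdata (d := d) (L * (n * G)) (L * ncoin d a be) (k * d)).
have szc : size (@ccode d n G L a be k) = sc0.+1 by rewrite size_cat addn1.
have Ecoords : CarolData [ffun=> true] (fun=> 0%N) (fun=> 0%N) 0 = @cdata d 0 0 0.
  by congr CarolData; apply/funext => -[].
have EC : carol_run (P := prot) rpub rpri (size (@ccode d n G L a be k)) = (sc, cstream).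
  have h1 := segc 0%N [::]; rewrite !add0n in h1.
  rewrite szc /carol_run iterS /start Ecoords [iter _ _ _]h1 /tick /step.
  rewrite [result _]/= [line _]/=.
  have -> : nth (Halt 0) (carol prot) sc0 = Halt 0 by rewrite nth_cat ltnn subnn.
  by rewrite /= cats0.
have sx : size [seq nat_of_bool (x i) | i <- enum 'I_d] = d by rewrite size_map size_enum_ord.
have inpx j : (j < d)%N -> nth 0%N (alice_input (P := prot) x m) j = bit x j.
  move=> hj; rewrite nth_cat sx hj (nth_map (Ordinal hj)) ?size_enum_ord //.
  by rewrite -[j in LHS]/(val (Ordinal hj)) nth_ord_enum -bitE.
have inpxm i : nth 0%N (alice_input (P := prot) x m) (d + i) = nth false m i by exact: nth_advice.
have sy : size [seq (if y i is Some b then nat_of_bool b else 2%N) | i <- enum 'I_d] = d.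
  by rewrite size_map size_enum_ord.
have inpy j : (j < d)%N ->
    nth 0%N (bob_input (P := prot) y m) j = if star y j then 2%N else yb y j.
  move=> hj; rewrite nth_cat sy hj (nth_map (Ordinal hj)) ?size_enum_ord //.
  rewrite -[j in LHS]/(val (Ordinal hj)) nth_ord_enum.
  rewrite -[j in RHS]/(val (Ordinal hj)) starE -[j in yb _ j]/(val (Ordinal hj)) ybE.
  by case: (y (Ordinal hj)) => [[]|].
have inpym i : nth 0%N (bob_input (P := prot) y m) (d + i) = nth false m i by exact: nth_advice.
pose FA b := if b then cstream else [::].
have [va [Ea fa]] := @aprog_exec d n G th M L a be nsl k _ m (ss rpub) (cs rpub) inpxm
  size_ss size_cs x inpx hb size_hb (fun _ _ _ => 0%N) FA [::] erefl.
have sia : size (alice_input (P := prot) x m) = base by rewrite size_cat sx size_map size_tuple.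
have [sa [EA stA _ resA]] := run_compiled (alice_special lam) (erefl acode)
  (wfs_aprog th M a be nsl k d0 n0 G0 L0) sia Ea fa.
pose FB b := if b then cstream else amsg.
have sam : size amsg = k.+1 by rewrite /amsg /= size_mkseq.
have [vb [rb [Eb fb accb]]] := @bprog_exec d n G th M L a be nsl k _ m (ss rpub) (cs rpub) inpym
  size_ss size_cs y inpy hb size_hb (fun _ _ _ => 0%N) FB [::] amsg sam erefl erefl.
have sib : size (bob_input (P := prot) y m) = base by rewrite size_cat sy size_map size_tuple.
have [sb [EB stB repB resB]] := run_compiled bob_special (erefl bcode)
  (wfs_bprog th M a be nsl k d0 n0 G0 L0) sib Eb fb.
have EA' : alice_run (P := prot) lam x m cstream (size acode) = (sa, amsg) by [].
have EB' : bob_run (P := prot) y m cstream amsg (size bcode) = (sb, [::]) by [].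
have fin := @network_final R d prot lam x y m rpub rpri (size (@ccode d n G L a be k))
  (size acode) (size bcode).
have [pC1 pC2 pC3] : [/\ isSome (result sc), steps sc = size (@ccode d n G L a be k)
    & aux sc = cdata (L * (n * G)) (L * ncoin d a be) (k * d)] by rewrite szc.
clearbody sc; move: fin; cbv zeta; rewrite EC -[(sc, cstream).2]/(cstream) -[(sc, cstream).1]/(sc).
rewrite EA' -[(sa, amsg).2]/(amsg) -[(sa, amsg).1]/(sa) EB' -[(sb, [::]).1]/(sb) => fin.
have resb : result sb = Some bres.
  rewrite resB; have [_ ->] := repB; last by rewrite /okvar /pD /=; lia.
  by rewrite accb /bres; case: bob_result.
exists sa, sb, sc; split=> //; last by rewrite resA.
apply: fin => //; [exact: ccode_norecv|exact: bcode_nosend|by rewrite resA|by rewrite resb].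
Qed.

End Assembly.

(** * Expectations *)

Section Expectation.
Variable R : realType.

(** Expectations as positive, normalised linear functionals. Conditioning, iteration and images of
    laws stay within this class, so no product space has to be built. *)
Record isE (T : Type) (E : (T -> R) -> R) : Prop := IsE {
  E_add : forall f g, E (fun x => f x + g x) = E f + E g;
  E_scale : forall c f, E (fun x => c * f x) = c * E f;
  E_mono : forall f g, (forall x, f x <= g x) -> E f <= E g;
  E_one : E (fun=> 1) = 1 }.

Section Basics.
Variables (T : Type) (E : (T -> R) -> R).
Hypothesis hE : isE E.

Lemma E_ext f g : f =1 g -> E f = E g.
Proof. by move=> h; congr E; apply/funext. Qed.

Lemma E_const c : E (fun=> c) = c.
Proof. by have := E_scale hE c (fun=> 1); rewrite (E_one hE) !mulr1. Qed.

Lemma E_ge0 f : (forall x, 0 <= f x) -> 0 <= E f.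
Proof. by move=> h; rewrite -(E_const 0); apply: E_mono. Qed.

Lemma E_sub f g : E (fun x => f x - g x) = E f - E g.
Proof.
rewrite -[- E g]mulN1r -(E_scale hE) -(E_add hE); apply: E_ext => x.
by rewrite mulN1r.
Qed.

Lemma E_sum (I : Type) (r : seq I) (P : pred I) (f : I -> T -> R) :
  E (fun x => \sum_(i <- r | P i) f i x) = \sum_(i <- r | P i) E (f i).
Proof.
elim: r => [|i r IH].
  rewrite big_nil -[RHS](E_const 0); apply: E_ext => x; by rewrite big_nil.
rewrite big_cons -IH; case: ifP => hi.
  by rewrite -(E_add hE); apply: E_ext => x; rewrite big_cons hi.
by apply: E_ext => x; rewrite big_cons hi.
Qed.

End Basics.

Fixpoint itE (T : Type) (E : (T -> R) -> R) n (F : seq T -> R) : R :=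
  if n is n'.+1 then E (fun x => itE E n' (fun s => F (x :: s))) else F [::].

Section Iteration.
Variables (T : Type) (E : (T -> R) -> R).
Hypothesis hE : isE E.

Lemma itE_ext_size n F F' : (forall s, size s = n -> F s = F' s) -> itE E n F = itE E n F'.
Proof.
elim: n F F' => [|n IH] F F' h /=; first exact: h.
by apply: E_ext => x; apply: IH => s hs; apply: h; rewrite /= hs.
Qed.

Lemma itE_le n F F' : (forall s, size s = n -> F s <= F' s) -> itE E n F <= itE E n F'.
Proof.
elim: n F F' => [|n IH] F F' h /=; first exact: h.
by apply: (E_mono hE) => x; apply: IH => s hs; apply: h; rewrite /= hs.
Qed.

Lemma isE_it n : isE (itE E n).
Proof.
elim: n => [|n IH]; first by split=> //=.
split=> [f g|c f|f g h|] /=.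
- by rewrite -(E_add hE); apply: E_ext => x; rewrite (E_add IH).
- by rewrite -(E_scale hE); apply: E_ext => x; rewrite (E_scale IH).
- by apply: (E_mono hE) => x; apply: (E_mono IH).
- by rewrite -[RHS](E_one hE); apply: E_ext => x; rewrite (E_one IH).
Qed.

Lemma itE_add n m F :
  itE E (n + m) F = itE E n (fun s => itE E m (fun s' => F (s ++ s'))).
Proof. by elim: n F => //= n IH F; apply: E_ext => x; rewrite IH. Qed.

Lemma itE_take n m F : itE E (n + m) (fun s => F (take n s)) = itE E n F.
Proof.
rewrite itE_add; apply: itE_ext_size => s hs.
rewrite -[RHS](E_const (isE_it m)); apply: E_ext => s'.
by rewrite -hs take_size_cat.
Qed.

Lemma itE_sum_seq n (f : T -> R) :
  itE E n (fun s => \sum_(x <- s) f x) = n%:R * E f.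
Proof.
elim: n => [|n IH] /=; first by rewrite big_nil mul0r.
rewrite -natr1 mulrDl mul1r addrC.
rewrite (_ : E _ = E (fun x => f x + n%:R * E f)).
  by rewrite (E_add hE) (E_const hE).
apply: E_ext => x; rewrite -IH -[f x in RHS](E_const (isE_it n)) -(E_add (isE_it n)).
by apply: E_ext => s; rewrite big_cons.
Qed.

Definition ind (b : bool) : R := b%:R.

(** The union bound over the [h]-subsets of the draws, obtained by Pascal's rule when conditioning
    on the first draw. *)
Lemma itE_count_ge n h (P : pred T) :
  itE E n (fun s => ind (h <= count P s)%N) <= 'C(n, h)%:R * E (fun x => ind (P x)) ^+ h.
Proof.
set p := E _; have p0 : 0 <= p by apply: E_ge0 => // x; rewrite /ind ler0n.
elim: n h => [|n IH] [|h] /=.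
- by rewrite bin0 expr0 mulr1.
- by rewrite bin0n mul0r.
- rewrite bin0 expr0 mulr1; apply: le_trans (_ : E (fun=> 1) <= 1); last by rewrite (E_const hE).
  apply: (E_mono hE) => x; rewrite -[leRHS](E_const (isE_it n)).
  by apply: (E_mono (isE_it n)) => s; rewrite /ind lern1 leq_b1.
- rewrite binS natrD mulrDl.
  apply: le_trans (_ : E (fun x => 'C(n, h.+1)%:R * p ^+ h.+1 +
     ('C(n, h)%:R * p ^+ h) * ind (P x)) <= _); last first.
    by rewrite (E_add hE) (E_const hE) (E_scale hE) -/p -mulrA -exprSr.
  apply: (E_mono hE) => x; case: (P x) => /=; rewrite /ind ?mulr1 ?mulr0.
    apply: le_trans (_ : 'C(n, h)%:R * p ^+ h <= _); last first.
      by rewrite lerDr mulr_ge0 // exprn_ge0.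
    apply: le_trans (IH h); apply: (E_mono (isE_it n)) => s; rewrite /ind ler_nat.
    by case: leqP => // h1; case: leqP => //; lia.
  by rewrite addr0; apply: le_trans (IH h.+1); apply: (E_mono (isE_it n)).
Qed.

(* Exchangeability: of [n.+1] draws, at most [th] can be the odd one out. *)
Lemma itE_count_lt n th (P : pred T) :
  n.+1%:R * E (fun x => ind (P x)) * itE E n (fun s => ind (count P s < th)%N) <= th%:R.
Proof.
set p := E _; have p0 : 0 <= p by apply: E_ge0 => // x; rewrite /ind ler0n.
have p1 : p <= 1.
  by rewrite -[leRHS](E_const hE); apply: (E_mono hE) => x; rewrite /ind lern1 leq_b1.
have a0 m t : 0 <= itE E m (fun s => ind (count P s < t)%N) <= 1.
  rewrite (E_ge0 (isE_it m)) /=; last by move=> s; rewrite /ind ler0n.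
  rewrite -[leRHS](E_const (isE_it m)); apply: (E_mono (isE_it m)) => s.
  by rewrite /ind lern1 leq_b1.
elim: n th => [|n IH] [|th].
- by rewrite /= /ind ltn0 !mulr0.
- rewrite /= /ind mul1r mulr1; apply: le_trans p1 _; by rewrite ler1n.
- rewrite (_ : itE _ _ _ = 0) ?mulr0 //; rewrite -[RHS](E_const (isE_it n.+1)).
  by apply: E_ext => s; rewrite /ind ltn0.
set an := itE E n (fun s => ind (count P s < th)%N).
set an1 := itE E n (fun s => ind (count P s < th.+1)%N).
(* Condition on the first draw. The induction hypotheses weighted by p and 1 - p contribute th + 1 -
   p, and the missing p pays for passing from n + 1 to n + 2. *)
have rec : itE E n.+1 (fun s => ind (count P s < th.+1)%N) = p * an + (1 - p) * an1.
  rewrite /=; transitivity (E (fun x => (an - an1) * ind (P x) + an1)).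
    apply: E_ext => x; case: (P x) => /=; rewrite /ind ?mulr1 ?mulr0 ?add0r //.
    by rewrite subrK; apply: E_ext => s; rewrite add1n ltnS.
  by rewrite (E_add hE) (E_const hE) (E_scale hE) -/p; ring.
have h1 := IH th; have h2 := IH th.+1; rewrite -/an in h1; rewrite -/an1 in h2.
have /andP[_ h3] := a0 n.+1 th.+1; have /andP[q0 _] := a0 n.+1 th.+1.
rewrite rec in h3 q0 *; rewrite -natr1 in h1 h2; rewrite -[n.+2%:R]natr1 -natr1.
rewrite -[th.+1%:R]natr1 in h2 *.
have e1 : p * ((n%:R + 1) * p * an) <= p * th%:R by exact: ler_wpM2l.
have e2 : (1 - p) * ((n%:R + 1) * p * an1) <= (1 - p) * (th%:R + 1).
  by apply: ler_wpM2l => //; rewrite subr_ge0.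
have e3 : p * (p * an + (1 - p) * an1) <= p * 1 by exact: ler_wpM2l.
rewrite (_ : (n%:R + 1 + 1) * p * (p * an + (1 - p) * an1) =
  p * ((n%:R + 1) * p * an) + (1 - p) * ((n%:R + 1) * p * an1) +
  p * (p * an + (1 - p) * an1)); last by ring.
by apply: le_trans (lerD (lerD e1 e2) e3) _; rewrite le_eqVlt; apply/orP; left; apply/eqP; ring.
Qed.

Fixpoint first_pay (v : pred T) (b : T -> R) (s : seq T) : R :=
  if s is x :: s' then if v x then b x else first_pay v b s' else 0.

(** The first draw satisfying [v] has the law conditioned on [v], with mean pay at least [c]; none
    occurs with probability (1 - pv)^n. *)
Lemma first_pay_ge n (v : pred T) (b : T -> R) c :
  let pv := E (fun x => ind (v x)) in
  c * pv <= E (fun x => ind (v x) * b x) ->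
  c * (1 - (1 - pv) ^+ n) <= itE E n (first_pay v b).
Proof.
move=> pv hc.
have pv1 : pv <= 1.
  by rewrite -[leRHS](E_const hE); apply: (E_mono hE) => x; rewrite /ind lern1 leq_b1.
elim: n => [|n IH] /=; first by rewrite expr0 subrr mulr0.
rewrite (_ : E _ = E (fun x => ind (v x) * b x) + (1 - pv) * itE E n (first_pay v b)).
  have h : (1 - pv) * (c * (1 - (1 - pv) ^+ n)) <= (1 - pv) * itE E n (first_pay v b).
    by apply: ler_wpM2l => //; rewrite subr_ge0.
  rewrite (_ : c * (1 - (1 - pv) ^+ n.+1) = c * pv + (1 - pv) * (c * (1 - (1 - pv) ^+ n))).
    exact: lerD.
  by rewrite exprS; ring.
rewrite (_ : (1 - pv) * itE E n (first_pay v b) =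
   E (fun x => itE E n (first_pay v b) * (1 - ind (v x)))); last first.
  by rewrite (E_scale hE) (E_sub hE) (E_const hE) mulrC.
rewrite -(E_add hE); apply: E_ext => x; case: (v x); rewrite /ind.
  by rewrite mul1r subrr mulr0 addr0 (E_const (isE_it n)).
by rewrite mul0r add0r subr0 mulr1.
Qed.

End Iteration.

(** Bernoulli's inequality for [(1 + q) ^+ n] together with (1 - q)(1 + q) <= 1. *)
Lemma exp_1B_le (q : R) n : 0 <= q -> q <= 1 -> (1 - q) ^+ n <= (1 + n%:R * q)^-1.
Proof.
move=> q0 q1.
have h n' : 1 + n'%:R * q <= (1 + q) ^+ n'.
  elim: n' => [|n' IH]; first by rewrite mul0r addr0 expr0.
  rewrite exprS; have := ler_wpM2l (_ : 0 <= 1 + q) IH; rewrite addr_ge0 // => /(_ isT).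
  apply: le_trans; rewrite -natr1.
  have : 0 <= n'%:R * q * q by rewrite !mulr_ge0.
  by rewrite mulrDl mulrDr !mulrDl !mul1r; nra.
have d0 : 0 < 1 + n%:R * q by rewrite ltr_pwDl // mulr_ge0.
rewrite -[leRHS]mul1r ler_pdivlMr //.
apply: le_trans (_ : (1 - q) ^+ n * (1 + q) ^+ n <= _).
  by apply: ler_wpM2l (h n); rewrite exprn_ge0 // subr_ge0.
by rewrite -exprMn exprn_ile1 //; nra.
Qed.

Lemma exp_1B_ge (q : R) n : 0 <= q -> q <= 1 -> 1 - n%:R * q <= (1 - q) ^+ n.
Proof.
move=> q0 q1; elim: n => [|n IH]; first by rewrite mul0r subr0 expr0.
rewrite exprS; have := ler_wpM2l (_ : 0 <= 1 - q) IH; rewrite subr_ge0 => /(_ q1).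
apply: le_trans; rewrite -natr1.
have : 0 <= n%:R * q * q by rewrite !mulr_ge0.
by nra.
Qed.

Definition Ef (T : finType) (P : T -> R) (F : T -> R) : R := \sum_x P x * F x.

Lemma isE_Ef (T : finType) (P : T -> R) : (forall x, 0 <= P x) -> \sum_x P x = 1 -> isE (Ef P).
Proof.
move=> P0 P1; split=> [f g|c f|f g h|]; rewrite /Ef.
- by rewrite -big_split; apply: eq_bigr => x _; rewrite mulrDr.
- by rewrite mulr_sumr; apply: eq_bigr => x _; rewrite mulrCA.
- by apply: ler_sum => x _; exact: ler_wpM2l.
- by under eq_bigr do rewrite mulr1.
Qed.

Definition Ec : (bool -> R) -> R := Ef (fun _ : bool => 2^-1).

Lemma EcE F : Ec F = (F true + F false) / 2.
Proof. by rewrite /Ec /Ef big_bool /=; lra. Qed.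

Lemma isE_Ec : isE Ec.
Proof. by apply: isE_Ef => [x|]; rewrite ?big_bool /=; lra. Qed.

Definition commE (T U : Type) (E : (T -> R) -> R) (E' : (U -> R) -> R) :=
  forall F : T -> U -> R, E (fun x => E' (F x)) = E' (fun u => E (F^~ u)).

Lemma commE_Ef (T : finType) (P : T -> R) (U : Type) (E' : (U -> R) -> R) :
  isE E' -> commE (Ef P) E'.
Proof.
move=> hE' F; rewrite /Ef (E_sum hE'); apply: eq_bigr => x _.
by rewrite (E_scale hE').
Qed.

Lemma commE_it (T U : Type) (E : (T -> R) -> R) (E' : (U -> R) -> R) n :
  commE E E' -> commE (itE E n) E'.
Proof.
move=> h; elim: n => [|n IH] F //=; rewrite -h; apply: E_ext => x.
exact: (IH (fun s => F (x :: s))).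
Qed.

Lemma itE_map (T U : Type) (E : (T -> R) -> R) (E' : (U -> R) -> R) (f : T -> U) n F :
  (forall H, E (fun x => H (f x)) = E' H) ->
  itE E n (fun s => F (map f s)) = itE E' n F.
Proof.
move=> h; elim: n F => //= n IH F; rewrite -h; apply: E_ext => x.
exact: (IH (fun s => F (f x :: s))).
Qed.

Lemma sum_tuple_itE (T : finType) (P : T -> R) n (F : seq T -> R) :
  \sum_(t : n.-tuple T) (\prod_(x <- t) P x) * F t = itE (Ef P) n F.
Proof.
elim: n F => [|n IH] F.
  rewrite (bigD1 [tuple]) //= big_nil mul1r big1 ?addr0 // => t.
  by case/eqP; apply: val_inj; case: t => -[].
rewrite /= /Ef.
rewrite (reindex (fun p : T * n.-tuple T => [tuple of p.1 :: p.2])) /=; last first.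
  exists (fun t => (thead t, [tuple of behead t])) => [[x t] _|t _] /=.
    by congr (_, _); apply: val_inj.
  by rewrite -tuple_eta.
rewrite -(pair_bigA _ (fun x (t : n.-tuple T) => (\prod_(z <- x :: t) P z) * F (x :: t))) /=.
apply: eq_bigr => x _; rewrite -IH mulr_sumr; apply: eq_bigr => t _.
by rewrite big_cons mulrA.
Qed.

Lemma sum_ffun_itE (T : finType) (P : T -> R) n (F : seq T -> R) :
  \sum_(f : {ffun 'I_n -> T}) (\prod_i P (f i)) * F (codom f) = itE (Ef P) n F.
Proof.
rewrite -sum_tuple_itE (reindex (fun t : n.-tuple T => [ffun i => tnth t i])) /=; last first.
  exists (fun f => [tuple f i | i < n]) => [t _|f _].
    by apply: eq_from_tnth => i; rewrite tnth_mktuple ffunE.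
  by apply/ffunP => i; rewrite ffunE tnth_mktuple.
apply: eq_bigr => t _; congr (_ * _).
  by rewrite big_tuple; apply: eq_bigr => i _; rewrite ffunE.
congr F; rewrite codomE -[RHS](map_tnth_enum t); apply: eq_map => i.
by rewrite ffunE.
Qed.

End Expectation.

(** * The law of the tapes *)

Section Tape.
Variables (R : realType) (d N : nat) (lam : {ffun cube d -> R}).
Hypothesis dist : is_dist lam.

Let lam0 x : 0 <= lam x. Proof. by have [] := dist. Qed.
Let lam1 : \sum_x lam x = 1. Proof. by have [] := dist. Qed.

Lemma restriction_ge0 S z : 0 <= restriction lam S z.
Proof. exact: sumr_ge0. Qed.

Lemma sample_law_ge0 q o : 0 <= sample_law lam q o.
Proof.
case: o => [z|] /=; last exact: ler0n.
case: ifP => // _; apply: divr_ge0; first exact: restriction_ge0.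
by apply: sumr_ge0 => z' _; exact: restriction_ge0.
Qed.

Lemma sum_option (U : finType) (f : option U -> R) :
  \sum_o f o = f None + \sum_z f (Some z).
Proof.
rewrite (bigD1 None) //=; congr (_ + _).
rewrite (reindex_omap Some id) /=; first by apply: eq_bigl => z; rewrite eqxx.
by case.
Qed.

Lemma sum_sample_law q : \sum_o sample_law lam q o = 1.
Proof.
rewrite sum_option /=.
rewrite -big_mkcond /= -mulr_suml -/(range_mass lam q).
by case: eqVneq => [->|nz]; rewrite ?invr0 ?mulr0 ?addr0 // add0r divff.
Qed.

Lemma full_in_range z : in_range (@full_query d) z.
Proof.
rewrite /in_range /= !inordK // leq0n /= /weight.
by apply: leq_trans (max_card _) _; rewrite card_ord.
Qed.

Lemma full_restriction z : restriction lam (@full_query d).1.1 z = lam z.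
Proof.
rewrite /restriction (eq_bigl (pred1 z)) ?big_pred1_eq // => x /=.
by congr (_ == z); apply/ffunP => i; rewrite !ffunE andbT.
Qed.

Lemma full_mass : range_mass lam (@full_query d) = 1.
Proof.
rewrite /range_mass (eq_bigl xpredT) => [|z]; last exact: full_in_range.
by rewrite -lam1; apply: eq_bigr => z _; exact: full_restriction.
Qed.

Lemma full_sample_law o : sample_law lam (@full_query d) o = if o is Some z then lam z else 0.
Proof.
case: o => [z|] /=; last by rewrite full_mass oner_eq0.
by rewrite full_in_range full_mass divr1 full_restriction.
Qed.

Definition tape_samples (r : tape d N) : seq (cube d) := mkseq (pub_sample r) N.
Definition tape_coins (r : tape d N) : seq bool := mkseq (coin r) N.

Lemma mkseq_insub (T : Type) (x0 : T) (f : 'I_N -> T) (g : nat -> T) :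
  (forall i : 'I_N, g i = f i) -> mkseq g N = codom f.
Proof.
move=> h; rewrite codomE /mkseq -val_enum_ord -map_comp; apply: eq_map => i.
exact: h.
Qed.

(** For fixed answers to [q], the answers to every other query are summed out, each contributing
    total mass 1. *)
Lemma marginal (F : {ffun 'I_N -> option (cube d)} -> R) q :
  \sum_(r : {ffun 'I_N * query d -> option (cube d)})
    (\prod_kq sample_law lam kq.2 (r kq)) * F [ffun k => r (k, q)] =
  \sum_(s : {ffun 'I_N -> option (cube d)}) (\prod_k sample_law lam q (s k)) * F s.
Proof.
rewrite (partition_big (fun r : {ffun 'I_N * query d -> option (cube d)} =>
  [ffun k => r (k, q)] : {ffun 'I_N -> option (cube d)}) xpredT) //=.
apply: eq_bigr => s _.
rewrite (eq_bigr (fun r : {ffun 'I_N * query d -> option (cube d)} =>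
  (\prod_kq sample_law lam kq.2 (r kq)) * F s)); last by move=> r /eqP ->.
rewrite -mulr_suml; congr (_ * F s).
pose Q (kq : 'I_N * query d) := [pred o : option (cube d) | (kq.2 == q) ==> (o == s kq.1)].
rewrite (eq_bigl (fun r => r \in family Q)); last first.
  move=> r; apply/eqP/familyP => [E [k q'] /=|h].
    by rewrite !inE -E ffunE; apply/implyP => /eqP /= ->.
  apply/ffunP => k; rewrite ffunE; have := h (k, q); rewrite !inE /= eqxx => /eqP ->.
  by [].
rewrite -(bigA_distr_big_dep _ (fun kq o => sample_law lam kq.2 o)).
rewrite -(pair_bigA _ (fun k q' => \sum_(o | Q (k, q') o) sample_law lam q' o)) /=.
apply: eq_bigr => k _; rewrite (bigD1 q) //= [X in _ * X]big1 ?mulr1.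
  by rewrite (eq_bigl (pred1 (s k))) ?big_pred1_eq // => o /=; rewrite eqxx.
move=> q' /negbTE nq; rewrite (eq_bigl xpredT) ?sum_sample_law // => o /=.
by rewrite nq.
Qed.

(** Only the full query is ever asked, so a tape amounts to independent coins and independent
    samples of [lam]. *)
Lemma tape_expect (F : seq bool -> seq (cube d) -> R) :
  \sum_(r : tape d N) tape_law lam r * F (tape_coins r) (tape_samples r) =
  itE (@Ec R) N (fun cs => itE (Ef lam) N (fun ss => F cs ss)).
Proof.
pose smps (r2 : {ffun 'I_N * query d -> option (cube d)}) : seq (cube d) :=
  [seq odflt (zero_cube d) o | o <- codom [ffun k => r2 (k, @full_query d)]].
have Es (r : tape d N) : tape_samples r = smps r.2.
  rewrite /smps /tape_samples.
  rewrite (mkseq_insub (zero_cube d) (f := fun k => odflt (zero_cube d) (r.2 (k, @full_query d)))).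
    by rewrite !codomE -map_comp; apply: eq_map => k /=; rewrite ffunE.
  by move=> i; rewrite /pub_sample /sample valK.
have Eco (r : tape d N) : tape_coins r = codom r.1.
  by apply: (mkseq_insub false) => i; rewrite /coin valK.
transitivity (\sum_(r1 : {ffun 'I_N -> bool})
    \sum_(r2 : {ffun 'I_N * query d -> option (cube d)})
    (\prod_(i < N) 2^-1) * (\prod_kq sample_law lam kq.2 (r2 kq)) * F (codom r1) (smps r2)).
  rewrite pair_bigA /=; apply: eq_bigr => r _.
  by rewrite Es Eco /tape_law prodr_const card_ord exprVn.
rewrite -(sum_ffun_itE (fun _ : bool => 2^-1)); apply: eq_bigr => r1 _.
transitivity ((\prod_(i < N) 2^-1) * \sum_(r2 : {ffun 'I_N * query d -> option (cube d)})
    (\prod_kq sample_law lam kq.2 (r2 kq)) * F (codom r1) (smps r2) : R).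
  by rewrite mulr_sumr; apply: eq_bigr => r2 _; rewrite mulrA.
congr (_ * _).
rewrite (marginal (fun s => F (codom r1) [seq odflt (zero_cube d) o | o <- codom s])).
rewrite (sum_ffun_itE (sample_law lam (@full_query d)) N
  (fun s => F (codom r1) [seq odflt (zero_cube d) o | o <- s])).
rewrite (@itE_map _ _ _ _ (Ef lam)) // => H; rewrite /Ef sum_option !full_sample_law mul0r add0r.
by apply: eq_bigr => z _; rewrite full_sample_law.
Qed.

Lemma tape_law_ge0 (r : tape d N) : 0 <= tape_law lam r.
Proof.
apply: mulr_ge0; first by rewrite invr_ge0 exprn_ge0.
by apply: prodr_ge0 => kq _; exact: sample_law_ge0.
Qed.

(** The answer [None] to the full query has probability 0, so it cannot occur on a tape of positive
    probability. *)
Lemma tape_law_sampled (r : tape d N) i : 0 < tape_law lam r -> (i < N)%N ->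
  sample r i (@full_query d) = Some (pub_sample r i).
Proof.
move=> pos hi; rewrite /pub_sample /sample (insubT (fun k => (k < N)%N) hi) /=.
rewrite -[eqtype.Sub i hi]/(Ordinal hi); case E: (r.2 _) => [//|]; move: pos; rewrite /tape_law.
by rewrite (bigD1 (Ordinal hi, @full_query d)) //= E full_sample_law mul0r mulr0 ltxx.
Qed.

End Tape.

(** * One round *)

Section Coins.
Variable R : realType.
Local Notation Ec := (@Ec R).
Local Notation hEc := (@isE_Ec R).

Lemma itE_blocks (T U : Type) (E : (T -> R) -> R) (f : seq T -> U) N m (F : seq U -> R) :
  isE E ->
  itE E (N * m) (fun s => F (mkseq (fun i => f (take m (drop (i * m) s))) N)) =
  itE (fun g => itE E m (fun s => g (f s))) N F.
Proof.
move=> hE; elim: N F => [|N IH] F //=.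
rewrite mulSn itE_add; apply: itE_ext_size => s hs; rewrite -IH.
apply: E_ext => s'; congr F; rewrite /mkseq /= mul0n drop0 -hs take_size_cat //.
congr (_ :: _); rewrite -[iota 1 N]/(iota (1 + 0) N) iotaDl -map_comp; apply: eq_map => i /=.
by rewrite mulnDl mul1n addnC -drop_drop drop_size_cat.
Qed.

Lemma itE_all m (f : bool -> R) :
  itE Ec m (fun c => f (all id c)) = 2^-1 ^+ m * f true + (1 - 2^-1 ^+ m) * f false.
Proof.
elim: m => [|m IH] /=; first by rewrite expr0; ring.
rewrite EcE /= IH (E_const (isE_it hEc m)) exprS; lra.
Qed.

Lemma itE_num m (F : nat -> R) :
  itE Ec m (fun c => F (num c)) = (\sum_(u < 2 ^ m) F u) / 2 ^+ m.
Proof.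
elim: m F => [|m IH] F /=; first by rewrite expr0 divr1 expn0 big_ord1.
rewrite EcE (IH (fun u => F (true + u.*2)%N)) (IH (fun u => F (false + u.*2)%N)).
rewrite -mulrDl -big_split /= exprS.
have -> : \sum_(u < 2 ^ m.+1) F u = \sum_(u < 2 ^ m) (F (1 + u.*2)%N + F (0 + u.*2)%N).
  rewrite -(big_mkord xpredT F) -(big_mkord xpredT (fun u => F (1 + u.*2)%N + F (0 + u.*2)%N)).
  rewrite expnS mul2n.
  elim: (2 ^ m)%N => [|q IHq]; first by rewrite !big_geq.
  by rewrite doubleS !big_nat_recr //= IHq -addrA; congr (_ + _); exact: addrC.
by rewrite invfM [2^-1 * _]mulrC mulrA.
Qed.

Variables (d be : nat).

Lemma Qset_cat0 c1 c2 : size c1 = be.+1 -> Qset be (c1 ++ c2) 0 = all id c1.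
Proof.
move=> hs; rewrite /Qset -[c1 in RHS](mkseq_nth false) hs all_map.
by apply: eq_in_all => i; rewrite mem_iota => /andP[_ hi] /=; rewrite nth_cat hs hi.
Qed.

Lemma Qset_catS c1 c2 j : size c1 = be.+1 -> Qset be (c1 ++ c2) j.+1 = Qset be c2 j.
Proof.
move=> hs; apply: eq_all => i; rewrite mulSn -addnA nth_cat hs.
by rewrite ltnNge leq_addr /= addKn.
Qed.

(** Memberships in Q use disjoint blocks of coins and are therefore independent. *)
Lemma Qset_prod (g : nat -> bool -> R) :
  itE Ec (d * be.+1) (fun c => \prod_(j < d) g j (Qset be c j)) =
  \prod_(j < d) (2^-1 ^+ be.+1 * g j true + (1 - 2^-1 ^+ be.+1) * g j false).
Proof.
elim: d g => [|d' IH] g; first by rewrite mul0n /= !big_ord0.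
rewrite mulSn itE_add big_ord_recl.
rewrite -(IH (fun j => g j.+1)) -itE_all mulrC -(E_scale (isE_it hEc be.+1)).
apply: itE_ext_size => c1 hs; rewrite mulrC -(E_scale (isE_it hEc _)).
apply: E_ext => c2; rewrite big_ord_recl /= Qset_cat0 //; congr (_ * _).
by apply: eq_bigr => j _; rewrite Qset_catS.
Qed.

Lemma Qset_take c j m : (j < d)%N -> (d * be.+1 <= m)%N -> Qset be (take m c) j = Qset be c j.
Proof.
move=> hj hm; apply: eq_in_all => i; rewrite mem_iota add0n => /andP[_ hi].
by rewrite nth_take //; apply: leq_trans hm; nia.
Qed.

Lemma itE_unum N (F : seq nat -> R) :
  itE Ec (d * be.+1 + N * be.+2) (fun c => F (mkseq (unum d be c) N)) =
  itE (fun g => (\sum_(u < 2 ^ be.+2) g (nat_of_ord u)) / 2 ^+ be.+2) N F.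
Proof.
rewrite itE_add.
transitivity (itE Ec (d * be.+1) (fun=> itE Ec (N * be.+2) (fun c =>
    F (mkseq (fun i => num (take be.+2 (drop (i * be.+2) c))) N)))).
  apply: itE_ext_size => c1 hs1; apply: itE_ext_size => c2 hs2; congr F.
  apply/eq_in_map => i; rewrite mem_iota add0n => /andP[_ hi]; congr num.
  have hsz : size (take be.+2 (drop (i * be.+2) c2)) = be.+2.
    by rewrite size_takel // size_drop hs2; nia.
  rewrite -[RHS](mkseq_nth false) hsz; apply/eq_in_map => r; rewrite mem_iota add0n => /andP[_ hr].
  by rewrite nth_cat hs1 ltnNge leq_addr /= addKn nth_take // nth_drop.
rewrite (E_const (isE_it hEc _)) (itE_blocks num _ _ _ hEc).
have -> : (fun g => itE Ec be.+2 (fun s => g (num s))) =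
    (fun g => (\sum_(u < 2 ^ be.+2) g (nat_of_ord u)) / 2 ^+ be.+2).
  by apply/funext => g; exact: itE_num.
by [].
Qed.

Lemma ffact_le_exp p q : (p ^_ q <= p ^ q)%N.
Proof.
by elim: q => // q IH; rewrite ffactnSr expnSr; apply: leq_mul => //; exact: leq_subr.
Qed.

Lemma exp_le_ffact p q : (q <= p)%N -> (p ^ q <= (p + p) ^_ q)%N.
Proof.
elim: q => // q IH hq; rewrite ffactnSr expnSr; apply: leq_mul; last by lia.
by apply: IH; exact: ltnW.
Qed.

Lemma bin_le_2exp p q : ('C(p, q) <= 2 ^ p)%N.
Proof.
elim: p q => [|p IH] [|q]; rewrite ?bin0 ?bin0n ?expn_gt0 //.
by rewrite binS expnS mul2n -addnn; exact: leq_add.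
Qed.

(** The estimate binom(p, q) <= (4p/q)^q. It combines binom(p, q) <= p^q/q! with q^q <= (2q)!/q! =
    binom(2q, q) q! <= 4^q q!. *)
Lemma bin_exp_le p q : ('C(p, q) * q ^ q <= (4 * p) ^ q)%N.
Proof.
have h1 : (q ^ q <= 4 ^ q * q`!)%N.
  apply: leq_trans (exp_le_ffact (leqnn q)) _; rewrite -bin_ffact leq_mul2r; apply/orP; right.
  by apply: leq_trans (bin_le_2exp _ _) _; rewrite addnn -mul2n expnM.
apply: leq_trans (leq_mul (leqnn _) h1) _.
by rewrite mulnCA bin_ffact expnMn leq_mul2l ffact_le_exp orbT.
Qed.

Lemma count_ind (T : Type) (P : pred T) s : (count P s)%:R = \sum_(x <- s) ind R (P x).
Proof. by rewrite -sum1_count natr_sum big_mkcond; apply: eq_bigr => x _; rewrite /ind; case: (P x). Qed.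

Lemma indT : ind R true = 1.
Proof. by []. Qed.

Lemma indF : ind R false = 0.
Proof. by []. Qed.

Lemma ind_ge0 b : 0 <= ind R b.
Proof. exact: ler0n. Qed.

Lemma ind_le1 b : ind R b <= 1.
Proof. by rewrite /ind lern1 leq_b1. Qed.

End Coins.

(** * Expected loss of surviving mass in one round *)

Section Round.
Variables (R : realType) (d n G th M a be h : nat).
Variables (lam : {ffun cube d -> R}) (y : pattern d) (A : cube d -> bool).
Hypothesis dist : is_dist lam.
Hypothesis stars_le : (stars y <= 2 ^ be)%N.

Local Notation Ec := (@Ec R).
Local Notation hEc := (@isE_Ec R).
Local Notation El := (Ef lam).

Let lam0 x : 0 <= lam x. Proof. by have [] := dist. Qed.
Let lam1 : \sum_x lam x = 1. Proof. by have [] := dist. Qed.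
Let hEl : isE El. Proof. exact: isE_Ef. Qed.

Definition mass (B : pred (cube d)) : R := \sum_(x | B x) lam x.

Lemma mass_ge0 B : 0 <= mass B.
Proof. exact: sumr_ge0. Qed.

Lemma mass_le (B B' : pred (cube d)) : (forall x, B x -> B' x) -> mass B <= mass B'.
Proof.
move=> BB; rewrite /mass [leLHS]big_mkcond [leRHS]big_mkcond; apply: ler_sum => x _.
by have := BB x; case: (B x); case: (B' x) => // /(_ isT).
Qed.

Definition Dj (x : cube d) j : bool := ~~ star y j && (bit x j != yb y j).
Definition Dn x : nat := (\sum_(j < d) Dj x j)%N.
(** Capped at 2^be, where the gain of the parity over Q saturates. *)
Definition Dw x : R := (minn (Dn x) (2 ^ be))%:R.

(** With p = 2^-(be+1), the parities differ with probability at least (1/2)(1 - p)^stars (1 - (1 -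
    2p)^Dn): Q has to avoid the stars, and the sign of its intersection with the disagreements has
    mean (1 - 2p)^Dn. The last two factors are at least 1/2 and Dw/(2 * 2^be). *)
Lemma Q_kills x :
  Dw x / (8 * 2 ^+ be) <= itE Ec (ncoin d a be) (fun c =>
    ind R (par (fun j => can_e be y c && Qset be c j) x !=
           ypar y (fun j => can_e be y c && Qset be c j))).
Proof.
set W : R := 2 ^+ be; have W0 : 0 < W by rewrite exprn_gt0.
pose p : R := 2^-1 ^+ be.+1.
have pW : p = (2 * W)^-1 by rewrite /p exprVn exprS.
have W1 : 1 <= W by rewrite /W -natrX ler1n expn_gt0.
have p0 : 0 <= p by rewrite pW invr_ge0; lra.
have p1 : 2 * p <= 1.
  by rewrite pW invfM mulrA divff ?mul1r ?invf_le1 //; lra.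
(* The product of the [u] indicates that Q avoids the stars, and [v] carries in addition the sign of
   the parity difference. Half the difference of the two products is the indicator of a violated
   parity. *)
pose u j (b : bool) : R := 1 - ind R (star y j && b).
pose v j (b : bool) : R := u j b * (-1) ^+ (Dj x j && b).
have pt c : size c = ncoin d a be ->
    2^-1 * (\prod_(j < d) u j (Qset be (take (d * be.+1) c) j) -
            \prod_(j < d) v j (Qset be (take (d * be.+1) c) j)) <=
    ind R (par (fun j => can_e be y c && Qset be c j) x !=
           ypar y (fun j => can_e be y c && Qset be c j)).
  move=> _.
  have Eq (j : 'I_d) : Qset be (take (d * be.+1) c) j = Qset be c j by exact: Qset_take.
  have -> : \prod_(j < d) u j (Qset be (take (d * be.+1) c) j) =
      \prod_(j < d) u j (Qset be c j) by apply: eq_bigr => j _; rewrite Eq.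
  have -> : \prod_(j < d) v j (Qset be (take (d * be.+1) c) j) =
      \prod_(j < d) v j (Qset be c j) by apply: eq_bigr => j _; rewrite Eq.
  rewrite /v big_split /=.
  have [ce|nce] := boolP (can_e be y c); last first.
    move: nce; rewrite /can_e negbK => /hasP[j]; rewrite mem_iota add0n => /andP[_ hj] hS.
    rewrite (_ : \prod_(j < d) u j (Qset be c j) = 0); first by rewrite mul0r subrr mulr0 ler0n.
    by apply/eqP/prodf_eq0; exists (Ordinal hj) => //=; rewrite /u hS subrr.
  have nS (j : 'I_d) : Qset be c j -> star y j = false.
    move=> Qj; move: ce => /hasPn/(_ (j : nat)); rewrite mem_iota ltn_ord => /(_ isT).
    by rewrite Qj andbT => /negbTE.
  rewrite big1 ?mul1r => [|j _]; last first.
    by rewrite /u; case E: (Qset be c j); rewrite ?andbF ?subr0 // (nS _ E) subr0.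
  have -> : \prod_(j < d) (-1) ^+ (Dj x j && Qset be c j) =
      (-1) ^+ (\sum_(j < d) (Dj x j && Qset be c j))%N :> R.
    by elim/big_rec2: _ => // i q1 q2 _ ->; rewrite exprD.
  have -> : par (fun j => true && Qset be c j) x != ypar y (fun j => true && Qset be c j) =
      odd (\sum_(j < d) (Dj x j && Qset be c j))%N.
    rewrite /par /ypar -negb_add /= negbK -oddD -big_split /=.
    have -> : odd (\sum_(j < d) ((Qset be c j && bit x j) + (Qset be c j && yb y j)))%N =
       odd (\sum_(j < d) (Dj x j && Qset be c j))%N; last by [].
    elim/big_rec2: _ => // j q1 q2 _; rewrite !oddD => ->; congr (_ (+) _).
    rewrite /Dj; case E: (Qset be c j) => /=; rewrite ?andbF // andbT (nS _ E) /=.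
    by case: (bit x j); case: (yb y j).
  by rewrite -signr_odd /ind; case: (odd _); rewrite /= ?expr1 ?expr0; lra.
apply: le_trans (itE_le hEc pt).
rewrite (E_scale (isE_it hEc _)) (itE_take hEc (d * be.+1) (ntry a * be.+2) (fun c =>
  \prod_(j < d) u j (Qset be c j) - \prod_(j < d) v j (Qset be c j))).
rewrite (E_sub (isE_it hEc _)) (Qset_prod _ _ u) (Qset_prod _ _ v) -/p.
have -> : \prod_(j < d) (p * u j true + (1 - p) * u j false) = (1 - p) ^+ stars y.
  rewrite -rk_star /rk; elim/big_rec2: _ => // j q1 q2 _ ->; rewrite exprD; congr (_ * _).
  by rewrite /u /ind andbT andbF; case: (star y j); rewrite /= ?expr1 ?expr0; ring.
have -> : \prod_(j < d) (p * v j true + (1 - p) * v j false) =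
    (1 - p) ^+ stars y * (1 - 2 * p) ^+ Dn x.
  rewrite -rk_star /rk /Dn.
  transitivity (\prod_(j < d) ((1 - p) ^+ star y j * (1 - 2 * p) ^+ Dj x j)).
    apply: eq_bigr => j _; rewrite /v /u /ind !andbT !andbF /Dj.
    by case: (star y j) => /=; [|case: (bit x j != yb y j)]; rewrite /= ?expr1 ?expr0; ring.
  rewrite big_split /=; congr (_ * _).
    by elim/big_rec2: _ => // j q1 q2 _ ->; rewrite exprD.
  by elim/big_rec2: _ => // j q1 q2 _ ->; rewrite exprD.
have hS : 2^-1 <= (1 - p) ^+ stars y.
  apply: le_trans (exp_1B_ge (stars y) p0 _); last by lra.
  have : (stars y)%:R * p <= 2 ^+ be * p by apply: ler_wpM2r => //; rewrite -natrX ler_nat.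
  have -> : 2 ^+ be * p = 2^-1 by rewrite pW -/W; field; rewrite gt_eqF.
  by lra.
(* With e = Dn/W the right-hand side is at least e/(1 + e), which is at least e/2 up to e = 1 and at
   least 1/2 beyond. *)
have hD : Dw x / (2 * W) <= 1 - (1 - 2 * p) ^+ Dn x.
  have p2 : 2 * p = W^-1 by rewrite pW; field; rewrite gt_eqF.
  have q0 : 0 <= 2 * p by lra.
  have := exp_1B_le (Dn x) q0 p1; set t := (1 - 2 * p) ^+ _; rewrite p2.
  set e := (Dn x)%:R / W; have e0 : 0 <= e by rewrite divr_ge0 // ltW.
  have ed : 0 < 1 + e by lra.
  move=> ht; have : Dw x / (2 * W) <= 1 - (1 + e)^-1; last by lra.
  have -> : 1 - (1 + e)^-1 = e / (1 + e).
    by field; rewrite gt_eqF.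
  rewrite ler_pdivlMr // invfM mulrA [Dw x / 2 / W]mulrAC -mulrA.
  rewrite /Dw; have [hle|hlt] := leqP (Dn x) (2 ^ be).
    have e1 : e <= 1 by rewrite /e ler_pdivrMr // mul1r /W -natrX ler_nat.
    rewrite (_ : (Dn x)%:R * (W^-1 / 2) = e / 2); last by rewrite /e mulrA.
    by nra.
  rewrite natrX -/W mulrA divff ?gt_eqF //.
  have e1 : 1 <= e by rewrite /e ler_pdivlMr // mul1r /W -natrX ler_nat ltnW.
  by lra.
rewrite -[X in X - _]mulr1 -mulrBr.
have D0 : 0 <= Dw x / (2 * W) by rewrite divr_ge0 ?ler0n //; lra.
have -> : Dw x / (8 * W) = 2^-1 * (2^-1 * (Dw x / (2 * W))).
  by field; rewrite gt_eqF.
by apply: ler_wpM2l; [lra|nra].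
Qed.

Local Notation mu := (mass A).
Hypothesis mu0 : 0 < mu.

(** The expectation under [lam] conditioned on [A]. *)
Definition Epi (F : cube d -> R) : R := (\sum_(x | A x) lam x * F x) / mu.

Lemma isE_Epi : isE Epi.
Proof.
split=> [f g|c f|f g hfg|]; rewrite /Epi.
- by rewrite -mulrDl -big_split; congr (_ / _); apply: eq_bigr => x _; rewrite mulrDr.
- by rewrite mulrA mulr_sumr; congr (_ / _); apply: eq_bigr => x _; rewrite mulrCA.
- apply: ler_wpM2r; first by rewrite invr_ge0 ltW.
  by apply: ler_sum => x _; exact: ler_wpM2l.
- by rewrite (eq_bigr lam) ?divff ?gt_eqF // => x _; rewrite mulr1.
Qed.

Lemma mu_Epi (B : pred (cube d)) : mu * Epi (fun x => ind R (B x)) = mass (fun x => A x && B x).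
Proof.
rewrite /Epi mulrC divfK ?gt_eqF // /mass big_mkcondr; apply: eq_bigr => x _.
by rewrite /ind; case: (B x); rewrite ?mulr1 ?mulr0.
Qed.

Definition fa (s : seq (cube d)) : cube d := nth (zero_cube d) s (find A s).

Lemma zvec_fa s i : (i.+1 * G <= size s)%N -> zvec G A s i = fa (take G (drop (i * G) s)).
Proof.
move=> hs; set s' := take _ _.
have sz : size s' = G by rewrite size_takel // size_drop; nia.
have Es : s' = mkseq (fun g => nth (zero_cube d) s (i * G + g)) G.
  rewrite -[LHS](mkseq_nth (zero_cube d)) sz; apply/eq_in_map => g.
  by rewrite mem_iota add0n => /andP[_ hg]; rewrite nth_take // nth_drop.
rewrite /zvec /fa -[has _ _]/(has (A \o (fun g => nth (zero_cube d) s (i * G + g))) _).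
rewrite -[find _ _]/(find (A \o (fun g => nth (zero_cube d) s (i * G + g))) _).
rewrite -has_map -find_map -/(mkseq _ _) -Es; case: ifP => hA.
  have hf : (find A s' < G)%N by rewrite -sz -has_find.
  by rewrite [RHS]nth_take // nth_drop.
by rewrite nth_default // hasNfind // hA.
Qed.

(** The first sample that falls into [A] has the conditional law, and a group contains one with
    probability 1 - (1 - mu)^G. The remaining case contributes a nonnegative amount. *)
Lemma group_ge (F : cube d -> R) : (forall x, 0 <= F x) ->
  (1 - (1 - mu) ^+ G) * Epi F <= itE El G (fun s => F (fa s)).
Proof.
move=> F0.
have mu1 : mu <= 1 by rewrite -lam1 /mass; exact: (mass_le (B' := xpredT)).
elim: G => [|G' IH] /=; first by rewrite expr0 subrr mul0r.
rewrite (_ : El _ = mu * Epi F + (1 - mu) * itE El G' (fun s => F (fa s))); last first.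
  rewrite /Epi mulrC divfK ?gt_eqF // /Ef (bigID A) /=; congr (_ + _).
    apply: eq_bigr => x Ax; congr (_ * _); rewrite -[RHS](E_const (isE_it hEl G')).
    by apply: E_ext => s; rewrite /fa /= Ax.
  have -> : 1 - mu = \sum_(x | ~~ A x) lam x by rewrite -lam1 (bigID A) /= addrAC subrr add0r.
  rewrite mulr_suml; apply: eq_bigr => x /negbTE nA; congr (_ * _).
  by apply: E_ext => s; rewrite /fa /= nA.
have -> : (1 - (1 - mu) ^+ G'.+1) * Epi F =
    mu * Epi F + (1 - mu) * ((1 - (1 - mu) ^+ G') * Epi F) by rewrite exprS; ring.
by apply: lerD => //; apply: ler_wpM2l => //; rewrite subr_ge0.
Qed.

Lemma groups_ge N (F : seq (cube d) -> R) : (forall s, 0 <= F s) ->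
  (1 - (1 - mu) ^+ G) ^+ N * itE Epi N F <= itE El (N * G) (fun s => F (zlist N G A s)).
Proof.
move=> F0.
have mu1 : mu <= 1 by rewrite -lam1 /mass; exact: (mass_le (B' := xpredT)).
have c0 : 0 <= 1 - (1 - mu) ^+ G.
  by rewrite subr_ge0 exprn_ile1 ?subr_ge0 // lerBlDr lerDl ltW.
have -> : itE El (N * G) (fun s => F (zlist N G A s)) =
    itE El (N * G) (fun s => F (mkseq (fun i => fa (take G (drop (i * G) s))) N)).
  apply: itE_ext_size => s hs; congr F; apply/eq_in_map => i.
  rewrite mem_iota add0n => /andP[_ hi]; apply: zvec_fa; rewrite hs leq_mul2r.
  by rewrite hi orbT.
rewrite (itE_blocks fa _ _ _ hEl); elim: N F F0 => [|N IH] F F0 /=; first by rewrite expr0 mul1r.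
set E' := fun g => itE El G (fun s => g (fa s)).
have hE' : isE E'.
  have hh := isE_it hEl G; split=> [f g|c f|f g hfg|]; rewrite /E'.
  - exact: (E_add hh).
  - exact: (E_scale hh).
  - by apply: (E_mono hh) => s.
  - exact: (E_one hh).
have F1 x : 0 <= itE E' N (fun s0 => F (x :: s0)) by apply: (E_ge0 (isE_it hE' N)).
apply: le_trans (group_ge F1).
rewrite exprS -mulrA; apply: ler_wpM2l => //.
rewrite -(E_scale isE_Epi); apply: (E_mono isE_Epi) => x.
by apply: IH.
Qed.

Definition killmass (z : seq (cube d)) c : R :=
  mass (fun x => A x && ~~ alive1 M (canc n th M a be y z c) x).
Definition pay z : R := itE Ec (ncoin d a be) (killmass z).
Definition wtz (z : seq (cube d)) (x : cube d) : nat :=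
  (\sum_(j < d) ((bit x j != center th z j) && ~~ inC n th z j))%N.

Lemma killmass_ge0 z c : 0 <= killmass z c.
Proof. exact: mass_ge0. Qed.

(** When closeness applies, an input of [A] near the center cannot survive: either it is decided or
    it violates a parity. *)
Lemma pay_weight z : can_md M y (inC n th z) ->
  mu * (1 - Epi (fun x => ind R (M < wtz z x)%N)) <= pay z.
Proof.
move=> md; rewrite -[X in mu * (X - _)](E_const isE_Epi) -(E_sub isE_Epi).
rewrite (_ : Epi _ = Epi (fun x => ind R (wtz z x <= M)%N)); last first.
  by apply: E_ext => x; rewrite /ind; case: leqP => _; rewrite /= ?subrr ?subr0.
rewrite mu_Epi -[leLHS](E_const (isE_it hEc (ncoin d a be))).
apply: (E_mono (isE_it hEc _)) => c; apply: mass_le => x /andP[-> hw] /=.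
by rewrite /alive1 /= md -/(wtz z x) hw andbF.
Qed.

Lemma first_payE (T : Type) (x0 : T) (v : pred T) (b : T -> R) s :
  first_pay v b s = if has v s then b (nth x0 s (find v s)) else 0.
Proof. by elim: s => //= x s ->; case: (v x). Qed.

Lemma sum_rk_lt (C : nat -> bool) N T :
  (\sum_(j < N) (C j && (rk C j < T)))%N = minn (rk C N) T.
Proof.
elim: N => [|N IH]; first by rewrite big_ord0 /rk big_ord0 min0n.
rewrite big_ord_recr /= IH rkS; case: (C N) => /=; last by rewrite !addn0.
by case: (ltnP (rk C N) T) => /= ?; lia.
Qed.

Lemma sum_has_rk (C B : nat -> bool) T : (forall j, B j -> C j) ->
  \sum_(u < T) ind R (has (fun j => B j && (nat_of_ord u == rk C j)) (iota 0 d)) =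
  (\sum_(j < d) (B j && (rk C j < T)))%N%:R.
Proof.
move=> BC.
rewrite (eq_bigr (fun u : 'I_T => \sum_(j < d) ind R (B j && (nat_of_ord u == rk C j)))); last first.
  move=> u _; have [/hasP[j]|/hasPn no] := boolP (has _ _).
    rewrite mem_iota add0n => /andP[_ hj] /andP[Bj /eqP Ej].
    rewrite (bigD1 (Ordinal hj)) //= Bj Ej eqxx big1 ?addr0 // => i ni.
    rewrite /ind; case Bi: (B i) => //=; case: eqP => // E.
    by case/eqP: ni; apply: val_inj; apply: (rk_inj (BC _ Bi) (BC _ Bj)); rewrite -E.
  by rewrite big1 // => i _; rewrite (negbTE (no i _)) // mem_iota ltn_ord.
rewrite exchange_big natr_sum; apply: eq_bigr => j _ /=.
case: (B j) => /=; last by rewrite big1.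
have [hj|hj] := ltnP (rk C j) T.
  rewrite (bigD1 (Ordinal hj)) //= eqxx big1 ?addr0 // => u nu.
  by rewrite /ind; case: eqP => // E; case/eqP: nu; apply: val_inj.
by rewrite big1 // => u _; rewrite /ind; case: eqP => // E; have := ltn_ord u; lia.
Qed.

(** This is 1/(2t), where t = 256 * 2^a is the base in [bin_nh]; the factor 1/2 is what makes the
    tail in [Pjunk] geometric. *)
Definition rho : R := (512 * 2 ^+ a)^-1.
Definition pj j : R := Epi (fun x => ind R ((Dn x <= 2 ^ be)%N && Dj x j)).
(** Too few inputs of [A] disagree with [y] at such a coordinate for its single-coordinate parity to
    pay. *)
Definition junk j : bool := pj j < rho.
Definition nbad (z : seq (cube d)) : nat := count (fun x => 2 ^ be < Dn x)%N z.
Definition cntg z j : nat := count (fun x => (Dn x <= 2 ^ be)%N && Dj x j) z.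
(** The junk that may enter C by accident. A non-star of C sees at least [th], that is 2h, samples
    disagreeing with [y]; if fewer than [h] samples are bad, at least [h] of these are good. *)
Definition njunk z : nat := (\sum_(j < d) [&& ~~ star y j, junk j & (h <= cntg z j)%N])%N.

Hypotheses (Hth : th = (2 * h)%N) (HM : (2 ^ be <= 2 ^ a * M)%N) (HMW : (M <= 2 ^ be)%N).

Let W0 : 0 < 2 ^+ be :> R. Proof. by rewrite exprn_gt0. Qed.
Let s0 : 0 < 2 ^+ a :> R. Proof. by rewrite exprn_gt0. Qed.
Let s1 : 1 <= 2 ^+ a :> R. Proof. by rewrite -natrX ler1n expn_gt0. Qed.
Let rho0 : 0 < rho. Proof. by rewrite invr_gt0 mulr_gt0. Qed.

Lemma count_Dj z j : (count (Dj^~ j) z <= nbad z + cntg z j)%N.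
Proof.
rewrite /nbad /cntg; elim: z => //= x z IH.
by case: (Dj x j); case: (leqP (Dn x) (2 ^ be)); rewrite /=; lia.
Qed.

Lemma count_flip z j : ~~ star y j ->
  count (Dj^~ j) z = if yb y j then (size z - cnt z j)%N else cnt z j.
Proof.
move=> ns; rewrite /cnt; have := count_size (fun x : cube d => bit x j) z.
have := count_predC (fun x : cube d => bit x j) z; case E: (yb y j) => /= E1 E2.
  have <- : count (predC (fun x : cube d => bit x j)) z =
    (size z - count (fun x : cube d => bit x j) z)%N by lia.
  by apply: eq_count => x /=; rewrite /Dj ns E eqb_id.
by apply: eq_count => x /=; rewrite /Dj ns E; case: (bit x j).
Qed.

(** The first useful trial names a random non-star among those in C that can be drawn. It exists
    with probability at least 1/2, is not junk with probability at least 1/2, and then cuts at least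
    [mu * rho] from [A]. *)
Lemma pay_parity z : size z = n -> ~~ can_md M y (inC n th z) -> (nbad z < h)%N ->
  (2 * njunk z <= M)%N -> mu * (rho / 4) <= pay z.
Proof.
move=> sz nmd hb hj; set C := inC n th z.
pose B j := C j && ~~ star y j; pose nb j := B j && ~~ junk j.
pose V u := has (fun j => B j && (u == rk C j)) (iota 0 d).
pose bp u := ind R (has (fun j => nb j && (u == rk C j)) (iota 0 d)).
pose T := (2 ^ be.+2)%N.
have pt c : mu * rho * first_pay V bp (mkseq (unum d be c) (ntry a)) <= killmass z c.
  rewrite (first_payE 0%N); set us := mkseq _ _.
  have [hV|_] := boolP (has V us); last by rewrite mulr0 killmass_ge0.
  rewrite /bp; have [/hasP[j]|_] := boolP (has _ (iota 0 d)); last by rewrite mulr0 killmass_ge0.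
  rewrite mem_iota add0n => /andP[_ hjd] /andP[/andP[Bj nj] /eqP Eu].
  have /andP[Cj nsj] := Bj.
  have fV : (find V us < ntry a)%N by rewrite -(size_mkseq (unum d be c) (ntry a)) -has_find.
  have Eidx : can_idx M a be y C c = find V us.
    rewrite /can_idx (negbTE nmd) /us /mkseq find_map; apply: eq_find => i /=.
    by apply: eq_has => j'; rewrite /B andbA.
  rewrite nth_mkseq // in Eu.
  have Esel i : selected d a be C c (find V us) i = (i == j).
    rewrite /selected fV /=; apply/andP/eqP => [[Ci /eqP E]|->]; last by rewrite Cj Eu.
    by apply: (rk_inj Ci Cj); rewrite -E Eu.
  have one (f : nat -> bool) : odd (\sum_(i < d) (selected d a be C c (find V us) i && f i))%N = f j.
    rewrite (bigD1 (Ordinal hjd)) //= Esel eqxx big1 ?addn0 ?oddb // => i ni.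
    by rewrite Esel; case: eqP => // E; case/eqP: ni; apply: val_inj.
  rewrite mulr1; apply: le_trans (_ : mu * pj j <= _).
    by apply: ler_wpM2l; [exact: ltW|rewrite leNgt].
  rewrite mu_Epi; apply: mass_le => x /andP[-> /andP[_ /andP[_ hx]]] /=.
  rewrite /alive1 negb_and /parok negb_and /=; apply/orP; left; apply/orP; right.
  by rewrite /par /ypar /= Eidx (one (bit x)) (one (yb y)).
rewrite /pay; apply: le_trans (itE_le hEc (fun c _ => pt c)).
rewrite (E_scale (isE_it hEc _)) (itE_unum d be (ntry a) (first_pay V bp)).
set Eu := fun g => _ / _.
have T0 : 0 < 2 ^+ be.+2 :> R by rewrite exprn_gt0.
have hEu : isE Eu.
  split=> [f g|c f|f g hfg|]; rewrite /Eu.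
  - by rewrite -mulrDl -big_split.
  - by rewrite mulrA mulr_sumr.
  - by apply: ler_wpM2r; [rewrite invr_ge0 ltW|apply: ler_sum].
  - by rewrite sumr_const card_ord natrX divff // gt_eqF.
rewrite -mulrA; apply: ler_wpM2l; first exact: ltW.
apply: ler_wpM2l; first exact: ltW.
pose cV := (\sum_(j < d) (B j && (rk C j < T)))%N.
pose cB := (\sum_(j < d) (nb j && (rk C j < T)))%N.
have EV : Eu (fun u => ind R (V u)) = cV%:R / 2 ^+ be.+2.
  by rewrite /Eu /cV (sum_has_rk (B := B)) // => j /andP[].
have EB : Eu (fun u => ind R (V u) * bp u) = cB%:R / 2 ^+ be.+2.
  rewrite /Eu /cB -(sum_has_rk (B := nb)) => [|j /andP[/andP[]]//].
  congr (_ / _); apply: eq_bigr => u _; rewrite /bp /V.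
  case hn: (has (fun j => nb j && (nat_of_ord u == rk C j)) (iota 0 d));
    last by rewrite /ind mulr0.
  rewrite (_ : has (fun j => B j && (nat_of_ord u == rk C j)) (iota 0 d) = true).
    by rewrite /ind mulr1.
  by apply: sub_has hn => j /andP[/andP[-> _] ->].
(* If C has more than 4 * 2^be elements, only its first 4 * 2^be ranks can be drawn; at most 2^be of
   them are stars, and the others still number at least M. *)
have BM : (M <= cV)%N.
  have hBs : (M < \sum_(j < d) B j)%N by rewrite ltnNge.
  have [hC|hC] := leqP (rk C d) T.
    apply: leq_trans (ltnW hBs) _; apply: leq_sum => j _; rewrite /B.
    by case Cj: (C j) => //=; rewrite (leq_trans (rk_lt Cj (ltn_ord j)) hC) andbT.
  have := sum_rk_lt C d T; rewrite (minn_idPr (ltnW hC)) => E.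
  have : (T <= cV + stars y)%N.
    rewrite -E -rk_star /cV /rk -big_split /=; apply: leq_sum => j _; rewrite /B.
    by case: (C j); case: (star y j); case: (_ < T)%N.
  by rewrite /T !expnS; lia.
have cVB : (cV <= cB + njunk z)%N.
  rewrite /cV /cB /njunk -big_split /=; apply: leq_sum => j _; rewrite /nb.
  case Bj: (B j) => //=; case Jj: (junk j) => /=; last by rewrite leq_addr.
  have /andP[Cj nsj] := Bj; rewrite nsj /=.
  suff -> : (h <= cntg z j)%N by rewrite leq_b1.
  have := count_Dj z j; rewrite count_flip //.
  have aux (q c b : nat) (f : bool) : (2 * h <= q)%N && (q + 2 * h <= n)%N ->
      ((if f then n - q else q) <= b + c)%N -> (b < h)%N -> (h <= c)%N.
    by clear; case: f; lia.
  by rewrite sz => /aux; apply=> //; move: Cj; rewrite /C /inC Hth.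
have pvb : 2^-1 * Eu (fun u => ind R (V u)) <= Eu (fun u => ind R (V u) * bp u).
  rewrite EV EB mulrA; apply: ler_wpM2r; first by rewrite invr_ge0 ltW.
  rewrite ler_pdivrMl //; have : (cV <= 2 * cB)%N by lia.
  by rewrite -(ler_nat R) natrM.
have := first_pay_ge hEu (ntry a) pvb; apply: le_trans.
set pv := Eu _; have pvE : pv = cV%:R / 2 ^+ be.+2 by [].
have pv0 : 0 <= pv by rewrite pvE divr_ge0 // ltW.
have pv1 : pv <= 1.
  by rewrite -[leRHS](E_const hEu); apply: (E_mono hEu) => u; rewrite /ind lern1 leq_b1.
have e1 := exp_1B_le (ntry a) pv0 pv1.
(* There are at least 4 * 2^a trials, each useful with probability at least M/(4 * 2^be) >= 1/(4 *
   2^a). *)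
have e2 : 1 <= (ntry a)%:R * pv.
  have q1 : 2 ^+ be <= 2 ^+ a * cV%:R :> R.
    by rewrite -!natrX -natrM ler_nat; apply: leq_trans HM _; rewrite leq_mul2l BM orbT.
  have q2 : 4 * 2 ^+ a <= (ntry a)%:R :> R.
    have s1' : (1 : R) <= 2 ^+ a := s1.
    rewrite /ntry -subn1 natrB ?expn_gt0 // natrX exprD.
    have -> : 2 ^+ 3 = 8 :> R by ring.
    by lra.
  rewrite pvE mulrA ler_pdivlMr // mul1r !exprS.
  have := ler_wpM2r (ler0n R cV) q2; lra.
have e3 : (1 + (ntry a)%:R * pv)^-1 <= 2^-1 by rewrite lef_pV2 ?posrE; lra.
by lra.
Qed.

Lemma pay_ge0 z : 0 <= pay z.
Proof. by apply: (E_ge0 (isE_it hEc _)) => c; exact: killmass_ge0. Qed.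

(** Both cases in one inequality that is linear in the bad events, so that the expectation over [z]
    can be taken term by term. *)
Lemma pay_ge z : size z = n ->
  mu * (rho / 4) * (1 - ind R (h <= nbad z)%N - ind R (M < 2 * njunk z)%N
    - Epi (fun x => ind R (M < wtz z x)%N)) <= pay z.
Proof.
move=> sz; set e := Epi _.
have e0 : 0 <= e by apply: (E_ge0 isE_Epi) => x; rewrite /ind ler0n.
have e1 : e <= 1.
  by rewrite -[leRHS](E_const isE_Epi); apply: (E_mono isE_Epi) => x; rewrite /ind lern1 leq_b1.
have rho1 : rho / 4 <= 1.
  have : rho <= 1 by rewrite /rho invf_le1 ?mulr_gt0 //; have s1' : (1 : R) <= 2 ^+ a := s1; lra.
  by lra.
have c0 : 0 <= mu * (rho / 4) by rewrite mulr_ge0 ?divr_ge0 // ltW.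
have b0 (b : bool) : 0 <= ind R b by rewrite ler0n.
have [md|nmd] := boolP (can_md M y (inC n th z)).
  apply: le_trans (pay_weight md); rewrite -/e.
  apply: le_trans (_ : mu * (rho / 4) * (1 - e) <= _).
    by apply: ler_wpM2l => //; have := b0 (h <= nbad z)%N; have := b0 (M < 2 * njunk z)%N; lra.
  rewrite -mulrA; apply: ler_wpM2l; first exact: ltW.
  by rewrite -[leRHS]mul1r; apply: ler_wpM2r => //; lra.
have [hb|hb] := leqP h (nbad z).
  apply: le_trans (pay_ge0 z); rewrite indT; apply: mulr_ge0_le0 => //.
  by have := b0 (M < 2 * njunk z)%N; lra.
have [hj|hj] := ltnP M (2 * njunk z).
  apply: le_trans (pay_ge0 z); rewrite indT indF.
  by apply: mulr_ge0_le0 => //; lra.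
apply: le_trans (pay_parity sz nmd hb hj); rewrite indF.
by rewrite -[leRHS]mulr1; apply: ler_wpM2l => //; lra.
Qed.

Hypotheses (Hh : h = (a + 4)%N) (Hn : n = (64 * (2 ^ a * h))%N).

Let h0 : 0 < h%:R :> R. Proof. by rewrite ltr0n Hh addn4. Qed.
Let nR : n%:R = 64 * (2 ^+ a * h%:R) :> R. Proof. by rewrite Hn !natrM natrX. Qed.
Let sM : 2 ^+ be <= 2 ^+ a * M%:R :> R. Proof. by rewrite -!natrX -natrM ler_nat. Qed.
Let M0 : 0 < M%:R :> R.
Proof. by rewrite ltr0n; move: HM; have := expn_gt0 2 be; case: M => //; rewrite muln0; lia. Qed.
Let hEz := isE_it isE_Epi n.

Lemma good_Dn_le x : \sum_(j < d) ind R ((Dn x <= 2 ^ be)%N && Dj x j) <= Dw x.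
Proof.
rewrite /Dw; case: leqP => hx /=; last by rewrite big1 // ler0n.
by rewrite /Dn natr_sum.
Qed.

Section SmallWeight.
Hypothesis small : Epi Dw <= 2 ^+ be / (1024 * 2 ^+ a).

Lemma Pbig : Epi (fun x => ind R (2 ^ be < Dn x)%N) <= (1024 * 2 ^+ a)^-1.
Proof.
rewrite -(ler_pM2l W0); apply: le_trans small; rewrite -(E_scale isE_Epi).
apply: (E_mono isE_Epi) => x; rewrite /Dw /ind.
by case: leqP => hx; rewrite ?mulr0 ?ler0n // mulr1 natrX.
Qed.

(** Markov's inequality: n/h = 64 * 2^a against the probability 1/(1024 * 2^a) of [Pbig]. *)
Lemma Pnbad : itE Epi n (fun z => ind R (h <= nbad z)%N) <= 16^-1.
Proof.
have hb : h%:R * itE Epi n (fun z => ind R (h <= nbad z)%N) <=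
    n%:R * Epi (fun x => ind R (2 ^ be < Dn x)%N).
  rewrite -(itE_sum_seq isE_Epi) -(E_scale hEz); apply: (E_mono hEz) => z.
  rewrite -count_ind -/(nbad z) /ind; case: (leqP h (nbad z)) => hz.
    by rewrite mulr1 ler_nat.
  by rewrite mulr0 ler0n.
rewrite -(ler_pM2l h0); apply: le_trans hb _; rewrite nR.
apply: le_trans (_ : 64 * (2 ^+ a * h%:R) * (1024 * 2 ^+ a)^-1 <= _).
  by apply: ler_wpM2l Pbig; rewrite !mulr_ge0 // ltW.
rewrite le_eqVlt; apply/orP; left; apply/eqP; field.
by rewrite gt_eqF.
Qed.

Lemma bin_nh : 'C(n, h)%:R <= (256 * 2 ^+ a) ^+ h :> R.
Proof.
have := bin_exp_le n h; rewrite -(ler_nat R) natrM !natrX natrM nR.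
have -> : 4 * (64 * (2 ^+ a * h%:R)) = 256 * 2 ^+ a * h%:R :> R by ring.
by rewrite exprMn ler_pM2r // exprn_gt0.
Qed.

Let pj_ge0 j : 0 <= pj j.
Proof. by apply: (E_ge0 isE_Epi) => x; exact: ind_ge0. Qed.

(** With t = 256 * 2^a, the bound binom(n, h) pj^h is at most t^h rho^(h-1) pj = t 2^-(a+3) pj = 32
    pj. This fixes h = a + 4; being linear in [pj], the bound can be summed over all coordinates. *)
Lemma Pjunk j : junk j -> itE Epi n (fun z => ind R (h <= cntg z j)%N) <= 32 * pj j.
Proof.
move=> jj; apply: le_trans (itE_count_ge isE_Epi n h _) _; rewrite -/(pj j).
have [t tE] : exists t : R, t = 256 * 2 ^+ a by exists (256 * 2 ^+ a).
have t0 : 0 < t by rewrite tE mulr_gt0.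
have key : t ^+ h * rho ^+ (a + 3) = 32.
  have -> : rho = (2 * t)^-1 by rewrite /rho tE; congr (_^-1); ring.
  rewrite Hh addnS exprS exprVn exprMn.
  set u := t ^+ (a + 3); have u0 : u != 0 by rewrite gt_eqF // exprn_gt0.
  have -> : 2 ^+ (a + 3) = 8 * 2 ^+ a :> R by rewrite exprD mulrC; congr (_ * _); ring.
  by clearbody u; rewrite tE; field; rewrite u0 gt_eqF.
rewrite -key -mulrA; apply: ler_pM => //; first by rewrite exprn_ge0.
  by rewrite tE; exact: bin_nh.
rewrite {1}Hh addnS exprSr; apply: ler_wpM2r => //.
by apply: lerXn2r; rewrite ?nnegrE //; exact: ltW.
Qed.

(** Markov's inequality. The expectation of [njunk] is at most 32 times the mean capped
    disagreement, and 2 * 32/1024 = 1/16. *)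
Lemma Pnjunk : itE Epi n (fun z => ind R (M < 2 * njunk z)%N) <= 16^-1.
Proof.
rewrite -(ler_pM2l M0).
have h1 : M%:R * itE Epi n (fun z => ind R (M < 2 * njunk z)%N) <=
    2 * itE Epi n (fun z => (njunk z)%:R).
  rewrite -!(E_scale hEz); apply: (E_mono hEz) => z; rewrite -natrM /ind.
  case: (ltnP M (2 * njunk z)) => hz; first by rewrite mulr1 ler_nat ltnW.
  by rewrite mulr0 ler0n.
have h2 : itE Epi n (fun z => (njunk z)%:R) <= 32 * Epi Dw.
  rewrite (_ : itE _ _ _ = \sum_(j < d) itE Epi n
      (fun z => ind R [&& ~~ star y j, junk j & (h <= cntg z j)%N])); last first.
    by rewrite -(E_sum hEz); apply: E_ext => z; rewrite natr_sum.
  apply: le_trans (_ : \sum_(j < d) 32 * pj j <= _).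
    apply: ler_sum => j _.
    have h32 : 0 <= 32 * pj j by rewrite mulr_ge0.
    case: (star y j) => /=; first by rewrite (E_const hEz).
    by case J: (junk j) => /=; [exact: Pjunk|rewrite (E_const hEz)].
  rewrite -mulr_sumr; apply: ler_wpM2l => //; rewrite -(E_sum isE_Epi).
  by apply: (E_mono isE_Epi) => x; exact: good_Dn_le.
have h3 : 2 ^+ be / (1024 * 2 ^+ a) <= M%:R / 1024 :> R.
  rewrite ler_pdivrMr ?mulr_gt0 //; apply: le_trans sM _.
  by rewrite le_eqVlt; apply/orP; left; apply/eqP; field.
by have := small; lra.
Qed.

Definition Vw (z : seq (cube d)) (x : cube d) : R :=
  \sum_(j < d) ind R [&& star y j, ~~ inC n th z j & bit x j != center th z j].

(** Outside C, where [x] is off-center, the coordinate is a star ([Vw]), or [x] disagrees with [y]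
    ([Dw]), or the center does. In the last case at least n/2 good samples disagree with [y], so
    there are at most 2/n times as many such coordinates as disagreements in the whole sample. *)
Lemma wtz_le z x : size z = n ->
  M%:R * ind R (M < wtz z x)%N <= M%:R * ind R (h <= nbad z)%N +
    M%:R * ind R (2 ^ be < Dn x)%N + Vw z x + Dw x + 2 / n%:R * \sum_(x' <- z) Dw x'.
Proof.
move=> sz.
have n0 : 0 < n%:R :> R by rewrite nR !mulr_gt0.
have V0 : 0 <= Vw z x by apply: sumr_ge0 => j _; exact: ind_ge0.
have D0 x' : 0 <= Dw x' by exact: ler0n.
have S0 : 0 <= 2 / n%:R * \sum_(x' <- z) Dw x'.
  by rewrite mulr_ge0 ?divr_ge0 ?sumr_ge0 // ltW.
have i1 := ind_le1 R (M < wtz z x)%N.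
have m1 : M%:R * ind R (M < wtz z x)%N <= M%:R by rewrite -[leRHS]mulr1 ler_wpM2l.
have D1 := D0 x.
case: (leqP h (nbad z)) => hb.
  have := ler_wpM2l (ltW M0) (ind_ge0 R (2 ^ be < Dn x)%N); rewrite mulr0 => ?.
  by rewrite indT mulr1; lra.
case: (ltnP (2 ^ be) (Dn x)) => hD.
  by rewrite indT indF mulr1 mulr0; lra.
rewrite indF !mulr0 !add0r.
apply: le_trans (_ : (wtz z x)%:R <= _).
  by rewrite /ind; case: ltnP => hw; rewrite ?mulr1 ?mulr0 ?ler_nat ?ler0n // ltnW.
have n64 : (64 * h <= n)%N by rewrite Hn leq_pmul2l // leq_pmull // expn_gt0.
pose far j := [&& ~~ star y j, ~~ inC n th z j & center th z j != yb y j].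
have farP j : far j -> (n <= 2 * cntg z j)%N.
  move=> /and3P[nsj nC cy]; have := count_Dj z j; rewrite count_flip //.
  have := count_size (fun x0 : cube d => bit x0 j) z; rewrite -/(cnt z j) sz.
  have aux (q c b : nat) (f : bool) : ~~ ((2 * h <= q)%N && (q + 2 * h <= n)%N) ->
      ((2 * h <= q)%N != f) -> (q <= n)%N -> ((if f then n - q else q) <= b + c)%N ->
      (b < h)%N -> (64 * h <= n)%N -> (n <= 2 * c)%N.
    by clear; case: f; case: leqP => /=; lia.
  by rewrite /inC /center Hth in nC cy => /(aux _ _ _ _ nC cy) h1 /h1; apply.
have far_le : \sum_(j < d) ind R (far j) <= 2 / n%:R * \sum_(x' <- z) Dw x'.
  apply: le_trans (_ : \sum_(j < d) 2 / n%:R * (cntg z j)%:R <= _).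
    apply: ler_sum => j _; rewrite /ind; case F: (far j); last by rewrite mulr_ge0 ?divr_ge0 // ltW.
    rewrite mulrAC ler_pdivlMr // mul1r -natrM ler_nat; exact: farP.
  rewrite -mulr_sumr; apply: ler_wpM2l; first by rewrite divr_ge0 // ltW.
  rewrite (eq_bigr (fun j : 'I_d => \sum_(x' <- z) ind R ((Dn x' <= 2 ^ be)%N && Dj x' j))).
    by rewrite exchange_big; apply: ler_sum => x' _; exact: good_Dn_le.
  by move=> j _; exact: count_ind.
have -> : Dw x = \sum_(j < d) ind R (Dj x j).
  by rewrite /Dw (minn_idPl hD) /Dn natr_sum.
apply: le_trans (_ : Vw z x + \sum_(j < d) ind R (Dj x j) + \sum_(j < d) ind R (far j) <= _).
  rewrite /wtz natr_sum /Vw -!big_split /=; apply: ler_sum => j _; rewrite /far /Dj /ind -!natrD ler_nat.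
  by case: (star y j); case: (inC n th z j); case: (bit x j); case: (center th z j); case: (yb y j).
by lra.
Qed.

(** Off-center outside C means that the value of [x] at [j] occurs fewer than [th] times among the
    draws. By exchangeability each of the two values contributes at most th/n = 1/(32 * 2^a). *)
Lemma EVj j : itE Epi n (fun z => Epi (fun x =>
    ind R (~~ inC n th z j && (bit x j != center th z j)))) <= (16 * 2 ^+ a)^-1.
Proof.
pose P1 (x : cube d) := bit x j; pose P2 (x : cube d) := ~~ bit x j.
apply: le_trans (_ : itE Epi n (fun z =>
   Epi (fun x => ind R (P1 x)) * ind R (count P1 z < th)%N +
   Epi (fun x => ind R (P2 x)) * ind R (count P2 z < th)%N) <= _).
  apply: (itE_le isE_Epi) => z sz.
  rewrite mulrC [X in _ + X]mulrC -!(E_scale isE_Epi) -(E_add isE_Epi).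
  apply: (E_mono isE_Epi) => x; rewrite /ind -!natrM -natrD ler_nat /P1 /P2.
  have := count_predC (fun x : cube d => bit x j) z; rewrite sz /= => E.
  rewrite /inC /center -/(cnt z j); rewrite -/(cnt z j) in E.
  rewrite (eq_count (a2 := predC (fun x0 : cube d => bit x0 j))) //.
  move: E; set q := count _ z.
  have aux (c : nat) (f : bool) : (c + q)%N = n ->
      (~~ ((th <= c) && (c + th <= n)) && (f != (th <= c)) <=
       (c < th) * f + (q < th) * ~~ f)%N.
    by clear; case: f => /= E; case: (leqP th c) => /=; case: (leqP (c + th) n) => /=;
      case: (ltnP q th) => //=; lia.
  by move=> /aux.
rewrite (E_add hEz) !(E_scale hEz).
have n0 : 0 < n%:R :> R by rewrite nR !mulr_gt0.
have half (P : pred (cube d)) : Epi (fun x => ind R (P x)) *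
    itE Epi n (fun z => ind R (count P z < th)%N) <= (32 * 2 ^+ a)^-1.
  have := itE_count_lt isE_Epi n th P; set p := Epi _; set i := itE _ _ _; rewrite -mulrA => H.
  have pi0 : 0 <= p * i.
    by rewrite mulr_ge0 //; [apply: (E_ge0 isE_Epi)|apply: (E_ge0 hEz)] => ?; exact: ind_ge0.
  rewrite -(ler_pM2l n0); apply: le_trans (_ : th%:R <= _).
    by apply: le_trans H; apply: ler_wpM2r => //; rewrite ler_nat.
  rewrite nR Hth natrM le_eqVlt; apply/orP; left; apply/eqP; field.
  by rewrite gt_eqF.
have := half P1; have := half P2.
have -> : (16 * 2 ^+ a)^-1 = 2 * (32 * 2 ^+ a)^-1 :> R by field; rewrite gt_eqF.
by lra.
Qed.

Lemma EV : itE Epi n (fun z => Epi (Vw z)) <= M%:R / 16.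
Proof.
rewrite (_ : itE _ _ _ = \sum_(j < d) itE Epi n (fun z => Epi (fun x =>
    ind R [&& star y j, ~~ inC n th z j & bit x j != center th z j]))); last first.
  by rewrite -(E_sum hEz); apply: E_ext => z; rewrite -(E_sum isE_Epi).
apply: le_trans (_ : \sum_(j < d) (16 * 2 ^+ a)^-1 * (star y j)%:R <= _).
  apply: ler_sum => j _; case: (star y j) => /=; first by rewrite mulr1; exact: EVj.
  rewrite mulr0 (_ : itE _ _ _ = 0) //; rewrite -[RHS](E_const hEz); apply: E_ext => z.
  by rewrite (E_const isE_Epi).
rewrite -mulr_sumr -natr_sum -/(rk (star y) d) rk_star mulrC.
rewrite ler_pdivrMr ?mulr_gt0 //.
have : (stars y)%:R <= 2 ^+ be :> R by rewrite -natrX ler_nat.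
have -> : M%:R / 16 * (16 * 2 ^+ a) = 2 ^+ a * M%:R :> R by field.
by move=> hs; apply: le_trans hs sM.
Qed.

(** The five terms of [wtz_le] average to at most M/16, M/1024, M/16, M/1024 and 2M/1024. *)
Lemma Pwt : itE Epi n (fun z => Epi (fun x => ind R (M < wtz z x)%N)) <= 4^-1.
Proof.
have n0 : 0 < n%:R :> R by rewrite nR !mulr_gt0.
rewrite -(ler_pM2l M0) -(E_scale hEz).
apply: le_trans (_ : itE Epi n (fun z => M%:R * ind R (h <= nbad z)%N +
    M%:R * Epi (fun x => ind R (2 ^ be < Dn x)%N) + Epi (Vw z) + Epi Dw +
    2 / n%:R * \sum_(x' <- z) Dw x') <= _).
  apply: (itE_le isE_Epi) => z sz; rewrite -(E_scale isE_Epi).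
  apply: le_trans (E_mono isE_Epi (fun x => wtz_le x sz)) _.
  by rewrite !(E_add isE_Epi) !(E_const isE_Epi) !(E_scale isE_Epi).
rewrite !(E_add hEz) !(E_const hEz) !(E_scale hEz) (itE_sum_seq isE_Epi).
have -> : 2 / n%:R * (n%:R * Epi Dw) = 2 * Epi Dw by field; rewrite gt_eqF.
have h3 : 2 ^+ be / (1024 * 2 ^+ a) <= M%:R / 1024 :> R.
  rewrite ler_pdivrMr ?mulr_gt0 //; apply: le_trans sM _.
  by rewrite le_eqVlt; apply/orP; left; apply/eqP; field.
have h4 := ler_wpM2l (ltW M0) Pnbad.
have h5 : M%:R * Epi (fun x => ind R (2 ^ be < Dn x)%N) <= M%:R / 1024.
  apply: ler_wpM2l; first exact: ltW.
  apply: le_trans Pbig _; rewrite lef_pV2 ?posrE ?mulr_gt0 //.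
  by have s1' : (1 : R) <= 2 ^+ a := s1; lra.
have h7 := le_trans small h3.
have h8 : 2 * Epi Dw <= 2 * (M%:R / 1024) by apply: ler_wpM2l.
apply: le_trans (lerD (lerD (lerD (lerD h4 h5) EV) h7) h8) _.
by have := M0; move: (M%:R : R) => q; lra.
Qed.

(** Here rho/4 = 1/(2048 * 2^a), and bad events of total weight at most 1/16 + 1/16 + 1/4 leave the
    factor 1/2. *)
Lemma pay_small : mu * (4096 * 2 ^+ a)^-1 <= itE Epi n pay.
Proof.
apply: le_trans (itE_le isE_Epi pay_ge).
rewrite (E_scale hEz) !(E_sub hEz) (E_const hEz).
have c0 : 0 <= mu * (rho / 4) by rewrite mulr_ge0 ?divr_ge0 // ltW.
have -> : mu * (4096 * 2 ^+ a)^-1 = mu * (rho / 4) * 2^-1.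
  by rewrite /rho; field; rewrite gt_eqF.
apply: ler_wpM2l => //.
by have := Pnbad; have := Pnjunk; have := Pwt; lra.
Qed.

End SmallWeight.

(** The parity over Q alone does it: average [Q_kills] over [A], with 8 * 1024 = 8192. *)
Lemma pay_large z : 2 ^+ be / (1024 * 2 ^+ a) <= Epi Dw -> mu * (8192 * 2 ^+ a)^-1 <= pay z.
Proof.
move=> large.
apply: le_trans (_ : itE Ec (ncoin d a be) (fun c => mu * Epi (fun x =>
    ind R (par (fun j => can_e be y c && Qset be c j) x !=
           ypar y (fun j => can_e be y c && Qset be c j)))) <= _); last first.
  apply: (E_mono (isE_it hEc _)) => c; rewrite mu_Epi; apply: mass_le => x /andP[-> hx] /=.
  by rewrite /alive1 /parok /= (negbTE hx).
rewrite (E_scale (isE_it hEc _)); apply: ler_wpM2l; first exact: ltW.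
rewrite (commE_it (ncoin d a be) (commE_Ef (fun _ : bool => 2^-1) isE_Epi)).
apply: le_trans (E_mono isE_Epi Q_kills).
rewrite (_ : Epi _ = (8 * 2 ^+ be)^-1 * Epi Dw); last first.
  by rewrite -(E_scale isE_Epi); apply: E_ext => x; rewrite mulrC.
have -> : (8192 * 2 ^+ a)^-1 = (8 * 2 ^+ be)^-1 * (2 ^+ be / (1024 * 2 ^+ a)) :> R.
  by field; rewrite !gt_eqF.
by apply: ler_wpM2l => //; rewrite invr_ge0 mulr_ge0 // ltW.
Qed.

(** A group misses [A] with probability at most 1/(1 + G mu) <= 1/(2n), so all groups succeed with
    probability at least 1/2. This lowers the rate of [pay_small] to that of [pay_large]. *)
Lemma round_pay eps : eps / 2 <= mu -> (4 * n)%:R <= eps * G%:R ->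
  mu * (8192 * 2 ^+ a)^-1 <= itE El (n * G) (fun s => pay (zlist n G A s)).
Proof.
move=> hmu hG.
have [large|small] := leP (2 ^+ be / (1024 * 2 ^+ a)) (Epi Dw).
  rewrite -[leLHS](E_const (isE_it hEl (n * G))); apply: (E_mono (isE_it hEl _)) => s.
  exact: pay_large.
apply: le_trans (groups_ge n pay_ge0).
have n0 : 0 < n%:R :> R by rewrite nR !mulr_gt0.
have mu1 : mu <= 1 by rewrite -lam1 /mass; exact: (mass_le (B' := xpredT)).
set q := (1 - mu) ^+ G.
have q0 : 0 <= q by rewrite exprn_ge0 // subr_ge0.
have hq : n%:R * q <= 2^-1.
  have := exp_1B_le G (ltW mu0) mu1; rewrite -/q => hq.
  have hG2 : 2 * n%:R <= G%:R * mu.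
    have := ler_wpM2l (ler0n R G) hmu; rewrite natrM in hG; lra.
  have : q <= (2 * n%:R)^-1.
    by apply: le_trans hq _; rewrite lef_pV2 ?posrE; lra.
  move=> hq2; apply: le_trans (ler_wpM2l (ltW n0) hq2) _.
  have -> : n%:R * (2 * n%:R)^-1 = 2^-1 :> R by field; rewrite gt_eqF.
  by [].
have q1 : q <= 1.
  by rewrite exprn_ile1 ?subr_ge0 // lerBlDr lerDl ltW.
have := exp_1B_ge n q0 q1; set e := (1 - q) ^+ n => he.
have hp := pay_small (ltW small).
have p0 : 0 <= mu * (4096 * 2 ^+ a)^-1.
  by rewrite mulr_ge0 ?invr_ge0 ?mulr_ge0 // ltW.
have -> : mu * (8192 * 2 ^+ a)^-1 = 2^-1 * (mu * (4096 * 2 ^+ a)^-1).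
  by field; rewrite gt_eqF.
by apply: ler_pM => //; lra.
Qed.

End Round.

(** No progress is claimed below mass eps/2: there the right-hand side exceeds the mass of [A],
    which a round never increases. *)
Lemma round_contract (R : realType) (d n G th M a be : nat) (lam : {ffun cube d -> R})
    (y : pattern d) (A : cube d -> bool) (eps : R) :
  is_dist lam -> (stars y <= 2 ^ be)%N -> th = (2 * (a + 4))%N ->
  (2 ^ be <= 2 ^ a * M)%N -> (M <= 2 ^ be)%N -> n = (64 * (2 ^ a * (a + 4)))%N ->
  0 < eps -> (4 * n)%:R <= eps * G%:R ->
  itE (Ef lam) (n * G) (fun s => itE (@Ec R) (ncoin d a be) (fun c =>
    mass lam (fun x => A x && alive1 M (canc n th M a be y (zlist n G A s) c) x))) <=
  (1 - (8192 * 2 ^+ a)^-1) * mass lam A + (8192 * 2 ^+ a)^-1 * (eps / 2).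
Proof.
move=> dist hs Hth HM HMW Hn e0 hG.
have hE : isE (Ef lam) by have [l0 l1] := dist; exact: isE_Ef.
have l0 : forall x, 0 <= lam x by have [] := dist.
set q : R := (8192 * 2 ^+ a)^-1.
have q0 : 0 <= q by rewrite invr_ge0 mulr_ge0 // exprn_ge0.
have split s c : mass lam (fun x => A x && alive1 M (canc n th M a be y (zlist n G A s) c) x) =
    mass lam A - killmass n th M a be lam y A (zlist n G A s) c.
  apply/eqP; rewrite eq_sym subr_eq; apply/eqP; rewrite /killmass /mass.
  rewrite (bigID (fun x => alive1 M (canc n th M a be y (zlist n G A s) c) x)) /=.
  by [].
rewrite (_ : itE _ _ _ = mass lam A -
    itE (Ef lam) (n * G) (fun s => pay n th M a be lam y A (zlist n G A s))); last first.
  rewrite -[X in X - _](E_const (isE_it hE (n * G))) -(E_sub (isE_it hE _)); apply: E_ext => s.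
  rewrite -[X in X - _](E_const (isE_it (isE_Ec R) (ncoin d a be))) -(E_sub (isE_it (isE_Ec R) _)).
  by apply: E_ext => c.
have [hm|hm] := leP (eps / 2) (mass lam A).
  have mu0 : 0 < mass lam A by lra.
  have := round_pay (h := (a + 4)%N) dist hs mu0 Hth HM HMW erefl Hn hm hG; rewrite -/q => hp.
  have := mulr_ge0 q0 (ltW e0); lra.
have p0 : 0 <= itE (Ef lam) (n * G) (fun s => pay n th M a be lam y A (zlist n G A s)).
  by apply: (E_ge0 (isE_it hE _)) => s; exact: pay_ge0.
have := ler_wpM2l q0 (ltW hm); lra.
Qed.

(** * Correctness *)

Section Blocks.
Variable T : Type.
Implicit Types s : seq T.

Definition blk m s t : seq T := take m (drop (t * m) s).

Lemma blk_take m s t L : (t < L)%N -> blk m (take (L * m) s) t = blk m s t.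
Proof. by move=> ht; rewrite /blk !take_drop take_takel // -mulSn leq_mul2r ht orbT. Qed.

Lemma blk_catl m s s' t L : size s = (L * m)%N -> (t < L)%N -> blk m (s ++ s') t = blk m s t.
Proof. by move=> hs ht; rewrite -(blk_take m (s ++ s') ht) -hs take_size_cat. Qed.

Lemma blk_catr m s s' L : size s = (L * m)%N -> size s' = m -> blk m (s ++ s') L = s'.
Proof. by move=> hs hs'; rewrite /blk -hs drop_size_cat // -hs' take_size. Qed.

Lemma blk_mkseq (f : nat -> T) m t N : (t.+1 * m <= N)%N ->
  mkseq (fun i => f (t * m + i)%N) m = blk m (mkseq f N) t.
Proof.
move=> hN; rewrite /blk /mkseq -map_drop -map_take drop_iota take_iota.
have -> : minn m (N - t * m) = m by apply/minn_idPl; lia.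
by rewrite add0n -[(t * m)%N in RHS]addn0 iotaDl -map_comp.
Qed.

End Blocks.

Lemma Kcan_ext d n G th M a be (y : pattern d) ss cs ss' cs' T :
  (forall t, (t < T)%N -> ss t = ss' t) -> (forall t, (t < T)%N -> cs t = cs' t) ->
  Kcan n G th M a be y ss cs T = Kcan n G th M a be y ss' cs' T.
Proof.
elim: T => //= T IH hs hc; rewrite (hs T) // (hc T) // IH // => t ht; [apply: hs|apply: hc];
  exact: ltnW.
Qed.

(** * Equality test by random inner products *)

Section Hash.
Variable R : realType.
Local Notation Ec := (@Ec R).
Local Notation hEc := (@isE_Ec R).

Lemma itE_takeN (T : Type) (E : (T -> R) -> R) n N F : isE E -> (n <= N)%N ->
  itE E N (fun s => F (take n s)) = itE E n F.
Proof. by move=> hE /subnKC <-; exact: itE_take. Qed.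

(** A single coin at a position where [g] holds makes the parity uniform, whatever the other coins
    are. *)
Lemma odd_half d (g : nat -> bool) b j : (j < d)%N -> g j ->
  itE Ec d (fun c => ind R (odd (\sum_(i < d) (nth false c i && g i)) == b)) = 2^-1.
Proof.
elim: d g b j => // d IH g b j hj gj /=; rewrite EcE.
have E c0 : itE Ec d (fun s => ind R (odd (\sum_(i < d.+1)
      (nth false (c0 :: s) i && g i)) == b)) =
    itE Ec d (fun s => ind R ((c0 && g 0%N) (+)
      odd (\sum_(i < d) (nth false s i && g i.+1)) == b)).
  by apply: E_ext => s; rewrite big_ord_recl oddD oddb.
rewrite !E /=; case g0: (g 0%N).
  rewrite -(E_add (isE_it hEc d)).
  rewrite (_ : itE _ _ _ = 1); first by rewrite mul1r.
  rewrite -[RHS](E_const (isE_it hEc d)); apply: E_ext => s; rewrite /ind.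
  by move: (odd _) => o; clear E; case: o; case: b; rewrite /= ?addr0 ?add0r.
have {}IH : itE Ec d (fun s => ind R (odd (\sum_(i < d) (nth false s i && g i.+1)) == b)) = 2^-1.
  by case: j hj gj => [|j] hj gj; [rewrite g0 in gj|exact: (IH (fun i => g i.+1) b j)].
by rewrite IH; lra.
Qed.

Lemma hpar_half d (f1 f2 : nat -> bool) j : (j < d)%N -> f1 j != f2 j ->
  itE Ec d (fun c => ind R (hpar d c f1 == hpar d c f2)) = 2^-1.
Proof.
move=> hj hf; rewrite -(@odd_half d (fun i => f1 i (+) f2 i) false j hj); last first.
  by move: hf; case: (f1 j); case: (f2 j).
apply: E_ext => c; congr ind; rewrite /hpar.
have -> : odd (\sum_(i < d) (nth false c i && (f1 i (+) f2 i))) =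
    odd (\sum_(i < d) (nth false c i && f1 i)) (+) odd (\sum_(i < d) (nth false c i && f2 i)).
  rewrite -oddD -big_split /=; elim/big_rec2: _ => // i p q _; rewrite !oddD => ->.
  by congr (_ (+) _); case: (nth _ _ _); case: (f1 i); case: (f2 i).
by case: (odd _); case: (odd _).
Qed.

Lemma itE_all_half (E : (bool -> R) -> R) k : isE E -> E (fun b => ind R b) = 2^-1 ->
  itE E k (fun s => ind R (all id s)) = 2^-1 ^+ k.
Proof.
move=> hE h; elim: k => [|k IH] //=; rewrite exprS -{1}h mulrC -(E_scale hE).
apply: E_ext => b; case: b => /=; first by rewrite IH indT mulr1.
by rewrite indF mulr0 (E_const (isE_it hE k)).
Qed.

Lemma hash_prob d k (f1 f2 : nat -> bool) j : (j < d)%N -> f1 j != f2 j ->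
  itE Ec (k * d) (fun c => ind R (all (fun i => hpar d (blk d c i) f1 == hpar d (blk d c i) f2)
    (iota 0 k))) = 2^-1 ^+ k.
Proof.
move=> hj hf.
pose E' (g : bool -> R) := itE Ec d (fun c => g (hpar d c f1 == hpar d c f2)).
have hE' : isE E'.
  have hh := isE_it hEc d; split=> [f g|c f|f g hfg|]; rewrite /E'.
  - exact: (E_add hh).
  - exact: (E_scale hh).
  - by apply: (E_mono hh) => s.
  - exact: (E_one hh).
rewrite -(itE_all_half k hE' (hpar_half hj hf)).
rewrite -(itE_blocks (fun c => hpar d c f1 == hpar d c f2) k d (fun s => ind R (all id s)) hEc).
by apply: E_ext => c; congr ind; rewrite all_map.
Qed.

End Hash.

Section Correct.
Variables (R : realType) (d n G th M L a be nsl k w : nat).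
Hypotheses (d0 : (0 < d)%N) (n0 : (0 < n)%N) (G0 : (0 < G)%N) (L0 : (0 < L)%N).
Hypotheses (hw : (w <= 2 ^ be)%N) (Hth : th = (2 * (a + 4))%N).
Hypotheses (HM : (2 ^ be <= 2 ^ a * M)%N) (HMW : (M <= 2 ^ be)%N).
Hypothesis Hn : n = (64 * (2 ^ a * (a + 4)))%N.
Hypothesis Hnsl : (skip a * M + (w + M) <= skip a * nsl)%N.
Variables (eps delta : R).
Hypotheses (eps0 : 0 < eps) (hG : (4 * n)%:R <= eps * G%:R).
Hypothesis hL : (1 - (8192 * 2 ^+ a)^-1) ^+ L <= eps / 2.
Hypothesis hk : 2^-1 ^+ k <= delta.

Local Notation P := (prot R d n G th M L a be nsl k).
Local Notation N := (tlen d n G L a be k).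
Local Notation Ec := (@Ec R).
Local Notation hEc := (@isE_Ec R).
Local Notation nc := (ncoin d a be).
Local Notation nG := (n * G)%N.

Variables (lam : {ffun cube d -> R}) (y : pattern d).
Hypotheses (dist : is_dist lam) (hy : (stars y <= w)%N).
Local Notation El := (Ef lam).

Let hEl : isE El. Proof. by have [l0 l1] := dist; exact: isE_Ef. Qed.
Let lam0 x : 0 <= lam x. Proof. by have [] := dist. Qed.
Let lam1 : \sum_x lam x = 1. Proof. by have [] := dist. Qed.
Let hy2 : (stars y <= 2 ^ be)%N. Proof. exact: leq_trans hw. Qed.
Let LG_le : (L * nG <= N)%N. Proof. by rewrite /tlen leq_addr. Qed.
Let Lc_le : (L * nc <= N)%N. Proof. by rewrite /tlen addnCA leq_addr. Qed.
Let kd_le : (k * d <= N)%N. Proof. by rewrite /tlen addnA leq_addl. Qed.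

Lemma tape_sampled (r : tape d N) : 0 < tape_law lam r ->
  forall i, (i < L * nG)%N -> sample r i full_query = Some (pub_sample r i).
Proof. by move=> hr i hi; apply: (tape_law_sampled dist) => //; exact: leq_trans LG_le. Qed.

Lemma sum_tape_law : \sum_(r : tape d N) tape_law lam r = 1.
Proof.
rewrite -[RHS](E_const (isE_it hEc N)).
rewrite (_ : itE _ _ _ = itE Ec N (fun=> itE El N (fun=> 1))); last first.
  by apply: E_ext => c; rewrite (E_const (isE_it hEl N)).
rewrite -(tape_expect N dist (fun _ _ => 1)).
by apply: eq_bigr => r _; rewrite mulr1.
Qed.

Local Notation hb := pri_coins_of.
Local Notation good m x r := (good n G th M L a be nsl
  (pub_samples_of n G r) (pub_coins_of a be r) m y x).
Local Notation Kc r := (Kcan n G th M a be y (pub_samples_of n G r) (pub_coins_of a be r) L).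

Section Outcome.
Variables (x : cube d) (m : (alen L a nsl).-tuple bool) (rpub : tape d N).
Hypothesis posr : 0 < tape_law lam rpub.

Local Notation ss := (pub_samples_of n G rpub).
Local Notation cs := (pub_coins_of a be rpub).
Local Notation U := (Uj n G th M L a be nsl ss cs m).
Local Notation xh := (xhat n G th M L a be nsl ss cs m y).

Lemma output_bres rpri : output (P := P) lam x y m rpub rpri = bres th M x y m rpub rpri.
Proof.
have [sa [sb [sc [E _ [Eb _] _ _]]]] :=
  exec_final th M d0 n0 G0 L0 lam x y m rpri (tape_sampled posr).
by rewrite /output E /= Eb.
Qed.

Lemma bresE (rpri : tape d N) : bres th M x y m rpub rpri =
  [&& bobok n G th M L a be nsl ss cs m y, aliceok n G th M L a be ss cs m x &
    all (fun i => hpar d (hb rpri i) (fun j => U j && bit x j) ==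
                  hpar d (hb rpri i) (fun j => U j && xh j)) (iota 0 k)].
Proof.
rewrite /bres /bob_result /amsg /alice_msg /=; congr [&& _, _ & _].
apply: eq_in_all => i; rewrite mem_iota add0n => /andP[_ hi].
by rewrite nth_mkseq.
Qed.

Lemma good_output rpri : good m x rpub -> output (P := P) lam x y m rpub rpri.
Proof.
move=> /and3P[hb1 ha /allP hx]; rewrite output_bres bresE hb1 ha /=.
apply/allP => i _; apply/eqP; rewrite /hpar; congr odd; apply: eq_bigr => j _.
have /implyP := hx j ltac:(by rewrite mem_iota ltn_ord).
by case: (U j) => //= /(_ isT)/eqP->.
Qed.

(** Either a deterministic check fails and acceptance is impossible, or [x] and Bob's reconstruction
    differ on U; each inner product with private coins, of which the advice is independent,
    overlooks this with probability 1/2. *)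
Lemma bad_accept : ~~ good m x rpub -> accept_prob (P := P) lam x y m rpub <= delta.
Proof.
move=> bad; rewrite /accept_prob.
have delta0 : 0 <= delta by apply: le_trans hk; rewrite exprn_ge0 ?invr_ge0.
have [ok|nok] := boolP (bobok n G th M L a be nsl ss cs m y && aliceok n G th M L a be ss cs m x);
  last first.
  rewrite big1 // => rpri; rewrite output_bres bresE andbA (negbTE nok).
  by [].
move: bad; rewrite -[good _ _ _]/([&& bobok n G th M L a be nsl ss cs m y,
  aliceok n G th M L a be ss cs m x & all (fun j => U j ==> (bit x j == xh j)) (iota 0 d)]).
rewrite andbA ok /= => /allPn[j]; rewrite mem_iota add0n => /andP[_ hj].
rewrite negb_imply => /andP[Uj0 ne].
pose f1 j := U j && bit x j; pose f2 j := U j && xh j.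
apply: le_trans hk; rewrite -(@hash_prob R d k f1 f2 j) //; last by rewrite /f1 /f2 Uj0.
rewrite -(@itE_takeN _ _ _ _ N _ hEc kd_le).
(* A dummy average over samples brings the expression into the form of [tape_expect]. *)
rewrite (_ : itE _ _ _ = itE Ec N (fun c => itE El N (fun=> ind R (all (fun i =>
    hpar d (blk d (take (k * d) c) i) f1 == hpar d (blk d (take (k * d) c) i) f2) (iota 0 k)))));
  last by apply: E_ext => c; rewrite (E_const (isE_it hEl N)).
rewrite -(tape_expect N dist (fun c _ => ind R (all (fun i =>
    hpar d (blk d (take (k * d) c) i) f1 == hpar d (blk d (take (k * d) c) i) f2) (iota 0 k)))).
rewrite big_mkcond; apply: ler_sum => rpri _.
have t0 := tape_law_ge0 dist rpri.
rewrite output_bres bresE.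
have -> : all (fun i => hpar d (hb rpri i) (fun j => U j && bit x j) ==
                  hpar d (hb rpri i) (fun j => U j && xh j)) (iota 0 k) =
   all (fun i => hpar d (blk d (take (k * d) (tape_coins rpri)) i) f1 ==
                 hpar d (blk d (take (k * d) (tape_coins rpri)) i) f2) (iota 0 k).
  apply: eq_in_all => i; rewrite mem_iota add0n => /andP[_ hi].
  rewrite blk_take // -(blk_mkseq (coin rpri)) //; apply: leq_trans kd_le.
  by rewrite leq_mul2r hi orbT.
set b := all _ _; rewrite /ind; case: b; first by rewrite mulr1; case: ifP.
by rewrite !andbF mulr0.
Qed.

End Outcome.

Lemma special_good x (r : tape d N) m : good (m : (alen L a nsl).-tuple bool) x r ->
  good (special_of th M nsl x y r) x r /\ m = special_of th M nsl x y r.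
Proof.
move=> gm; have gs : good (special_of th M nsl x y r) x r.
  by rewrite /special_of; case: pickP => [m' //|/(_ m)]; rewrite gm.
split=> //; apply: val_inj; apply: (good_uniq _ _ gm gs); exact: size_tuple.
Qed.

Lemma special_match x (r : tape d N) : fpm x y -> good (special_of th M nsl x y r) x r.
Proof.
move=> fx.
have [m /eqP sm gm] := good_exists n G th L be (pub_samples_of n G r) (pub_coins_of a be r)
  fx hy Hnsl.
by have [] := @special_good x r (Tuple sm) gm.
Qed.

Definition surv T : R := itE Ec (T * nc) (fun C => itE El (T * nG) (fun S =>
  mass lam (alive M (Kcan n G th M a be y (blk nG S) (blk nc C) T)))).

(** Condition on the first [T] rounds and apply [round_contract] to the fresh samples and coins of
    the next one. *)
Lemma survS T : surv T.+1 <= (1 - (8192 * 2 ^+ a)^-1) * surv T + (8192 * 2 ^+ a)^-1 * (eps / 2).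
Proof.
rewrite /surv [(T.+1 * nc)%N]mulSnr [(T.+1 * nG)%N]mulSnr itE_add.
rewrite -(E_scale (isE_it hEc _)) -[X in _ <= _ + X](E_const (isE_it hEc (T * nc))).
rewrite -(E_add (isE_it hEc _)); apply: (itE_le hEc) => C sC.
rewrite (_ : itE Ec nc _ = itE Ec nc (fun c => itE El (T * nG) (fun S => itE El nG (fun s =>
  mass lam (alive M (Kcan n G th M a be y (blk nG (S ++ s)) (blk nc (C ++ c)) T.+1)))))); last first.
  by apply: E_ext => c; rewrite itE_add.
rewrite (commE_it nc (commE_Ef (fun _ : bool => 2^-1) (isE_it hEl (T * nG)))).
rewrite -(E_scale (isE_it hEl _)) -[X in _ <= _ + X](E_const (isE_it hEl (T * nG))).
rewrite -(E_add (isE_it hEl _)); apply: (itE_le hEl) => S sS.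
rewrite (commE_it nc (commE_Ef (fun _ : bool => 2^-1) (isE_it hEl nG))).
set A := alive M _.
apply: le_trans (round_contract A dist hy2 Hth HM HMW Hn eps0 hG).
apply: (itE_le hEl) => s hs; apply: (itE_le hEc) => c hc; apply: mass_le => // x.
rewrite /= (blk_catr sS hs) (blk_catr sC hc).
rewrite (@Kcan_ext _ _ _ _ _ _ _ _ _ _ (blk nG S) (blk nc C)) => [|t ht|t ht]; last 2 first.
- exact: (blk_catl _ sS).
- exact: (blk_catl _ sC).
by rewrite -/A /alive all_rcons andbC.
Qed.

(** The recursion has the fixed point eps/2, and the excess decays like (1 - q)^T, which [hL] bounds
    by eps/2 at T = L. *)
Lemma surv_le : surv L <= eps.
Proof.
set q : R := (8192 * 2 ^+ a)^-1.
have q0 : 0 <= q by rewrite invr_ge0 mulr_ge0 // exprn_ge0.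
have q1 : q <= 1.
  have s1 : (1 : R) <= 2 ^+ a by rewrite -natrX ler1n expn_gt0.
  by rewrite invf_le1 ?mulr_gt0 ?exprn_gt0 //; lra.
have h T : surv T <= (1 - q) ^+ T + eps / 2.
  elim: T => [|T IH].
    rewrite /surv !mul0n /= expr0; apply: le_trans (_ : mass lam xpredT <= _).
      exact: mass_le.
    have -> : mass lam xpredT = 1 by exact: lam1.
    by rewrite lerDl divr_ge0 // ltW.
  apply: le_trans (survS T) _; rewrite -/q exprS.
  have := ler_wpM2l (_ : 0 <= 1 - q) IH; rewrite subr_ge0 => /(_ q1).
  by move: (surv T) ((1 - q) ^+ T) => v p; lra.
apply: le_trans (h L) _; have := hL; rewrite -/q; lra.
Qed.

Lemma alive_prob :
  \sum_x \sum_(r : tape d N) lam x * tape_law lam r * ind R (alive M (Kc r) x) = surv L.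
Proof.
rewrite exchange_big /=.
transitivity (\sum_(r : tape d N) tape_law lam r * mass lam (alive M
   (Kcan n G th M a be y (blk nG (take (L * nG) (tape_samples r)))
     (blk nc (take (L * nc) (tape_coins r))) L))).
  apply: eq_bigr => r _; rewrite /mass mulr_sumr [RHS]big_mkcond; apply: eq_bigr => x _.
  rewrite (@Kcan_ext _ _ _ _ _ _ _ _ _ _ (blk nG (take (L * nG) (tape_samples r)))
     (blk nc (take (L * nc) (tape_coins r)))) => [|t ht|t ht]; last 2 first.
  - by rewrite blk_take // -blk_mkseq //; apply: leq_trans LG_le; rewrite leq_mul2r ht orbT.
  - by rewrite blk_take // -blk_mkseq //; apply: leq_trans Lc_le; rewrite leq_mul2r ht orbT.
  by rewrite /ind; case: ifP => _; rewrite ?mulr1 ?mulr0 // mulrC.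
rewrite (tape_expect N dist (fun C S => mass lam (alive M
   (Kcan n G th M a be y (blk nG (take (L * nG) S)) (blk nc (take (L * nc) C)) L)))).
rewrite (@itE_takeN _ _ _ (L * nc) N (fun C => itE El N (fun S => mass lam (alive M
   (Kcan n G th M a be y (blk nG (take (L * nG) S)) (blk nc C) L)))) hEc Lc_le).
apply: E_ext => C.
exact: (@itE_takeN _ _ _ (L * nG) N (fun S => mass lam (alive M
   (Kcan n G th M a be y (blk nG S) (blk nc C) L))) hEl LG_le).
Qed.

(** Matching inputs cause no error. For the others the special advice can be good only if [x]
    survives all rounds, which has total weight eps; otherwise it is accepted with probability at
    most delta. *)
Lemma error_le : error P lam y <= eps + delta.
Proof.
have delta0 : 0 <= delta by apply: le_trans hk; rewrite exprn_ge0 ?invr_ge0.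
apply: le_trans (_ : \sum_x \sum_(r : tape d N)
   (lam x * tape_law lam r * ind R (alive M (Kc r) x) + lam x * tape_law lam r * delta) <= _);
  last first.
  under eq_bigr do rewrite big_split /=.
  rewrite big_split /= alive_prob; apply: lerD; first exact: surv_le.
  rewrite (eq_bigr (fun x => lam x * delta)) => [|x _].
    by rewrite -mulr_suml lam1 mul1r.
  by rewrite -mulr_suml -mulr_sumr sum_tape_law mulr1.
apply: ler_sum => x _; apply: ler_sum => r _.
rewrite -mulrDr -mulr_sumr.
have tl0 := tape_law_ge0 dist r.
have [r0|/negbTE rn0] := eqVneq (tape_law lam r) 0; first by rewrite r0 mulr0 !mul0r.
apply: ler_wpM2l; first exact: mulr_ge0.
have posr : 0 < tape_law lam r by rewrite lt_def rn0.
have i0 := ind_ge0 R (alive M (Kc r) x).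
have [fx|nfx] := boolP (fpm x y).
  rewrite big_pred0 => [|rpri]; first exact: addr_ge0.
  by rewrite (good_output posr rpri (special_match r fx)).
have [g|bad] := boolP (good (special_of th M nsl x y r) x r); last first.
  by apply: le_trans (bad_accept posr bad) _; rewrite lerDr.
have [fx|->] := good_fpm_or_alive g; first by rewrite fx in nfx.
rewrite indT; apply: le_trans (_ : 1 <= _); last by rewrite lerDl.
rewrite -sum_tape_law big_mkcond; apply: ler_sum => rpri _.
by case: ifP => // _; exact: tape_law_ge0.
Qed.

Lemma match_output x (rpub rpri : tape d N) : 0 < tape_law lam rpub -> fpm x y ->
  output (P := P) lam x y (special_of th M nsl x y rpub) rpub rpri.
Proof. by move=> pos fx; apply: good_output => //; exact: special_match. Qed.

Lemma soundness_le x (rpub : tape d N) (m : (alen L a nsl).-tuple bool) :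
  0 < tape_law lam rpub -> m != special_of th M nsl x y rpub ->
  accept_prob (P := P) lam x y m rpub <= delta.
Proof.
move=> pos ne; apply: bad_accept => //; apply: contra ne => /special_good[_ <-].
by [].
Qed.

End Correct.

(** * Costs *)

(** Each line runs exactly once, so it is charged one step besides its bit length of at most 1 + 3
    bits. *)
Lemma compiled_time (base ng D dep cmax nt : nat) (O : Type) (osize : O -> nat) p r S :
  all (wfs base ng D dep cmax nt) p -> (r <= maxreg base ng D dep cmax nt)%N ->
  (psz p + 1 <= S)%N ->
  (code_size osize (compile base ng D nt O p ++ [:: Halt r]) +
   size (compile base ng D nt O p ++ [:: Halt r]) <=
   S * (2 + 3 * bits (maxreg base ng D dep cmax nt)))%N.
Proof.
move=> wp hr hS; set N := maxreg _ _ _ _ _ _ in hr *.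
have ch : all (cheap osize N) (compile base ng D nt O p ++ [:: Halt r]).
  rewrite all_cat (cheap_compile osize wp) /= andbT /cheap /=.
  by have := bits_le hr; lia.
have := code_size_cheap ch; rewrite size_cat size_compile /=.
move: (code_size _ _) (bits N) hS => c b hS hc.
apply: leq_trans (leq_mul hS (leqnn _)); lia.
Qed.

Section Sizes.
Variables (d n G th M L a be nsl k w : nat).
Hypotheses (d0 : (0 < d)%N) (n0 : (0 < n)%N) (G0 : (0 < G)%N) (L0 : (0 < L)%N).
Hypotheses (an : (8 * 2 ^ a <= n)%N) (thn : (th <= n)%N).
Hypotheses (w0 : (0 < w)%N) (wd : (w <= d)%N) (wLn : (w <= L * n)%N).
Hypotheses (bw : (2 ^ be <= 2 * w)%N) (MW : (M <= 2 ^ be)%N) (Ensl : nsl = (3 * M)%N).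

(** The dominant cost: in each of [L] rounds, [n * G] samples are tested on [d] coordinates against
    up to [L] announcements. *)
Definition vol : nat := (L * L * (n * G) * d)%N.

Lemma vol_ge p1 p2 p3 p4 p5 : (p1 <= L)%N -> (p2 <= L)%N -> (p3 <= n)%N -> (p4 <= G)%N ->
  (p5 <= d)%N -> (p1 * p2 * (p3 * p4) * p5 <= vol)%N.
Proof. by move=> *; rewrite /vol !leq_mul. Qed.

Let a8 : (a + 8 <= n)%N.
Proof. by apply: leq_trans an; have := ltn_expl a (isT : 1 < 2)%N; clear; lia. Qed.
Let nt_n : (ntry a <= n)%N.
Proof. by rewrite /ntry expnD; apply: leq_trans (leq_pred _) _; rewrite mulnC. Qed.
Let skip_n : (skip a <= n)%N.
Proof.
rewrite /skip expnD; apply: leq_trans (leq_pred _) _; apply: leq_trans an.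
by rewrite mulnC leq_mul2r orbT.
Qed.
Let be2 : (be.+2 <= 3 * w)%N.
Proof. by have := ltn_expl be (isT : 1 < 2)%N; move: bw w0; clear; lia. Qed.
Let nsl_w : (nsl <= 6 * w)%N. Proof. by move: bw MW Ensl; clear; lia. Qed.

Let v1 : (1 <= vol)%N. Proof. by have := vol_ge L0 L0 n0 G0 d0. Qed.
Let vd : (d <= vol)%N. Proof. by have := vol_ge L0 L0 n0 G0 (leqnn d); rewrite !mul1n. Qed.
Let vn : (n <= vol)%N.
Proof. by have := vol_ge L0 L0 (leqnn n) G0 d0; rewrite !mul1n !muln1. Qed.
Let vL : (L <= vol)%N.
Proof. by have := vol_ge (leqnn L) L0 n0 G0 d0; rewrite !muln1. Qed.
Let vLL : (L * L <= vol)%N.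
Proof. by have := vol_ge (leqnn L) (leqnn L) n0 G0 d0; rewrite !muln1. Qed.
Let vLd : (L * d <= vol)%N.
Proof. by have := vol_ge (leqnn L) L0 n0 G0 (leqnn d); rewrite !muln1. Qed.
Let vLn p : (p <= n)%N -> (L * p <= vol)%N.
Proof. by move=> hp; have := vol_ge (leqnn L) L0 hp G0 d0; rewrite !muln1. Qed.
Let vLnd p : (p <= n)%N -> (L * p * d <= vol)%N.
Proof. by move=> hp; have := vol_ge (leqnn L) L0 hp G0 (leqnn d); rewrite !muln1. Qed.
Let vnd p : (p <= n)%N -> (p * d <= vol)%N.
Proof. by move=> hp; have := vol_ge L0 L0 hp G0 (leqnn d); rewrite !mul1n !muln1. Qed.
Let vLnG : (L * (n * G) <= vol)%N.
Proof. by have := vol_ge (leqnn L) L0 (leqnn n) (leqnn G) d0; rewrite !muln1. Qed.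
Let vLnGd : (L * (n * G) * d <= vol)%N.
Proof. by have := vol_ge (leqnn L) L0 (leqnn n) (leqnn G) (leqnn d); rewrite !muln1. Qed.
Let vLLnd : (L * L * n * d <= vol)%N.
Proof. by have := vol_ge (leqnn L) (leqnn L) (leqnn n) G0 (leqnn d); rewrite !muln1. Qed.
Let x1 : (L * d * be.+2 <= 3 * vol)%N.
Proof.
apply: leq_trans (leq_mul (leqnn _) (leq_trans be2 (leq_mul (leqnn 3) wLn))) _.
by have := vLLnd; clear; lia.
Qed.
Let x2 : (L * ntry a * be.+2 <= 3 * vol)%N.
Proof.
apply: leq_trans (leq_mul (leqnn _) (leq_trans be2 (leq_mul (leqnn 3) wd))) _.
by have := vLnd nt_n; clear; lia.
Qed.
Let x5 : (d * nsl <= 6 * vol)%N.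
Proof.
apply: leq_trans (leq_mul (leqnn _) (leq_trans nsl_w (leq_mul (leqnn 6) wLn))) _.
by have := vLnd (leqnn n); clear; lia.
Qed.
Let x6 : (nsl * (a + 1) <= 6 * vol)%N.
Proof.
have a1 : (a + 1 <= n)%N by move: a8; clear; lia.
apply: leq_trans (leq_mul (leq_trans nsl_w (leq_mul (leqnn 6) wd)) (leqnn _)) _.
by have := vnd a1; clear; lia.
Qed.
Let x7 : (L * nsl <= 6 * vol)%N.
Proof.
apply: leq_trans (leq_mul (leqnn _) (leq_trans nsl_w (leq_mul (leqnn 6) wd))) _.
by have := vLd; clear; lia.
Qed.

Lemma progB_le : (progB d n G L a be nsl k <= 24 * vol + k * d)%N.
Proof.
have a3 : (a + 3 <= n)%N by move: a8; clear; lia.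
have y1 : (L * (n * G * L.+1 * d) <= 2 * vol)%N by move: vLnGd; rewrite /vol; clear; lia.
have y2 : (L * (d * (ntry a + be.+2)) <= 4 * vol)%N.
  by have := vLnd nt_n; move: x1; clear; lia.
have y3 : (L * (ntry a * be.+2 + (a + 3)) <= 4 * vol)%N.
  by have := vLn a3; move: x2; clear; lia.
have y4 : (d * (L + nsl + 1) <= 8 * vol)%N by move: vLd x5 vd; clear; lia.
rewrite /progB /roundB /finB !(mulnDr L); move: y1 y2 y3 y4 x6; rewrite !(mulnDr L).
clear; lia.
Qed.

Let c_le : (L * ncoin d a be <= 6 * vol)%N.
Proof. by rewrite /ncoin mulnDr; move: x1 x2; clear; lia. Qed.

Local Notation N := (maxreg (pbase d L a nsl) 29 (pD d n G L a be nsl) pdep (pcmax n th M a) L.+1).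

(** A crude bound on addresses is enough, since only their bit length enters the time. *)
Lemma maxreg_le : (N <= 40 * 40 * vol)%N.
Proof.
have yD : (L * pD d n G L a be nsl <= 19 * vol)%N.
  have hc := c_le; rewrite /pD; move: (ncoin d a be) hc => c hc; rewrite !(mulnDr L).
  have vA : (L * (n * G * d) <= vol)%N by rewrite mulnA.
  have vB : (L * (n * d) <= vol)%N by rewrite mulnA vLnd.
  have vD : (L * 2 <= vol * 2)%N by rewrite leq_mul2r vL.
  apply: leq_trans (leq_add vA (leq_add hc (leq_add vB (leq_add vLd (leq_add x7
    (leq_add vLL (leq_add (vLn nt_n) vD))))))) _.
  by move: vol => v; clear; lia.
have yD2 : (L.+1 * pD d n G L a be nsl <= 38 * vol)%N.
  have : (pD d n G L a be nsl <= L * pD d n G L a be nsl)%N by rewrite leq_pmull.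
  by rewrite mulSn; move: yD; clear; lia.
have yb : (pbase d L a nsl <= 14 * vol)%N.
  rewrite /pbase /alen; have := vLn a8; move: x6 vd; clear; lia.
have yc : (pcmax n th M a <= 8 * vol)%N.
  rewrite /pcmax; move: bw MW wd vn vd v1 thn nt_n skip_n; clear; lia.
rewrite /maxreg geq_max; apply/andP; split; last first.
  by apply: leq_trans yc _; rewrite leq_mul2r orbT.
rewrite /tmp /pdep; have -> : (L.+1 * 29 * pD d n G L a be nsl = 29 * (L.+1 * pD d n G L a be nsl))%N.
  by rewrite mulnAC mulnC.
move: yD2 yb v1; move: (L.+1 * _)%N (pbase _ _ _ _) vol => p q v; clear; lia.
Qed.

Lemma d4_maxreg : (d + 4 <= N)%N.
Proof. by rewrite /maxreg leq_max /tmp /pbase /pdep; apply/orP; left; clear; lia. Qed.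

Let kd : (k * d <= k * vol)%N. Proof. by rewrite leq_mul2l vd orbT. Qed.

Definition tmax : nat := (60 * 60 * (25 * (vol * k.+1)) * (2 + 3 * bits N))%N.

Let psz_le p : (psz p <= 60 * 60 * progB d n G L a be nsl k)%N ->
  (psz p + 1 <= 60 * 60 * (25 * (vol * k.+1)))%N.
Proof.
move=> hp; apply: leq_trans (leq_add hp (leqnn 1)) _.
have h1 : (progB d n G L a be nsl k + 1 <= 25 * (vol * k.+1))%N.
  by move: v1 kd progB_le; move: vol (progB _ _ _ _ _ _ _ _) => v q; clear; lia.
apply: leq_trans (leq_mul (leqnn (60 * 60)) h1); rewrite mulnDr leq_add2l.
by [].
Qed.

Lemma acode_time : (code_size alice_instr_size (acode d n G th M L a be nsl k) +
  size (acode d n G th M L a be nsl k) <= tmax)%N.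
Proof.
apply: compiled_time (wfs_aprog th M a be nsl k d0 n0 G0 L0) _ _ => //.
exact: psz_le (psz_aprog th M a be nsl k d0 n0 G0 L0).
Qed.

Lemma bcode_time : (code_size bob_instr_size (bcode d n G th M L a be nsl k) +
  size (bcode d n G th M L a be nsl k) <= tmax)%N.
Proof.
apply: compiled_time (wfs_bprog th M a be nsl k d0 n0 G0 L0) _ _.
  rewrite /maxreg leq_max; apply/orP; left; apply: ltnW; apply: reg_lt_tmp.
  by rewrite /okvar /pD /=; lia.
exact: psz_le (psz_bprog th M a be nsl k d0 n0 G0 L0).
Qed.

Let size_c : (size (@ccode d n G L a be k) <= 60 * 60 * (25 * (vol * k.+1)))%N.
Proof.
apply: leq_trans (_ : 25 * (vol * k.+1) <= _)%N; last by rewrite leq_pmull.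
rewrite size_ccode; have y1 : (L * (n * G * d.+1) <= 2 * vol)%N.
  by move: vLnGd vLnG; clear; lia.
have y2 : (k * (d * 2) <= 2 * (k * vol))%N by move: kd; clear; lia.
move: y1 y2 c_le v1; move: (ncoin d a be) vol => c v; clear; lia.
Qed.

Lemma ccode_time : (code_size carol_instr_size (@ccode d n G L a be k) +
  size (@ccode d n G L a be k) <= tmax)%N.
Proof.
have := code_size_cheap (@ccode_cheap d n G L a be k); have := bits_le d4_maxreg.
rewrite /tmax; move: size_c; set S := (60 * 60 * _)%N; move: (size _) (code_size _ _) (bits N).
move: (bits (d + 4)) S => b S s c b' hs hb hc.
apply: leq_trans (leq_mul hs (leqnn _)).
have : (s * (1 + 3 * b) <= s * (1 + 3 * b'))%N by rewrite leq_mul2l; apply/orP; right; lia.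
by move: hc; clear; rewrite !mulnDr; lia.
Qed.

Lemma nsamples_le : (L * (n * G) <= vol)%N.
Proof. exact: vLnG. Qed.

End Sizes.

(** * Logarithms *)

Section Logs.
Variable R : realType.
Implicit Types (x y t : R).

(** From ln(1 + x) <= x at x = -1/2. *)
Lemma ln2_ge : 2^-1 <= ln (2 : R).
Proof.
have := @le_ln1Dx R (- 2^-1); have -> : 1 + - 2^-1 = 2^-1 :> R by lra.
by rewrite lnV ?posrE // => h; have := h ltac:(lra); lra.
Qed.

Let ln2_gt0 : 0 < ln (2 : R). Proof. by have := ln2_ge; lra. Qed.

Lemma ler_log2 x y : 0 < x -> x <= y -> log2 x <= log2 y.
Proof.
move=> x0 xy; rewrite /log2 ler_pM2r ?invr_gt0 // ler_ln ?posrE //.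
exact: lt_le_trans xy.
Qed.

Lemma log2M x y : 0 < x -> 0 < y -> log2 (x * y) = log2 x + log2 y.
Proof. by move=> x0 y0; rewrite /log2 lnM ?posrE // mulrDl. Qed.

Lemma log2Xn x n : 0 < x -> log2 (x ^+ n) = n%:R * log2 x.
Proof. by move=> x0; rewrite /log2 lnXn // -[ln x *+ n]mulr_natl mulrA. Qed.

Lemma log2_2 : log2 2 = 1 :> R.
Proof. by rewrite /log2 divff // gt_eqF. Qed.

Lemma log2X n : log2 (2 ^+ n) = n%:R :> R.
Proof. by rewrite log2Xn // log2_2 mulr1. Qed.

Lemma log2_ge0 x : 1 <= x -> 0 <= log2 x.
Proof. by move=> x1; apply: divr_ge0; [exact: ln_ge0|exact: ltW]. Qed.

Lemma log2_ge1 x : 2 <= x -> 1 <= log2 x.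
Proof. by move=> x2; rewrite -log2_2; apply: ler_log2. Qed.

Lemma log2_lin x : 0 < x -> log2 x <= 2 * x.
Proof.
move=> x0; rewrite /log2 ler_pdivrMr //; apply: le_trans (ltW (ln_sublinear x0)) _.
by have := ler_wpM2l (ltW x0) ln2_ge; lra.
Qed.

Lemma ceil_log2 t : 1 <= t ->
  exists l : nat, [/\ t <= 2 ^+ l, log2 t <= l%:R & l%:R <= log2 t + 1].
Proof.
move=> t1; have /andP[h1 h2] := truncn_itv (log2_ge0 t1).
have t0 : 0 < t by lra.
exists (Num.truncn (log2 t)).+1; split; [|exact: ltW|by rewrite -natr1 lerD2r].
rewrite -ler_ln ?posrE ?exprn_gt0 // lnXn // -[_ *+ _]mulr_natl -ler_pdivrMr //.
exact: ltW.
Qed.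

Lemma bits_log2 N t : (0 < N)%N -> N%:R <= t -> (bits N)%:R <= log2 t + 1.
Proof.
move=> N0 hN; rewrite /bits -natr1 lerD2r -(log2X (trunc_log 2 N)).
apply: ler_log2; first by rewrite exprn_gt0.
by apply: le_trans hN; rewrite -natrX ler_nat trunc_logP.
Qed.

Lemma le_log2_1 t : log2 t <= log2_1 t.
Proof. by rewrite /log2_1 le_max lexx orbT. Qed.

Lemma log2_1_ge1 t : 1 <= log2_1 t.
Proof. by rewrite /log2_1 le_max lexx. Qed.

End Logs.

Lemma size_flatten_map (T U : Type) (f : T -> seq U) (s : seq T) c :
  (forall x, size (f x) = c) -> size (flatten (map f s)) = (size s * c)%N.
Proof. by move=> h; elim: s => //= x s IH; rewrite size_cat h IH mulSn. Qed.

Lemma exec_costs (R : realType) (d n G th M L a be nsl k : nat) (lam : {ffun cube d -> R}) x y m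
    (rpub rpri : tape d (tlen d n G L a be k)) :
  (0 < d)%N -> (0 < n)%N -> (0 < G)%N -> (0 < L)%N -> is_dist lam -> 0 < tape_law lam rpub ->
  let P := prot R d n G th M L a be nsl k in
  [/\ terminates (P := P) lam x y m rpub rpri,
      alice_cost (P := P) lam x y m rpub rpri = k.+1 /\
        bob_cost (P := P) lam x y m rpub rpri = 0%N,
      alice_time (P := P) lam x y m rpub rpri =
        (code_size alice_instr_size (acode d n G th M L a be nsl k) +
         size (acode d n G th M L a be nsl k))%N /\
      bob_time (P := P) lam x y m rpub rpri =
        (code_size bob_instr_size (bcode d n G th M L a be nsl k) +
         size (bcode d n G th M L a be nsl k))%N,
      (carol_cost (P := P) lam x y m rpub rpri <= size (@ccode d n G L a be k))%N &
      forall ts tu, carol_time (P := P) lam x y m rpub rpri ts tu =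
        (code_size carol_instr_size (@ccode d n G L a be k) + size (@ccode d n G L a be k)
         + L * (n * G) * ts)%N].
Proof.
move=> d0 n0 G0 L0 dist pos P.
have [sa [sb [sc [E [ra sta] [rb stb] [rc stc] Ex]]]] :=
  exec_final th M d0 n0 G0 L0 lam x y m rpri (tape_sampled dist pos).
split.
- by rewrite /terminates E /= ra rb rc.
- by rewrite /alice_cost /bob_cost E /= size_mkseq.
- by rewrite /alice_time /bob_time E /= sta stb.
- rewrite /carol_cost E -[ch_carol _]/(cstream rpub rpri) /cstream cats0 size_cat.
  rewrite (@size_flatten_map _ _ (pri_coins_of rpri) _ d) => [|i]; last by rewrite size_mkseq.
  rewrite (@size_flatten_map _ _ _ _ (n * G * d + ncoin d a be)) => [|t]; last first.
    rewrite size_cat (@size_flatten_map _ _ _ _ d) => [|z]; last by rewrite /sample_bits size_mkseq.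
    by rewrite !size_mkseq.
  rewrite !size_iota size_ccode; move: (ncoin d a be) => c; clear; lia.
move=> ts tu; rewrite /carol_time E -[st_carol _]/sc stc Ex.
rewrite -[nsamples _ false]/(L * (n * G))%N -[nsamples _ true]/0%N -[nupdates _]/0%N.
by rewrite addn0 mul0n addn0.
Qed.

(** The least [a] with w <= 4^a l, found by descent from a = w. Minimality gives the reverse bound,
    unless [a] is 0. With [l] about log(1/eps) this is the balance that the round count rests on. *)
Lemma ex_scale (w l : nat) : (0 < l)%N -> exists a,
  (w <= 2 ^ a * 2 ^ a * l)%N /\ (a = 0%N \/ 2 ^ a * 2 ^ a * l <= 4 * w)%N.
Proof.
move=> l0.
have ind b : (w <= 2 ^ b * 2 ^ b * l)%N -> exists a,
    (w <= 2 ^ a * 2 ^ a * l)%N /\ (a = 0%N \/ 2 ^ a * 2 ^ a * l <= 4 * w)%N.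
  elim: b => [|b IH] hb; first by exists 0%N; split; [|left].
  have [h|h] := leqP w (2 ^ b * 2 ^ b * l); first exact: IH.
  exists b.+1; split=> //; right; rewrite !expnS; move: h; move: (2 ^ b)%N => p; clear; lia.
apply: (ind w); have := ltn_expl w (isT : 1 < 2)%N => h.
apply: leq_trans (ltnW h) _; rewrite -mulnA leq_pmulr // muln_gt0 expn_gt0 l0.
by [].
Qed.

Lemma ex_pow2 w : (0 < w)%N -> exists2 be, (w <= 2 ^ be)%N & (2 ^ be <= 2 * w)%N.
Proof.
move=> w0; exists (trunc_log 2 w).+1; first exact: ltnW (trunc_log_ltn w _).
by rewrite expnS leq_mul2l trunc_logP.
Qed.

(** Absorbs both factors [a + 4] of n^2 in one factor 2^a, so that n G is of order 8^a/eps. *)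
Lemma sqr_le_pow2 a : ((a + 4) * (a + 4) <= 16 * 2 ^ a)%N.
Proof.
elim: a => // a IH; rewrite expnS; move: IH; move: (2 ^ a)%N => p IH.
have h : ((a.+1 + 4) * (a.+1 + 4) <= 2 * ((a + 4) * (a + 4)))%N by clear; nia.
by apply: leq_trans h (leq_trans (leq_mul (leqnn 2) IH) _); rewrite mulnCA.
Qed.

(** * Choice of parameters and final estimates *)

Section Constants.
Variable R : realType.

(** Here 2^13 is the contraction constant 8192, and the factor 2 replaces l + 1 by 2l. *)
Definition cL : R := 2 * 2 ^+ 13.
Definition cG : R := 4 * 64 * 64 * 16 * 2.
Definition cV : R := cL * cL * cG * 256.
Definition cbit : R := log2 (40 * 40 * cV).
(** The factors 60 * 60 * 25 come from the program size; 15 is 3 * 5, where 3 bounds k + 1 by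
    log(1/delta) and 5 bounds 2 + 3 bits. *)
Definition ctime : R := 60 * 60 * 25 * 15 * cV * (cbit + 9).
(** The 18 accounts for two codes of 3 [pM] slots with [pM] <= 3 * 2^a l, and 30 = 3 * 10 combines
    [sl_le] with [a_le]. *)
Definition cadv : R := (cL + 18) * 30.

Definition cK : R := ctime + cV + cadv + 3.

Lemma cL_ge1 : 1 <= cL.
Proof.
rewrite /cL; have : 1 <= 2 ^+ 13 :> R by rewrite exprn_ege1 // ler1n.
by move: (2 ^+ 13) => p; lra.
Qed.

Lemma cG_ge1 : 1 <= cG.
Proof. by rewrite /cG -!natrM ler1n. Qed.

Lemma cV_ge1 : 1 <= cV.
Proof.
have h1 := cL_ge1; have h2 := cG_ge1; rewrite /cV.
by rewrite !mulr_ege1 // ler1n.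
Qed.

Lemma cbit_ge0 : 0 <= cbit.
Proof. by apply: log2_ge0; rewrite !mulr_ege1 ?cV_ge1 // ler1n. Qed.

Lemma ctime_ge0 : 0 <= ctime.
Proof.
have := cV_ge1; have := cbit_ge0; rewrite /ctime => h1 h2.
by rewrite !mulr_ge0 //; lra.
Qed.

Lemma cadv_ge0 : 0 <= cadv.
Proof. by rewrite /cadv; have := cL_ge1; lra. Qed.

End Constants.

Section Estimates.
Variables (R : realType) (eps delta : R) (d w l k ie a be : nat).
Hypotheses (e0 : 0 < eps) (e1 : eps < 1 / 10) (dl0 : 0 < delta) (dle : delta <= eps).
Hypotheses (w0 : (0 < w)%N) (wd : (w <= d)%N).
Hypotheses (hl2 : log2 (1 / eps) <= l%:R) (hl3 : l%:R <= log2 (1 / eps) + 1).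
Hypotheses (hl1 : 1 / eps <= 2 ^+ l) (hk1 : 1 / delta <= 2 ^+ k).
Hypothesis hk3 : k%:R <= log2 (1 / delta) + 1.
Hypotheses (hie1 : 1 / eps <= ie%:R) (hie2 : ie%:R <= 2 / eps).
Hypothesis ha1 : (w <= 2 ^ a * 2 ^ a * l)%N.
Hypothesis ha2 : a = 0%N \/ (2 ^ a * 2 ^ a * l <= 4 * w)%N.
Hypotheses (hb1 : (w <= 2 ^ be)%N) (hb2 : (2 ^ be <= 2 * w)%N).

Definition pn : nat := (64 * (2 ^ a * (a + 4)))%N.
Definition pG : nat := (4 * pn * ie)%N.
(** The subtraction is truncated: for a > be this is 1, and 2^be <= 2^a M still holds. *)
Definition pM : nat := (2 ^ (be - a))%N.
(** A batch of 2^13 * 2^a rounds halves the excess mass, and [l.+1] halvings bring it below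
    eps/2. *)
Definition pL : nat := (2 ^ 13 * (2 ^ a * l.+1))%N.
Definition pth : nat := (2 * (a + 4))%N.
Definition pnsl : nat := (3 * pM)%N.

Local Notation s := (2 ^+ a : R).
Local Notation ell := (log2 (1 / delta)).
Local Notation lm := (log2 (1 / eps)).
Local Notation Lm := (log2 (w%:R / eps)).
Local Notation wr := (w%:R : R).
Local Notation lr := (l%:R : R).
Local Notation D := (log2_1 (d%:R : R)).
Local Notation q := (log2_1 (w%:R / log2 (1 / eps))).

Let s1 : 1 <= s. Proof. by rewrite exprn_ege1 // ler1n. Qed.
Let w1 : 1 <= wr. Proof. by rewrite ler1n. Qed.
Let d1 : 1 <= d%:R :> R. Proof. by rewrite ler1n; exact: leq_trans wd. Qed.
Let ei : 2 <= 1 / eps. Proof. by rewrite ler_pdivlMr //; have := e1; lra. Qed.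
Let lm1 : 1 <= lm. Proof. exact: log2_ge1. Qed.
Let LmE : Lm = log2 wr + lm.
Proof. by rewrite -log2M ?div1r ?invr_gt0 ?ltr0n. Qed.
Let lw0 : 0 <= log2 wr. Proof. exact: log2_ge0. Qed.
Let Lm1 : 1 <= Lm. Proof. by rewrite LmE; have := lm1; have := lw0; lra. Qed.
Let ell1 : 1 <= ell.
Proof. by apply: log2_ge1; rewrite ler_pdivlMr //; have := e1; have := dle; lra. Qed.
Let D1 : 1 <= D. Proof. exact: log2_1_ge1. Qed.
Let q1 : 1 <= q. Proof. exact: log2_1_ge1. Qed.
Let l1 : 1 <= lr. Proof. exact: le_trans lm1 hl2. Qed.
Let l0 : (0 < l)%N. Proof. by have := l1; rewrite ler1n. Qed.
Let lLm : lr <= 2 * Lm. Proof. by rewrite LmE; have := lm1; have := lw0; have := hl3; lra. Qed.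

Lemma pn_gt0 : (0 < pn)%N. Proof. by rewrite /pn !muln_gt0 expn_gt0 addn4. Qed.
Lemma ie_gt0 : (0 < ie)%N.
Proof.
have h : 1 <= ie%:R :> R by have := ei; have := hie1; lra.
by rewrite ler1n in h.
Qed.
Lemma pG_gt0 : (0 < pG)%N. Proof. by rewrite /pG muln_gt0 ie_gt0 andbT muln_gt0 pn_gt0. Qed.
Lemma pL_gt0 : (0 < pL)%N. Proof. by rewrite /pL !muln_gt0 !expn_gt0. Qed.

Lemma pM_ge : (2 ^ be <= 2 ^ a * pM)%N.
Proof. by rewrite /pM -expnD leq_exp2l // -leq_subLR. Qed.
Lemma pM_le : (pM <= 2 ^ be)%N. Proof. by rewrite /pM leq_exp2l // leq_subr. Qed.

(** One block of [pM] slots serves the declarations; the two others serve the skips, as [w] and [pM]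
    are both at most [skip a * pM]. *)
Lemma pnsl_ok : (skip a * pM + (w + pM) <= skip a * pnsl)%N.
Proof.
have sk : (2 ^ a <= skip a)%N.
  rewrite /skip addn1 expnS; have := expn_gt0 2 a; move: (2 ^ a)%N => p; clear; lia.
have h1 : (w <= skip a * pM)%N.
  by apply: leq_trans hb1 _; apply: leq_trans pM_ge _; rewrite leq_mul2r sk orbT.
have h2 : (pM <= skip a * pM)%N.
  by rewrite leq_pmull //; apply: leq_trans sk; rewrite expn_gt0.
rewrite /pnsl mulnCA; move: h1 h2; move: (skip a * pM)%N => v; clear; lia.
Qed.

Lemma pn_ge8 : (8 * 2 ^ a <= pn)%N.
Proof. by rewrite /pn; move: (2 ^ a)%N => p; clear; nia. Qed.

Lemma pth_le : (pth <= pn)%N.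
Proof.
by rewrite /pth /pn; apply: leq_mul => //; apply: leq_pmull; rewrite expn_gt0.
Qed.

(** Lets the size estimates trade a factor [w] for L n, and so absorb the slot and coin counts in
    [vol]. *)
Lemma w_le_Ln : (w <= pL * pn)%N.
Proof.
apply: leq_trans ha1 _; rewrite -mulnA [(2 ^ a * l)%N]mulnC mulnA; apply: leq_mul.
  rewrite /pL; apply: leq_trans (_ : 2 ^ a * l.+1 <= _)%N; first by rewrite leq_mul2l leqnSn orbT.
  by rewrite leq_pmull // expn_gt0.
by apply: leq_trans pn_ge8; rewrite leq_pmull.
Qed.

Lemma pL_le : pL%:R <= cL R * (s * lr).
Proof.
have -> : pL%:R = 2 ^+ 13 * (s * (lr + 1)) by rewrite /pL natrM natrX natrM natrX natr1.
rewrite /cL; move: (2 ^+ 13 : R) (exprn_ge0 13 (ler0n R 2)) => c c0.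
have : s * (lr + 1) <= s * (2 * lr) by apply: ler_wpM2l; [|have := l1]; have := s1; lra.
by move=> /(ler_wpM2l c0); lra.
Qed.

Lemma pnG_le : (pn * pG)%:R <= cG R * (s ^+ 3 / eps).
Proof.
have h2 : (a + 4)%:R * (a + 4)%:R <= 16 * s by rewrite -natrM -natrX -natrM ler_nat sqr_le_pow2.
have e0' : 0 <= eps^-1 by rewrite invr_ge0 ltW.
rewrite /pG /pn !natrM natrX; move: h2; move: ((a + 4)%:R : R) (ler0n R (a + 4)) => h h0 h2.
have hs : 0 <= s by have := s1; lra.
have -> : 64 * (s * h) * (4 * (64 * (s * h)) * ie%:R) =
    4 * 64 * 64 * (s * s) * ((h * h) * ie%:R) by ring.
have hh : h * h * ie%:R <= 16 * s * (2 / eps).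
  by apply: ler_pM => //; rewrite mulr_ge0.
rewrite (_ : cG R * (s ^+ 3 / eps) = 4 * 64 * 64 * (s * s) * (16 * s * (2 / eps))).
  by apply: ler_wpM2l => //; rewrite !mulr_ge0.
by rewrite /cG; ring.
Qed.

(** The source of w^3 in the time bound: L^2 n G contributes 2^(5a) l^2, and 4^a l <= 4 w turns four
    of the factors 2^a and l^2 into 16 w^2, the fifth into 4 w. *)
Lemma s5_le : s ^+ 5 * lr ^+ 2 <= 256 * (wr ^+ 3 * Lm ^+ 2).
Proof.
have W3 : 1 <= wr ^+ 3 by rewrite exprn_ege1.
have L2 : 1 <= Lm ^+ 2 by rewrite exprn_ege1.
case: ha2 => [->|h].
  rewrite expr0 expr1n mul1r.
  have h1 : lr ^+ 2 <= (2 * Lm) ^+ 2 by rewrite lerXn2r ?nnegrE //; have := Lm1; have := l1; lra.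
  have h2 : Lm ^+ 2 <= wr ^+ 3 * Lm ^+ 2 by rewrite ler_peMl //; lra.
  have E4 : 2 ^+ 2 = 4 :> R by ring.
  by move: h1 h2; rewrite exprMn E4; lra.
have {}h : s * s * lr <= 4 * wr by rewrite -natrX -!natrM ler_nat.
have p0 : 0 <= s * s * lr by rewrite !mulr_ge0 //; have := s1; lra.
have h1 : (s * s * lr) * (s * s * lr) <= (4 * wr) * (4 * wr) by apply: ler_pM.
have h2 : s <= 4 * wr.
  apply: le_trans h; rewrite -mulrA ler_peMr //; last by rewrite mulr_ege1.
  by have := s1; lra.
have h3 : (s * s * lr) * (s * s * lr) * s <= (4 * wr) * (4 * wr) * (4 * wr).
  by apply: ler_pM => //; [exact: mulr_ge0|have := s1; lra].
have -> : s ^+ 5 * lr ^+ 2 = (s * s * lr) * (s * s * lr) * s by ring.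
apply: le_trans h3 _.
have -> : (4 * wr) * (4 * wr) * (4 * wr) = 64 * wr ^+ 3 by ring.
have : wr ^+ 3 <= wr ^+ 3 * Lm ^+ 2 by rewrite ler_peMr //; lra.
by move: (wr ^+ 3) W3 (wr ^+ 3 * _) => u ? v; lra.
Qed.

Local Notation T := (d%:R * wr ^+ 3 / eps * Lm ^+ 2).

Let T1 : 1 <= T.
Proof.
have i1 : 1 <= eps^-1 by have := ei; rewrite div1r; lra.
by apply: mulr_ege1; [apply: mulr_ege1; [apply: mulr_ege1|]|]; rewrite ?exprn_ege1.
Qed.

Lemma vol_le : (vol d pn pG pL)%:R <= cV R * T.
Proof.
rewrite /vol natrM [(pL * pL * _)%:R]natrM [(pL * pL)%:R]natrM.
have hL := pL_le; have hG := pnG_le; have hs := s5_le.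
move: ((pn * pG)%:R : R) (ler0n R (pn * pG)) hG => g g0 hG.
move: (pL%:R : R) (ler0n R pL) hL => L L0 hL.
have c1 := cL_ge1 R; have c2 := cG_ge1 R.
have sl0 : 0 <= s * lr by rewrite mulr_ge0 //; have := s1; lra.
have de : 0 <= d%:R / eps by rewrite divr_ge0 // ltW.
apply: le_trans (_ : cL R * (s * lr) * (cL R * (s * lr)) * (cG R * (s ^+ 3 / eps)) * d%:R <= _).
  by apply: ler_wpM2r => //; apply: ler_pM => //; [exact: mulr_ge0|exact: ler_pM].
rewrite (_ : _ * d%:R = cL R * cL R * cG R * (s ^+ 5 * lr ^+ 2) * (d%:R / eps)); last by ring.
rewrite (_ : cV R * T = cL R * cL R * cG R * (256 * (wr ^+ 3 * Lm ^+ 2)) * (d%:R / eps)); last first.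
  by rewrite /cV; ring.
by apply: ler_wpM2r => //; apply: ler_wpM2l => //; rewrite !mulr_ge0 //; lra.
Qed.

Local Notation N := (maxreg (pbase d pL a pnsl) 29 (pD d pn pG pL a be pnsl) pdep
  (pcmax pn pth pM a) pL.+1).

Let d0 : (0 < d)%N. Proof. exact: leq_trans wd. Qed.

(** The logarithm of the volume is at most log d + 7 log(w/eps) up to a constant, double logarithms
    being absorbed by [log2_lin]. Sums are then bounded by products of factors that are at least
    1. *)
Lemma bits_le_log : (bits N)%:R <= (cbit R + 9) * (D * Lm).
Proof.
have hN := maxreg_le d0 pn_gt0 pG_gt0 pL_gt0 pn_ge8 pth_le w0 wd w_le_Ln hb2 pM_le (erefl pnsl).
have N0 : (0 < N)%N by apply: leq_trans (d4_maxreg _ _ _ _ _ _ _ _ _); rewrite addn4.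
have T0 : 0 < T by have := T1; lra.
have cv := cV_ge1 R.
have h1 : N%:R <= 40 * 40 * cV R * T.
  apply: le_trans (_ : 40 * 40 * (vol d pn pG pL)%:R <= _).
    by rewrite -!natrM ler_nat.
  by rewrite -[leRHS]mulrA; apply: ler_wpM2l vol_le; rewrite mulr_ge0.
have := bits_log2 N0 h1; rewrite log2M //; last by rewrite !mulr_gt0 //; lra.
rewrite -/(cbit R) => hb; apply: le_trans hb _.
have ie0 : 0 < eps^-1 by rewrite invr_gt0.
have Lm0 : 0 < Lm by have := Lm1; lra.
have wr0 : 0 < wr by have := w1; lra.
have dr0 : 0 < d%:R :> R by have := d1; lra.
have -> : log2 T = log2 d%:R + 3 * log2 wr + log2 (1 / eps) + 2 * log2 Lm.
  have p4 : 0 < wr ^+ 3 by rewrite exprn_gt0.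
  have p3 : 0 < Lm ^+ 2 by rewrite exprn_gt0.
  have p1 := mulr_gt0 dr0 p4; have p2 := mulr_gt0 p1 ie0.
  by rewrite (log2M p2 p3) (log2M p1 ie0) (log2M dr0 p4) (log2Xn 3 wr0) (log2Xn 2 Lm0) div1r.
have hd : log2 d%:R <= D by exact: le_log2_1.
have hLL := log2_lin Lm0.
have : log2 d%:R + 3 * log2 wr + log2 (1 / eps) + 2 * log2 Lm <= D + 7 * Lm.
  have E' : Lm = log2 w%:R + lm := LmE; have p' : 0 <= log2 w%:R :> R := lw0.
  have aux (A B C E F H : R) : C = B + E -> F <= 2 * C -> A <= H -> 0 <= B -> 0 <= E ->
    A + 3 * B + E + 2 * F <= H + 7 * C by move=> ->; lra.
  exact: aux E' hLL hd p' (le_trans ler01 lm1).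
have h2 : D <= D * Lm by rewrite ler_peMr //; have := D1; lra.
have h3 : Lm <= D * Lm by rewrite ler_peMl //; lra.
have h4 : 1 <= D * Lm by rewrite mulr_ege1.
have h5 : cbit R <= cbit R * (D * Lm) by rewrite ler_peMr // cbit_ge0.
by move: h2 h3 h4 h5; move: (D * Lm) (log2 d%:R + _ + _ + _) => u v; lra.
Qed.

Lemma time_boundE : time_bound d w eps delta = T * ell * (D * Lm) * D ^+ 2.
Proof. by rewrite /time_bound; ring. Qed.

Let TB_ge : T * ell * (D * Lm) <= time_bound d w eps delta.
Proof.
rewrite time_boundE ler_peMr ?exprn_ege1 //.
have := T1; have := ell1; have := D1; have := Lm1 => ? ? ? ?.
by apply: mulr_ge0; apply: mulr_ge0; lra.
Qed.

Lemma T_le_time : T <= time_bound d w eps delta.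
Proof.
apply: le_trans TB_ge.
have h : 1 <= ell * (D * Lm).
  by apply: mulr_ege1; [exact: ell1|apply: mulr_ege1; [exact: D1|exact: Lm1]].
have aux (A B C : R) : 1 <= A -> 1 <= B * C -> A <= A * B * C.
  by move=> hA hB; rewrite -mulrA -[X in X <= _]mulr1; apply: ler_wpM2l => //; lra.
exact: aux T1 h.
Qed.

Lemma time_ge0 : 0 <= time_bound d w eps delta.
Proof. by apply: le_trans T_le_time; have := T1; lra. Qed.

Lemma tmax_le : (tmax d pn pG pth pM pL a be pnsl k)%:R <= ctime R * time_bound d w eps delta.
Proof.
rewrite /tmax natrM [(60 * 60 * _)%:R]natrM [(60 * 60)%:R]natrM [(25 * _)%:R]natrM.
rewrite [(_ * k.+1)%:R]natrM natrD natrM.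
have hv := vol_le; have hb := bits_le_log; have cv := cV_ge1 R; have cb := cbit_ge0 R.
have b1 : 1 <= (bits N)%:R :> R by rewrite ler1n.
move: ((bits N)%:R : R) hb b1 => b hb b1.
move: ((vol d pn pG pL)%:R : R) (ler0n R (vol d pn pG pL)) hv => v v0 hv.
have hk : k.+1%:R <= 3 * ell by rewrite -natr1; have := hk3; have := ell1; lra.
have h1 : v * k.+1%:R <= cV R * T * (3 * ell) by apply: ler_pM.
have h2 : 60 * 60 * (25 * (v * k.+1%:R)) <= 60 * 60 * (25 * (cV R * T * (3 * ell))).
  apply: ler_wpM2l; first exact: mulr_ge0.
  by apply: ler_wpM2l.
have h3 : 2 + 3 * b <= 5 * ((cbit R + 9) * (D * Lm)) by lra.
apply: le_trans (ler_pM _ _ h2 h3) _; first by rewrite !mulr_ge0.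
  by lra.
have -> : 60 * 60 * (25 * (cV R * T * (3 * ell))) * (5 * ((cbit R + 9) * (D * Lm))) =
    ctime R * (T * ell * (D * Lm)) by rewrite /ctime; ring.
by apply: ler_wpM2l TB_ge; exact: ctime_ge0.
Qed.

Lemma sl_le : s * lr <= 3 * (Num.sqrt (wr * Lm) + Lm).
Proof.
have sq0 : 0 <= Num.sqrt (wr * Lm) by exact: sqrtr_ge0.
have Lm0 : 0 <= Lm by have := Lm1; lra.
case: ha2 => [->|h]; first by rewrite expr0 mul1r; have := lLm; lra.
have {}h : s * s * lr <= 4 * wr by rewrite -natrX -!natrM ler_nat.
have wL : 0 <= wr * Lm by rewrite mulr_ge0.
have sl0 : 0 <= s * lr by rewrite mulr_ge0 //; have := s1; lra.
suff : s * lr <= 3 * Num.sqrt (wr * Lm) by lra.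
have h2 : (s * lr) ^+ 2 <= (3 * Num.sqrt (wr * Lm)) ^+ 2.
  have -> : (s * lr) ^+ 2 = s * s * lr * lr by ring.
  rewrite [leRHS]exprMn sqr_sqrtr //.
  apply: le_trans (_ : 4 * wr * (2 * Lm) <= _).
    have s0 : 0 <= s by have := s1; lra.
    by apply: ler_pM => //; rewrite !mulr_ge0.
  have -> : 3 ^+ 2 = 9 :> R by ring.
  by lra.
by move: h2; rewrite ler_pXn2r ?nnegrE //; exact: mulr_ge0.
Qed.

(** Taking logarithms in 4^a <= 4 w/log(1/eps) bounds [a] by 1 plus half of log(w/log(1/eps)). *)
Lemma a_le : (a + 8)%:R <= 10 * q.
Proof.
rewrite natrD; have q1' := q1.
case: ha2 => [->|h]; first by lra.
have {}h : s * s * lr <= 4 * wr by rewrite -natrX -!natrM ler_nat.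
have lm0 : 0 < lm by have := lm1; lra.
have h1 : s * s * lm <= 4 * wr.
  by apply: le_trans h; apply: ler_wpM2l => //; rewrite mulr_ge0 //; have := s1; lra.
have h2 : s * s <= 4 * (wr / lm) by rewrite mulrA ler_pdivlMr.
have wl0 : 0 < wr / lm by rewrite divr_gt0 //; have := w1; lra.
have ss0 : 0 < s * s by rewrite mulr_gt0 //; have := s1; lra.
have s0 : 0 < s by have := s1; lra.
have f4 : 0 < 4 :> R by [].
have E4 : log2 4 = 2 :> R by rewrite (_ : 4 = 2 ^+ 2) ?log2X //; ring.
have := ler_log2 ss0 h2; rewrite (log2M s0 s0) (log2M f4 wl0) log2X E4.
by have := le_log2_1 (wr / lm); lra.
Qed.

(** Since 2^a M = 2^be <= 2 w <= 2 * 4^a l, the slots cost no more than the rounds, up to a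
    constant. *)
Lemma pM_sl : pM%:R <= 3 * (s * lr).
Proof.
have h : (pM <= 3 * (2 ^ a * l))%N.
  have p0 := expn_gt0 2 a.
  have [hab|hab] := leqP a be.
    have E : (2 ^ a * pM = 2 ^ be)%N by rewrite /pM -expnD subnKC.
    rewrite -(leq_pmul2l p0) E; apply: leq_trans hb2 _.
    by move: ha1; move: (2 ^ a)%N => p; clear; lia.
  have -> : pM = 1%N by rewrite /pM (_ : be - a = 0)%N // ; apply/eqP; rewrite subn_eq0 ltnW.
  by rewrite !muln_gt0 p0 l0.
by move: h; rewrite -(ler_nat R) !natrM natrX.
Qed.

Lemma advice_le : (alen pL a pnsl)%:R <= cadv R * merlin_bound w eps.
Proof.
have gen (u v : nat) : (u * (a + 8) + (3 * v * (a + 1) + 3 * v * (a + 1)))%:R =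
    u%:R * (a + 8)%:R + (3 * v%:R * (a + 1)%:R + 3 * v%:R * (a + 1)%:R) :> R.
  by rewrite !(natrD, natrM).
rewrite -[alen _ _ _]/(pL * (a + 8) + (3 * pM * (a + 1) + 3 * pM * (a + 1)))%N gen.
rewrite /merlin_bound.
have sl0 : 0 <= s * lr by rewrite mulr_ge0 //; have := s1; lra.
have hL := pL_le; have hM := pM_sl; have ha := a_le; have hs := sl_le.
have a1 : (a + 1)%:R <= (a + 8)%:R :> R by rewrite ler_nat leq_add2l.
have c1 := cL_ge1 R.
move: (Num.sqrt _ + Lm) hs => S hs.
apply: le_trans (_ : (cL R + 18) * (s * lr) * (10 * q) <= _); last first.
  rewrite (_ : cadv R * (S * q) = (cL R + 18) * (3 * S) * (10 * q)); last by rewrite /cadv; ring.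
  have q1' := q1; apply: ler_wpM2r; first by lra.
  by apply: ler_wpM2l => //; lra.
have h1 : pL%:R * (a + 8)%:R <= cL R * (s * lr) * (10 * q) by apply: ler_pM.
have h2 : 3 * pM%:R * (a + 1)%:R <= 9 * (s * lr) * (10 * q).
  have h3 : 3 * pM%:R <= 9 * (s * lr) by lra.
  by apply: ler_pM h3 (le_trans a1 ha); rewrite ?mulr_ge0.
by move: h1 h2; move: (q) => q'; lra.
Qed.

Lemma alice_le : k.+1%:R <= 3 * alice_bound w eps delta.
Proof.
rewrite /alice_bound -natr1.
by have := sqrtr_ge0 (wr / lm); have := hk3; have := ell1; lra.
Qed.

Lemma bob_ge0 : 0 <= bob_bound w eps delta.
Proof.
have Lm0 : 0 <= Lm by have := Lm1; lra.
have q1' := q1; have el := ell1; have w1' := w1; have Lm1' := Lm1.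
rewrite /bob_bound; apply: addr_ge0; last by lra.
apply: addr_ge0; first by apply: mulr_ge0; [have := sqrtr_ge0 (wr * Lm)|]; lra.
apply: mulr_ge0; apply: log2_ge0; last by lra.
apply: le_trans el _; apply: ler_log2; first by rewrite divr_gt0.
by apply: ler_wpM2r => //; rewrite invr_ge0 ltW.
Qed.

Lemma hG_ok : (4 * pn)%:R <= eps * pG%:R.
Proof.
rewrite /pG [(4 * pn * ie)%:R]natrM mulrCA ler_peMr //.
by move: hie1; rewrite ler_pdivrMr // mulrC.
Qed.

Lemma hash_ok : 2^-1 ^+ k <= delta.
Proof. by rewrite exprVn invf_ple ?posrE ?exprn_gt0 // -div1r. Qed.

Lemma rounds_ok : (1 - (8192 * 2 ^+ a)^-1) ^+ pL <= eps / 2.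
Proof.
have E8 : 8192 = 2 ^+ 13 :> R by rewrite -natrX.
rewrite E8; have c0 : 0 < 2 ^+ 13 :> R by rewrite exprn_gt0.
have EL : pL = (2 ^ 13 * 2 ^ a * l.+1)%N by rewrite /pL mulnA.
rewrite EL exprM; set m := (2 ^ 13 * 2 ^ a)%N; set u : R := (2 ^+ 13 * 2 ^+ a)^-1.
have s0 : 0 < 2 ^+ a :> R by rewrite exprn_gt0.
have mE : m%:R = 2 ^+ 13 * 2 ^+ a :> R by rewrite /m natrM !natrX.
have mu : m%:R * u = 1 by rewrite mE divff // gt_eqF // mulr_gt0.
have m1 : 1 <= m%:R :> R by rewrite ler1n muln_gt0 !expn_gt0.
have u0 : 0 < u by rewrite invr_gt0 mulr_gt0.
have u1 : u <= 1 by rewrite -mu ler_peMl // ltW.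
(* With m u = 1 this says that (1 - u)^m is at most 1/2. *)
have := exp_1B_le m (ltW u0) u1; rewrite mu; have -> : (1 + 1)^-1 = 2^-1 :> R by [].
have v0 : 0 <= (1 - u) ^+ m by rewrite exprn_ge0 // subr_ge0.
move: ((1 - u) ^+ m) v0 => v v0 hv.
have h1 : v ^+ l.+1 <= 2^-1 ^+ l.+1 by apply: lerXn2r; rewrite ?nnegrE ?invr_ge0.
have h2 : 2^-1 ^+ l <= eps by rewrite exprVn invf_ple ?posrE ?exprn_gt0 // -div1r.
apply: le_trans h1 _; rewrite exprS; move: (2^-1 ^+ l) h2 => z h2.
by rewrite mulrC ler_pM2r ?invr_gt0.
Qed.

Lemma main_protocol : exists P : protocol R d,
  let Y := fun y : pattern d => (stars y <= w)%N in
  (all_executions P Y (fun lam x y m rpub rpri =>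
     terminates lam x y m rpub rpri)) /\
  (has_soundness P Y delta) /\
  (has_error P Y (eps + delta) /\ false_positive_only P Y) /\
  ((advice_len P)%:R <= cK R * merlin_bound w eps) /\
  (all_executions P Y (fun lam x y m rpub rpri =>
     [/\ (alice_cost lam x y m rpub rpri)%:R <= cK R * alice_bound w eps delta,
         (bob_cost lam x y m rpub rpri)%:R <= cK R * bob_bound w eps delta,
         (alice_time lam x y m rpub rpri)%:R <= cK R * time_bound d w eps delta
       & (bob_time lam x y m rpub rpri)%:R <= cK R * time_bound d w eps delta])) /\
  (all_executions P Y (fun lam x y m rpub rpri =>
     (carol_cost lam x y m rpub rpri)%:R <= cK R * time_bound d w eps delta /\
     forall tsample tupdate : nat, (0 < tsample)%N -> (0 < tupdate)%N ->
       (carol_time lam x y m rpub rpri tsample tupdate)%:R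
         <= cK R * (time_bound d w eps delta * tsample%:R
                 + d%:R * tupdate%:R))).
Proof.
exists (prot R d pn pG pth pM pL a be pnsl k) => Y.
have n0 := pn_gt0; have G0 := pG_gt0; have L0 := pL_gt0.
have hMge := pM_ge; have hMle := pM_le; have hns := pnsl_ok; have hg := hG_ok.
have hr := rounds_ok; have hh := hash_ok.
have p8 := pn_ge8; have pt := pth_le; have wL := w_le_Ln.
have cv := cV_ge1 R; have ct := ctime_ge0 R; have ca := cadv_ge0 R.
have TB0 := time_ge0.
have kt : ctime R <= cK R by rewrite /cK; lra.
have ka : cadv R <= cK R by rewrite /cK; lra.
have k3 : 3 <= cK R by rewrite /cK; lra.
have k0 : 0 <= cK R by lra.
have mb0 : 0 <= merlin_bound w eps.
  apply: mulr_ge0; last exact: le_trans ler01 q1.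
  by apply: addr_ge0; [exact: sqrtr_ge0|exact: le_trans ler01 Lm1].
have ab0 : 0 <= alice_bound w eps delta.
  by apply: addr_ge0; [exact: le_trans ler01 ell1|exact: sqrtr_ge0].
have bound (t : nat) : (t <= tmax d pn pG pth pM pL a be pnsl k)%N ->
    t%:R <= cK R * time_bound d w eps delta.
  rewrite -(ler_nat R) => h; apply: le_trans h (le_trans tmax_le _).
  exact: ler_wpM2r.
have ta : (code_size alice_instr_size (acode d pn pG pth pM pL a be pnsl k) +
    size (acode d pn pG pth pM pL a be pnsl k) <= tmax d pn pG pth pM pL a be pnsl k)%N.
  by apply: (@acode_time d pn pG pth pM pL a be pnsl k w); first [assumption|exact: erefl].
have tb : (code_size bob_instr_size (bcode d pn pG pth pM pL a be pnsl k) +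
    size (bcode d pn pG pth pM pL a be pnsl k) <= tmax d pn pG pth pM pL a be pnsl k)%N.
  by apply: (@bcode_time d pn pG pth pM pL a be pnsl k w); first [assumption|exact: erefl].
have tc : (code_size carol_instr_size (@ccode d pn pG pL a be k) +
    size (@ccode d pn pG pL a be k) <= tmax d pn pG pth pM pL a be pnsl k)%N.
  by apply: (@ccode_time d pn pG pth pM pL a be pnsl k w); first [assumption|exact: erefl].
split.
  move=> lam x y m rpub rpri dist _ _ pos _.
  by have [] := @exec_costs R d pn pG pth pM pL a be pnsl k lam x y m rpub rpri d0 n0 G0 L0 dist pos.
split.
  move=> lam y x rpub m dist hy _ pos ne.
  by apply: soundness_le; first [assumption|exact: erefl].
split.
  split=> [lam y dist hy|lam y x rpub rpri dist hy _ pos _ fx].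
    by apply: (error_le (w := w)); first [assumption|exact: erefl].
  by apply: (@match_output R d pn pG pth pM pL a be pnsl k w); first [assumption|exact: erefl].
split; first by apply: le_trans advice_le _; exact: ler_wpM2r.
split=> lam x y m rpub rpri dist hy _ pos _.
  have [_ [-> ->] [-> ->] _ _] :=
    @exec_costs R d pn pG pth pM pL a be pnsl k lam x y m rpub rpri d0 n0 G0 L0 dist pos.
  split; [|by rewrite mulr_ge0 // bob_ge0|exact: bound|exact: bound].
  by apply: le_trans alice_le _; exact: ler_wpM2r.
have [_ _ _ hc ht] :=
  @exec_costs R d pn pG pth pM pL a be pnsl k lam x y m rpub rpri d0 n0 G0 L0 dist pos.
split.
  by apply: bound; apply: leq_trans hc (leq_trans _ tc); exact: leq_addl.
move=> ts tu ts0 _; rewrite ht natrD natrM.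
have h1 : (code_size carol_instr_size (@ccode d pn pG pL a be k) +
    size (@ccode d pn pG pL a be k))%:R <= ctime R * time_bound d w eps delta.
  by apply: le_trans tmax_le; rewrite ler_nat.
have h2 : (pL * (pn * pG))%:R <= cV R * time_bound d w eps delta.
  apply: le_trans (_ : (vol d pn pG pL)%:R <= _).
    by rewrite ler_nat; apply: nsamples_le; assumption.
  apply: le_trans vol_le _; apply: ler_wpM2l; [by lra|exact: T_le_time].
have t1 : 1 <= ts%:R :> R by rewrite ler1n.
have u0 : 0 <= d%:R * tu%:R :> R by rewrite mulr_ge0.
move: (time_bound d w eps delta) (d%:R * tu%:R) (ts%:R : R) TB0 u0 t1 h1 h2.
move=> X u t X0 u0 t1 h1 h2.
have Xt0 : 0 <= X * t by apply: mulr_ge0 => //; lra.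
have Xt : X <= X * t by rewrite ler_peMr.
have g1 := ler_wpM2l ct Xt.
have g2 := ler_wpM2r (le_trans ler01 t1) h2.
have g3 := mulr_ge0 ca Xt0; have g4 := mulr_ge0 k0 u0.
rewrite mulrDr; apply: le_trans (lerD h1 g2) _.
apply: le_trans (_ : cK R * (X * t) <= _); last by rewrite lerDl.
apply: le_trans (_ : ctime R * (X * t) + cV R * (X * t) <= _).
  by apply: lerD => //; rewrite mulrA.
rewrite -mulrDl; apply: ler_wpM2r => //; rewrite /cK; lra.
Qed.

End Estimates.

Theorem theorem3p3 (R : realType) :
  exists2 K : R, 0 < K &
  forall (eps delta : R) (d w : nat),
    0 < eps < 1 / 10 -> 0 < delta < 1 / 10 -> delta <= eps ->
    (0 < w)%N -> (w <= d)%N ->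
  exists P : protocol R d,
  let Y := fun y : pattern d => (stars y <= w)%N in
  (all_executions P Y (fun lam x y m rpub rpri =>
     terminates lam x y m rpub rpri)) /\
  (has_soundness P Y delta) /\
  (has_error P Y (eps + delta) /\ false_positive_only P Y) /\
  ((advice_len P)%:R <= K * merlin_bound w eps) /\
  (all_executions P Y (fun lam x y m rpub rpri =>
     [/\ (alice_cost lam x y m rpub rpri)%:R <= K * alice_bound w eps delta,
         (bob_cost lam x y m rpub rpri)%:R <= K * bob_bound w eps delta,
         (alice_time lam x y m rpub rpri)%:R <= K * time_bound d w eps delta
       & (bob_time lam x y m rpub rpri)%:R <= K * time_bound d w eps delta])) /\
  (all_executions P Y (fun lam x y m rpub rpri =>
     (carol_cost lam x y m rpub rpri)%:R <= K * time_bound d w eps delta /\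
     forall tsample tupdate : nat, (0 < tsample)%N -> (0 < tupdate)%N ->
       (carol_time lam x y m rpub rpri tsample tupdate)%:R
         <= K * (time_bound d w eps delta * tsample%:R
                 + d%:R * tupdate%:R))).
Proof.
exists (cK R).
  by have := cV_ge1 R; have := ctime_ge0 R; have := cadv_ge0 R; rewrite /cK; lra.
move=> eps delta d w /andP[e0 e1] /andP[dl0 _] dle w0 wd.
have ei : 2 <= 1 / eps by rewrite ler_pdivlMr //; lra.
have di : 1 <= 1 / delta by rewrite ler_pdivlMr //; lra.
have [l [hl1 hl2 hl3]] := ceil_log2 (le_trans (ler1n R 2) ei).
have [k [hk1 _ hk3]] := ceil_log2 di.
have l0 : (0 < l)%N.
  have : 1 <= l%:R :> R by apply: le_trans hl2; exact: log2_ge1.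
  by rewrite ler1n.
have [a [ha1 ha2]] := ex_scale w l0.
have [be hb1 hb2] := ex_pow2 w0.
have [ie hie1 hie2] : exists2 ie : nat, 1 / eps <= ie%:R & ie%:R <= 2 / eps.
  have i0 : 0 <= 1 / eps by lra.
  have /andP[h1 h2] := truncn_itv i0; exists (Num.truncn (1 / eps)).+1; first exact: ltW.
  rewrite -natr1 (_ : 2 / eps = 1 / eps + 1 / eps); last by rewrite -mulrDl.
  by apply: lerD => //; lra.
exact: (@main_protocol R eps delta d w l k ie a be).
Qed.
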